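(* Suppose $R>0$. Then Problem (P1), i.e. $\inf_{u}J^{\rm F}_{\rm soc}(u)$ over all $u=(u_1,\dots,u_N)$ with $u_i\in L^2_{\mathcal F_t}(0,T;\mathbb R^r)$, has a set of optimal control laws if and only if Problem (P1) is convex in $u$ and the following system of forward-backward stochastic differential equations on $[0,T]$ admits a set of (adapted) solutions $(x_i,p_i,\beta_i^j,\ i,j=1,\dots,N)$: $$\left\{\begin{aligned} dx_i&=\big(Ax_i-BR^{-1}B^Tp_i+Gx^{(N)}+f\big)dt+\sigma\,dW_i,\\ dp_i&=-\big[(A-\rho I)^Tp_i+G^Tp^{(N)}\big]dt-\big(Qx_i-Q_\Gamma x^{(N)}-\bar\eta\big)dt+\sum_{j=1}^N\beta_i^j\,dW_j,\\ x_i(0)&=x_{i0},\quad p_i(T)=0,\quad i=1,\dots,N, \end{aligned}\right.$$ where $x^{(N)}=\frac1N\sum_{i=1}^Nx_i$, $p^{(N)}=\frac1N\sum_{i=1}^Np_i$, $Q_\Gamma=\Gamma^TQ+Q\Gamma-\Gamma^TQ\Gamma$ and $\bar\eta=Q\eta-\Gamma^TQ\eta$. Furthermore, the optimal control is then given by $\check u_i=-R^{-1}B^Tp_i$, $i=1,\dots,N$.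
   Context: $N$ is the number of agents, $T>0$ a finite horizon, $\rho>0$ a discount constant. $A,G,\Gamma,Q\in\mathbb R^{n\times n}$, $B\in\mathbb R^{n\times r}$, $R\in\mathbb R^{r\times r}$, $\eta\in\mathbb R^n$ are constant, with $Q,R$ symmetric; $f,\sigma:[0,\infty)\to\mathbb R^n$ are continuous with $\int_0^\infty e^{-\rho t}(\|f\|^2+\|\sigma\|^2)dt<\infty$. $W_1,\dots,W_N$ are independent one-dimensional Brownian motions. Agent $i$ has state $x_i\in\mathbb R^n$ and control $u_i\in\mathbb R^r$ with $$dx_i=[Ax_i+Bu_i+Gx^{(N)}+f]dt+\sigma dW_i,\quad x_i(0)=x_{i0},\quad x^{(N)}=\tfrac1N\sum_{j=1}^Nx_j.$$ Standing assumption on the initial data: $x_{10},\dots,x_{N0}$ are mutually independent with common mean $\bar x_0$, $\max_{i}\mathbb E\|x_{i0}\|^2<C_0$ with $C_0$ independent of $N$, and $\{x_{i0}\}$ is independent of $\{W_i\}$. $\mathcal F_t=\sigma\big(\bigcup_{i=1}^N\mathcal F^i_t\big)$ with $\mathcal F^i_t=\sigma(x_{i0},W_i(s),0\le s\le t)$, and $L^2_{\mathcal F_t}(0,T;\mathbb R^k)$ is the space of $\mathcal F_t$-adapted $\mathbb R^k$-valued processes $z$ with $\mathbb E\int_0^T\|z(t)\|^2dt<\infty$. Costs (with $\|z\|_M^2=z^TMz$): $J^{\rm F}_i(u)=\mathbb E\int_0^Te^{-\rho t}\{\|x_i-\Gamma x^{(N)}-\eta\|_Q^2+\|u_i\|_R^2\}dt$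 and $J^{\rm F}_{\rm soc}(u)=\sum_{i=1}^NJ^{\rm F}_i(u)$. ''Problem (P1) is convex in $u$'' means that $u\mapsto J^{\rm F}_{\rm soc}(u)$ is convex on the set of admissible $u$. *)

(* Defs.v *)
From HB Require Import structures.
From mathcomp Require Import all_boot all_order all_algebra.
From mathcomp Require Import all_classical all_reals all_analysis.

Set Implicit Arguments.
Unset Strict Implicit.
Unset Printing Implicit Defensive.

Import Order.TTheory GRing.Theory Num.Theory.
Import numFieldNormedType.Exports.

Local Open Scope classical_set_scope.
Local Open Scope ring_scope.

Definition qform (R : realType) (k : nat) (M : 'M[R]_k) (z : 'cV[R]_k) : R :=
  (z^T *m M *m z) 0 0.

(* Squared Euclidean norm; the norm `|z| that MathComp-Analysis puts on
   matrices is the sup norm. *)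
Definition sqnorm (R : realType) (k : nat) (z : 'cV[R]_k) : R := (z^T *m z) 0 0.

Definition posdef (R : realType) (k : nat) (M : 'M[R]_k) : Prop :=
  M^T = M /\ forall z : 'cV[R]_k, z != 0 -> 0 < qform M z.

Definition vint (R : realType) (k : nat) (a b : R) (g : R -> 'cV[R]_k) :
    'cV[R]_k :=
  \col_l \int[lebesgue_measure]_(s in `[a, b]) g s l 0.

Definition avg (R : realType) (N k : nat) (z : 'I_N -> 'cV[R]_k) : 'cV[R]_k :=
  N%:R^-1 *: \sum_(j < N) z j.

Section Probability.
Context {d : measure_display} {Omega : measurableType d} {R : realType}.
Variable P : probability Omega R.

Definition sigma_gen (I : Type) (D : set I) (X : I -> Omega -> R) :
    set (set Omega) :=
  <<s \bigcup_(i in D) preimage_set_system setT (X i) measurable >>.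

(* Independence of a finite family of sigma-algebras.  Since every F i contains
   the whole space, the product rule over the full index set yields the product
   rule over all subfamilies. *)
Definition mutually_independent (I : finType) (F : I -> set (set Omega)) : Prop :=
  forall E : I -> set Omega, (forall i, F i (E i)) ->
    P (\bigcap_(i in [set: I]) E i) = (\prod_(i : I) P (E i))%E.

Definition independent2 (F G : set (set Omega)) : Prop :=
  forall A B, F A -> G B -> P (A `&` B) = (P A * P B)%E.

(* Brownian motion on [0, +oo[; the values at negative times are irrelevant.
   The law is stated for s < t only: normal_prob 0 0 is not a Dirac mass. *)
Definition is_brownian (W : R -> {RV P >-> R}) : Prop :=
  [/\ {ae P, forall w, W 0 w = 0},
      forall (m : nat) (tau : nat -> R), 0 <= tau 0%N ->
        (forall l, tau l <= tau l.+1) ->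
        mutually_independent (fun l : 'I_m =>
          sigma_gen [set: unit] (fun _ w => W (tau l.+1) w - W (tau l) w)),
      forall s t : R, 0 <= s -> s < t -> forall B : set R, measurable B ->
        P ((fun w => W t w - W s w) @^-1` B) =
        normal_prob 0 (Num.sqrt (t - s)) B
    & {ae P, forall w, {within `[0, +oo[, continuous (fun t => W t w)}}].

Section Integration.
Variables (F : R -> set (set Omega)) (T : R).

(* A random vector is F-measurable iff all its components are. *)
Definition vmeas (G : set (set Omega)) (k : nat) (z : Omega -> 'cV[R]_k) : Prop :=
  forall (l : 'I_k) (B : set R), measurable B -> G ((fun w => z w l 0) @^-1` B).

Definition adapted (k : nat) (z : R -> Omega -> 'cV[R]_k) : Prop :=
  forall t, 0 <= t <= T -> vmeas (F t) (z t).

Definition sqnormL2 (k : nat) (z : R -> Omega -> 'cV[R]_k) : \bar R :=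
  (\int[P]_w \int[lebesgue_measure]_(t in `[0%R, T]) (sqnorm (z t w))%:E)%E.

(* The space L^2_F(0, T; R^k). *)
Definition L2F (k : nat) (z : R -> Omega -> 'cV[R]_k) : Prop :=
  [/\ forall l : 'I_k, measurable_fun (`[0, T] `*` [set: Omega])
        (fun q : R * Omega => z q.1 q.2 l 0),
      adapted z
    & (sqnormL2 z < +oo)%E].

(* The simple process  sum_(l < sp_m) sp_x l * 1_]sp_t l, sp_t l.+1]. *)
Record simple_process (k : nat) := SimpleProcess {
  sp_m : nat;
  sp_t : nat -> R;
  sp_x : nat -> Omega -> 'cV[R]_k }.

Definition simple_wf (k : nat) (S : simple_process k) : Prop :=
  forall l, (l < sp_m S)%N ->
    [/\ 0 <= sp_t S l, sp_t S l <= sp_t S l.+1, sp_t S l.+1 <= T,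
        vmeas (F (sp_t S l)) (sp_x S l)
      & exists C : R, forall w, sqnorm (sp_x S l w) <= C].

Definition simple_val (k : nat) (S : simple_process k) (t : R) (w : Omega) :
    'cV[R]_k :=
  \sum_(l < sp_m S | sp_t S l < t <= sp_t S l.+1) sp_x S l w.

Definition simple_int (W : R -> {RV P >-> R}) (k : nat) (S : simple_process k)
    (t : R) (w : Omega) : 'cV[R]_k :=
  \sum_(l < sp_m S)
    (W (Num.min (sp_t S l.+1) t) w - W (Num.min (sp_t S l) t) w) *: sp_x S l w.

(* Z is a version, with almost surely continuous paths, of the Ito integral
   t |-> int_0^t b dW on [0, T]: the L^2 limit of the elementary integrals of
   simple processes converging to b in L^2.  By the Ito isometry this
   determines Z up to indistinguishability. *)
Definition is_ito_integral (W : R -> {RV P >-> R}) (k : nat)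
    (b Z : R -> Omega -> 'cV[R]_k) : Prop :=
  [/\ L2F b, adapted Z,
      {ae P, forall w, {within `[0, T], continuous (fun t => Z t w)}}
    & exists S : nat -> simple_process k,
      [/\ forall m, simple_wf (S m),
          (fun m => sqnormL2 (fun t w => b t w - simple_val (S m) t w))
            @ \oo --> 0%E
        & forall t, 0 <= t <= T ->
          (fun m => \int[P]_w (sqnorm (Z t w - simple_int W (S m) t w))%:E)%E
            @ \oo --> 0%E]].

(* dx = b dt + dZ on [0, T] with x(0) = xi, i.e.
   x(t) = xi + int_0^t b ds + Z(t) for all t in [0, T], almost surely. *)
Definition ito_equation (k : nat) (xi : Omega -> 'cV[R]_k)
    (b Z x : R -> Omega -> 'cV[R]_k) : Prop :=
  {ae P, forall w, forall t, 0 <= t <= T ->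
    x t w = xi w + vint 0 t (fun s => b s w) + Z t w}.

End Integration.
End Probability.

Record lq_data (R : realType) (n r : nat) := LQData {
  lqA : 'M[R]_n;
  lqB : 'M[R]_(n, r);
  lqG : 'M[R]_n;
  lqGamma : 'M[R]_n;
  lqQ : 'M[R]_n;
  lqR : 'M[R]_r;
  lqeta : 'cV[R]_n;
  lqf : R -> 'cV[R]_n;
  lqsigma : R -> 'cV[R]_n;
  lqrho : R;
  lqT : R }.

Section Problem.
Context {d : measure_display} {Omega : measurableType d} {R : realType}.
Variables (P : probability Omega R) (N n r : nat).
Variables (D : lq_data R n r).
Variables (x0 : 'I_N -> Omega -> 'cV[R]_n) (W : 'I_N -> R -> {RV P >-> R}).

Local Notation A := (lqA D).
Local Notation B := (lqB D).
Local Notation G := (lqG D).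
Local Notation Gamma := (lqGamma D).
Local Notation Q := (lqQ D).
Local Notation eta := (lqeta D).
Local Notation f := (lqf D).
Local Notation sigma := (lqsigma D).
Local Notation rho := (lqrho D).
Local Notation T := (lqT D).

Definition sigma_init (i : 'I_N) : set (set Omega) :=
  sigma_gen [set: 'I_n] (fun k w => x0 i w k 0).

Definition sigma_noise (i : 'I_N) : set (set Omega) :=
  sigma_gen `[0, +oo[ (fun s w => W i s w).

(* Neither F^i_t nor F_t is augmented by the null sets. *)
Definition agent_filtration (i : 'I_N) (t : R) : set (set Omega) :=
  <<s sigma_init i `|` sigma_gen `[0, t] (fun s w => W i s w) >>.

Definition filtration (t : R) : set (set Omega) :=
  <<s \bigcup_(i in [set: 'I_N]) agent_filtration i t >>.

Definition L2 (k : nat) (z : R -> Omega -> 'cV[R]_k) : Prop :=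
  L2F P filtration T z.

Definition is_ito (k : nat) (V : R -> {RV P >-> R})
    (b Z : R -> Omega -> 'cV[R]_k) : Prop :=
  is_ito_integral filtration T V b Z.

(* N-tuples of R^k-valued processes. *)
Definition processes (k : nat) : Type := 'I_N -> R -> Omega -> 'cV[R]_k.

Definition avgp (k : nat) (z : processes k) (t : R) (w : Omega) : 'cV[R]_k :=
  avg (fun j => z j t w).

Definition admissible : set (processes r) := [set u | forall i, L2 (u i)].

Definition is_state (u : processes r) (x : processes n) : Prop :=
  forall i, L2 (x i) /\
    exists2 Z, is_ito (W i) (fun t _ => sigma t) Z &
      ito_equation P T (x0 i)
        (fun t w => A *m x i t w + B *m u i t w + G *m avgp x t w + f t) Z (x i).

(* The state driven by u, unique up to indistinguishability; the constant 0 is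
   a dummy value for a control without state. *)
Definition state (u : processes r) : processes n :=
  xget (fun _ _ _ => 0) [set x | is_state u x].

Definition running_cost (x : processes n) (u : processes r) (i : 'I_N)
    (t : R) (w : Omega) : R :=
  expR (- rho * t) *
    (qform Q (x i t w - Gamma *m avgp x t w - eta) + qform (lqR D) (u i t w)).

Definition J (i : 'I_N) (u : processes r) : \bar R :=
  (\int[P]_w \int[lebesgue_measure]_(t in `[0%R, T])
     (running_cost (state u) u i t w)%:E)%E.

Definition Jsoc (u : processes r) : \bar R := (\sum_(i < N) J i u)%E.

Definition optimal (u : processes r) : Prop :=
  admissible u /\ Jsoc u = ereal_inf [set Jsoc v | v in admissible].

Definition convex_in_u : Prop :=
  forall (u v : processes r) (l : R), admissible u -> admissible v ->
    0 <= l <= 1 ->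
    (Jsoc (fun i t w => (l *: u i t w + (1 - l) *: v i t w)%R)
       <= l%:E * Jsoc u + (1 - l)%:E * Jsoc v)%E.

Definition QGamma : 'M[R]_n :=
  Gamma^T *m Q + Q *m Gamma - Gamma^T *m Q *m Gamma.

Definition etabar : 'cV[R]_n := Q *m eta - Gamma^T *m Q *m eta.

Definition ucheck (p : processes n) : processes r :=
  fun i t w => - (invmx (lqR D) *m B^T *m p i t w).

Definition fbsde (x p : processes n)
    (beta : 'I_N -> 'I_N -> R -> Omega -> 'cV[R]_n) : Prop :=
  forall i : 'I_N,
    [/\ L2 (x i), L2 (p i), forall j, L2 (beta i j),
        exists2 Z, is_ito (W i) (fun t _ => sigma t) Z &
          ito_equation P T (x0 i)
            (fun t w => A *m x i t w - B *m invmx (lqR D) *m B^T *m p i t w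
                        + G *m avgp x t w + f t) Z (x i)
      & (exists2 Z : 'I_N -> R -> Omega -> 'cV[R]_n,
          forall j, is_ito (W j) (beta i j) (Z j) &
          ito_equation P T (p i 0)
            (fun t w =>
              - ((A - rho%:M)^T *m p i t w + G^T *m avgp p t w)
              - (Q *m x i t w - QGamma *m avgp x t w - etabar))
            (fun t w => \sum_(j < N) Z j t w) (p i))
        /\ {ae P, forall w, p i T w = 0}].

(* Equality dt (x) dP almost everywhere on [0, T] x Omega. *)
Definition ae_eq_processes (u v : processes r) : Prop :=
  forall i, {ae (lebesgue_measure \x P)%E, forall q : R * Omega,
    0 <= q.1 <= T -> u i q.1 q.2 = v i q.1 q.2}.

End Problem.

(* Main.v *)
(* The running cost is quadratic: J(u + V) = J(u) + dJ(u; V) + q(V), and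
   convexity amounts to q >= 0.  Sufficiency: Ito's product rule along (x, p)
   gives dJ(u; V) = 0 for the feedback control.

   Necessity: testing optimality with the controls 1_A 1_{t >= a} c, A in F_a,
   yields for the means E[x 1_A] a deterministic Hamiltonian two-point problem
   with horizon T.  Since R > 0 and q >= 0 the Hamiltonian flow has no conjugate
   point, so its upper block Y(t) is invertible on ]0, T], and E[x_T | F_t] is an
   explicit affine function of x_t.  Hence this martingale is an Ito integral
   with a deterministic integrand, no general martingale representation is
   needed, and p is an affine function of it.  Time 0, where Y may degenerate,
   is reached by Blumenthal's zero-one law. *)

Require Import Defs.
From HB Require Import structures.
From mathcomp Require Import all_boot all_order all_algebra.
From mathcomp Require Import all_classical all_reals all_analysis.
From mathcomp Require Import measurable_realfun ring lra.

Set Implicit Arguments.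
Unset Strict Implicit.
Unset Printing Implicit Defensive.

Import Order.TTheory GRing.Theory Num.Theory.
Import numFieldNormedType.Exports.

Local Open Scope classical_set_scope.
Local Open Scope ring_scope.

(** * Integration *)

(** The agents are stacked into one vector of length N n with block diagonal control weight, so that
    a single linear-quadratic problem is solved. Two obstacles shape the rest. First, the filtration
    is not augmented and processes are only jointly measurable and adapted, so a time integral is
    F_t-measurable merely up to a null set. Measurability modulo null sets ([AM]) is therefore
    carried along and turned back into exact adaptedness by choosing versions of continuous
    processes. Second, Y^-1 may blow up at time 0. With m_t = E[x_T | F_t] the state is x = Y m + a,
    and dm = Y^-1 sigma dW is first known on [e, T] only; the Ito isometry and E|x_T - m_e|^2 <=
    E|x_T|^2 bound the integrand uniformly in e, so that the stochastic integral exists from time 0.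
    Products of stochastic integrals with deterministic functions are differentiated by a Hilbert
    space argument: the residual of the product rule has zero covariance with the very integrals it
    is made of, hence vanishes. *)

Section AlmostEverywhere.
Context d (T : measurableType d) (R : realType) (mu : {measure set T -> \bar R}).
Implicit Types P Q : T -> Prop.

Lemma ae_imp P Q : (forall x, P x -> Q x) -> {ae mu, forall x, P x} -> {ae mu, forall x, Q x}.
Proof. by move=> PQ; apply: filterS. Qed.

Lemma ae_and P Q : {ae mu, forall x, P x} -> {ae mu, forall x, Q x} ->
  {ae mu, forall x, P x /\ Q x}.
Proof. by move=> hP hQ; apply: filterS2 hP hQ => x; split. Qed.

Lemma ae_imp2 P Q (P' : T -> Prop) : (forall x, P x -> Q x -> P' x) ->
  {ae mu, forall x, P x} -> {ae mu, forall x, Q x} -> {ae mu, forall x, P' x}.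
Proof. by move=> PQ hP hQ; apply: filterS2 hP hQ => x; exact: PQ. Qed.

Lemma ae_nat (P : nat -> T -> Prop) : (forall n, {ae mu, forall x, P n x}) ->
  {ae mu, forall x, forall n, P n x}.
Proof. by move=> h; apply/ae_foralln. Qed.

Lemma ae_fin (I : finType) (P : I -> T -> Prop) : (forall i, {ae mu, forall x, P i x}) ->
  {ae mu, forall x, forall i, P i x}.
Proof.
move=> h.
have : {ae mu, forall x, forall n, if insub n is Some k then P (@enum_val I predT k) x else True}.
  apply: ae_nat => n; case: insubP => [k _ _|_]; first exact: h.
  exact: aeW.
apply: ae_imp => x H i; have := H (enum_rank i).
by rewrite valK enum_rankK.
Qed.

Lemma ae_true P : (forall x, P x) -> {ae mu, forall x, P x}.
Proof. exact: aeW. Qed.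

End AlmostEverywhere.

(** * Real-valued integrable and square-integrable functions *)

Section Integrable.
Context d (T : measurableType d) (R : realType) (mu : {measure set T -> \bar R}).
Variable D : set T.
Hypothesis mD : measurable D.
Implicit Types (f g : T -> R) (c : R).

Set Default Proof Using "mD".

Definition L1 f := mu.-integrable D (EFin \o f).
Definition L2s f := measurable_fun D f /\ L1 (fun x => f x ^+ 2).

Lemma L1_meas f : L1 f -> measurable_fun D f.
Proof. by move=> /(measurable_int mu) /measurable_EFinP. Qed.

Lemma L1_eq f g : (forall x, D x -> f x = g x) -> L1 f -> L1 g.
Proof.
move=> fg; apply: eq_integrable => // x; rewrite inE => Dx /=.
by rewrite fg.
Qed.

Lemma L1D f g : L1 f -> L1 g -> L1 (fun x => f x + g x).
Proof. by move=> hf hg; apply: eq_integrable (integrableD _ hf hg). Qed.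

Lemma L1Z c f : L1 f -> L1 (fun x => c * f x).
Proof. by move=> hf; apply: eq_integrable (integrableZl _ c hf). Qed.

Lemma L1N f : L1 f -> L1 (fun x => - f x).
Proof. by move=> hf; apply: eq_integrable (integrableN hf). Qed.

Lemma L1B f g : L1 f -> L1 g -> L1 (fun x => f x - g x).
Proof. by move=> hf hg; apply: L1D => //; exact: L1N. Qed.

Lemma L1_0 : L1 (fun=> 0).
Proof. exact: integrable0. Qed.

Lemma L1_sum (I : Type) (s : seq I) (P : pred I) (h : I -> T -> R) :
  (forall i, P i -> L1 (h i)) -> L1 (fun x => \sum_(i <- s | P i) h i x).
Proof.
move=> H; elim: s => [|i s IH].
  by apply: L1_eq L1_0 => x _; rewrite big_nil.
case Pi : (P i).
  by apply: L1_eq (L1D (H _ Pi) IH) => x _; rewrite big_cons Pi.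
by apply: L1_eq IH => x _; rewrite big_cons Pi.
Qed.

Lemma L1_le f g : measurable_fun D f -> (forall x, D x -> `|f x| <= g x) ->
  L1 g -> L1 f.
Proof.
move=> mf fg; apply: le_integrable => //; first exact/measurable_EFinP.
move=> x Dx; rewrite /= lee_fin.
exact: le_trans (fg _ Dx) (ler_norm _).
Qed.

Lemma L1_norm f : L1 f -> L1 (fun x => `|f x|).
Proof. by move=> hf; apply: eq_integrable (integrable_norm hf). Qed.

Lemma L1_cst c : (mu D < +oo)%E -> L1 (fun=> c).
Proof.
move=> h; apply: measurable_bounded_integrable => //.
rewrite /bounded_near; near=> M => x _ /=.
by near: M; exact: nbhs_pinfty_ge.
Unshelve. all: by end_near. Qed.

Lemma L1_bddM f g c : measurable_fun D f -> (forall x, D x -> `|f x| <= c) ->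
  L1 g -> L1 (fun x => f x * g x).
Proof.
move=> mf fc hg; apply: (L1_le _ _ (L1Z c (L1_norm hg))).
  exact: measurable_funM mf (L1_meas hg).
by move=> x Dx; rewrite normrM ler_wpM2r// fc.
Qed.

Lemma IntD f g : L1 f -> L1 g ->
  \int[mu]_(x in D) (f x + g x) = \int[mu]_(x in D) f x + \int[mu]_(x in D) g x.
Proof. exact: RintegralD. Qed.

Lemma IntB f g : L1 f -> L1 g ->
  \int[mu]_(x in D) (f x - g x) = \int[mu]_(x in D) f x - \int[mu]_(x in D) g x.
Proof. exact: RintegralB. Qed.

Lemma IntZ c f : L1 f -> \int[mu]_(x in D) (c * f x) = c * \int[mu]_(x in D) f x.
Proof. exact: RintegralZl. Qed.

Lemma IntZr c f : L1 f -> \int[mu]_(x in D) (f x * c) = \int[mu]_(x in D) f x * c.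
Proof. exact: RintegralZr. Qed.

Lemma IntN f : L1 f -> \int[mu]_(x in D) (- f x) = - \int[mu]_(x in D) f x.
Proof.
move=> hf; rewrite -[RHS]mulN1r -IntZ//.
by apply: eq_Rintegral => x _; rewrite mulN1r.
Qed.

Lemma Int_eq f g : (forall x, D x -> f x = g x) ->
  \int[mu]_(x in D) f x = \int[mu]_(x in D) g x.
Proof using Type. by move=> fg; apply: eq_Rintegral => x; rewrite inE => /fg. Qed.

Lemma Int_0 : \int[mu]_(x in D) (0 : R) = 0.
Proof using Type. by rewrite /Rintegral integral0. Qed.

Lemma Int_sum (I : Type) (s : seq I) (P : pred I) (h : I -> T -> R) :
  (forall i, P i -> L1 (h i)) ->
  \int[mu]_(x in D) (\sum_(i <- s | P i) h i x) =
  \sum_(i <- s | P i) \int[mu]_(x in D) h i x.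
Proof.
move=> H; elim: s => [|i s IH].
  by rewrite big_nil -[RHS]Int_0; apply: Int_eq => x _; rewrite big_nil.
rewrite big_cons; case Pi : (P i).
  rewrite -IH -IntD//; [|exact: H|exact: L1_sum].
  by apply: Int_eq => x _; rewrite big_cons Pi.
by rewrite -IH; apply: Int_eq => x _; rewrite big_cons Pi.
Qed.

Lemma Int_le f g : L1 f -> L1 g -> (forall x, D x -> f x <= g x) ->
  \int[mu]_(x in D) f x <= \int[mu]_(x in D) g x.
Proof. exact: le_Rintegral. Qed.

Lemma Int_ge0 f : (forall x, D x -> 0 <= f x) -> 0 <= \int[mu]_(x in D) f x.
Proof using Type. exact: Rintegral_ge0. Qed.

Lemma Int_norm f : L1 f ->
  `|\int[mu]_(x in D) f x| <= \int[mu]_(x in D) `|f x|.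
Proof. exact: le_normr_Rintegral. Qed.

Lemma Int_E f : L1 f -> (\int[mu]_(x in D) (f x)%:E)%E = (\int[mu]_(x in D) f x)%:E.
Proof. by move=> hf; rewrite /Rintegral fineK//; exact: integrable_fin_num. Qed.

Lemma L1_ae f g : measurable_fun D g -> {ae mu, forall x, D x -> f x = g x} ->
  L1 f -> L1 g.
Proof.
move=> mg fg /integrableP [mf hf]; apply/integrableP; split.
  exact/measurable_EFinP.
rewrite (le_lt_trans _ hf)// (ae_eq_integral (abse \o (EFin \o f)))//=.
- by apply: measurableT_comp => //; apply: measurableT_comp => //.
- by apply: measurableT_comp.
- by apply: filterS fg => x /= h Dx; rewrite h.
Qed.

Lemma Int_ae f g : measurable_fun D f -> measurable_fun D g ->
  {ae mu, forall x, D x -> f x = g x} ->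
  \int[mu]_(x in D) f x = \int[mu]_(x in D) g x.
Proof.
move=> mf mg fg; congr fine; apply: ae_eq_integral => //.
- exact/measurable_EFinP.
- exact/measurable_EFinP.
- by apply: filterS fg => x /= h Dx; rewrite h.
Qed.

Lemma Int_ge0_ae0 f : L1 f -> (forall x, D x -> 0 <= f x) ->
  \int[mu]_(x in D) f x <= 0 -> {ae mu, forall x, D x -> f x = 0}.
Proof.
move=> hf f0 If.
have /(ae_eq_integral_abs mu mD) [+ _] : measurable_fun D (EFin \o f : T -> \bar R).
  exact: measurable_int hf.
have -> : (\int[mu]_(x in D) `|(EFin \o f) x|)%E = (\int[mu]_(x in D) (f x)%:E)%E.
  by apply: eq_integral => x; rewrite inE => Dx /=; rewrite ger0_norm// f0.
rewrite Int_E//; have -> : \int[mu]_(x in D) f x = 0.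
  by apply/eqP; rewrite eq_le If Int_ge0.
by move=> /(_ erefl); apply: filterS => x /= h Dx; case: (h Dx).
Qed.

Lemma L2s_sq f : L2s f -> L1 (fun x => f x ^+ 2). Proof. by case. Qed.

Lemma L2sM f g : L2s f -> L2s g -> L1 (fun x => f x * g x).
Proof.
move=> [mf hf] [mg hg]; apply: (L1_le _ _ (L1D hf hg)).
  exact: measurable_funM.
move=> x _; rewrite ler_norml; apply/andP; split.
  rewrite -subr_ge0 (_ : _ - _ = (f x + g x)^+2 / 2 + (f x ^+ 2 + g x ^+ 2) / 2).
    by rewrite addr_ge0// divr_ge0// ?sqr_ge0// addr_ge0// sqr_ge0.
  by field.
rewrite -subr_ge0 (_ : _ - _ = (f x - g x)^+2 / 2 + (f x ^+ 2 + g x ^+ 2) / 2).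
  by rewrite addr_ge0// divr_ge0// ?sqr_ge0// addr_ge0// sqr_ge0.
by field.
Qed.

Lemma L2sD f g : L2s f -> L2s g -> L2s (fun x => f x + g x).
Proof.
move=> hf hg; split; first by apply: measurable_funD; [exact: hf.1|exact: hg.1].
apply: L1_eq (L1D (L1D hf.2 hg.2) (L1Z 2 (L2sM hf hg))) => x _.
by ring.
Qed.

Lemma L2sZ c f : L2s f -> L2s (fun x => c * f x).
Proof.
move=> hf; split; first by apply: measurable_funM => //; exact: hf.1.
by apply: L1_eq (L1Z (c ^+ 2) hf.2) => x _; rewrite exprMn.
Qed.

Lemma L2sN f : L2s f -> L2s (fun x => - f x).
Proof.
by move=> [mf hf]; split; [exact: measurableT_comp|apply: L1_eq hf => x _; rewrite sqrrN].
Qed.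

Lemma L2sB f g : L2s f -> L2s g -> L2s (fun x => f x - g x).
Proof. by move=> hf hg; apply: L2sD => //; exact: L2sN. Qed.

Lemma L2s_eq f g : (forall x, D x -> f x = g x) -> L2s f -> L2s g.
Proof.
move=> fg [mf hf]; split; last by apply: L1_eq hf => x Dx; rewrite fg.
by apply: eq_measurable_fun mf => x; rewrite inE => /fg.
Qed.

Lemma L2s_0 : L2s (fun=> 0).
Proof. by split=> //; apply: L1_eq L1_0 => x _; rewrite expr0n. Qed.

Lemma L2s_sum (I : Type) (s : seq I) (P : pred I) (h : I -> T -> R) :
  (forall i, P i -> L2s (h i)) -> L2s (fun x => \sum_(i <- s | P i) h i x).
Proof.
move=> H; elim: s => [|i s IH].
  by apply: L2s_eq L2s_0 => x _; rewrite big_nil.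
case Pi : (P i).
  by apply: L2s_eq (L2sD (H _ Pi) IH) => x _; rewrite big_cons Pi.
by apply: L2s_eq IH => x _; rewrite big_cons Pi.
Qed.

Lemma L2s_le f g : measurable_fun D f -> (forall x, D x -> `|f x| <= `|g x|) ->
  L2s g -> L2s f.
Proof.
move=> mf fg [mg hg]; split=> //; apply: L1_le hg.
  exact: measurable_funX.
move=> x Dx; rewrite normrX -[leRHS]ger0_norm ?sqr_ge0// normrX.
by rewrite lerXn2r ?nnegrE// fg.
Qed.

Lemma L2s_bddM f g c : measurable_fun D f -> (forall x, D x -> `|f x| <= c) ->
  L2s g -> L2s (fun x => f x * g x).
Proof.
move=> mf fc hg; apply: L2s_le (L2sZ c hg).
  exact: measurable_funM mf hg.1.
move=> x Dx; rewrite !normrM ler_wpM2r//.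
exact: le_trans (fc _ Dx) (ler_norm _).
Qed.

Lemma L2s_cst c : (mu D < +oo)%E -> L2s (fun=> c).
Proof. by move=> h; split=> //; exact: L1_cst. Qed.

Lemma L2s_bdd f c : (mu D < +oo)%E -> measurable_fun D f ->
  (forall x, D x -> `|f x| <= c) -> L2s f.
Proof.
move=> h mf fc; apply: L2s_le (L2s_cst c h) => // x Dx.
exact: le_trans (fc _ Dx) (ler_norm _).
Qed.

Lemma L2s_L1 f : (mu D < +oo)%E -> L2s f -> L1 f.
Proof.
move=> h hf; apply: L1_eq (L2sM hf (L2s_cst 1 h)) => x _.
by rewrite mulr1.
Qed.

Lemma L2s_ae f g : measurable_fun D g -> {ae mu, forall x, D x -> f x = g x} ->
  L2s f -> L2s g.
Proof.
move=> mg fg [mf hf]; split=> //; apply: L1_ae hf.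
  exact: measurable_funX.
by apply: filterS fg => x /= h /h ->.
Qed.

(** The quadratic polynomial l |-> int (f + l g)^2 is nonnegative. Its value at the minimiser -c / b
    is the claim; when b = 0 it is affine, hence constant. *)
Lemma Cauchy_Schwarz f g : L2s f -> L2s g ->
  (\int[mu]_(x in D) (f x * g x)) ^+ 2 <=
  (\int[mu]_(x in D) (f x ^+ 2)) * (\int[mu]_(x in D) (g x ^+ 2)).
Proof.
move=> hf hg.
set a := \int[mu]_(x in D) (f x ^+ 2); set b := \int[mu]_(x in D) (g x ^+ 2).
set c := \int[mu]_(x in D) (f x * g x).
have q l : 0 <= a + 2 * l * c + l ^+ 2 * b.
  have -> : a + 2 * l * c + l ^+ 2 * b = \int[mu]_(x in D) ((f x + l * g x) ^+ 2).
    rewrite /a /b /c -!IntZ//; [|exact: L2s_sq|exact: L2sM].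
    rewrite -!IntD//; [|exact: L1D (L2s_sq hf) (L1Z _ (L2sM hf hg))|
      exact: L1Z (L2s_sq hg)|exact: L2s_sq|exact: L1Z (L2sM hf hg)].
    by apply: Int_eq => x _; ring.
  by apply: Int_ge0 => x _; exact: sqr_ge0.
have b0 : 0 <= b by apply: Int_ge0 => x _; exact: sqr_ge0.
have [b0'|bn0] := eqVneq b 0.
  have c0 : c = 0.
    apply/eqP; apply: contraT => cn0.
    (* With b = 0 and c != 0 this choice of l would give the polynomial the value -1. *)
    have := q (- (a + 1) / (2 * c)); rewrite b0' mulr0 addr0.
    rewrite (_ : _ + _ = -1); last by field.
    by rewrite lerNr oppr0 ler10.
  by rewrite c0 b0' expr0n mulr0.
have := q (- c / b).
rewrite (_ : _ + _ + _ = (a * b - c ^+ 2) / b); last by field.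
by rewrite pmulr_lge0 ?invr_gt0 ?lt_def ?bn0// subr_ge0.
Qed.

End Integrable.
Unset Default Proof Using.

Lemma L1_prod d1 d2 (T1 : measurableType d1) (T2 : measurableType d2) (R : realType)
  (m1 : {sigma_finite_measure set T1 -> \bar R})
  (m2 : {sigma_finite_measure set T2 -> \bar R}) (f : T1 -> R) (g : T2 -> R) :
  L1 m1 setT f -> L1 m2 setT g ->
  L1 (m1 \x m2)%E setT (fun q => f q.1 * g q.2).
Proof.
move=> hf hg.
have mh : measurable_fun setT (fun q : T1 * T2 => (f q.1 * g q.2)%:E).
  apply/measurable_EFinP; apply: measurable_funM.
  - exact: measurableT_comp (L1_meas measurableT hf) measurable_fst.
  - exact: measurableT_comp (L1_meas measurableT hg) measurable_snd.
apply/(integrable12ltyP m1 m2 mh).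
have -> : (\int[m1]_x \int[m2]_y `|(f x * g y)%:E|)%E =
  (\int[m1]_x (`|f x| * \int[m2]_y `|g y|)%:E)%E.
  apply: eq_integral => x _; rewrite EFinM -Int_E; last exact: L1_norm.
  rewrite -ge0_integralZl//=.
  - by apply: eq_integral => y _; rewrite normrM EFinM.
  - by apply/measurable_EFinP; have := L1_meas measurableT (L1_norm measurableT hg).
  - exact: measurableT.
rewrite Int_E ?ltry//.
by apply: (L1_eq measurableT _ (L1Z measurableT (\int[m2]_y `|g y|) (L1_norm measurableT hf))) => x _; rewrite mulrC.
Qed.

(** * Fubini and Tonelli on a strip D x Omega *)

Section Fubini_slab.
Context d1 d2 (T1 : measurableType d1) (T2 : measurableType d2) (R : realType).
Variables (m1 : {sigma_finite_measure set T1 -> \bar R}).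
Variables (m2 : {sigma_finite_measure set T2 -> \bar R}).
Variable D : set T1.
Hypothesis mD : measurable D.
Variable f : T1 -> T2 -> R.
Local Notation DD := (D `*` [set: T2]).
Local Notation uf := (fun q : T1 * T2 => f q.1 q.2).
(** Extension of [f] by 0 outside the strip, so that the theorems for the whole product space
    apply. *)
Let g : T1 * T2 -> \bar R := patch (cst 0%E) DD (EFin \o uf).
Local Notation m12 := (m1 \x m2)%E.

Let mDD : measurable DD.
Proof. exact: measurableX. Qed.

Let gE t w : g (t, w) = patch (cst 0%E) D (EFin \o (f^~ w)) t.
Proof.
rewrite /g !patchE /=; case: (boolP (t \in D)) => tD.
  by rewrite ifT// inE; split => //=; move: tD; rewrite inE.
by rewrite ifF//; apply/negbTE; move: tD; apply: contra; rewrite !inE => -[].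
Qed.

Let gE1 t w : D t -> g (t, w) = (f t w)%:E.
Proof. by move=> Dt; rewrite gE patchE mem_set. Qed.

Let gE0 t w : ~ D t -> g (t, w) = 0%E.
Proof. by move=> Dt; rewrite gE patchE memNset. Qed.

Lemma slab_meas1 w : measurable_fun DD uf -> measurable_fun D (f^~ w).
Proof.
move=> mf.
have : measurable_fun D (uf \o (fun t => (t, w))).
  apply: (measurable_comp (F := DD)) => //; first by move=> _ [t Dt <-].
  exact: measurable_funS (measurable_pair2 w).
by [].
Qed.

Let mg : measurable_fun DD uf -> measurable_fun setT g.
Proof.
move=> mf; have := (measurable_restrict (EFin \o uf) mDD measurableT).1.
rewrite setTI; apply; exact/measurable_EFinP.
Qed.

Lemma tonelli_slab1 : measurable_fun DD uf ->
  (\int[m1]_(t in D) \int[m2]_w `|f t w|%:E < +oo)%E ->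
  L1 m12 DD uf.
Proof.
move=> mf h; suff : m12.-integrable setT g by move=> /(integrable_mkcond _ mDD).2.
apply/integrable12ltyP; first exact: mg.
rewrite integral_mkcond in h; rewrite (le_lt_trans _ h)// le_eqVlt; apply/orP; left.
apply/eqP; apply: eq_integral => t _; rewrite patchE.
case: ifPn => [|]; rewrite ?notin_setE ?inE => tD.
  by apply: eq_integral => w _; rewrite gE1.
by rewrite -[RHS](@integral0 _ _ _ m2 setT); apply: eq_integral => w _; rewrite gE0// abse0.
Qed.

Lemma tonelli_slabE : measurable_fun DD uf -> (forall t w, D t -> 0 <= f t w) ->
  (\int[m2]_w \int[m1]_(t in D) (f t w)%:E =
   \int[m12]_(q in DD) (uf q)%:E)%E.
Proof.
move=> mf f0; rewrite [RHS]integral_mkcond (@fubini_tonelli2 _ _ _ _ _ m1 m2 g); [|exact: mg|].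
  apply: eq_integral => w _; rewrite /fubini_G (integral_mkcond D).
  by apply: eq_integral => t _; rewrite gE.
move=> [t w]; case: (pselect (D t)) => Dt; first by rewrite gE1// lee_fin f0.
by rewrite gE0.
Qed.

Hypothesis If : L1 m12 DD uf.

Let Ig : m12.-integrable setT g.
Proof. exact: (integrable_mkcond _ mDD).1 If. Qed.

Lemma slab_L1_1 : {ae m2, forall w, L1 m1 D (f^~ w)}.
Proof.
apply: filterS (ae_integrable2 Ig) => w h; apply: (integrable_mkcond _ mD).2.
by apply: eq_integrable h => // t _; rewrite gE.
Qed.

Lemma slab_L1_2 : {ae m1, forall t, D t -> L1 m2 setT (f t)}.
Proof.
apply: filterS (ae_integrable1 Ig) => t h Dt.
by apply: eq_integrable h => // w _; rewrite gE1.
Qed.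

Lemma slab_L1_int1 : L1 m2 setT (fun w => \int[m1]_(t in D) f t w).
Proof.
have mG := measurable_fubini_G Ig.
have mh : measurable_fun setT (fun w => \int[m1]_(t in D) f t w).
  apply: (eq_measurable_fun (fun w => fine (fubini_G m1 g w))).
    move=> w _; rewrite /fubini_G /Rintegral (integral_mkcond D).
    by congr fine; apply: eq_integral => t _; rewrite gE.
  exact: measurableT_comp (fine_measurable measurableT) mG.
apply/integrableP; split; first exact/measurable_EFinP.
have mg' : measurable_fun setT g := measurable_int _ Ig.
apply: le_lt_trans ((integrable21ltyP m1 m2 mg').1 Ig).
have mA : measurable_fun setT (fun w => \int[m1]_t `|g (t, w)|)%E.
  apply: (measurable_fun_fubini_tonelli_G (abse \o g)) => //.
    by apply: measurableT_comp => //; exact: measurable_int Ig.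
  by move=> q; exact: abse_ge0.
apply: ge0_le_integral => //.
- by do 2 apply: measurableT_comp => //.
- move=> w _ /=; apply: (@le_trans _ _ `|fubini_G m1 g w|%E).
    rewrite /fubini_G /Rintegral (integral_mkcond D).
    under [in leRHS]eq_integral => t _ do rewrite gE.
    (* Where the inner integral is infinite, [Rintegral] takes the default value 0, and the bound
       persists. *)
    by case: (\int[_]_x _)%E => //= ; rewrite ?normr0 ?leey.
  apply: le_abse_integral => //.
  exact: measurableT_comp (measurable_int _ Ig) (measurable_pair2 w).
Qed.

Lemma slab_L1_int2 : L1 m1 D (fun t => \int[m2]_w f t w).
Proof.
have h := integrable_fubini_F Ig.
have mh : measurable_fun D (fun t => \int[m2]_w f t w).
  apply: (eq_measurable_fun (fun t => fine (fubini_F m2 g t))).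
    move=> t; rewrite inE => Dt; rewrite /fubini_F /Rintegral.
    by congr fine; apply: eq_integral => w _; rewrite gE1.
  apply: measurable_funTS.
  exact: measurableT_comp (fine_measurable measurableT) (measurable_int _ h).
have /integrableP[mF h2] := h.
apply/integrableP; split; first exact/measurable_EFinP.
apply: (@le_lt_trans _ _ (\int[m1]_(t in D) `|fubini_F m2 g t|)%E).
  apply: ge0_le_integral => //.
  - by do 2 apply: measurableT_comp => //.
  - by apply: measurableT_comp => //; exact: measurable_funTS.
  - move=> t Dt /=; rewrite /fubini_F /Rintegral.
    under [in leRHS]eq_integral => w _ do rewrite gE1//.
    by case: (\int[_]_x _)%E => //= ; rewrite ?normr0 ?leey.
rewrite (le_lt_trans _ h2)//; apply: ge0_subset_integral => //.
by apply: measurableT_comp.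
Qed.

Lemma fubini_slab1 :
  \int[m2]_w \int[m1]_(t in D) f t w = \int[m12]_(q in DD) uf q.
Proof.
rewrite [RHS]/Rintegral [X in _ = fine X]integral_mkcond -/g -integral21_prod_meas1//.
rewrite /Rintegral; congr fine.
apply: ae_eq_integral => //.
- exact/measurable_EFinP/(L1_meas measurableT slab_L1_int1).
- exact: measurable_fubini_G Ig.
- apply: filterS slab_L1_1 => w h _ /=; rewrite -Int_E//.
  by rewrite (integral_mkcond D); apply: eq_integral => t _; rewrite gE.
Qed.

Lemma fubini_slab2 :
  \int[m1]_(t in D) \int[m2]_w f t w = \int[m12]_(q in DD) uf q.
Proof.
rewrite [RHS]/Rintegral [X in _ = fine X]integral_mkcond -/g -integral12_prod_meas1//.
rewrite /Rintegral; congr fine; rewrite integral_mkcond.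
apply: ae_eq_integral => //.
- have := (measurable_restrict (EFin \o (fun t => \int[m2]_w f t w)) mD measurableT).1.
  by rewrite setTI; apply; exact/measurable_EFinP/(L1_meas mD slab_L1_int2).
- exact: measurable_int (integrable_fubini_F Ig).
- apply: filterS slab_L1_2 => t h _ /=; rewrite patchE.
  case: ifPn => [|]; rewrite ?notin_setE ?inE => tD.
    by rewrite -Int_E//; last exact: h; apply: eq_integral => w _; rewrite gE1.
  by rewrite /fubini_F -[LHS](@integral0 _ _ _ m2 setT); apply: eq_integral => w _; rewrite gE0.
Qed.

Lemma fubini_slab :
  \int[m2]_w \int[m1]_(t in D) f t w = \int[m1]_(t in D) \int[m2]_w f t w.
Proof. by rewrite fubini_slab1 fubini_slab2. Qed.

End Fubini_slab.
Arguments tonelli_slab1 [d1 d2 T1 T2 R m1 m2 D] mD f _ _.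
Arguments tonelli_slabE [d1 d2 T1 T2 R m1 m2 D] mD f _ _.
Arguments slab_meas1 [d1 d2 T1 T2 R D] mD f w _.
Arguments slab_L1_1 [d1 d2 T1 T2 R m1 m2 D] mD f If.
Arguments slab_L1_2 [d1 d2 T1 T2 R m1 m2 D] mD f If.
Arguments slab_L1_int1 [d1 d2 T1 T2 R m1 m2 D] mD f If.
Arguments slab_L1_int2 [d1 d2 T1 T2 R m1 m2 D] mD f If.
Arguments fubini_slab [d1 d2 T1 T2 R m1 m2 D] mD f If.
Arguments fubini_slab1 [d1 d2 T1 T2 R m1 m2 D] mD f If.
Arguments fubini_slab2 [d1 d2 T1 T2 R m1 m2 D] mD f If.

(** The iterated integrals stay extended real: this is the shape in which the costs [J] are
    defined. *)
Lemma fubini_slab1E d1 d2 (X1 : measurableType d1) (X2 : measurableType d2) (Rr : realType)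
  (m1 : {sigma_finite_measure set X1 -> \bar Rr}) (m2 : {sigma_finite_measure set X2 -> \bar Rr})
  (E0 : set X1) (f : X1 -> X2 -> Rr) : measurable E0 ->
  L1 (m1 \x m2)%E (E0 `*` setT) (fun q => f q.1 q.2) ->
  (\int[m2]_w \int[m1]_(t in E0) (f t w)%:E)%E = (\int[(m1 \x m2)%E]_(q in E0 `*` setT) f q.1 q.2)%:E.
Proof.
move=> mD If; have mX : measurable (E0 `*` [set: X2]) by exact: measurableX.
rewrite -(Int_E mX If) integral_mkcond -integral21_prod_meas1; last exact: (integrable_mkcond _ mX).1.
apply: eq_integral => w _; rewrite integral_mkcond; apply: eq_integral => t _.
rewrite !patchE; case: ifPn => [|]; rewrite ?notin_setE ?inE => tD; first by rewrite ifT// inE; split.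
by rewrite ifF//; apply/negbTE; rewrite notin_setE => -[].
Qed.

(** * Absolutely continuous functions and linear ODEs *)

Section AbsCont.
Variable R : realType.
Local Notation lam := (@lebesgue_measure R).
Implicit Types (a b c t s : R) (f g F G : R -> R).

Lemma itv_meas a b : @measurable _ (measurableTypeR R) `[a, b].
Proof. exact: measurable_itv. Qed.
#[local] Hint Resolve itv_meas : core.

Lemma lam_itv_lty a b : (lam `[a, b] < +oo)%E.
Proof. by rewrite lebesgue_measure_itv /=; case: ifP => _; rewrite ?ltry. Qed.

Lemma L1_sub a b c e f : a <= c -> e <= b -> L1 lam `[a, b] f -> L1 lam `[c, e] f.
Proof.
move=> ac eb; apply: integrableS => //.
by apply: subset_itvScc; rewrite bnd_simp.
Qed.

Lemma Int_add a b c f : a <= c -> c <= b -> L1 lam `[a, b] f ->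
  \int[lam]_(s in `[a, b]) f s =
  \int[lam]_(s in `[a, c]) f s + \int[lam]_(s in `[c, b]) f s.
Proof.
move=> ac cb hf.
have := @Rintegral_itvB R f (BLeft a) (BRight b) c hf.
rewrite !bnd_simp => /(_ ac cb) h.
rewrite -(@Rintegral_itv_obnd_cbnd R c (BRight b) f); last first.
  by apply: integrableS hf => //; apply: subset_itvScc; rewrite ?bnd_simp.
by rewrite -h addrC subrK.
Qed.

Lemma L1I_eq a b f g : (forall t, t \in `[a, b] -> f t = g t) ->
  L1 lam `[a, b] f -> L1 lam `[a, b] g.
Proof. by move=> h; apply: (L1_eq (itv_meas a b)). Qed.

Lemma Int_pt a f : \int[lam]_(s in `[a, a]) f s = 0.
Proof. by rewrite set_itv1 Rintegral_set1. Qed.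

Lemma Int_patch a b (h : R -> R) : \int[lam]_(s in `[a, b]) h s =
  \int[lam]_s (if s \in `[a, b] then h s else 0).
Proof.
rewrite Rintegral_mkcond; apply: eq_Rintegral => s _.
by rewrite patchE mem_setE.
Qed.

Lemma L1_patch a b (h : R -> R) : L1 lam `[a, b] h ->
  L1 lam setT (fun s => if s \in `[a, b] then h s else 0).
Proof.
move=> hh; have := (integrable_mkcond _ (itv_meas a b)).1 hh.
apply: (eq_integrable measurableT) => s _; rewrite patchE mem_setE /=.
by case: ifP.
Qed.

Lemma Int_cst a b c : a <= b -> \int[lam]_(s in `[a, b]) c = c * (b - a).
Proof.
move=> ab; rewrite (Rintegral_cst lam (itv_meas a b) c); congr (_ * _).
transitivity (fine (b - a)%:E) => //; congr fine.
etransitivity; first exact: (lebesgue_measure_itv `[a, b]).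
rewrite /= lte_fin; case: ltP => h //.
by have -> : a = b by [apply/eqP; rewrite eq_le ab]; rewrite subrr.
Qed.

(** Fubini for f(s) g(t) on the triangle s <= t. One order of integration gives the first term; the
    other gives the integral of f(s) int_s^b g, which is the full product minus the second term. *)
Lemma IBP0 a b f g : a <= b -> L1 lam `[a, b] f -> L1 lam `[a, b] g ->
  \int[lam]_(t in `[a, b]) (g t * \int[lam]_(s in `[a, t]) f s) +
  \int[lam]_(s in `[a, b]) (f s * \int[lam]_(t in `[a, s]) g t) =
  (\int[lam]_(s in `[a, b]) f s) * (\int[lam]_(t in `[a, b]) g t).
Proof.
move=> ab hf hg.
pose f' s := if s \in `[a, b] then f s else 0.
pose g' s := if s \in `[a, b] then g s else 0.
have hf' : L1 lam setT f' by exact: L1_patch.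
have hg' : L1 lam setT g' by exact: L1_patch.
pose h (s t : R) := f' s * g' t * (s <= t)%R%:R.
have mh : measurable_fun (setT `*` setT) (fun q : R * R => h q.1 q.2).
  rewrite setXTT; apply: measurable_funM.
    apply: measurable_funM.
    - exact: measurableT_comp (L1_meas measurableT hf') measurable_fst.
    - exact: measurableT_comp (L1_meas measurableT hg') measurable_snd.
  have : measurable_fun setT (fun q : R * R => q.1 <= q.2).
    by apply: measurable_fun_ler; [exact: measurable_fst|exact: measurable_snd].
  move=> m; rewrite (_ : (fun q : R * R => (q.1 <= q.2)%R%:R) = (fun b : bool => b%:R : R) \o (fun q : R * R => q.1 <= q.2))//.
  by apply: measurableT_comp => //.
have hh : L1 (lam \x lam)%E (setT `*` setT) (fun q : R * R => h q.1 q.2).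
  rewrite setXTT; apply: (L1_le measurableT _ _ (L1_norm measurableT (L1_prod hf' hg'))) => //.
    by rewrite -setXTT.
  move=> q _; rewrite /h normrM; case: (q.1 <= q.2)%R.
    by rewrite normr1 mulr1.
  by rewrite normr0 mulr0.
have E1 t : t \in `[a, b] -> \int[lam]_s h s t = g t * \int[lam]_(s in `[a, t]) f s.
  move=> tab; rewrite (Int_patch a t) -IntZ//; last first.
    by apply: L1_patch; apply: L1_sub hf => //; rewrite (itvP tab).
  apply: eq_Rintegral => s _; rewrite /h /f' /g' tab.
  have -> : (s \in `[a, t]) = (s \in `[a, b]) && (s <= t).
    rewrite !in_itv /=; case: (a <= s) => //=; case: (leP s t) => st.
      by rewrite (le_trans st)// (itvP tab).
    by rewrite andbF.
  by case: (s \in _) => /=; case: (s <= t); rewrite ?mulr0 ?mul0r ?mulr1// mulrC.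
have E1' t : t \notin `[a, b] -> \int[lam]_s h s t = 0.
  move=> tab; rewrite -[RHS](Int_0 lam setT); apply: eq_Rintegral => s _.
  by rewrite /h /g' (negbTE tab) mulr0 mul0r.
have E2 s : s \in `[a, b] -> \int[lam]_t h s t = f s * \int[lam]_(t in `[s, b]) g t.
  move=> sab; rewrite (Int_patch s b) -IntZ//; last first.
    by apply: L1_patch; apply: L1_sub hg => //; rewrite (itvP sab).
  apply: eq_Rintegral => t _; rewrite /h /f' /g' sab.
  have -> : (t \in `[s, b]) = (t \in `[a, b]) && (s <= t).
    rewrite !in_itv /=; case: (leP s t) => st /=; last by rewrite andbF.
    by rewrite andbT (le_trans _ st)// (itvP sab).
  by case: (t \in _) => /=; case: (s <= t); rewrite ?mulr0 ?mul0r ?mulr1.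
have E2' s : s \notin `[a, b] -> \int[lam]_t h s t = 0.
  move=> tab; rewrite -[RHS](Int_0 lam setT); apply: eq_Rintegral => t _.
  by rewrite /h /f' (negbTE tab) !mul0r.
have K1 : L1 lam `[a, b] (fun t => g t * \int[lam]_(s in `[a, t]) f s).
  apply: (@L1I_eq _ _ (fun t => \int[lam]_s h s t)) => [t tab|]; first by rewrite E1.
  by have := slab_L1_int1 measurableT (h : measurableTypeR R -> measurableTypeR R -> R) hh; apply: integrableS.
have K2 : L1 lam `[a, b] (fun s => f s * \int[lam]_(t in `[s, b]) g t).
  apply: (@L1I_eq _ _ (fun s => \int[lam]_t h s t)) => [t tab|]; first by rewrite E2.
  by have := slab_L1_int2 measurableT (h : measurableTypeR R -> measurableTypeR R -> R) hh; apply: integrableS.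
have := fubini_slab measurableT (h : measurableTypeR R -> measurableTypeR R -> R) hh.
rewrite (_ : (\int[lam]_w _) = \int[lam]_(t in `[a, b]) (g t * \int[lam]_(s in `[a, t]) f s)); last first.
  rewrite Int_patch; apply: eq_Rintegral => t _; case: ifPn => tab; first by rewrite E1.
  by rewrite E1'.
move=> ->.
rewrite (_ : (\int[lam]_w _) = \int[lam]_(s in `[a, b]) (f s * \int[lam]_(t in `[s, b]) g t)); last first.
  rewrite Int_patch; apply: eq_Rintegral => t _; case: ifPn => tab; first by rewrite E2.
  by rewrite E2'.
have K3 : L1 lam `[a, b] (fun s => f s * \int[lam]_(t in `[a, s]) g t).
  have := L1B (itv_meas a b) (L1Z (itv_meas a b) (\int[lam]_(t in `[a, b]) g t) hf) K2.
  apply: L1I_eq => // s sab.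
  rewrite (@Int_add a b s)// ?(itvP sab)//.
  by ring.
rewrite -IntD// -IntZr//; apply: Int_eq => s sab.
rewrite (@Int_add a b s)// ?(itvP sab)//.
by ring.
Qed.

(** Absolute continuity with a chosen density as part of the data: the rules below return explicit
    densities, and a differential equation is stated by writing its right-hand side in place of
    [f]. *)
Definition AC a b F f := L1 lam `[a, b] f /\
  forall t, a <= t <= b -> F t = F a + \int[lam]_(s in `[a, t]) f s.

Lemma AC_int a b F f t s : AC a b F f -> a <= t -> t <= s -> s <= b ->
  F s = F t + \int[lam]_(r in `[t, s]) f r.
Proof.
move=> [hf h] at_ ts sb; rewrite h ?(le_trans at_)// (h t) ?at_ ?(le_trans ts)//.
rewrite (@Int_add a s t)//; first by rewrite addrA.
exact: L1_sub hf.
Qed.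

Lemma AC_sub a b c e F f : a <= c -> e <= b -> AC a b F f -> AC c e F f.
Proof.
move=> ac eb h; split; first by apply: L1_sub h.1.
move=> t /andP[ct te]; apply: (AC_int h) => //; exact: le_trans eb.
Qed.

Lemma AC_prim a b c f : L1 lam `[a, b] f ->
  AC a b (fun t => c + \int[lam]_(s in `[a, t]) f s) f.
Proof. by move=> hf; split=> // t _; rewrite Int_pt addr0. Qed.

Lemma AC_eq a b F f G g : (forall t, a <= t <= b -> F t = G t) ->
  (forall t, a <= t <= b -> f t = g t) -> AC a b F f -> AC a b G g.
Proof.
move=> FG fg [hf h]; split.
  by apply: L1I_eq hf => // t; rewrite /= in_itv /=; exact: fg.
move=> t /andP[at_ tb]; rewrite -!FG ?at_ ?lexx ?(le_trans at_)//=.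
rewrite h ?at_//; congr (_ + _); apply: Int_eq => s /=; rewrite in_itv /= => /andP[as_ st].
by rewrite fg// as_ (le_trans st).
Qed.

(** Densities matter only up to null sets. This is how optimality conditions valid for almost every
    time are inserted into differential equations. *)
Lemma AC_aed a b F f g : measurable_fun `[a, b] g ->
  {ae lam, forall t, t \in `[a, b] -> f t = g t} -> AC a b F f -> AC a b F g.
Proof.
move=> mg fg [hf h]; split; first exact: L1_ae hf.
move=> t /andP[at_ tb]; rewrite h ?at_//; congr (_ + _).
have sub : `[a, t] `<=` `[a, b] by apply: subset_itvScc; rewrite bnd_simp.
apply: Int_ae => //.
- by apply: measurable_funS sub _ => //; exact: L1_meas hf.
- exact: measurable_funS sub mg.
- by apply: ae_imp fg => s /= H /sub; exact: H.
Qed.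

Lemma AC_cst a b c : AC a b (fun=> c) (fun=> 0).
Proof.
split; first exact: L1_0.
by move=> t _; rewrite Int_0 ?addr0.
Qed.

Lemma AC_add a b F f G g : AC a b F f -> AC a b G g ->
  AC a b (fun t => F t + G t) (fun t => f t + g t).
Proof.
move=> hF hG; split; first exact: L1D hF.1 hG.1.
move=> t /andP[at_ tb]; rewrite hF.2 ?at_// hG.2 ?at_// IntD//; first by ring.
- exact: L1_sub hF.1.
- exact: L1_sub hG.1.
Qed.

Lemma AC_scale a b c F f : AC a b F f -> AC a b (fun t => c * F t) (fun t => c * f t).
Proof.
move=> hF; split; first exact: L1Z hF.1.
move=> t /andP[at_ tb]; rewrite hF.2 ?at_// IntZ//; first by ring.
exact: L1_sub hF.1.
Qed.

Lemma AC_opp a b F f : AC a b F f -> AC a b (fun t => - F t) (fun t => - f t).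
Proof.
by move=> h; apply: AC_eq (AC_scale (-1) h) => t _; rewrite mulN1r.
Qed.

Lemma AC_sum (I : Type) (s : seq I) (P : pred I) a b (F f : I -> R -> R) :
  (forall i, P i -> AC a b (F i) (f i)) ->
  AC a b (fun t => \sum_(i <- s | P i) F i t) (fun t => \sum_(i <- s | P i) f i t).
Proof.
move=> H; elim: s => [|i s IH].
  by apply: AC_eq (AC_cst a b 0) => t _; rewrite big_nil.
case Pi : (P i).
  by apply: AC_eq (AC_add (H _ Pi) IH) => t _; rewrite big_cons Pi.
by apply: AC_eq IH => t _; rewrite big_cons Pi.
Qed.

Lemma AC_cont a b F f : a <= b -> AC a b F f -> {within `[a, b], continuous F}.
Proof.
move=> ab h.
have c : {within `[a, b], continuous (fun t => F a + \int[lam]_(s in `[a, t]) f s)}.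
  have := parameterized_integral_continuous ab h.1.
  by move=> c x; apply: cvgD; [exact: cvg_cst|exact: c].
apply: subspace_eq_continuous c => t; rewrite inE /= in_itv /= => tab.
by rewrite /from_subspace -h.2.
Qed.

Lemma AC_meas a b F f : a <= b -> AC a b F f -> measurable_fun `[a, b] F.
Proof.
move=> ab h; apply: subspace_continuous_measurable_fun; first exact: itv_meas.
exact: AC_cont ab h.
Qed.

Lemma AC_bdd a b F f : AC a b F f -> exists c, forall t, t \in `[a, b] -> `|F t| <= c.
Proof.
move=> h; exists (`|F a| + \int[lam]_(s in `[a, b]) `|f s|) => t.
rewrite in_itv /= => /andP[at_ tb]; rewrite h.2 ?at_//.
rewrite (le_trans (ler_normD _ _))// lerD2l.
have h1 : L1 lam `[a, t] f by apply: L1_sub h.1.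
apply: le_trans (Int_norm _ h1) _; first exact: itv_meas.
rewrite [leRHS](@Int_add a b t)//; last exact: L1_norm h.1.
by rewrite lerDl Int_ge0.
Qed.

Lemma AC_L2s a b F f : a <= b -> AC a b F f -> L2s lam `[a, b] F.
Proof.
move=> ab hF; have [c hc] := AC_bdd hF.
by apply: (L2s_bdd (itv_meas a b) (c := c) (lam_itv_lty a b) (AC_meas ab hF)) => t; exact: hc.
Qed.

Lemma AC_L1M a b F f g : a <= b -> AC a b F f -> L1 lam `[a, b] g ->
  L1 lam `[a, b] (fun t => F t * g t).
Proof.
move=> ab h hg; have [c hc] := AC_bdd h.
by apply: (L1_bddM (itv_meas a b) (AC_meas ab h) hc).
Qed.

(** Once the initial values are split off, this is [IBP0] on each [a, t]. *)
Lemma AC_mul a b F f G g : AC a b F f -> AC a b G g ->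
  AC a b (fun t => F t * G t) (fun t => f t * G t + F t * g t).
Proof.
(* For b < a the interval is empty and both clauses are vacuous. *)
move=> hF hG; case: (leP a b) => [ab|ba]; last first.
  split.
    by rewrite set_itv_ge ?bnd_simp -?ltNge//; exact: integrable_set0.
  by move=> t /andP[at_ tb]; have := lt_le_trans ba (le_trans at_ tb); rewrite ltxx.
have h1 : L1 lam `[a, b] (fun t => f t * G t).
  by apply: L1I_eq (AC_L1M ab hG hF.1) => // t _; rewrite mulrC.
have h2 := AC_L1M ab hF hG.1.
split; first exact: L1D.
move=> t /andP[at_ tb].
have hF' : L1 lam `[a, t] f by apply: L1_sub hF.1.
have hG' : L1 lam `[a, t] g by apply: L1_sub hG.1.
rewrite IntD//; [|exact: L1_sub h1|exact: L1_sub h2].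
have := IBP0 at_ hF' hG'.
set If := \int[lam]_(s in `[a, t]) f s; set Ig := \int[lam]_(s in `[a, t]) g s.
have -> : \int[lam]_(x in `[a, t]) (f x * G x) = G a * If +
   \int[lam]_(s in `[a, t]) (f s * \int[lam]_(r in `[a, s]) g r).
  rewrite -IntZ// -IntD//; last 2 first.
  - exact: L1Z.
  - have := AC_L1M at_ (AC_prim 0 hG') hF'.
    by apply: L1I_eq => // s _; rewrite add0r mulrC.
  apply: Int_eq => s; rewrite /= in_itv /= => /andP[as_ st].
  by rewrite hG.2 ?as_ ?(le_trans st)//; ring.
have -> : \int[lam]_(x in `[a, t]) (F x * g x) = F a * Ig +
   \int[lam]_(s in `[a, t]) (g s * \int[lam]_(r in `[a, s]) f r).
  rewrite -IntZ// -IntD//; last 2 first.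
  - exact: L1Z.
  - have := AC_L1M at_ (AC_prim 0 hF') hG'.
    by apply: L1I_eq => // s _; rewrite add0r mulrC.
  apply: Int_eq => s; rewrite /= in_itv /= => /andP[as_ st].
  by rewrite hF.2 ?as_ ?(le_trans st)//; ring.
move=> E; rewrite hF.2 ?at_// hG.2 ?at_// -/If -/Ig.
by rewrite mulrDr mulrDl [in LHS]mulrDl -E; ring.
Qed.

Lemma cont_meas a b f : {within `[a, b], continuous f} -> measurable_fun `[a, b] f.
Proof.
by move=> c; apply: subspace_continuous_measurable_fun => //; exact: itv_meas.
Qed.

Lemma cont_L1 a b f : {within `[a, b], continuous f} -> L1 lam `[a, b] f.
Proof.
by move=> c; apply: continuous_compact_integrable => //; exact: segment_compact.
Qed.

Lemma AC_C1 a b F f : (forall t, is_derive t 1 F (f t)) -> continuous f -> AC a b F f.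
Proof.
move=> d c; split.
  by apply: cont_L1; exact: continuous_subspaceT.
have cF : continuous F.
  by move=> x; apply/differentiable_continuous/derivable1_diffP; case: (d x).
move=> t /andP[]; rewrite le_eqVlt => /predU1P[<- _|at_ tb]; first by rewrite Int_pt addr0.
have H := @continuous_FTC2 R f F a t at_.
rewrite (_ : \int[lam]_(s in `[a, t]) f s = F t - F a).
  by rewrite addrC subrK.
rewrite /Rintegral H//.
- exact: continuous_subspaceT.
- split; [by move=> x _; case: (d x)|exact/cvg_at_right_filter/cF|exact/cvg_at_left_filter/cF].
- by move=> x _; rewrite derive1E; case: (d x).
Qed.

(** With F the primitive of f from a, the function exp(-C t) F(t) starts at 0 and has density exp(-C
    t) (f - C F) <= 0, so F <= 0. As f >= 0, also F >= 0; then F = 0 and f is squeezed to 0. *)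
Lemma gronwall a b C f : measurable_fun `[a, b] f ->
  (exists M, forall t, t \in `[a, b] -> `|f t| <= M) ->
  (forall t, t \in `[a, b] -> 0 <= f t <= C * \int[lam]_(s in `[a, t]) f s) ->
  forall t, t \in `[a, b] -> f t = 0.
Proof.
move=> mf [M fM] h t tab.
have hf : L1 lam `[a, b] f.
  have H := L1_cst (itv_meas a b) M (lam_itv_lty a b).
  by apply: (L1_le (itv_meas a b) mf _ H).
have hF := AC_prim 0 hf.
pose E t := expR (- C * t).
have hE : AC a b E (fun t => - C * E t).
  apply: AC_C1 => x.
    by rewrite /E; apply: is_derive_eq; rewrite /GRing.scale /= mulr1 mulrC.
  apply: cvgM; first exact: cvg_cst.
  by apply: continuous_comp; [exact: mulrl_continuous|exact: continuous_expR].
have hEF := AC_mul hE hF.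
have F0 s : s \in `[a, b] -> \int[lam]_(r in `[a, s]) f r = 0.
  move=> sab; apply/eqP; rewrite eq_le; apply/andP; split; last first.
    apply: Int_ge0 => r rs; have /h/andP[] // : r \in `[a, b].
    move: rs sab; rewrite /= !in_itv /= => /andP[-> rs] /andP[_ sb].
    exact: le_trans rs sb.
  have E0 : 0 < E s by exact: expR_gt0.
  rewrite -(pmulr_rle0 _ E0).
  have := hEF.2 s; rewrite !Int_pt !addr0 mulr0 !add0r => ->; last by move: sab; rewrite in_itv.
  rewrite -oppr_ge0 -IntN//; last first.
    by apply: L1_sub hEF.1 => //; rewrite (itvP sab).
  apply: Int_ge0 => r rs.
  have rab : r \in `[a, b].
    by move: rs; rewrite /= !in_itv /= => /andP[-> rs]; rewrite (le_trans rs)// (itvP sab).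
  have /andP[_ hr] := h _ rab.
  rewrite add0r (_ : - _ = E r * (C * \int[lam]_(s0 in `[a, r]) f s0 - f r)); last by ring.
  by rewrite mulr_ge0 ?expR_ge0// subr_ge0.
have /andP[h0 h1] := h _ tab.
by apply/eqP; rewrite eq_le h0 (le_trans h1)// F0// mulr0.
Qed.

End AbsCont.

Section MatrixAC.
Variable R : realType.
Local Notation lam := (@lebesgue_measure R).
Implicit Types (a b c t s : R).

Definition ACm p q a b (A A' : R -> 'M[R]_(p, q)) :=
  forall i j, AC a b (fun t => A t i j) (fun t => A' t i j).

Lemma ACm_mul p q r a b (A A' : R -> 'M[R]_(p, q)) (B B' : R -> 'M[R]_(q, r)) :
  ACm a b A A' -> ACm a b B B' ->
  ACm a b (fun t => A t *m B t) (fun t => A' t *m B t + A t *m B' t).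
Proof.
move=> hA hB i j.
have h : AC a b (fun t => \sum_k A t i k * B t k j)
    (fun t => \sum_k (A' t i k * B t k j + A t i k * B' t k j)).
  by apply: AC_sum => k _; exact: AC_mul.
by apply: AC_eq h => t _; rewrite !mxE// big_split.
Qed.

Lemma ACm_cst p q a b (A : 'M[R]_(p, q)) : ACm a b (fun=> A) (fun=> 0).
Proof. by move=> i j; apply: AC_eq (AC_cst a b (A i j)) => t _; rewrite ?mxE. Qed.

Lemma ACm_eq p q a b (A A' B B' : R -> 'M[R]_(p, q)) :
  (forall t, a <= t <= b -> A t = B t) -> (forall t, a <= t <= b -> A' t = B' t) ->
  ACm a b A A' -> ACm a b B B'.
Proof.
by move=> h h' H i j; apply: AC_eq (H i j) => t tab; rewrite (h, h').
Qed.

Lemma ACm_add p q a b (A A' B B' : R -> 'M[R]_(p, q)) : ACm a b A A' -> ACm a b B B' ->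
  ACm a b (fun t => A t + B t) (fun t => A' t + B' t).
Proof. by move=> hA hB i j; apply: AC_eq (AC_add (hA i j) (hB i j)) => t _; rewrite mxE. Qed.

Lemma ACm_opp p q a b (A A' : R -> 'M[R]_(p, q)) : ACm a b A A' ->
  ACm a b (fun t => - A t) (fun t => - A' t).
Proof. by move=> hA i j; apply: AC_eq (AC_opp (hA i j)) => t _; rewrite mxE. Qed.

Lemma ACm_sub p q a b (A A' B B' : R -> 'M[R]_(p, q)) : ACm a b A A' -> ACm a b B B' ->
  ACm a b (fun t => A t - B t) (fun t => A' t - B' t).
Proof. by move=> hA hB; apply: ACm_add => //; exact: ACm_opp. Qed.

Lemma ACm_mull p q r a b (C : 'M[R]_(r, p)) (A A' : R -> 'M[R]_(p, q)) : ACm a b A A' ->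
  ACm a b (fun t => C *m A t) (fun t => C *m A' t).
Proof.
by move=> hA; apply: ACm_eq (ACm_mul (ACm_cst a b C) hA) => // t _; rewrite mul0mx add0r.
Qed.

Lemma ACm_itv p q a b c e (A A' : R -> 'M[R]_(p, q)) : a <= c -> e <= b ->
  ACm a b A A' -> ACm c e A A'.
Proof. by move=> h1 h2 hA i j; apply: AC_sub (hA i j). Qed.

Lemma ACm_const p q a b (A : R -> 'M[R]_(p, q)) : ACm a b A (fun=> 0) ->
  forall t, a <= t <= b -> A t = A a.
Proof.
move=> h t tab; apply/matrixP => i j; rewrite (h i j).2//.
by rewrite (_ : \int[lam]_(_ in _) _ = 0) ?addr0// -[RHS](Int_0 lam `[a, t]);
  apply: Int_eq => s _; rewrite mxE.
Qed.

End MatrixAC.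

(** * Matrix exponential and linear differential equations *)

Section MatrixExp.
Variables (R : realType) (m : nat).
Implicit Types (M : 'M[R]_m) (t s a b : R).

(** Taylor coefficients of the entries of A exp(t M). The left factor is kept general because
    differentiation in t then merely replaces [A] by [A *m M]. *)
Definition ecoef p (A : 'M[R]_(p, m)) M i j (k : nat) : R :=
  (A *m (M ^+ k)) i j / k`!%:R.

(** The entrywise l1 norm is submultiplicative, which yields the scalar majorant msum A exp(msum M
    |t|) of the exponential series. *)
Definition msum p q (A : 'M[R]_(p, q)) : R := \sum_i \sum_j `|A i j|.

Lemma msum_ge p q (A : 'M[R]_(p, q)) i j : `|A i j| <= msum A.
Proof.
rewrite /msum (bigD1 i)//= (bigD1 j)//= -addrA lerDl addr_ge0//.
  by apply: sumr_ge0.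
by apply: sumr_ge0 => k _; apply: sumr_ge0.
Qed.

Lemma msum_ge0 p q (A : 'M[R]_(p, q)) : 0 <= msum A.
Proof. by apply: sumr_ge0 => k _; apply: sumr_ge0. Qed.

Lemma msumM p q r (A : 'M[R]_(p, q)) (B : 'M[R]_(q, r)) : msum (A *m B) <= msum A * msum B.
Proof.
rewrite /msum mulr_suml ler_sum// => i _.
apply: (@le_trans _ _ (\sum_j \sum_k `|A i k| * `|B k j|)).
  apply: ler_sum => j _; rewrite mxE (le_trans (ler_norm_sum _ _ _))//.
  by apply: ler_sum => k _; rewrite normrM.
rewrite exchange_big /= mulr_suml ler_sum// => k _.
rewrite -mulr_sumr ler_wpM2l//.
rewrite (bigD1 k)//= lerDl; apply: sumr_ge0 => l _; exact: sumr_ge0.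
Qed.

Lemma msum_exp p (A : 'M[R]_(p, m)) M k : msum (A *m M ^+ k) <= msum A * msum M ^+ k.
Proof.
elim: k => [|k IH]; first by rewrite !expr0 mulr1 mulmx1.
rewrite exprSr -[M ^+ k * M]/(M ^+ k *m M) mulmxA (le_trans (msumM _ _))//.
by rewrite exprSr mulrA ler_wpM2r// msum_ge0.
Qed.

Lemma ecoef_cvg p (A : 'M[R]_(p, m)) M i j t : cvgn (pseries (ecoef A M i j) t).
Proof.
apply: normed_cvg.
apply: (@series_le_cvg _ _ (fun k => msum A * exp_coeff (msum M * `|t|) k)).
- by move=> k /=.
- by move=> k; rewrite mulr_ge0 ?msum_ge0// exp_coeff_ge0// mulr_ge0 ?msum_ge0.
- move=> k; rewrite /= /ecoef /exp_coeff /= normrM normrX normrM.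
  rewrite [`|_^-1|]ger0_norm ?invr_ge0// exprMn !mulrA [leRHS]mulrAC ler_wpM2r ?exprn_ge0//.
  by rewrite ler_wpM2r ?invr_ge0// (le_trans (msum_ge _ _ _))// msum_exp.
- have -> : series (fun k => msum A * exp_coeff (msum M * `|t|) k) =
      (fun n => msum A * series (exp_coeff (msum M * `|t|)) n).
    by apply/funext => n; rewrite /series /= mulr_sumr.
  by apply: is_cvgMr; exact: is_cvg_series_exp_coeff.
Qed.

Definition exA p (A : 'M[R]_(p, m)) M t : 'M[R]_(p, m) :=
  \matrix_(i, j) limn (pseries (ecoef A M i j) t).

Lemma ecoef_diffs p (A : 'M[R]_(p, m)) M i j :
  pseries_diffs (ecoef A M i j) = ecoef (A *m M) M i j.
Proof.
apply/funext => k; rewrite /pseries_diffs /ecoef exprS -mulmxA factS natrM invfM.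
rewrite -[M * M ^+ k]/(M *m M ^+ k) mulrCA [X in _ * X]mulrA mulfV ?mul1r//.
Qed.

Lemma exA_derive p (A : 'M[R]_(p, m)) M t i j :
  is_derive t 1 (fun t => exA A M t i j) (exA (A *m M) M t i j).
Proof.
have := @pseries_snd_diffs R (ecoef A M i j) (`|t| + 1) t.
rewrite !ecoef_diffs => h.
have {}h : is_derive t 1 (fun x => limn (pseries (ecoef A M i j) x))
    (limn (pseries (ecoef (A *m M) M i j) t)).
  by apply: h; [exact: ecoef_cvg..|rewrite [ltRHS]ger0_norm ?ltrDl// addr_ge0].
rewrite [X in is_derive _ _ _ X]mxE.
by rewrite (_ : (fun t => _) = (fun x => limn (pseries (ecoef A M i j) x)))//;
  apply/funext => x; rewrite mxE.
Qed.

Lemma exA_cont p (A : 'M[R]_(p, m)) M i j : continuous (fun t => exA A M t i j).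
Proof.
move=> t; apply/differentiable_continuous/derivable1_diffP.
by case: (exA_derive A M t i j).
Qed.

Lemma limn_sum (I : Type) (r : seq I) (u : I -> nat -> R) :
  (forall i, cvgn (u i)) ->
  (fun n => \sum_(i <- r) u i n) @ \oo --> \sum_(i <- r) limn (u i).
Proof.
move=> h; elim: r => [|i r IH].
  by rewrite big_nil; under eq_fun do rewrite big_nil; exact: cvg_cst.
rewrite big_cons; under eq_fun do rewrite big_cons.
by apply: cvgD => //; exact: h.
Qed.

Lemma exA_mull p q (C : 'M[R]_(q, p)) (A : 'M[R]_(p, m)) M t :
  exA (C *m A) M t = C *m exA A M t.
Proof.
apply/matrixP => i j; rewrite !mxE; apply/cvg_lim => //.
have -> : pseries (ecoef (C *m A) M i j) t =
  (fun n => \sum_k (C i k * pseries (ecoef A M k j) t n)).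
  apply/funext => n; rewrite /pseries /series /=.
  under [RHS]eq_bigr do rewrite mulr_sumr.
  rewrite exchange_big /=; apply: eq_bigr => l _.
  rewrite /ecoef -mulmxA mxE !mulr_suml; apply: eq_bigr => k _.
  by rewrite !mulrA.
have := @limn_sum _ (index_enum _) (fun k n => C i k * pseries (ecoef A M k j) t n).
have h k : cvgn (fun n => C i k * pseries (ecoef A M k j) t n).
  by apply: is_cvgMr; exact: ecoef_cvg.
move=> /(_ h).
rewrite (_ : \sum_(i0 <- _) _ = \sum_j0 C i j0 * exA A M t j0 j)//.
apply: eq_bigr => k _; rewrite mxE.
by apply/cvg_lim => //; apply: cvgMr; exact: ecoef_cvg.
Qed.

Lemma exA_0 p (A : 'M[R]_(p, m)) M : exA A M 0 = A.
Proof.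
apply/matrixP => i j; rewrite mxE; apply/cvg_lim => //.
rewrite -(cvg_shiftS (pseries (ecoef A M i j) 0)) /=.
have -> : (fun n => pseries (ecoef A M i j) 0 n.+1) = (fun=> A i j).
  apply/funext => n; rewrite /pseries /series /= big_nat_recl//= big1 ?addr0.
    by rewrite [X in _ * X](expr0 (0 : R)) mulr1 /ecoef [M ^+ 0]expr0 mulmx1 fact0 divr1.
  by move=> k _; rewrite expr0n /= mulr0.
exact: cvg_cst.
Qed.

Definition expm M t := exA 1%:M M t.

Lemma exA_E p (A : 'M[R]_(p, m)) M t : exA A M t = A *m expm M t.
Proof. by rewrite /expm -exA_mull mulmx1. Qed.

Lemma expm_derive M t i j : is_derive t 1 (fun t => expm M t i j) ((M *m expm M t) i j).
Proof. by rewrite -exA_E -[X in exA X _ _]mul1mx; exact: exA_derive. Qed.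

Lemma expm0 M : expm M 0 = 1%:M.
Proof. exact: exA_0. Qed.

Lemma expm_comm M t : expm M t *m M = M *m expm M t.
Proof.
rewrite -exA_E; apply/esym/matrixP => i j; rewrite !mxE; apply/cvg_lim => //.
have -> : pseries (ecoef M M i j) t =
  (fun n => \sum_k (pseries (ecoef 1%:M M i k) t n * M k j)).
  apply/funext => n; rewrite /pseries /series /=.
  under [RHS]eq_bigr do rewrite mulr_suml.
  rewrite exchange_big /=; apply: eq_bigr => l _.
  rewrite /ecoef -[M *m M ^+ l]/(M * M ^+ l) -exprS exprSr mxE !mulr_suml.
  by apply: eq_bigr => k _; rewrite mul1mx; ring.
have := @limn_sum _ (index_enum _) (fun k n => pseries (ecoef 1%:M M i k) t n * M k j).
have h k : cvgn (fun n => pseries (ecoef 1%:M M i k) t n * M k j).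
  by apply: is_cvgMl; exact: ecoef_cvg.
move=> /(_ h).
rewrite (_ : \sum_(i0 <- _) _ = \sum_j0 expm M t i j0 * M j0 j)//.
apply: eq_bigr => k _; rewrite mxE.
by apply/cvg_lim => //; apply: cvgMl; exact: ecoef_cvg.
Qed.

Lemma expm_cont M i j : continuous (fun t => expm M t i j).
Proof. exact: exA_cont. Qed.

Lemma expm_AC M a b s : ACm a b (fun t => expm M (t - s)) (fun t => M *m expm M (t - s)).
Proof.
move=> i j; apply: AC_C1 => t.
  have h : is_derive (t - s) 1 (fun t => expm M t i j) ((M *m expm M (t - s)) i j).
    exact: expm_derive.
  have h2 : is_derive t 1 (fun t => t - s) 1.
    by have := is_deriveB (is_derive_id t 1) (is_derive_cst s t 1); rewrite subr0.
  by have := @is_derive1_comp R (fun t => expm M t i j) (fun t => t - s) t _ _ h h2; rewrite mulr1.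
under eq_fun do rewrite -exA_E.
apply: (@continuous_comp _ _ _ (fun t => t - s) (fun t => exA M M t i j)).
  by apply: cvgB; [exact: cvg_id|exact: cvg_cst].
exact: exA_cont.
Qed.

Lemma expm_ACN M a b s : ACm a b (fun t => expm M (s - t)) (fun t => - (expm M (s - t) *m M)).
Proof.
move=> i j; apply: AC_C1 => t.
  have h : is_derive (s - t) 1 (fun t => expm M t i j) ((M *m expm M (s - t)) i j).
    exact: expm_derive.
  have h2 : is_derive t 1 (fun t => s - t) (-1).
    by have := is_deriveB (is_derive_cst s t 1) (is_derive_id t 1); rewrite sub0r.
  by have := @is_derive1_comp R (fun t => expm M t i j) (fun t => s - t) t _ _ h h2; rewrite mulrN1 expm_comm [in X in _ -> X]mxE.
under eq_fun do rewrite expm_comm -exA_E mxE.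
apply: cvgN.
apply: (@continuous_comp _ _ _ (fun t => s - t) (fun t => exA M M t i j)).
  by apply: cvgB; [exact: cvg_cst|exact: cvg_id].
exact: exA_cont.
Qed.

(** The product has derivative 0 on [-|t|, |t|], an interval that contains both t and 0, and it is
    the identity at 0. *)
Lemma expm_invl M t : expm M (- t) *m expm M t = 1%:M.
Proof.
have h : ACm (- `|t|) `|t| (fun t => expm M (0 - t) *m expm M (t - 0)) (fun=> 0).
  apply: ACm_eq (ACm_mul (expm_ACN M _ _ 0) (expm_AC M _ _ 0)) => // s _.
  by rewrite mulNmx mulmxA addNr.
have e := ACm_const h.
have := e t; rewrite lerNl -normrN ler_norm normrN ler_norm => /(_ isT).
rewrite sub0r subr0 => ->.
have := e 0; rewrite oppr_le0 normr_ge0 => /(_ isT) <-.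
by rewrite subr0 expm0 mulmx1.
Qed.

Lemma expm_invr M t : expm M t *m expm M (- t) = 1%:M.
Proof. by rewrite -{1}[t]opprK expm_invl. Qed.

(** Multiplied by the integrating factor expm M (a - t), the solution is constant. *)
Lemma ode_unique q M a b (z : R -> 'M[R]_(m, q)) : a <= b ->
  ACm a b z (fun t => M *m z t) -> z b = expm M (b - a) *m z a.
Proof.
move=> ab hz.
have h : ACm a b (fun t => expm M (a - t) *m z t) (fun=> 0).
  apply: ACm_eq (ACm_mul (expm_ACN M _ _ a) hz) => // s _.
  by rewrite mulNmx mulmxA addNr.
have := ACm_const h; move=> /(_ b); rewrite lexx ab => /(_ isT).
rewrite subrr expm0 mul1mx => <-.
by rewrite mulmxA -[a - b]opprB expm_invr mul1mx.
Qed.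

Lemma L1_expm M a b s (g : R -> 'cV[R]_m) : a <= b ->
  (forall i, L1 (@lebesgue_measure R) `[a, b] (fun t => g t i 0)) ->
  forall i, L1 (@lebesgue_measure R) `[a, b] (fun t => (expm M (s - t) *m g t) i 0).
Proof.
move=> ab hg i.
have h : L1 (@lebesgue_measure R) `[a, b] (fun t => \sum_k expm M (s - t) i k * g t k 0).
  by apply: (L1_sum (itv_meas a b)) => k _; apply: (AC_L1M ab (expm_ACN M a b s i k)).
by apply: L1I_eq h => t _; rewrite mxE.
Qed.

(** Variation of constants formula. *)
Definition ode_sol M a (z0 : 'cV[R]_m) (g : R -> 'cV[R]_m) t : 'cV[R]_m :=
  expm M (t - a) *m (z0 + vint a t (fun s => expm M (a - s) *m g s)).

Lemma ode_solP M a b z0 (g : R -> 'cV[R]_m) : a <= b ->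
  (forall i, L1 (@lebesgue_measure R) `[a, b] (fun t => g t i 0)) ->
  ACm a b (ode_sol M a z0 g) (fun t => M *m ode_sol M a z0 g t + g t).
Proof.
move=> ab hg.
have h : ACm a b (fun t => z0 + vint a t (fun s => expm M (a - s) *m g s))
   (fun t => expm M (a - t) *m g t).
  move=> i j; rewrite ord1.
  have := AC_prim (z0 i 0) (L1_expm M a ab hg i).
  by apply: AC_eq => t _ //; rewrite !mxE.
apply: ACm_eq (ACm_mul (expm_AC M _ _ a) h) => // t _.
by rewrite /ode_sol -!mulmxA [expm M (t - a) *m (expm M _ *m _)]mulmxA -[a - t]opprB expm_invr mul1mx.
Qed.

Lemma ode_sol0 M a z0 g : ode_sol M a z0 g a = z0.
Proof.
rewrite /ode_sol subrr expm0 mul1mx (_ : vint _ _ _ = 0) ?addr0//.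
by apply/matrixP => i j; rewrite !mxE Int_pt.
Qed.

(** The initial value is the prescribed terminal value pulled back through the variation of
    constants formula. *)
Lemma ode_backward M a b zb (g : R -> 'cV[R]_m) : a <= b ->
  (forall i, L1 (@lebesgue_measure R) `[a, b] (fun t => g t i 0)) ->
  exists z, ACm a b z (fun t => M *m z t + g t) /\ z b = zb.
Proof.
move=> ab hg.
exists (ode_sol M a (expm M (a - b) *m zb - vint a b (fun s => expm M (a - s) *m g s)) g).
split; first exact: ode_solP.
by rewrite /ode_sol subrK mulmxA -[a - b]opprB expm_invr mul1mx.
Qed.

Lemma exAv_derive p (A : 'M[R]_(p, m)) M (v : 'cV[R]_m) t i :
  is_derive t 1 (fun t => (exA A M t *m v) i 0) ((exA (A *m M) M t *m v) i 0).
Proof.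
have h k : is_derive t 1 (fun t => v k 0 * exA A M t i k) (v k 0 * exA (A *m M) M t i k).
  have := is_deriveZ (v k 0) (exA_derive A M t i k).
  by [].
have H (r : seq 'I_m) : is_derive t 1 (fun t => \sum_(k <- r) v k 0 * exA A M t i k)
    (\sum_(k <- r) v k 0 * exA (A *m M) M t i k).
  elim: r => [|k r IH].
    rewrite big_nil (_ : (fun t => _) = cst 0); first exact: is_derive_cst.
    by apply/funext => x; rewrite big_nil.
  rewrite big_cons (_ : (fun t => _) = (fun t => v k 0 * exA A M t i k) + (fun t => \sum_(k <- r) v k 0 * exA A M t i k)).
    exact: is_deriveD.
  by apply/funext => x; rewrite big_cons.
rewrite [X in is_derive _ _ _ X]mxE; under eq_bigr do rewrite mulrC.
rewrite (_ : (fun t => _) = (fun t => \sum_k v k 0 * exA A M t i k)); first exact: H.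
by apply/funext => x; rewrite mxE; under eq_bigr do rewrite mulrC.
Qed.

(* An output A z of a solution that vanishes on an interval has all its
   derivatives A M^k z equal to 0 there, hence vanishes identically. *)
Lemma unique_continuation p (A : 'M[R]_(p, m)) M (z : R -> 'cV[R]_m) a c b : a < c -> c <= b ->
  ACm a b z (fun t => M *m z t) -> (forall t, a <= t <= c -> A *m z t = 0) ->
  A *m z b = 0.
Proof.
move=> ac cb hz h0.
have zE t : a <= t <= b -> z t = expm M (t - a) *m z a.
  by move=> /andP[at_ tb]; apply: ode_unique => //; apply: ACm_itv hz.
(* Induction on the order of the derivative: each one is the derivative of a function that vanishes
   on an open interval. *)
have K k : forall t, t \in `]0, (c - a)[ -> exA (A *m M ^+ k) M t *m z a = 0.
  elim: k => [|k IH] t tac.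
    rewrite expr0 mulmx1 exA_E -mulmxA.
    have tac' : a <= t + a <= c.
      by rewrite lerDr (itvP tac) /= -lerBrDr ltW// (itvP tac).
    rewrite -{1}[t](addrK a) -zE ?h0//.
    by have /andP[-> /le_trans ->] := tac'.
  apply/matrixP => i j; rewrite ord1 [RHS]mxE.
  have d1 : is_derive t 1 (fun t => (exA (A *m M ^+ k) M t *m z a) i 0)
      ((exA (A *m M ^+ k.+1) M t *m z a) i 0).
    by rewrite exprSr -[M ^+ k * M]/(M ^+ k *m M) mulmxA; exact: exAv_derive.
  have d2 : is_derive t 1 (fun t => (exA (A *m M ^+ k) M t *m z a) i 0) 0.
    have : is_derive t 1 (cst 0 : R -> R) 0 by exact: is_derive_cst.
    apply: near_eq_is_derive => //.
    near=> s; rewrite IH ?mxE//.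
    by near: s; apply: near_in_itvoo.
  by rewrite -(@derive_val _ _ _ _ _ _ _ d1) (@derive_val _ _ _ _ _ _ _ d2).
pose t0 := (c - a) / 2.
have t0i : t0 \in `]0, (c - a)[.
  rewrite in_itv /= /t0 divr_gt0 ?subr_gt0//= ltr_pdivrMr// ltr_pMr ?subr_gt0//.
  by rewrite ltr1n.
have t0b : a <= t0 + a <= b.
  by rewrite lerDr (itvP t0i) /= (le_trans _ cb)// -lerBrDr ltW// (itvP t0i).
have -> : z b = expm M (b - (t0 + a)) *m z (t0 + a).
  have /andP[x1 x2] := t0b.
  by apply: ode_unique => //; apply: ACm_itv hz.
have {}K k : A *m M ^+ k *m z (t0 + a) = 0.
  by rewrite zE// addrK mulmxA -exA_E K.
rewrite mulmxA -exA_E; set w := z (t0 + a) in K *; set s := b - _.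
apply/matrixP => i j; rewrite ord1 [RHS]mxE mxE.
have h k : cvgn (fun n => pseries (ecoef A M i k) s n * w k 0).
  by apply: is_cvgMl; exact: ecoef_cvg.
have := @limn_sum _ (index_enum 'I_m) _ h.
(* Applied to w, every partial sum of the series is a combination of the vanishing vectors A M^l
   w. *)
have -> : (fun n => \sum_(k <- index_enum _) pseries (ecoef A M i k) s n * w k 0) = (fun=> 0).
  apply/funext => n; rewrite /pseries /series /=.
  under eq_bigr do rewrite mulr_suml.
  rewrite exchange_big /= big1// => l _.
  transitivity ((A *m M ^+ l *m w) i 0 / l`!%:R * s ^+ l).
    by rewrite [in RHS]mxE !mulr_suml; apply: eq_bigr => k _; rewrite /ecoef; ring.
  by rewrite K mxE !mul0r.
move=> H; apply: etrans (cvg_unique (@Rhausdorff R) H (@cvg_cst _ _ _ _ _)).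
apply: eq_bigr => k _; rewrite mxE; apply/esym/cvg_lim => //.
by apply: cvgMl; exact: ecoef_cvg.
Unshelve. all: by end_near. Qed.

End MatrixExp.

Import HBNNSimple.

Section Clamp.
Variable R : realType.
Implicit Types x : R.

(** The clamp to [-1, 1] of a random variable serves as a bounded test function of the same sign;
    the three cases are in a form that arithmetic tactics consume. *)
Lemma clampP x : let c := Num.max (Num.min x 1) (-1) in
  [\/ c = x /\ (-1 <= x /\ x <= 1), c = 1 /\ 1 < x | c = -1 /\ x < -1].
Proof.
have N11 : -1 <= 1 :> R by lra.
rewrite /=; have [h|h] := leP x 1; last by rewrite (max_l N11); constructor 2.
have [h'|h'] := leP (-1) x; first by constructor 1.
by constructor 3.
Qed.

Lemma truncP x : let c := Num.max (Num.min x 1) 0 in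
  [\/ c = x /\ (0 <= x /\ x <= 1), c = 1 /\ 1 < x | c = 0 /\ x < 0].
Proof.
rewrite /=; have [h|h] := leP x 1; last by rewrite max_l ?ler01//; constructor 2.
have [h'|h'] := leP 0 x; first by constructor 1.
by constructor 3.
Qed.

End Clamp.

(** * Sub-sigma-algebras *)

Section SubSigma.
Context d (Omega : measurableType d) (R : realType) (P : probability Omega R).
Implicit Types (G : set (set Omega)) (xi zeta eta : Omega -> R).

(** Measurability for a sub-sigma-algebra is obtained by retyping Omega, so that the general lemmas
    on measurable functions apply unchanged. *)
Definition gmeas G (f : Omega -> R) : Prop :=
  @measurable_fun _ _ (g_sigma_algebraType G) R setT f.

Definition subsigma G := sigma_algebra setT G /\ forall A, G A -> measurable A.

Lemma gmeasP G f : sigma_algebra setT G ->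
  (gmeas G f <-> forall B : set R, measurable B -> G (f @^-1` B)).
Proof.
move=> sG; have E := sigma_algebra_id sG; split=> [h B mB|h _ B mB].
  by have := h measurableT B mB; rewrite setTI /measurable /= E.
by rewrite setTI /measurable /= E; exact: h.
Qed.

Lemma gmeas_set G A : sigma_algebra setT G -> G A <-> @measurable _ (g_sigma_algebraType G) A.
Proof. by move=> sG; rewrite /measurable /= (sigma_algebra_id sG). Qed.

Lemma gmeas_meas G f : subsigma G -> gmeas G f -> measurable_fun setT f.
Proof. by move=> [sG GM] /(gmeasP _ sG) h _ B mB; rewrite setTI; apply/GM/h. Qed.

Lemma gmeas_mono G G' f : sigma_algebra setT G -> sigma_algebra setT G' -> G `<=` G' ->
  gmeas G f -> gmeas G' f.
Proof. by move=> sG sG' GG' /(gmeasP _ sG) h; apply/gmeasP => // B mB; apply/GG'/h. Qed.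

Lemma gmeas_cst G c : gmeas G (fun=> c).
Proof. exact: measurable_cst. Qed.

Lemma gmeasD G f g : gmeas G f -> gmeas G g -> gmeas G (fun w => f w + g w).
Proof. exact: measurable_funD. Qed.

Lemma gmeasB G f g : gmeas G f -> gmeas G g -> gmeas G (fun w => f w - g w).
Proof. exact: measurable_funB. Qed.

Lemma gmeasM G f g : gmeas G f -> gmeas G g -> gmeas G (fun w => f w * g w).
Proof. exact: measurable_funM. Qed.

Lemma gmeasZ G c f : gmeas G f -> gmeas G (fun w => c * f w).
Proof. by move=> h; apply: gmeasM => //; exact: gmeas_cst. Qed.

Lemma gmeasN G f : gmeas G f -> gmeas G (fun w => - f w).
Proof. by move=> h; exact: measurableT_comp. Qed.

Lemma gmeas_sum G (I : Type) (s : seq I) (Q : pred I) (h : I -> Omega -> R) :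
  (forall i, Q i -> gmeas G (h i)) -> gmeas G (fun w => \sum_(i <- s | Q i) h i w).
Proof.
move=> H; elim: s => [|i s IH].
  rewrite (_ : (fun w => _) = fun=> 0); first exact: gmeas_cst.
  by apply/funext => w; rewrite big_nil.
case Qi : (Q i).
  rewrite (_ : (fun w => _) = fun w => h i w + \sum_(i <- s | Q i) h i w).
    by apply: gmeasD => //; exact: H.
  by apply/funext => w; rewrite big_cons Qi.
rewrite (_ : (fun w => _) = fun w => \sum_(i <- s | Q i) h i w)//.
by apply/funext => w; rewrite big_cons Qi.
Qed.

Lemma gmeas_ind G A : sigma_algebra setT G -> G A -> gmeas G (\1_A : Omega -> R).
Proof. by move=> sG GA; apply: measurable_indic; apply/(gmeas_set _ sG). Qed.

Lemma gmeas_gt G f c : sigma_algebra setT G -> gmeas G f -> G [set w | c < f w].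
Proof.
move=> sG /(gmeasP _ sG) h; have := h `]c, +oo[%classic (measurable_itv _).
by rewrite (_ : _ @^-1` _ = [set w | c < f w])//; apply/seteqP; split => w /=; rewrite in_itv/= andbT.
Qed.

Lemma P_lty : (P setT < +oo)%E.
Proof. by rewrite probability_setT ltry. Qed.

Lemma ind_le1 (A : set Omega) w : `|\1_A w : R| <= 1.
Proof. by rewrite indicE; case: (_ \in _); rewrite ?normr1 ?normr0. Qed.

Lemma ind_L2s (A : set Omega) : measurable A -> L2s P setT (\1_A : Omega -> R).
Proof.
by move=> mA; apply: (L2s_bdd measurableT P_lty (measurable_indic mA)) => w _; exact: ind_le1.
Qed.

Lemma L2s_L1P xi : L2s P setT xi -> L1 P setT xi.
Proof. exact: (L2s_L1 measurableT P_lty). Qed.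

Lemma Int_ind A (f : Omega -> R) : measurable A ->
  \int[P]_w (\1_A w * f w) = \int[P]_(w in A) f w.
Proof.
move=> mA; rewrite [RHS]Rintegral_mkcond; apply: eq_Rintegral => w _.
by rewrite patchE indicE; case: (_ \in _); rewrite ?mul1r ?mul0r.
Qed.

Lemma L1_ind A (f : Omega -> R) : measurable A -> L1 P setT f -> L1 P setT (fun w => \1_A w * f w).
Proof.
move=> mA; apply: (L1_bddM measurableT (c := 1)) => [|w _]; first exact: measurable_indic.
by rewrite indicE; case: (_ \in _); rewrite ?normr1 ?normr0.
Qed.

Lemma L1_setT A f : measurable A -> L1 P setT f -> L1 P A f.
Proof. by move=> mA; exact: integrableS. Qed.

Lemma L2s_L1A A xi : measurable A -> L2s P setT xi -> L1 P A xi.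
Proof. by move=> mA /L2s_L1P; exact: L1_setT. Qed.

Section Orth.
Variable G : set (set Omega).
Hypothesis sG : subsigma G.

(** This is E[xi | G] = 0 in integrated form. Martingale properties and conditional expectations are
    all expressed this way. *)
Definition orth xi := forall A, G A -> \int[P]_(w in A) xi w = 0.

Let OG := g_sigma_algebraType G.

Lemma orth_nnsfun xi (s : {nnsfun OG >-> R}) : L1 P setT xi -> orth xi ->
  L1 P setT (fun w => s w * xi w) /\ \int[P]_w (s w * xi w) = 0.
Proof.
move=> hxi o.
have GA r : G (s @^-1` [set r]).
  by apply/(gmeas_set _ sG.1); exact: measurable_sfunP.
have MA r : measurable (s @^-1` [set r] : set Omega) by apply: sG.2; exact: GA.
have E w : s w * xi w =
   \sum_(r <- finmap.enum_fset (fset_set (range s))) r * (\1_(s @^-1` [set r]) w * xi w).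
  rewrite {1}(fimfunE s w) fsbig_finite//= mulr_suml.
  by apply: eq_bigr => r _; rewrite mulrA.
have H r : L1 P setT (fun w => r * (\1_(s @^-1` [set r]) w * xi w)).
  by apply: (L1Z measurableT); exact: L1_ind.
split.
  apply: (L1_eq measurableT _ (L1_sum measurableT (finmap.enum_fset (fset_set (range s))) (P := xpredT) (fun r _ => H r))) => w _.
  by rewrite E.
rewrite (Int_eq P (g := fun w => \sum_(r <- finmap.enum_fset (fset_set (range s))) r * (\1_(s @^-1` [set r]) w * xi w))).
  rewrite (Int_sum measurableT)// big1// => r _.
  rewrite (IntZ measurableT); last exact: L1_ind.
  by rewrite Int_ind// o ?mulr0.
by move=> w _; rewrite E.
Qed.

(** Simple functions increase to zeta, and |zeta xi| dominates the products. *)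
Lemma orth_ext_ge0 xi zeta : L1 P setT xi -> orth xi -> gmeas G zeta ->
  (forall w, 0 <= zeta w) -> L1 P setT (fun w => zeta w * xi w) ->
  \int[P]_w (zeta w * xi w) = 0.
Proof.
move=> hxi o gz z0 hz.
have mz : @measurable_fun _ _ OG (\bar R) setT (EFin \o zeta) by apply/measurable_EFinP.
pose s := nnsfun_approx measurableT mz.
have z0' : forall x : OG, [set: OG] x -> (0 <= (EFin \o zeta) x)%E.
  by move=> x _ /=; rewrite lee_fin.
have cs w : (fun n => s n w) @ \oo --> zeta w.
  have := @cvg_nnsfun_approx _ _ _ _ measurableT _ mz z0' w I.
  by move/fine_cvgP => [].
have sle n w : s n w <= zeta w.
  have nd : nondecreasing_seq (fun n => s n w).
    by move=> i j ij; have /lefP := @nd_nnsfun_approx _ _ _ _ measurableT _ mz i j ij; exact.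
  have := nondecreasing_cvgn_le nd (cvgP _ (cs w)) n.
  by rewrite (cvg_lim _ (cs w)).
have hs n := orth_nnsfun (s n) hxi o.
have mzx : measurable_fun [set: Omega] (fun w => (zeta w * xi w)%:E).
  exact/measurable_EFinP/(L1_meas measurableT hz).
have := @dominated_convergence _ Omega R P setT measurableT
  (fun n w => (s n w * xi w)%:E) (fun w => (zeta w * xi w)%:E) (fun w => `|zeta w * xi w|%:E).
case.
- by move=> n; apply/measurable_EFinP/(L1_meas measurableT (hs n).1).
- exact: mzx.
- apply: aeW => w _; apply/fine_cvgP; split; first exact: nearW.
  by apply: cvgMl; exact: cs.
- by have := L1_norm measurableT hz.
- apply: aeW => w n _; rewrite /= lee_fin !normrM ler_wpM2r//.
  by rewrite !ger0_norm// z0.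
move=> _ _; rewrite (_ : (fun n => _) = fun=> 0%E); last first.
  by apply/funext => n; rewrite (Int_E measurableT (hs n).1) (hs n).2.
move=> /(cvg_unique _ (@cvg_cst _ 0%E _ \oo _)) /= => /(_ (@ereal_hausdorff R)).
by rewrite (Int_E measurableT hz) => -[].
Qed.

Lemma orth_ext xi zeta : L1 P setT xi -> orth xi -> gmeas G zeta ->
  L1 P setT (fun w => zeta w * xi w) -> \int[P]_w (zeta w * xi w) = 0.
Proof.
move=> hxi o gz hz.
pose zp w := Num.max (zeta w) 0; pose zn w := Num.max (- zeta w) 0.
have gp : gmeas G zp by apply: measurable_maxr => //; exact: gmeas_cst.
have gn : gmeas G zn by apply: measurable_maxr; [exact: gmeasN|exact: gmeas_cst].
have E w : zeta w = zp w - zn w.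
  rewrite /zp /zn; case: (ltP (zeta w) 0) => h; case: (ltP (- zeta w) 0) => h'; lra.
have Lp : L1 P setT (fun w => zp w * xi w).
  apply: (L1_le measurableT _ _ (L1_norm measurableT hz)).
    by apply: measurable_funM; [exact: gmeas_meas gp|exact: L1_meas hxi].
  move=> w _; rewrite !normrM ler_wpM2r// /zp.
  by case: (ltP (zeta w) 0) => h; rewrite ?normr0.
have Ln : L1 P setT (fun w => zn w * xi w).
  apply: (L1_le measurableT _ _ (L1_norm measurableT hz)).
    by apply: measurable_funM; [exact: gmeas_meas gn|exact: L1_meas hxi].
  move=> w _; rewrite !normrM ler_wpM2r// /zn.
  by case: (ltP (- zeta w) 0) => h; rewrite ?normr0// normrN.
rewrite (Int_eq P (g := fun w => zp w * xi w - zn w * xi w)); last first.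
  by move=> w _; rewrite {1}E mulrBl.
rewrite (IntB measurableT Lp Ln) !orth_ext_ge0 ?subrr// => w; rewrite /zp /zn le_max lexx orbT//.
Qed.

Let nu xi (A : set OG) : \bar R := (\int[P]_(w in (A : set Omega)) (xi w)%:E)%E.

Section Density.
Variable xi : Omega -> R.
Hypotheses (hxi : L1 P setT xi) (xi0 : forall w, 0 <= xi w).

Let nu0 : nu xi set0 = 0%E.
Proof. exact: integral_set0. Qed.

Let nu_ge0 A : (0 <= nu xi A)%E.
Proof. by apply: integral_ge0 => w _; rewrite lee_fin. Qed.

Let mOG (A : set OG) : measurable A -> @measurable _ Omega A.
Proof. by move=> /(gmeas_set _ sG.1) /sG.2. Qed.

Let nu_sa : semi_sigma_additive (nu xi).
Proof.
move=> F mF tF mUF; rewrite /nu ge0_integral_bigcup//.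
- apply: is_cvg_nneseries => n _ _.
  by apply: integral_ge0 => w _; rewrite lee_fin.
- by move=> n; exact: mOG.
- by apply/measurable_EFinP; apply: measurable_funTS; exact: (L1_meas measurableT hxi).
- by move=> w _; rewrite lee_fin.
Qed.

HB.instance Definition _ := isMeasure.Build _ OG R (nu xi) nu0 nu_ge0 nu_sa.

Let nu_fin : fin_num_fun (nu xi).
Proof.
move=> A mA; rewrite /nu (Int_E (mOG mA)) //.
by apply: L1_setT hxi; exact: mOG.
Qed.

HB.instance Definition _ := @Measure_isFinite.Build _ OG R (nu xi) nu_fin.

Definition dens : {finite_measure set OG -> \bar R} := nu xi.

Lemma densE A : G A -> dens A = (\int[P]_(w in A) xi w)%:E.
Proof.
move=> GA; have mA : measurable A by exact: sG.2.
by rewrite /dens /= /nu (Int_E mA)//; exact: L1_setT.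
Qed.

End Density.

Let L1_1 : L1 P setT (fun=> 1). Proof. exact: L1_cst measurableT _ P_lty. Qed.

(** The restriction of P to G, realised as the measure of density 1 so that it lives on the retyped
    space and is finite by construction. *)
Let PG : {finite_measure set OG -> \bar R} := dens L1_1 (fun=> ler01).

Let PGE A : G A -> PG A = P A.
Proof.
move=> GA; have mA : measurable A by exact: sG.2.
rewrite densE// (Rintegral_cst P mA 1) mul1r fineK//.
exact: fin_num_measure.
Qed.

Let idm : measurable_fun [set: Omega] (idfun : Omega -> OG).
Proof. by move=> _ A mA; rewrite setTI; apply: sG.2; exact/(gmeas_set _ sG.1). Qed.

(** The identity from Omega to the retyped space is measurable and P restricted to G is its
    pushforward, so integrals of G-measurable functions transfer. *)
Let int_PG (f : OG -> \bar R) : measurable_fun setT f -> (forall w, 0 <= f w)%E ->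
  forall A : set OG, measurable A -> (\int[PG]_(w in A) f w)%E = (\int[P]_(w in (A : set Omega)) f w)%E.
Proof.
move=> mf f0 A mA.
pose Q := pushforward P (idfun : Omega -> OG).
have mfA : measurable_fun A f by exact: measurable_funTS.
have f0' : {in A, forall y, (0 <= f y)%E} by move=> y _; exact: f0.
have E : (\int[Q]_(y in A) f y)%E = (\int[P]_(w in (A : set Omega)) f w)%E :=
  @ge0_integral_pushforward _ _ Omega OG R idfun idm P A f mA mfA f0'.
rewrite -[RHS]E.
apply: eq_measure_integral => B mB _.
by apply: PGE; apply/(gmeas_set _ sG.1).
Qed.

(** Radon-Nikodym derivative of xi P with respect to P, both restricted to G. *)
Lemma condexp_ge0 xi : L1 P setT xi -> (forall w, 0 <= xi w) ->
  exists eta, [/\ gmeas G eta, L1 P setT eta & orth (fun w => xi w - eta w)].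
Proof.
move=> hxi xi0.
have dom : dens hxi xi0 `<< PG.
  apply/null_content_dominatesP => A mA PA.
  have GA : G A by apply/(gmeas_set _ sG.1).
  have PA0 : P A = 0%E by rewrite -(PGE GA).
  rewrite densE// /Rintegral null_set_integral//.
  - exact: sG.2.
  - by apply: (measurable_int P); apply: L1_setT hxi; exact: sG.2.
pose g := Radon_Nikodym_SigmaFinite.f (dens hxi xi0) PG.
have gE w : g w = (fine (g w))%:E.
  by rewrite fineK//; exact: Radon_Nikodym_SigmaFinite.f_fin_num.
have g0 w : (0 <= g w)%E by exact: Radon_Nikodym_SigmaFinite.f_ge0.
have mg : @measurable_fun _ _ OG (\bar R) setT g.
  exact: measurable_int (Radon_Nikodym_SigmaFinite.f_integrable dom).
have gI A : G A -> (\int[P]_(w in A) g w)%E = (\int[P]_(w in A) xi w)%:E.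
  move=> GA; have mA : @measurable _ OG A by apply/(gmeas_set _ sG.1).
  rewrite -(densE hxi xi0 GA) (Radon_Nikodym_SigmaFinite.f_integral dom mA).
  by apply/esym; apply: int_PG.
have gm : gmeas G (fun w => fine (g w)).
  exact: measurableT_comp (fine_measurable measurableT) mg.
have GT : G setT by have [a b c] := sG.1; rewrite -setC0 -setTD; exact: b.
have gL : L1 P setT (fun w => fine (g w)).
  apply/integrableP; split.
    apply/measurable_EFinP; exact: gmeas_meas sG gm.
  have := gI setT GT.
  rewrite (_ : (\int[P]_x g x)%E = (\int[P]_x `|(EFin \o (fun w => fine (g w))) x|)%E).
    by move=> ->; rewrite ltry.
  apply: eq_integral => w _ /=; rewrite [LHS]gE ger0_norm//.
  by rewrite -lee_fin -gE.
exists (fun w => fine (g w)); split => // A GA.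
have mA : measurable A := sG.2 _ GA.
rewrite (IntB mA (L1_setT mA hxi) (L1_setT mA gL)).
suff -> : \int[P]_(w in A) fine (g w) = \int[P]_(w in A) xi w by rewrite subrr.
rewrite {1}/Rintegral (_ : (\int[P]_(w in A) (fine (g w))%:E)%E = (\int[P]_(w in A) g w)%E).
  by rewrite gI.
by apply: eq_integral => w _; rewrite -gE.
Qed.

Lemma condexp xi : L1 P setT xi ->
  exists eta, [/\ gmeas G eta, L1 P setT eta & orth (fun w => xi w - eta w)].
Proof.
move=> hxi.
have Lp : L1 P setT (fun w => Num.max (xi w) 0).
  apply: (L1_le measurableT _ _ (L1_norm measurableT hxi)).
    by apply: measurable_maxr => //; exact: L1_meas hxi.
  by move=> w _; case: (ltP (xi w) 0) => h; rewrite ?normr0.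
have Ln : L1 P setT (fun w => Num.max (- xi w) 0).
  apply: (L1_le measurableT _ _ (L1_norm measurableT hxi)).
    apply: measurable_maxr => //; apply: measurableT_comp => //; exact: L1_meas hxi.
  by move=> w _; case: (ltP (- xi w) 0) => h; rewrite ?normr0 ?normrN.
have [|e1 [g1 L1e o1]] := condexp_ge0 Lp; first by move=> w; rewrite le_max lexx orbT.
have [|e2 [g2 L2e o2]] := condexp_ge0 Ln; first by move=> w; rewrite le_max lexx orbT.
exists (fun w => e1 w - e2 w); split; [exact: gmeasB|exact: (L1B measurableT)|].
move=> A GA; have mA : measurable A := sG.2 _ GA.
rewrite (Int_eq P (g := fun w => (Num.max (xi w) 0 - e1 w) - (Num.max (- xi w) 0 - e2 w))); last first.
  by move=> w _; case: (ltP (xi w) 0) => h; case: (ltP (- xi w) 0) => h'; lra.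
rewrite (IntB mA); [by rewrite o1// o2// subrr|..]; apply: L1_setT => //; exact: (L1B measurableT).
Qed.

(** Tested against its own clamp, which is bounded and G-measurable, xi gives the integral of a
    nonnegative function that vanishes only where xi does. *)
Lemma orth_gmeas_ae0 xi : L1 P setT xi -> gmeas G xi -> orth xi ->
  {ae P, forall w, xi w = 0}.
Proof.
move=> hxi gxi o.
have gm : gmeas G (fun w => Num.max (Num.min (xi w) 1) (-1)).
  apply: measurable_maxr; last exact: gmeas_cst.
  by apply: measurable_minr => //; exact: gmeas_cst.
have b w : `|Num.max (Num.min (xi w) 1) (-1)| <= 1.
  by rewrite ler_norml; case: (clampP (xi w)) => -[-> h]; apply/andP; split; lra.
have hL : L1 P setT (fun w => Num.max (Num.min (xi w) 1) (-1) * xi w).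
  by apply: (L1_bddM measurableT (c := 1)) => //; exact: gmeas_meas gm.
have := orth_ext hxi o gm hL.
have p w : 0 <= Num.max (Num.min (xi w) 1) (-1) * xi w.
  by case: (clampP (xi w)) => -[-> h]; nra.
move=> I0; have := Int_ge0_ae0 measurableT hL (fun w _ => p w).
rewrite I0 lexx => /(_ isT); apply: ae_imp => w /(_ I) /eqP.
rewrite mulf_eq0 => /orP[/eqP|/eqP//].
by case: (clampP (xi w)) => -[-> h]; lra.
Qed.

(** A version of P(B | G) with values in [0, 1] at every point, so that its products with integrable
    functions are integrable. Any version can be truncated to [0, 1] at the price of a null set. *)
Lemma condexp_event B : measurable B ->
  exists eta, [/\ gmeas G eta, forall w, 0 <= eta w <= 1 & orth (fun w => \1_B w - eta w)].
Proof.
move=> mB.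
have LB : L1 P setT (\1_B : Omega -> R).
  apply: (L1_le measurableT _ _ L1_1); first exact: measurable_indic.
  by move=> w _; rewrite indicE; case: (_ \in _); rewrite ?normr1 ?normr0.
have [eta [ge Le oe]] := condexp LB.
pose eta' w := Num.max (Num.min (eta w) 1) 0.
have ge' : gmeas G eta'.
  apply: measurable_maxr; last exact: gmeas_cst.
  by apply: measurable_minr => //; exact: gmeas_cst.
have b w : 0 <= eta' w <= 1.
  by rewrite /eta'; case: (truncP (eta w)) => -[-> h]; apply/andP; split; lra.
have Le' : L1 P setT eta'.
  apply: (L1_le measurableT _ _ L1_1); first exact: gmeas_meas ge'.
  by move=> w _; have /andP[b0 b1] := b w; rewrite ger0_norm.
exists eta'; split => //.
pose D w := eta w - eta' w.
have LD : L1 P setT D by exact: (L1B measurableT).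
have gD : gmeas G D by exact: gmeasB.
have D0 : {ae P, forall w, D w = 0}.
  (* D has the sign of [1_B - eta] reversed wherever it does not vanish *)
  pose z w := Num.max (Num.min (D w) 1) (-1).
  have gz : gmeas G z.
    apply: measurable_maxr; last exact: gmeas_cst.
    by apply: measurable_minr => //; exact: gmeas_cst.
  have bz w : `|z w| <= 1.
    by rewrite /z ler_norml; case: (clampP (D w)) => -[-> h]; apply/andP; split; lra.
  have hL : L1 P setT (fun w => z w * (\1_B w - eta w)).
    apply: (L1_bddM measurableT (c := 1)) => //; first exact: gmeas_meas gz.
    exact: (L1B measurableT).
  have I0 := orth_ext (L1B measurableT LB Le) oe gz hL.
  have p w : 0 <= - (z w * (\1_B w - eta w)).
    rewrite /z indicE; case: (clampP (D w)) => -[-> +]; rewrite /D /eta';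
    case: (truncP (eta w)) => -[-> h] h'; case: (_ \in _) => /=; nra.
  have := Int_ge0_ae0 measurableT (L1N measurableT hL) (fun w _ => p w).
  rewrite (IntN measurableT hL) I0 oppr0 lexx => /(_ isT); apply: ae_imp => w /(_ I) /eqP.
  rewrite oppr_eq0 mulf_eq0 /z indicE => /orP[] /eqP.
    by case: (clampP (D w)) => -[-> h]; lra.
  by rewrite /D /eta'; case: (truncP (eta w)) => -[-> h]; case: (_ \in _) => /=; lra.
move=> A GA; have mA : measurable A := sG.2 _ GA.
rewrite -[RHS](oe A GA); apply: (Int_ae mA).
- by apply: measurable_funB; apply: measurable_funTS; [exact: measurable_indic|exact: gmeas_meas ge'].
- by apply: measurable_funB; apply: measurable_funTS; [exact: measurable_indic|exact: gmeas_meas ge].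
- by apply: ae_imp D0 => w; rewrite /D => h _; lra.
Qed.

(** Measurability for the completion of G. Limits and time integrals of adapted processes only have
    this property, as the filtration is not augmented. *)
Definition AM xi := exists2 zeta, gmeas G zeta & {ae P, forall w, xi w = zeta w}.

Lemma AM_gmeas xi : gmeas G xi -> AM xi.
Proof. by move=> h; exists xi => //; exact: ae_true. Qed.

Lemma AM_ae xi xi' : {ae P, forall w, xi w = xi' w} -> AM xi -> AM xi'.
Proof.
by move=> h [z gz h']; exists z => //; apply: ae_imp2 h h' => w -> .
Qed.

Lemma AMD xi xi' : AM xi -> AM xi' -> AM (fun w => xi w + xi' w).
Proof.
move=> [z gz h] [z' gz' h']; exists (fun w => z w + z' w); first exact: gmeasD.
by apply: ae_imp2 h h' => w -> ->.
Qed.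

Lemma AMZ c xi : AM xi -> AM (fun w => c * xi w).
Proof.
by move=> [z gz h]; exists (fun w => c * z w); [exact: gmeasZ|apply: ae_imp h => w ->].
Qed.

End Orth.

Lemma subsigma_full : subsigma (@measurable _ Omega).
Proof.
split=> //; split; first exact: measurable0.
  by move=> A mA; rewrite setTD; exact: measurableC.
by move=> F mF; exact: bigcupT_measurable.
Qed.

Lemma L1_ae0 D : L1 P setT D -> (forall B, measurable B -> \int[P]_(w in B) D w = 0) ->
  {ae P, forall w, D w = 0}.
Proof.
move=> hD H; apply: (orth_gmeas_ae0 subsigma_full) => //.
apply/(gmeasP _ subsigma_full.1) => B mB; rewrite -[X in measurable X]setTI.
exact: (L1_meas measurableT hD).
Qed.

(* E[xi 1_B] = E[xi E[1_B|G]] for every B says that xi and E[xi|G] have the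
   same integral over every B. *)
Lemma AM_dual G xi : subsigma G -> L1 P setT xi ->
  (forall B eta, measurable B -> gmeas G eta -> (forall w, 0 <= eta w <= 1) ->
    orth G (fun w => \1_B w - eta w) ->
    \int[P]_(w in B) xi w = \int[P]_w (eta w * xi w)) -> AM G xi.
Proof.
move=> sG hxi H.
have [x' [gx Lx ox]] := condexp sG hxi.
exists x' => //.
have LD : L1 P setT (fun w => xi w - x' w) by exact: (L1B measurableT).
have mD : measurable_fun setT (fun w => xi w - x' w) := L1_meas measurableT LD.
have K B : measurable B -> \int[P]_(w in B) (xi w - x' w) = 0.
  move=> mB; have [eta [ge be oe]] := condexp_event sG mB.
  have ne w : `|eta w| <= 1 by have /andP[b0 b1] := be w; rewrite ger0_norm.
  have me := gmeas_meas sG ge.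
  have L1e : L1 P setT (fun w => eta w * xi w) by exact: (L1_bddM measurableT me (fun w _ => ne w)).
  have L2e : L1 P setT (fun w => eta w * x' w) by exact: (L1_bddM measurableT me (fun w _ => ne w)).
  rewrite (IntB mB (L1_setT mB hxi) (L1_setT mB Lx)) (H B eta)//.
  have LeB : L1 P setT (fun w => \1_B w - eta w).
    apply: (L1B measurableT).
      have := L1_ind mB (L1_cst measurableT 1 P_lty); apply: (L1_eq measurableT) => w _; rewrite mulr1//.
    have := L1_bddM measurableT me (fun w _ => ne w) (L1_cst measurableT 1 P_lty).
    by apply: (L1_eq measurableT) => w _; rewrite mulr1.
  have LeBx : L1 P setT (fun w => x' w * (\1_B w - eta w)).
    have := L1B measurableT (L1_ind mB Lx) L2e.
    by apply: (L1_eq measurableT) => w _; ring.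
  have e1 := orth_ext sG LeB oe gx LeBx.
  have e2 : \int[P]_w (eta w * (xi w - x' w)) = 0.
    apply: (orth_ext sG) => //.
    by have := L1B measurableT L1e L2e; apply: (L1_eq measurableT) => w _; ring.
  move: e2; rewrite (Int_eq P (g := fun w => eta w * xi w - eta w * x' w)); last first.
    by move=> w _; ring.
  rewrite (IntB measurableT L1e L2e) => /eqP; rewrite subr_eq0 => /eqP ->.
  move: e1; rewrite (Int_eq P (g := fun w => \1_B w * x' w - eta w * x' w)); last first.
    by move=> w _; ring.
  rewrite (IntB measurableT (L1_ind mB Lx) L2e) => /eqP; rewrite subr_eq0 => /eqP <-.
  by rewrite Int_ind// subrr.
by apply: ae_imp (L1_ae0 LD K) => w /eqP; rewrite subr_eq0 => /eqP.
Qed.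

End SubSigma.

Lemma within_cvg_seq (R : realType) (a b : R) (f : R -> R) t (u : nat -> R) :
  {within `[a, b], continuous f} -> t \in `[a, b] -> (forall n, u n \in `[a, b]) ->
  u @ \oo --> t -> (fun n => f (u n)) @ \oo --> f t.
Proof.
move=> /subspace_continuousP cf tab uab ut.
have h := cf t tab.
apply: (cvg_comp u f _ h).
move=> S; rewrite /within /= => -[e /= e0 he].
have := ut _ (nbhsx_ballx t _ e0); rewrite /nbhs /= /nbhs /=.
by apply: filterS => n /= hn; apply: he => //; exact: uab.
Qed.

(** * Adapted processes and their versions *)

Section Processes.
Context d (Omega : measurableType d) (R : realType) (P : probability Omega R).
Variables (F : R -> set (set Omega)) (T : R).
Local Notation lam := (@lebesgue_measure R).
Hypothesis sF : forall t, subsigma (F t).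
Hypothesis mF : forall s t, s <= t -> F s `<=` F t.
Hypothesis T0 : 0 <= T.
Local Notation DD := (`[0, T] `*` [set: Omega]).
Implicit Types (z X : R -> Omega -> R) (f : Omega -> R).

Lemma gmeas_le s t f : s <= t -> gmeas (F s) f -> gmeas (F t) f.
Proof. by move=> st; apply: gmeas_mono; [exact: (sF s).1|exact: (sF t).1|exact: mF]. Qed.

Definition acont X := {ae P, forall w, {within `[0, T], continuous (X^~ w)}}.

(** Almost surely the equality holds at all points j / (m + 1) of [0, T] at once; every t is a limit
    of such points from the left, and continuity concludes. *)
Lemma ae_grid (X I : R -> Omega -> R) : acont X -> acont I ->
  (forall t, 0 <= t <= T -> {ae P, forall w, X t w = I t w}) ->
  {ae P, forall w, forall t, 0 <= t <= T -> X t w = I t w}.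
Proof.
move=> cX cI h.
pose q (m j : nat) : R := j%:R / m.+1%:R.
have H : {ae P, forall w, forall m j, 0 <= q m j <= T -> X (q m j) w = I (q m j) w}.
  apply: ae_nat => m; apply: ae_nat => j.
  case: (boolP (0 <= q m j <= T)) => hq; last exact: ae_true.
  by apply: ae_imp (h _ hq) => w ->.
apply: ae_imp2 (ae_and cX cI) H => w [cx ci] hw t /andP[t0 tT].
pose j m := Num.trunc (m.+1%:R * t).
have jq m : q m (j m) <= t < q m (j m) + m.+1%:R^-1.
  have := truncn_itv (mulr_ge0 (ler0n _ m.+1) t0).
  rewrite -/(j m) /q ler_pdivrMr ?ltr0n// mulrC => /andP[-> /=].
  by rewrite -[X in _ + X]div1r -mulrDl natr1 ltr_pdivlMr ?ltr0n.
have qT m : q m (j m) \in `[0, T].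
  by rewrite in_itv /= divr_ge0//= (le_trans _ tT)//; case/andP: (jq m).
have qt : (fun m => q m (j m)) @ \oo --> t.
  apply: (@squeeze_cvgr _ _ _ _ (fun m => t - m.+1%:R^-1) (cst t)).
  - by apply: nearW => m; have /andP[-> /ltW] := jq m; rewrite lerBlDr => ->.
  - rewrite -[X in _ --> X]subr0; apply: cvgB; first exact: cvg_cst.
    exact: cvg_harmonic.
  - exact: cvg_cst.
have tt : t \in `[0, T] by rewrite in_itv /= t0.
have c1 := within_cvg_seq cx tt qT qt.
have c2 := within_cvg_seq ci tt qT qt.
apply: (cvg_unique (@Rhausdorff R) c1).
rewrite (_ : (fun n => X (q n (j n)) w) = (fun n => I (q n (j n)) w))//.
by apply/funext => m; apply: hw; have := qT m; rewrite in_itv.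
Qed.

(** A jointly measurable and exactly adapted process, indistinguishable from X. At time t it is the
    limsup of measurable representatives of X at the grid points just below t; as these points
    precede t, their values are F_t-measurable. *)
Lemma version X : acont X -> (forall t, 0 <= t <= T -> AM P (F t) (X t)) ->
  exists I, [/\ measurable_fun setT (fun q : R * Omega => I q.1 q.2),
    (forall t, 0 <= t <= T -> gmeas (F t) (I t)) &
    {ae P, forall w, forall t, 0 <= t <= T -> X t w = I t w}].
Proof.
move=> cX aX.
pose q (m j : nat) : R := j%:R / m.+1%:R.
have /choice[Y hY] : forall mj : nat * nat, exists Y : Omega -> R,
    0 <= q mj.1 mj.2 <= T -> gmeas (F (q mj.1 mj.2)) Y /\
      {ae P, forall w, X (q mj.1 mj.2) w = Y w}.
  move=> mj; case: (boolP (0 <= q mj.1 mj.2 <= T)) => h; last by exists (fun=> 0).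
  by have [Y gY hY] := aX _ h; exists Y.
have {}hY m j : 0 <= q m j <= T -> gmeas (F (q m j)) (Y (m, j)) /\
      {ae P, forall w, X (q m j) w = Y (m, j) w}.
  exact: hY (m, j).
pose j m (t : R) := Num.trunc (m.+1%:R * t).
have jq m t : 0 <= t -> q m (j m t) <= t < q m (j m t) + m.+1%:R^-1.
  move=> t0; have := truncn_itv (mulr_ge0 (ler0n _ m.+1) t0).
  rewrite -/(j m t) /q ler_pdivrMr ?ltr0n// mulrC => /andP[-> /=].
  by rewrite -[X in _ + X]div1r -mulrDl natr1 ltr_pdivlMr ?ltr0n.
have qT m t : 0 <= t <= T -> 0 <= q m (j m t) <= T.
  move=> /andP[t0 tT]; rewrite divr_ge0//= (le_trans _ tT)//; by case/andP: (jq m t t0).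
(* Grid points outside [0, T] receive the value 0, so that joint measurability holds for all real
   t. *)
pose Y' m k : Omega -> R := if 0 <= q m k <= T then Y (m, k) else fun=> 0.
pose I m (t : R) (w : Omega) : \bar R := (Y' m (j m t) w)%:E.
exists (fun t w => fine (limn_esup (fun m => I m t w))).
have mY' m k : measurable_fun setT (Y' m k).
  rewrite /Y'; case: ifPn => // h; exact: gmeas_meas (sF _) (hY _ _ h).1.
have mj m k : measurable [set t : R | j m t = k].
  case: k => [|k].
    rewrite (_ : [set t | _] = `]-oo, m.+1%:R^-1[%classic); first exact: measurable_itv.
    apply/seteqP; split => t /=; rewrite in_itv /= /j.
      move=> /truncn0Pn; rewrite -ltNge => h.
      by rewrite -(@ltr_pM2l _ m.+1%:R) ?ltr0n// mulfV ?pnatr_eq0.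
    move=> h; apply/truncn0Pn; rewrite -ltNge.
    by rewrite -(@ltr_pM2l _ m.+1%:R) ?ltr0n// mulfV ?pnatr_eq0// in h.
  rewrite (_ : [set t | _] = `[k.+1%:R / m.+1%:R, k.+2%:R / m.+1%:R[%classic); first exact: measurable_itv.
  apply/seteqP; split => t /=; rewrite in_itv /= /j ler_pdivrMr ?ltr0n// ltr_pdivlMr ?ltr0n//.
    move=> h; have h1 : (0 < Num.trunc (m.+1%:R * t))%N by rewrite h.
    have h2 : 0 <= m.+1%:R * t.
      by move: h1; rewrite truncn_gt0; apply: le_trans.
    by have := truncn_itv h2; rewrite h mulrC.
  by move=> h; apply: truncn_def; rewrite mulrC.
have mI m : measurable_fun setT (fun p : R * Omega => I m p.1 p.2).
  apply/measurable_EFinP => _ B mB; rewrite setTI.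
  rewrite (_ : _ @^-1` B = \bigcup_k ([set t : R | j m t = k] `*` (Y' m k @^-1` B))).
    apply: bigcupT_measurable => k; apply: measurableX; first exact: mj.
    by rewrite -[X in measurable X]setTI; exact: mY'.
  apply/seteqP; split=> [[t w] /= h|[t w] [k _ [/= -> //]]].
  by exists (j m t).
split.
- exact: measurableT_comp (fine_measurable measurableT) (measurable_fun_limn_esup mI).
- move=> t tT.
  have h : @measurable_fun _ _ (g_sigma_algebraType (F t)) (\bar R) setT
      (fun w => limn_esup (fun m => I m t w)).
    apply: (@measurable_fun_limn_esup _ (g_sigma_algebraType (F t))) => m.
    apply/measurable_EFinP; rewrite /Y' (qT m t tT).
    have /andP[t0 _] := tT; have /andP[h _] := jq m t t0.
    exact: gmeas_le h (hY _ _ (qT m t tT)).1.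
  exact: measurableT_comp (fine_measurable measurableT) h.
- have H : {ae P, forall w, forall m k, 0 <= q m k <= T -> X (q m k) w = Y (m, k) w}.
    apply: ae_nat => m; apply: ae_nat => k.
    case: (boolP (0 <= q m k <= T)) => hq; last exact: ae_true.
    by apply: ae_imp (hY _ _ hq).2 => w ->.
  apply: ae_imp2 cX H => w cx hw t tT; have /andP[t0 tT'] := tT.
  have qt : (fun m => q m (j m t)) @ \oo --> t.
    apply: (@squeeze_cvgr _ _ _ _ (fun m => t - m.+1%:R^-1) (cst t)).
    - by apply: nearW => m; have /andP[-> /ltW] := jq m t t0; rewrite lerBlDr => ->.
    - rewrite -[X in _ --> X]subr0; apply: cvgB; first exact: cvg_cst.
      exact: cvg_harmonic.
    - exact: cvg_cst.
  have tt : t \in `[0, T] by rewrite in_itv /= t0.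
  have qT' m : q m (j m t) \in `[0, T] by rewrite in_itv /= qT.
  have c1 := within_cvg_seq cx tt qT' qt.
  have c2 : (fun m => I m t w) @ \oo --> (X t w)%:E.
    rewrite (_ : (fun m => I m t w) = EFin \o (fun m => X (q m (j m t)) w)).
      by apply/fine_cvgP; split; [exact: nearW|exact: c1].
    by apply/funext => m; rewrite /= /I /Y' (qT m t tT) hw// qT.
  by rewrite (cvg_limn_einf_sup c2).2.
Qed.

(** Componentwise form of [L2F]; see [L2F_SL2]. *)
Definition SL2 z :=
  [/\ measurable_fun DD (fun q : R * Omega => z q.1 q.2),
      (forall t, 0 <= t <= T -> gmeas (F t) (z t)) &
      L2s (lam \x P)%E DD (fun q : R * Omega => z q.1 q.2)].

Lemma mDD : @measurable _ (measurableTypeR R * Omega)%type DD.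
Proof. by apply: measurableX => //; exact: itv_meas. Qed.

Lemma DD_lty : ((lam \x P)%E DD < +oo)%E.
Proof.
have -> : (lam \x P)%E DD = (lam `[0%R, T] * P setT)%E.
  exact: product_measure1E (itv_meas 0 T) measurableT.
rewrite probability_setT mule1.
exact: lam_itv_lty.
Qed.

Lemma SL2_L1 z : SL2 z -> L1 (lam \x P)%E DD (fun q : R * Omega => z q.1 q.2).
Proof. by move=> [_ _ h]; apply: L2s_L1 h; [exact: mDD|exact: DD_lty]. Qed.

Lemma SL2D z z' : SL2 z -> SL2 z' -> SL2 (fun t w => z t w + z' t w).
Proof.
move=> [m1 a1 l1] [m2 a2 l2]; split.
- exact: measurable_funD.
- by move=> t tT; apply: gmeasD; [exact: a1|exact: a2].
- exact: (L2sD mDD).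
Qed.

Lemma SL2_detM (c : R -> R) C z : measurable_fun `[0, T] c ->
  (forall t, 0 <= t <= T -> `|c t| <= C) -> SL2 z -> SL2 (fun t w => c t * z t w).
Proof.
move=> mc bc [m1 a1 l1].
have mc' : measurable_fun DD (fun q : R * Omega => c q.1).
  have : measurable_fun DD (c \o (fst : R * Omega -> R)).
    apply: (measurable_comp (F := `[0, T])) => //.
    - by move=> _ [[t w] [/= h _] <-].
    - exact: measurable_funTS measurable_fst.
  by [].
split.
- exact: measurable_funM.
- by move=> t tT; apply: gmeasZ; exact: a1.
- apply: (L2s_bddM mDD (c := C)) => // -[t w] [/= tT _]; apply: bc.
  by move: tT; rewrite in_itv.
Qed.

Lemma SL2Z c z : SL2 z -> SL2 (fun t w => c * z t w).
Proof. by apply: (SL2_detM (C := `|c|)). Qed.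

Lemma SL2N z : SL2 z -> SL2 (fun t w => - z t w).
Proof.
move=> h; have := SL2Z (-1) h.
by rewrite (_ : (fun t w => -1 * z t w) = (fun t w => - z t w))//; apply/funext => t; apply/funext => w; rewrite mulN1r.
Qed.

Lemma SL2B z z' : SL2 z -> SL2 z' -> SL2 (fun t w => z t w - z' t w).
Proof. by move=> h h'; apply: SL2D => //; exact: SL2N. Qed.

Lemma SL2_eq z z' : (forall t w, 0 <= t <= T -> z t w = z' t w) -> SL2 z -> SL2 z'.
Proof.
move=> E [m1 a1 l1].
have E' (q : R * Omega) : DD q -> z q.1 q.2 = z' q.1 q.2.
  by case: q => t w [/= tT _]; apply: E; move: tT; rewrite in_itv.
split.
- by apply: eq_measurable_fun m1 => q; rewrite inE => /E'.
- move=> t tT; have := a1 t tT.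
  by rewrite (_ : z t = z' t)//; apply/funext => w; exact: E.
- exact: L2s_eq mDD _ _ E' l1.
Qed.

Lemma SL2_det (c : R -> R) : L2s lam `[0, T] c -> SL2 (fun t _ => c t).
Proof.
move=> [mc lc]; 
have mc' (f : R -> R) : measurable_fun `[0, T] f -> measurable_fun DD (fun q : R * Omega => f q.1).
  move=> mf; have : measurable_fun DD (f \o (fst : R * Omega -> R)).
    apply: (measurable_comp (F := `[0, T])) => //.
    - by move=> _ [[t w] [/= h _] <-].
    - exact: measurable_funTS measurable_fst.
  by [].
split.
- exact: mc'.
- by move=> t _; exact: gmeas_cst.
- split; first exact: mc'.
  apply: (tonelli_slab1 (itv_meas 0 T) (fun t _ => c t ^+ 2)).
  + by apply: (mc' (fun t => c t ^+ 2)); exact: measurable_funX.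
  + rewrite (_ : (\int[_]_(t in _) _)%E = (\int[lam]_(t in `[0%R, T]) (c t ^+ 2)%:E)%E).
      by rewrite (Int_E (itv_meas 0 T) lc) ltry.
    apply: eq_integral => t _; etransitivity; first exact: (integral_cst P measurableT).
    rewrite -[RHS]mule1; congr (_ * _)%E; last exact: probability_setT.
    by rewrite ger0_norm// sqr_ge0.
Qed.

Lemma SL2_0 : SL2 (fun _ _ => 0).
Proof. by apply: SL2_det; exact: L2s_0 (itv_meas 0 T). Qed.

Lemma SL2_sum (I : Type) (s : seq I) (Q : pred I) (h : I -> R -> Omega -> R) :
  (forall i, Q i -> SL2 (h i)) -> SL2 (fun t w => \sum_(i <- s | Q i) h i t w).
Proof.
move=> H; elim: s => [|i s IH].
  by apply: SL2_eq SL2_0 => t w _; rewrite big_nil.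
case Qi : (Q i).
  by apply: SL2_eq (SL2D (H _ Qi) IH) => t w _; rewrite big_cons Qi.
by apply: SL2_eq IH => t w _; rewrite big_cons Qi.
Qed.

Lemma SL2_aeL1 z : SL2 z -> {ae P, forall w, L1 lam `[0, T] (z^~ w)}.
Proof. by move=> h; apply: (slab_L1_1 (itv_meas 0 T)); exact: SL2_L1. Qed.

Lemma SL2_aeL2 z : SL2 z -> {ae P, forall w, L2s lam `[0, T] (z^~ w)}.
Proof.
move=> [m1 a1 [_ l1]].
have := slab_L1_1 (itv_meas 0 T) (fun t w => z t w ^+ 2) l1.
apply: ae_imp => w h; split => //.
exact: (slab_meas1 (itv_meas 0 T) z w m1).
Qed.

(** Joint measurability refers to the full sigma-algebra, so Fubini alone does not make the integral
    F_t-measurable. By [AM_dual] it suffices to exchange 1_B with E[1_B | F_t] inside the time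
    integral, and for each s <= t this is allowed because z_s is F_t-measurable. *)
Lemma AM_int z t : SL2 z -> 0 <= t <= T ->
  AM P (F t) (fun w => \int[lam]_(s in `[0, t]) z s w).
Proof.
move=> hz /andP[t0 tT]; have [m1 a1 l1] := hz.
have sub : `[0, t] `*` [set: Omega] `<=` DD.
  by move=> [s w] [/= h _]; split => //=; move: h; rewrite !in_itv /= => /andP[-> h]; exact: le_trans tT.
have mt : @measurable _ (measurableTypeR R * Omega)%type (`[0, t] `*` [set: Omega]).
  by apply: measurableX => //; exact: itv_meas.
have L : L1 (lam \x P)%E (`[0, t] `*` [set: Omega]) (fun q : R * Omega => z q.1 q.2).
  by apply: integrableS (SL2_L1 hz) => //; exact: mDD.
have Lm (eta : Omega -> R) : measurable_fun setT eta -> (forall w, `|eta w| <= 1) ->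
    L1 (lam \x P)%E (`[0, t] `*` [set: Omega]) (fun q : R * Omega => eta q.2 * z q.1 q.2).
  move=> me be; apply: (L1_bddM mt (c := 1)) => //.
  by apply: measurable_funTS; exact: measurableT_comp me measurable_snd.
have E (eta : Omega -> R) : measurable_fun setT eta -> (forall w, `|eta w| <= 1) ->
    \int[P]_w (eta w * \int[lam]_(s in `[0, t]) z s w) =
    \int[lam]_(s in `[0, t]) \int[P]_w (eta w * z s w).
  move=> me be.
  have := fubini_slab (itv_meas 0 t) (fun s w => eta w * z s w) (Lm eta me be) => <-.
  apply: Int_ae => //.
  - apply: measurable_funM => //; exact (L1_meas measurableT (slab_L1_int1 (itv_meas 0 t) z L)).
  - exact (L1_meas measurableT (slab_L1_int1 (itv_meas 0 t) (fun s w => eta w * z s w) (Lm eta me be))).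
  - apply: ae_imp (slab_L1_1 (itv_meas 0 t) z L) => w h _.
    by rewrite (IntZ (itv_meas 0 t)).
apply: (AM_dual (sF t)).
  exact (slab_L1_int1 (itv_meas 0 t) z L).
move=> B eta mB ge be oe.
have be' w : `|eta w| <= 1 by have /andP[b0 b1] := be w; rewrite ger0_norm.
have me := gmeas_meas (sF t) ge.
have mi : measurable_fun setT (\1_B : Omega -> R) by exact: measurable_indic.
have bi w : `|\1_B w : R| <= 1.
  by rewrite indicE; case: (_ \in _); rewrite ?normr1 ?normr0.
rewrite -Int_ind// E// E//.
apply: (Int_ae (itv_meas 0 t)).
- exact (L1_meas (itv_meas 0 t) (slab_L1_int2 (itv_meas 0 t) (fun s w => \1_B w * z s w) (Lm _ mi bi))).
- exact (L1_meas (itv_meas 0 t) (slab_L1_int2 (itv_meas 0 t) (fun s w => eta w * z s w) (Lm _ me be'))).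
- apply: ae_imp (slab_L1_2 (itv_meas 0 t) z L) => s h st.
  have hs := h st; move: st; rewrite /= in_itv /= => /andP[s0 st].
  have gz : gmeas (F t) (z s).
    by apply: (gmeas_le st); apply: a1; rewrite s0 (le_trans st).
  have L1i := L1_bddM measurableT mi (fun w _ => bi w) hs.
  have L1e := L1_bddM measurableT me (fun w _ => be' w) hs.
  have LB : L1 P setT (fun w => \1_B w - eta w).
    by apply: (L1B measurableT);
     apply: (L1_le measurableT _ _ (L1_cst measurableT 1 (P_lty P))) => // w _.
  have LBz : L1 P setT (fun w => z s w * (\1_B w - eta w)).
    by have := L1B measurableT L1i L1e; apply: (L1_eq measurableT) => w _; ring.
  have := orth_ext (sF t) LB oe gz LBz.
  rewrite (Int_eq P (g := fun w => \1_B w * z s w - eta w * z s w)); last by move=> w _; ring.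
  by rewrite (IntB measurableT L1i L1e) => /eqP; rewrite subr_eq0 => /eqP.
Qed.

(** The adapted version of the primitive comes from [version]. By Cauchy-Schwarz its square is at
    every time at most T times the integral of z^2 over [0, T], an integrable random variable. *)
Lemma SL2_int z : SL2 z -> exists I, [/\ SL2 I,
  {ae P, forall w, forall t, 0 <= t <= T -> I t w = \int[lam]_(s in `[0, t]) z s w} &
  forall t, 0 <= t <= T -> L2s P setT (I t)].
Proof.
move=> hz.
have c : acont (fun t w => \int[lam]_(s in `[0, t]) z s w).
  apply: ae_imp (SL2_aeL1 hz) => w h.
  exact: parameterized_integral_continuous.
have [I [mI aI eI]] := version c (fun t => AM_int hz).
have eI' : {ae P, forall w, forall t, 0 <= t <= T -> I t w = \int[lam]_(s in `[0, t]) z s w}.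
  by apply: ae_imp eI => w h t /h.
have [m1 a1 l1] := hz.
pose q w := \int[lam]_(s in `[0, T]) (z s w ^+ 2).
have Lq : L1 P setT q by exact (slab_L1_int1 (itv_meas 0 T) (fun t w => z t w ^+ 2) l1.2).
have bI : {ae P, forall w, forall t, 0 <= t <= T -> I t w ^+ 2 <= T * q w}.
  apply: ae_imp2 eI' (SL2_aeL2 hz) => w h l2 t tT; rewrite h//.
  have /andP[t0 tT'] := tT.
  have sub : `[0, t] `<=` `[0, T] by apply: subset_itvScc; rewrite bnd_simp.
  have l2t : L2s lam `[0, t] (z^~ w).
    split; first by apply: measurable_funS sub l2.1; exact: itv_meas.
    by apply: L1_sub l2.2.
  have l1t : L2s lam `[0, t] (fun=> 1) by exact: L2s_cst (itv_meas 0 t) _ (lam_itv_lty _ _).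
  have := Cauchy_Schwarz (itv_meas 0 t) l1t l2t.
  have -> : \int[lam]_(x in `[0, t]) (1 * z x w) = \int[lam]_(x in `[0, t]) z x w.
    by apply: Int_eq => s _; rewrite mul1r.
  have -> : \int[lam]_(x in `[0, t]) (1 ^+ 2) = t.
    rewrite (_ : \int[lam]_(x in `[0, t]) (1 ^+ 2) = \int[lam]_(x in `[0, t]) 1).
      by rewrite Int_cst// mul1r subr0.
    by apply: Int_eq => s _; rewrite expr1n.
  move=> /le_trans; apply.
  rewrite ler_pM//.
    by apply: Int_ge0 => s _; exact: sqr_ge0.
  rewrite /q [leRHS](@Int_add _ 0 T t)//; last exact: l2.2.
  by rewrite lerDl; apply: Int_ge0 => s _; exact: sqr_ge0.
have mIT t : 0 <= t <= T -> measurable_fun setT (I t).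
  by move=> tT; exact: gmeas_meas (sF t) (aI t tT).
have LTq : L1 P setT (fun w => T * q w) by exact: (L1Z measurableT).
have LI2 t : 0 <= t <= T -> (\int[P]_w (I t w ^+ 2)%:E <= (\int[P]_w (T * q w))%:E)%E.
  move=> tT; rewrite -(Int_E measurableT LTq); apply: ae_ge0_le_integral => //.
  - by move=> w _; rewrite lee_fin sqr_ge0.
  - by apply/measurable_EFinP; apply: measurable_funX; exact: mIT.
  - move=> w _; rewrite lee_fin mulr_ge0//; apply: Int_ge0 => s _; exact: sqr_ge0.
  - exact/measurable_EFinP/(L1_meas measurableT LTq).
  - by apply: ae_imp bI => w h _; rewrite lee_fin h.
have L2I t : 0 <= t <= T -> L2s P setT (I t).
  move=> tT; split; first exact: mIT.
  apply/integrableP; split.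
    by apply/measurable_EFinP; apply: measurable_funX; exact: mIT.
  apply: le_lt_trans (le_trans _ (LI2 t tT)) (ltry _).
  by rewrite le_eqVlt; apply/orP; left; apply/eqP; apply: eq_integral => w _ /=; rewrite ger0_norm ?sqr_ge0.
exists I; split => //; split => //.
  exact: measurable_funTS.
split; first exact: measurable_funTS.
apply: (tonelli_slab1 (itv_meas 0 T) (fun t w => I t w ^+ 2)).
  by apply: measurable_funTS; exact: measurable_funX.
apply: (@le_lt_trans _ _ (\int[lam]_(t in `[0%R, T]) ((\int[P]_w (T * q w))%:E))%E).
  apply: ge0_le_integral.
  - exact: itv_meas.
  - by move=> t _; apply: integral_ge0.
  - apply: measurable_funTS.
    apply: (measurable_fun_fubini_tonelli_F (m2 := P) (fun p : measurableTypeR R * Omega => (`|I p.1 p.2 ^+ 2|)%:E)).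
      apply/measurable_EFinP; apply: measurableT_comp => //; exact: measurable_funX.
    by move=> p; rewrite lee_fin.
  - exact: measurable_cst.
  - move=> t; rewrite /= in_itv /= => tT; apply: le_trans (LI2 t tT).
    by rewrite le_eqVlt; apply/orP; left; apply/eqP; apply: eq_integral => w _ /=; rewrite ger0_norm ?sqr_ge0.
rewrite integral_cst; last exact: itv_meas.
rewrite lte_mul_pinfty ?lee_fin//; last exact: lam_itv_lty.
by apply: Int_ge0 => w _; rewrite mulr_ge0//; apply: Int_ge0 => s _; exact: sqr_ge0.
Qed.

End Processes.

(** * Brownian filtrations *)

Section NormalMoments.
Variable R : realType.
Local Notation lam := (@lebesgue_measure R).

(** The integral over a symmetric interval is an increment of the primitive, and dominated
    convergence passes to the whole line. *)
Lemma odd_increment_Int0 (g G : R -> R) : continuous g ->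
  (forall x : R, is_derive x 1 G (g x)) -> L1 lam setT g ->
  (fun n : nat => G n.+1%:R - G (- n.+1%:R)) @ \oo --> (0 : R) -> \int[lam]_x g x = 0.
Proof.
move=> cg dG Lg h0.
have mg : measurable_fun setT g by exact: continuous_measurable_fun.
have cG : continuous G by move=> x; apply: differentiable_continuous; apply/derivable1_diffP; case: (dG x).
have E n : \int[lam]_x (\1_`[- n.+1%:R, n.+1%:R] x * g x) = G n.+1%:R - G (- n.+1%:R).
  rewrite (_ : \int[lam]_x _ = \int[lam]_(x in `[- n.+1%:R, n.+1%:R]) g x); last first.
    rewrite [RHS]Rintegral_mkcond; apply: eq_Rintegral => w _.
    by rewrite patchE indicE; case: (_ \in _); rewrite ?mul1r ?mul0r.
  have hn : - n.+1%:R < n.+1%:R :> R by rewrite -subr_gt0 opprK -natrD ltr0n.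
  rewrite /Rintegral (@continuous_FTC2 _ g G (- n.+1%:R) n.+1%:R)//.
  - exact: continuous_subspaceT.
  - split; first by move=> x _; case: (dG x).
    + by apply: cvg_at_right_filter; exact: cG.
    + by apply: cvg_at_left_filter; exact: cG.
  - by move=> x _; rewrite derive1E; exact: derive_val.
have LI n : L1 lam setT (fun x => \1_`[- n.+1%:R, n.+1%:R] x * g x).
  have mi : measurable_fun setT (\1_`[- n.+1%:R, n.+1%:R] : R -> R) by apply: measurable_indic.
  apply: (L1_le measurableT _ _ (L1_norm measurableT Lg)); first exact: measurable_funM.
  move=> w _; rewrite normrM ler_piMl//.
  by exact: ind_le1.
have := @dominated_convergence _ _ R lam setT measurableT
  (fun n x => (\1_`[- n.+1%:R, n.+1%:R] x * g x)%:E) (fun x => (g x)%:E) (fun x => `|g x|%:E).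
case.
- by move=> n; apply/measurable_EFinP; exact (L1_meas measurableT (LI n)).
- by apply/measurable_EFinP; exact mg.
- apply: aeW => w _; apply/fine_cvgP; split; first exact: nearW.
  apply: cvg_near_cst; exists (Num.trunc `|w|).+1 => // n /= hn.
  rewrite indicE mem_set ?mul1r//= in_itv /= -ler_norml.
  by rewrite (le_trans (ltW (truncnS_gt _)))// ler_nat; apply: leq_trans hn _.
- exact (L1_norm measurableT Lg).
- apply: aeW => w n _; rewrite /= lee_fin normrM ler_piMl//.
  by exact: ind_le1.
move=> _ _; rewrite (_ : (fun n => _) = fun n => (G n.+1%:R - G (- n.+1%:R))%:E); last first.
  by apply/funext => n; rewrite (Int_E measurableT (LI n)) E.
have h0' : ((G n.+1%:R - G (- n.+1%:R))%:E @[n --> \oo] --> 0%E)%classic by apply/fine_cvgP; split; [exact: nearW|].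
move=> /(cvg_unique _ h0') /= => /(_ (@ereal_hausdorff R)).
by rewrite (Int_E measurableT Lg) => -[].
Qed.

Section S.
Variable s : R.
Hypothesis s0 : s != 0.
Local Notation phi := (normal_pdf 0 s).

Let phiE x : phi x = normal_peak s * expR (- x ^+ 2 / (s ^+ 2 *+ 2)).
Proof. by rewrite normal_pdfE// /normal_fun subr0. Qed.

Let s2 : 0 < s ^+ 2. Proof. by rewrite exprn_even_gt0. Qed.

Lemma normal_pdf_derive (x : R) : is_derive x 1 phi (- x / s ^+ 2 * phi x).
Proof.
have -> : phi = fun x => normal_peak s * expR (- x ^+ 2 / (s ^+ 2 *+ 2)).
  by apply/funext.
apply: is_derive_eq.
rewrite /GRing.scale /= !mulr1 mulr2n; field.
by rewrite s0 -mulr2n mulrn_eq0 sqrf_eq0.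
Qed.

Lemma expRN_le (y : R) : 0 < y -> expR (- y) <= y^-1.
Proof.
move=> y0; rewrite expRN lef_pV2 ?posrE ?expR_gt0//.
by apply: le_trans (expR_ge1Dx y); rewrite lerDr.
Qed.

(** Half of the exponent is spent on y exp(-y) <= 1 with y = x^2 / (4 s^2); the other half is the
    exponent of the normal density of standard deviation sqrt(2) s. *)
Lemma sqr_normal_pdf_le (x : R) :
  x ^+ 2 * phi x <= (4 * s ^+ 2 * normal_peak s / normal_peak (Num.sqrt 2 * s)) * normal_pdf 0 (Num.sqrt 2 * s) x.
Proof.
have q0 : Num.sqrt 2 * s != 0 by rewrite mulf_neq0// sqrtr_eq0 -ltNge.
rewrite (normal_pdfE _ q0) /normal_fun subr0 phiE.
set K := normal_peak _; set K' := normal_peak _.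
have K'0 : K' != 0 by rewrite gt_eqF// normal_peak_gt0.
set y := x ^+ 2 / (4 * s ^+ 2).
have -> : - x ^+ 2 / ((Num.sqrt 2 * s) ^+ 2 *+ 2) = - y.
  by rewrite /y exprMn sqr_sqrtr//; field.
have -> : - x ^+ 2 / (s ^+ 2 *+ 2) = - y + - y.
  by rewrite /y; field.
have -> : x ^+ 2 = 4 * s ^+ 2 * y by rewrite /y; field.
rewrite expRD; set e := expR _.
have -> : 4 * s ^+ 2 * K / K' * (K' * e) = 4 * s ^+ 2 * K * e by field.
have -> : 4 * s ^+ 2 * y * (K * (e * e)) = 4 * s ^+ 2 * K * e * (y * e) by ring.
have c0 : 0 <= 4 * s ^+ 2 * K * e.
  apply: mulr_ge0; last exact: expR_ge0.
  by apply: mulr_ge0; [rewrite mulr_ge0 ?sqr_ge0|exact: normal_peak_ge0].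
rewrite -[leRHS]mulr1 ler_wpM2l//.
have [y0|y0] := leP y 0; first by rewrite (le_trans _ ler01)// mulr_le0_ge0// expR_ge0.
by rewrite -ler_pdivlMl// mulr1; exact: expRN_le.
Qed.

Lemma L1_sqr_normal_pdf : L1 lam setT (fun x => x ^+ 2 * phi x).
Proof.
have mp : measurable_fun setT phi by exact: measurable_normal_pdf.
have L : L1 lam setT (normal_pdf 0 (Num.sqrt 2 * s)) by exact: integrable_normal_pdf.
apply: (L1_le measurableT _ _ (L1Z measurableT (4 * s ^+ 2 * normal_peak s / normal_peak (Num.sqrt 2 * s)) L)).
  by apply: measurable_funM => //; exact: measurable_funX.
move=> x _; rewrite ger0_norm; last by rewrite mulr_ge0 ?sqr_ge0 ?normal_pdf_ge0.
exact: sqr_normal_pdf_le.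
Qed.

(** Since phi' = -x phi / s^2, the function x^2 phi - s^2 phi is the derivative of -s^2 x phi, whose
    increments over [-n, n] tend to 0. *)
Lemma Int_sqr_normal_pdf : \int[lam]_x (x ^+ 2 * phi x) = s ^+ 2.
Proof.
have Lp : L1 lam setT phi by exact: integrable_normal_pdf.
have Ip : \int[lam]_x phi x = 1 by rewrite /Rintegral integral_normal_pdf.
have cp : continuous phi by exact: continuous_normal_pdf.
have H := @odd_increment_Int0 (fun x => x ^+ 2 * phi x - s ^+ 2 * phi x) (fun x => - s ^+ 2 * (x * phi x)).
have {}H : \int[lam]_x (x ^+ 2 * phi x - s ^+ 2 * phi x) = 0.
  apply: H.
  - move=> x; apply: cvgB; apply: cvgM => //; [exact: sqr_continuous|exact: cp|exact: cvg_cst|exact: cp].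
  - move=> x; have dp := normal_pdf_derive x; apply: is_derive_eq.
    by rewrite /GRing.scale /=; field.
  - by apply: (L1B measurableT L1_sqr_normal_pdf); exact: L1Z.
  - apply: norm_cvg0.
    apply: (@squeeze_cvgr _ _ _ _ (fun=> 0) (fun n : nat => 4 * s ^+ 4 * normal_peak s * n.+1%:R^-1)); last 2 first.
    + exact: cvg_cst.
    + rewrite -[X in _ --> X](mulr0 (4 * s ^+ 4 * normal_peak s)); apply: cvgMr; exact: cvg_harmonic.
    + apply: nearW => n; rewrite normr_ge0/=; set a : R := n.+1%:R.
      have a0 : 0 < a by rewrite ltr0n.
      have -> : - s ^+ 2 * (a * phi a) - - s ^+ 2 * (- a * phi (- a)) = - (2 * s ^+ 2 * a * phi a).
        by rewrite !phiE sqrrN; ring.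
      rewrite normrN ger0_norm; last first.
        apply: mulr_ge0; last exact: normal_pdf_ge0.
        by rewrite mulr_ge0 ?(ltW a0)// mulr_ge0 ?sqr_ge0.
      rewrite phiE mulNr.
      have y0 : 0 < a ^+ 2 / (s ^+ 2 *+ 2) by rewrite divr_gt0 ?exprn_gt0// mulrn_wgt0.
      have -> : 4 * s ^+ 4 * normal_peak s * a^-1 = 2 * s ^+ 2 * a * (normal_peak s * (a ^+ 2 / (s ^+ 2 *+ 2))^-1).
        by rewrite -mulr_natl; field; rewrite s0 gt_eqF.
      rewrite ler_wpM2l//; first by rewrite mulr_ge0 ?(ltW a0)// mulr_ge0 ?sqr_ge0.
      by rewrite ler_wpM2l ?normal_peak_ge0// expRN_le.
move: H; rewrite (IntB measurableT L1_sqr_normal_pdf (L1Z measurableT _ Lp)) (IntZ measurableT _ Lp) Ip mulr1.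
by move/eqP; rewrite subr_eq0 => /eqP.
Qed.

Lemma L1_id_normal_pdf : L1 lam setT (fun x => x * phi x).
Proof.
have Lp : L1 lam setT phi by exact: integrable_normal_pdf.
apply: (L1_le measurableT _ _ (L1D measurableT L1_sqr_normal_pdf Lp)).
  by apply: measurable_funM => //; exact: measurable_normal_pdf.
move=> x _; rewrite normrM (ger0_norm (normal_pdf_ge0 _ _ _)) (_ : _ + _ = (x ^+ 2 + 1) * phi x); last by rewrite mulrDl mul1r.
rewrite ler_wpM2r ?normal_pdf_ge0// -real_normK ?num_real//.
have := sqr_ge0 (`|x| - 2^-1); nra.
Qed.

Lemma Int_id_normal_pdf : \int[lam]_x (x * phi x) = 0.
Proof.
have cp : continuous phi by exact: continuous_normal_pdf.
apply: (@odd_increment_Int0 _ (fun x => - s ^+ 2 * phi x)).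
- by move=> x; apply: cvgM => //; exact: cp.
- move=> x; have dp := normal_pdf_derive x; apply: is_derive_eq.
  by rewrite /GRing.scale /=; field.
- exact: L1_id_normal_pdf.
- rewrite (_ : (fun n => _) = fun=> 0); first exact: cvg_cst.
  by apply/funext => n; rewrite !phiE sqrrN subrr.
Qed.
End S.
End NormalMoments.

Section NormalLaw.
Context d (Omega : measurableType d) (R : realType) (P : probability Omega R).
Local Notation lam := (@lebesgue_measure R).
Variables (s : R) (X : Omega -> R).
Hypotheses (s0 : s != 0) (mX : measurable_fun setT X).
Hypothesis lawX : forall B : set R, measurable B -> P (X @^-1` B) = normal_prob 0 s B.

(** The law is given by its values on sets: comparing them identifies its Radon-Nikodym derivative
    with the density almost everywhere, after which functions can be integrated. *)
Lemma normal_prob_integral (f : R -> R) : measurable_fun setT f -> (forall x, 0 <= f x) ->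
  (\int[normal_prob 0 s]_x (f x)%:E = \int[lam]_x (f x * normal_pdf 0 s x)%:E)%E.
Proof.
move=> mf f0.
have mfE : @measurable_fun _ _ (measurableTypeR R) (\bar R) setT (EFin \o f) by apply/measurable_EFinP.
have f0' x : (0 <= (EFin \o f) x)%E by rewrite lee_fin.
have dom := normal_prob_dominates 0 s.
pose nu : {finite_measure set (measurableTypeR R) -> \bar R} := normal_prob 0 s.
pose g := Radon_Nikodym_SigmaFinite.f nu lam.
have E := @Radon_Nikodym_SigmaFinite.change_of_variables _ (measurableTypeR R) R nu lam dom (EFin \o f) setT f0' measurableT mfE.
rewrite -[LHS]E.
have Lg : lam.-integrable setT g := Radon_Nikodym_SigmaFinite.f_integrable dom.
have mp : @measurable_fun _ _ (measurableTypeR R) (\bar R) setT (fun x => (normal_pdf 0 s x)%:E).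
  by apply/measurable_EFinP; exact: measurable_normal_pdf.
have gE : ae_eq lam setT g (fun x => (normal_pdf 0 s x)%:E).
  apply: (integral_ae_eq measurableT Lg mp) => A _ mA.
  by rewrite -(Radon_Nikodym_SigmaFinite.f_integral dom mA).
apply: ae_eq_integral => //.
- by apply: emeasurable_funM => //; exact: measurable_int Lg.
- by have := emeasurable_funM mfE mp.
- by apply: ae_imp gE => x h _; have := h I => /= e; rewrite [LHS]/= -/g e EFinM.
Qed.

Lemma normal_law_integral (f : R -> R) : measurable_fun setT f -> (forall x, 0 <= f x) ->
  (\int[P]_w (f (X w))%:E = \int[lam]_x (f x * normal_pdf 0 s x)%:E)%E.
Proof.
move=> mf f0; rewrite -normal_prob_integral//.
have mfE : measurable_fun [set: R] (EFin \o f) by apply/measurable_EFinP.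
pose Xm : {mfun Omega >-> measurableTypeR R} := HB.pack (X : Omega -> measurableTypeR R) (isMeasurableFun.Build _ _ Omega (measurableTypeR R) X mX).
have E := @ge0_integral_pushforward _ _ Omega (measurableTypeR R) R Xm mX P setT (EFin \o f) measurableT mfE (fun _ _ => f0 _).
rewrite -[LHS]E.
apply: eq_measure_integral => B mB _.
exact: lawX.
Qed.

Lemma normal_law_Int (f : R -> R) : measurable_fun setT f ->
  L1 lam setT (fun x => f x * normal_pdf 0 s x) ->
  L1 P setT (fun w => f (X w)) /\ \int[P]_w f (X w) = \int[lam]_x (f x * normal_pdf 0 s x).
Proof.
move=> mf Lf.
pose fp x := Num.max (f x) 0; pose fn x := Num.max (- f x) 0.
have mfp : measurable_fun setT fp by apply: measurable_maxr.
have mfn : measurable_fun setT fn by apply: measurable_maxr => //; exact: measurableT_comp.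
have fp0 x : 0 <= fp x by rewrite le_max lexx orbT.
have fn0 x : 0 <= fn x by rewrite le_max lexx orbT.
have K (h : R -> R) : measurable_fun setT h -> (forall x, 0 <= h x) -> (forall x, h x <= `|f x|) ->
    [/\ L1 lam setT (fun x => h x * normal_pdf 0 s x), L1 P setT (fun w => h (X w)) &
     \int[P]_w h (X w) = \int[lam]_x (h x * normal_pdf 0 s x)].
  move=> mh h0 hf.
  have L : L1 lam setT (fun x => h x * normal_pdf 0 s x).
    apply: (L1_le measurableT _ _ (L1_norm measurableT Lf)).
      by apply: measurable_funM => //; exact: measurable_normal_pdf.
    by move=> x _; rewrite !normrM ler_wpM2r// ger0_norm.
  split=> //.
    apply/integrableP; split; first by apply/measurable_EFinP; exact: measurableT_comp.
    rewrite (_ : (\int[P]_x _)%E = (\int[P]_w (h (X w))%:E)%E).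
      by rewrite normal_law_integral// (Int_E measurableT L) ltry.
    by apply: eq_integral => w _ /=; rewrite ger0_norm.
  by rewrite /Rintegral normal_law_integral.
have fE x : f x = fp x - fn x by rewrite /fp /fn; case: (ltP (f x) 0) => h; case: (ltP (- f x) 0) => h'; lra.
have [|L1p L2p Ep] := K fp mfp fp0.
  by move=> x; rewrite /fp; case: (ltP (f x) 0) => h; rewrite ?normr_ge0 ?ler_norm.
have [|L1n L2n En] := K fn mfn fn0.
  by move=> x; rewrite /fn -normrN; case: (ltP (- f x) 0) => h; rewrite ?normr_ge0 ?ler_norm.
split.
  by apply: (L1_eq measurableT _ (L1B measurableT L2p L2n)) => w _; rewrite fE.
rewrite (Int_eq P (g := fun w => fp (X w) - fn (X w))); last by move=> w _; rewrite fE.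
rewrite (IntB measurableT L2p L2n) Ep En -(IntB measurableT L1p L1n).
by apply: Int_eq => x _; rewrite -mulrBl -fE.
Qed.

Lemma normal_law_moments : [/\ L2s P setT X, \int[P]_w X w = 0 & \int[P]_w (X w ^+ 2) = s ^+ 2].
Proof.
have [L1X E1] := normal_law_Int (@measurable_id _ R setT) (L1_id_normal_pdf s0).
have [L2X E2] := normal_law_Int (@exprn_measurable R setT 2) (L1_sqr_normal_pdf s0).
split; first by split.
  by rewrite E1 Int_id_normal_pdf.
by rewrite E2 Int_sqr_normal_pdf.
Qed.

End NormalLaw.

(** * Independence of sigma-algebras *)

Section Independence.
Context d (Omega : measurableType d) (R : realType) (P : probability Omega R).
Implicit Types (F G H : set (set Omega)).

(** Independence says that 1_A - P(A) is orthogonal to G, and [orth_ext] passes from sets to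
    functions. *)
Lemma indep_Int G A (f : Omega -> R) : subsigma G -> measurable A ->
  (forall B, G B -> P (A `&` B) = (P A * P B)%E) -> gmeas G f -> L1 P setT f ->
  \int[P]_(w in A) f w = fine (P A) * \int[P]_w f w.
Proof.
move=> sG mA ind gf Lf.
have Lc := L1_cst measurableT (1 : R) (P_lty P).
have LA : L1 P setT (\1_A : Omega -> R).
  apply: (L1_le measurableT _ _ Lc); first exact: measurable_indic.
  by move=> w _; exact: ind_le1.
have Lx : L1 P setT (fun w => \1_A w - fine (P A)).
  by apply: (L1B measurableT) => //; exact: L1_cst measurableT _ (P_lty P).
have o : orth P G (fun w => \1_A w - fine (P A)).
  move=> B GB; have mB : measurable B := sG.2 _ GB.
  rewrite (IntB mB); last 2 first.
  - exact: L1_setT.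
  - by apply: L1_setT => //; exact: L1_cst measurableT _ (P_lty P).
  have -> : \int[P]_(x in B) \1_A x = fine (P (A `&` B)) by rewrite /Rintegral integral_indic.
  rewrite Rintegral_cst// ind// fineM ?fin_num_measure//.
  by rewrite subrr.
have fA : L1 P setT (fun w => \1_A w * f w) by exact: L1_ind.
have fP : L1 P setT (fun w => fine (P A) * f w) by exact: L1Z.
have := orth_ext sG Lx o gf.
rewrite (Int_eq P (g := fun w => \1_A w * f w - fine (P A) * f w)); last by move=> w _; ring.
rewrite (IntB measurableT fA fP) Int_ind// (IntZ measurableT) // => /(_ _)/eqP; rewrite subr_eq0 => h.
apply/eqP/h; apply: (L1_eq measurableT _ (L1B measurableT fA fP)) => w _; ring.
Qed.

(* Uniqueness of measures on a pi-system, for the finite measures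
   [P (. `&` C)] and [P C * P (.)]. *)
Lemma indep_gen (Gn : set (set Omega)) C : setI_closed Gn -> Gn setT -> (forall A, Gn A -> measurable A) ->
  measurable C -> (forall A, Gn A -> P (A `&` C) = (P A * P C)%E) ->
  forall A, <<s Gn >> A -> P (A `&` C) = (P A * P C)%E.
Proof.
move=> GI GT Gm mC h A GA.
have C0 : 0 <= fine (P C) by rewrite fine_ge0.
pose m1 : {measure set Omega -> \bar R} := mrestr P mC.
pose m2 : {measure set Omega -> \bar R} := mscale (NngNum C0) P.
have E B : m2 B = (P B * P C)%E.
  by rewrite /m2 /= /mscale /= fineK ?fin_num_measure// muleC.
rewrite -E; apply: (@g_sigma_algebra_measure_unique _ _ _ Gn _ (fun=> setT) _ _ m1 m2) => //.
- by rewrite bigcup_const//; exact: I.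
- by move=> B GB; rewrite E -h.
- by move=> k; rewrite /m1 /= /mrestr setTI ltey_eq fin_num_measure.
Qed.

(** The intersections of a set of F with a set of G form a pi-system that generates the join. *)
Lemma indep_join F G C : sigma_algebra setT F -> sigma_algebra setT G ->
  (forall A, F A -> measurable A) -> (forall A, G A -> measurable A) -> measurable C ->
  (forall A B, F A -> G B -> P (A `&` B `&` C) = (P (A `&` B) * P C)%E) ->
  forall A, <<s F `|` G >> A -> P (A `&` C) = (P A * P C)%E.
Proof.
move=> sF sG mF mG mC h.
pose Gn : set (set Omega) := [set X | exists A B, [/\ F A, G B & X = A `&` B]].
have FT : F setT by have [a b c] := sF; rewrite -setC0 -setTD; exact: b.
have GT : G setT by have [a b c] := sG; rewrite -setC0 -setTD; exact: b.
have sub : <<s F `|` G >> `<=` <<s Gn >>.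
  apply: smallest_sub; first exact: smallest_sigma_algebra.
  move=> X [FX|GX]; apply: sub_sigma_algebra.
  - by exists X, setT; split=> //; rewrite setIT.
  - by exists setT, X; split=> //; rewrite setTI.
move=> A /sub; apply: indep_gen => //.
- move=> _ _ [A1 [B1 [a1 b1 ->]]] [A2 [B2 [a2 b2 ->]]].
  exists (A1 `&` A2), (B1 `&` B2); split; last by rewrite setIACA.
  + have := @measurableI _ (g_sigma_algebraType F) A1 A2.
    by rewrite /measurable/= (sigma_algebra_id sF); exact.
  + have := @measurableI _ (g_sigma_algebraType G) B1 B2.
    by rewrite /measurable/= (sigma_algebra_id sG); exact.
- by exists setT, setT; split=> //; rewrite setIT.
- by move=> _ [A1 [B1 [a1 b1 ->]]]; apply: measurableI; [exact: mF|exact: mG].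
- by move=> _ [A1 [B1 [a1 b1 ->]]]; exact: h.
Qed.

(** Each group is generated by the pi-system of those finite intersections that are trivial outside
    the group; the product rule is extended to the generated sigma-algebras one side at a time. *)
Lemma mutually_independent_group (I : finType) (J : pred I) (F : I -> set (set Omega)) :
  (forall i, subsigma (F i)) -> mutually_independent P F ->
  forall A B, <<s \bigcup_(i in [set i | J i]) F i >> A -> <<s \bigcup_(i in [set i | ~~ J i]) F i >> B ->
  P (A `&` B) = (P A * P B)%E.
Proof.
move=> sF ind.
pose Pi (K : pred I) : set (set Omega) := [set X | exists E : I -> set Omega,
  [/\ forall i, F i (E i), forall i, ~~ K i -> E i = setT & X = \bigcap_(i in [set: I]) E i]].
have FT i : F i setT by have [[a b c] _] := sF i; rewrite -setC0 -setTD; exact: b.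
have FI i A B : F i A -> F i B -> F i (A `&` B).
  have := @measurableI _ (g_sigma_algebraType (F i)) A B.
  by rewrite /measurable/= (sigma_algebra_id (sF i).1); exact.
have sub (K : pred I) : <<s \bigcup_(i in [set i | K i]) F i >> `<=` <<s Pi K >>.
  apply: smallest_sub; first exact: smallest_sigma_algebra.
  move=> X [i /= Ki FX]; apply: sub_sigma_algebra.
  exists (fun j => if j == i then X else setT); split.
  - by move=> j; case: eqP => // ->.
  - by move=> j nK; case: eqP => // e; move: nK; rewrite e Ki.
  - apply/seteqP; split=> w; first by move=> Xw j _; case: ifP.
    by move=> /(_ i Logic.I); rewrite eqxx.
have PiI K : setI_closed (Pi K).
  move=> _ _ [E1 [f1 g1 ->]] [E2 [f2 g2 ->]]; exists (fun i => E1 i `&` E2 i); split.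
  - by move=> i; exact: FI.
  - by move=> i h; rewrite g1// g2// setIT.
  - by rewrite bigcapI.
have PiT K : Pi K setT.
  by exists (fun=> setT); split=> //; apply/seteqP; split=> w.
have Pim K A : Pi K A -> measurable A.
  by move=> [E [f g ->]]; apply: fin_bigcap_measurable => // i _; exact: (sF i).2.
have Psm K A : <<s Pi K >> A -> measurable A.
  by apply: smallest_sub => //; [exact: sigma_algebra_measurable|exact: Pim].
move=> A B /sub hA /sub hB.
apply: (indep_gen (PiI J) (PiT J) (Pim J) (Psm _ _ hB) _ hA) => A1 hA1.
rewrite setIC [RHS]muleC.
apply: (indep_gen (PiI _) (PiT _) (Pim _) (Pim _ _ hA1) _ hB) => _ [E2 [f2 g2 ->]].
have [E1 [f1 g1 ->]] := hA1.
rewrite -bigcapI !ind//; last by move=> i; exact: FI.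
rewrite -big_split /=; apply: eq_bigr => i _.
have [Ji|nJi] := boolP (J i).
- by rewrite g2 ?Ji// setTI probability_setT mul1e.
- by rewrite g1// setIT probability_setT mule1.
Qed.

(** The sets depending on finitely many variables form a generating pi-system ([sigma_gen_seqI]).
    Independence for uncountably many times thus reduces to finitely many. *)
Lemma sigma_gen_finite (I : choiceType) (D : set I) (X : I -> Omega -> R) A :
  sigma_gen D X A -> <<s [set B | exists2 s : seq I, (forall i, i \in s -> D i) & sigma_gen [set` s] X B] >> A.
Proof.
apply: sub_smallest2r.
  exact: smallest_sigma_algebra.
move=> B [i Di hB]; exists [:: i].
  by move=> j; rewrite inE => /eqP ->.
by apply: sub_sigma_algebra; exists i => //=; rewrite inE.
Qed.

Lemma sigma_gen_seqI (I : choiceType) (D : set I) (X : I -> Omega -> R) :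
  setI_closed [set B | exists2 s : seq I, (forall i, i \in s -> D i) & sigma_gen [set` s] X B].
Proof.
move=> A B [s hs hA] [s' hs' hB]; exists (s ++ s').
  by move=> i; rewrite mem_cat => /orP[/hs|/hs'].
have K (t t' : seq I) C : {subset t <= t'} -> sigma_gen [set` t] X C -> sigma_gen [set` t'] X C.
  move=> tt; apply: sub_smallest2r => [|E [i it hE]]; first exact: smallest_sigma_algebra.
  by exists i => //; exact: tt.
apply: (@measurableI _ (g_sigma_algebraType _)).
- by apply: K hA => i; rewrite mem_cat => ->.
- by apply: K hB => i; rewrite mem_cat => ->; rewrite orbT.
Qed.

End Independence.

(** [is_brownian] speaks of increments along an infinite nondecreasing sequence of times; a finite
    family of times is sorted into such a sequence. *)
Lemma nondecreasing_grid (R : realType) (a : R) (us : seq R) : (forall u, u \in us -> a <= u) ->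
  exists tau : nat -> R, [/\ tau 0%N = a, forall l, tau l <= tau l.+1 &
    exists m, forall u, u \in us -> exists2 l, (l <= m)%N & tau l = u].
Proof.
move=> au; pose L := sort <=%R (a :: us).
have sL : sorted <=%R L by apply: sort_sorted; exact: le_total.
have mL u : (u \in L) = (u \in a :: us) by rewrite mem_sort.
have szL : size L = (size us).+1 by rewrite size_sort.
(* The default repeats the last time, which keeps the sequence nondecreasing beyond the end of the
   list. *)
pose tau l := nth (last a L) L l.
have mon l l' : (l <= l')%N -> tau l <= tau l'.
  rewrite /tau; have [h' ll|h' ll] := ltnP l' (size L).
    by apply: (sorted_leq_nth le_trans le_refl) => //; rewrite inE (leq_ltn_trans ll).
  rewrite (nth_default _ h'); have [h|h] := ltnP l (size L); last by rewrite nth_default.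
  set dl := last a L; have Edl : dl = nth dl L (size L).-1.
    by rewrite nth_last /dl; case: (L) szL.
  rewrite [leRHS]Edl.
  by apply: (sorted_leq_nth le_trans le_refl) => //; rewrite ?inE szL// -ltnS -szL.
have hit u : u \in a :: us -> exists2 l, (l <= size us)%N & tau l = u.
  rewrite -mL => uL; exists (index u L).
    by rewrite -ltnS -szL index_mem.
  by rewrite /tau nth_index.
exists tau; split.
- have [|l _ la] := hit a; first by rewrite mem_head.
  apply/eqP; rewrite eq_le -{1}la mon//=.
  have : tau 0%N \in a :: us by rewrite -mL /tau mem_nth// szL.
  by rewrite inE => /orP[/eqP->//|/au].
- by move=> l; exact: mon.
- by exists (size us) => u uu; apply: hit; rewrite inE uu orbT.
Qed.

Section SigmaGen.
Context d (Omega : measurableType d) (R : realType) (P : probability Omega R).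
Implicit Types (G : set (set Omega)).

Lemma subsigma_gen G : (forall A, G A -> measurable A) -> subsigma <<s G >>.
Proof.
move=> mG; split; first exact: smallest_sigma_algebra.
by apply: smallest_sub => //; exact: sigma_algebra_measurable.
Qed.

Lemma sigma_gen_sub (I : Type) (D : set I) (X : I -> Omega -> R) G : sigma_algebra setT G ->
  (forall i, D i -> gmeas G (X i)) -> sigma_gen D X `<=` G.
Proof.
move=> sG h; apply: smallest_sub => // A [i Di [B mB <-]].
by rewrite setTI; apply: (gmeasP _ sG).1 => //; exact: h.
Qed.

Lemma gmeas_sigma_gen (I : Type) (D : set I) (X : I -> Omega -> R) i : D i ->
  gmeas (sigma_gen D X) (X i).
Proof.
move=> Di; apply/gmeasP; first exact: smallest_sigma_algebra.
move=> B mB; apply: sub_sigma_algebra; exists i => //; exists B => //.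
by rewrite setTI.
Qed.

Lemma gmeas_sigma_gen_sub (I : Type) (D : set I) (X : I -> Omega -> R) G i : sigma_algebra setT G ->
  sigma_gen D X `<=` G -> D i -> gmeas G (X i).
Proof.
move=> sG XG Di; apply: (gmeas_mono _ sG XG); first exact: smallest_sigma_algebra.
exact: gmeas_sigma_gen.
Qed.

Lemma subsigma_sigma_gen (I : Type) (D : set I) (X : I -> Omega -> R) :
  (forall i, D i -> measurable_fun setT (X i)) -> subsigma (sigma_gen D X).
Proof.
move=> mX; apply: subsigma_gen => A [i Di [B mB <-]].
by rewrite setTI -[X in measurable X]setTI; exact: mX.
Qed.

Lemma ae_eq_P (A B : set Omega) : measurable A -> measurable B ->
  {ae P, forall w, A w <-> B w} -> P A = P B.
Proof.
move=> mA mB h; rewrite -[A]setIT -[B]setIT -!integral_indic//.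
apply: ae_eq_integral => //; try by apply/measurable_EFinP; exact: measurable_indic.
apply: ae_imp h => w h _; rewrite !indicE; congr (_%:R%:E).
by congr nat_of_bool; apply/idP/idP; rewrite !inE => /h.
Qed.

End SigmaGen.

(** * Past and future of a single Brownian motion *)

Section OneBrownian.
Context d (Omega : measurableType d) (R : realType) (P : probability Omega R).
Variable B : R -> {RV P >-> R}.
Hypothesis hB : is_brownian B.

(** Increments from time 0 instead of values, because these are sums of grid increments; the
    variable at time 0 is added back in [past_future]. *)
Definition pastinc (s : R) := sigma_gen `[0, s] (fun u w => B u w - B 0 w).
Definition future (s : R) := sigma_gen `[s, +oo[ (fun v w => B v w - B s w).

Lemma measurable_increment s t : measurable_fun setT (fun w => B s w - B t w).
Proof. by apply: measurable_funB. Qed.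

(** All times and s itself are put on one grid. With p the index of s, past variables are sums of
    grid increments of index below p and future ones of index at least p, so grouping the
    independent grid increments gives the claim. *)
Lemma pastinc_future_seq (s : R) (us vs : seq R) A C : (forall u, u \in us -> 0 <= u <= s) ->
  (forall v, v \in vs -> s <= v) -> 0 <= s ->
  sigma_gen [set` us] (fun u w => B u w - B 0 w) A ->
  sigma_gen [set` vs] (fun v w => B v w - B s w) C -> P (A `&` C) = (P A * P C)%E.
Proof.
move=> us0 vs0 s0 hA hC.
have [|tau [tau0 taul [m hm]]] := @nondecreasing_grid R 0 (s :: us ++ vs).
  move=> u; rewrite inE mem_cat => /orP[/eqP->//|/orP[/us0/andP[]//|/vs0]].
  exact: le_trans.
have mono l l' : (l <= l')%N -> tau l <= tau l'.
  by move: l l'; apply: (homo_leq le_refl le_trans).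
have [|p pm ps] := hm s; first by rewrite mem_head.
(* Times may be repeated: a past time found at an index beyond p equals s and is moved back to p. *)
have mid : forall u, u \in us -> exists2 l, (l <= p)%N & tau l = u.
  move=> u uu; have [|l lm lu] := hm u; first by rewrite inE mem_cat uu orbT.
  have [lp|/ltnW pl] := leqP l p; first by exists l.
  exists p => //; apply/eqP; rewrite eq_le -{1}lu mono//= ps.
  by have /andP[] := us0 _ uu.
have fut : forall v, v \in vs -> exists2 l, (p <= l <= m)%N & tau l = v.
  move=> v vv; have [|l lm lv] := hm v; first by rewrite inE mem_cat vv !orbT.
  have [pl|/ltnW lp] := leqP p l; first by exists l => //; rewrite pl.
  exists p; first by rewrite leqnn.
  by apply/eqP; rewrite eq_le -{2}lv mono// andbT ps vs0.
have [_ inc _ _] := hB.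
have := inc m tau; rewrite tau0 => /(_ (lexx _) taul).
set Fl := (fun l : 'I_m => _) => ind.
have sFl l : subsigma (Fl l).
  by apply: subsigma_sigma_gen => _ _; exact: measurable_increment.
apply: (mutually_independent_group (J := fun l : 'I_m => (l < p)%N) sFl ind).
- have sG : sigma_algebra setT <<s \bigcup_(i in [set i : 'I_m | (i < p)%N]) Fl i >>.
    exact: smallest_sigma_algebra.
  apply: (sigma_gen_sub sG) hA => u /= /mid[l lp <-].
  rewrite (_ : (fun w => _) = fun w => \sum_(k < m | (k < l)%N) (B (tau k.+1) w - B (tau k) w)).
    apply: gmeas_sum => k kl.
    have sub : Fl k `<=` <<s \bigcup_(i in [set i : 'I_m |  (i < p)%N]) Fl i >>.
      by move=> E hE; apply: sub_sigma_algebra; exists k => //=; exact: leq_trans kl lp.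
    exact: (gmeas_sigma_gen_sub sG sub (i := tt)).
  apply/funext => w; rewrite (_ : B 0 w = B (tau 0%N) w); last by rewrite tau0.
  rewrite -(telescope_sumr (fun k => B (tau k) w) (leq0n l)).
  by rewrite big_mkord (big_ord_widen m (fun k => B (tau k.+1) w - B (tau k) w)) ?(leq_trans lp).
- have sG : sigma_algebra setT <<s \bigcup_(i in [set i : 'I_m | ~~ (i < p)%N]) Fl i >>.
    exact: smallest_sigma_algebra.
  apply: (sigma_gen_sub sG) hC => u /= /fut[l /andP[pl lm] <-].
  rewrite (_ : (fun w => _) = fun w => \sum_(k < m | (p <= k < l)%N) (B (tau k.+1) w - B (tau k) w)).
    apply: gmeas_sum => k /andP[pk kl].
    have sub : Fl k `<=` <<s \bigcup_(i in [set i : 'I_m | ~~ (i < p)%N]) Fl i >>.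
      by move=> E hE; apply: sub_sigma_algebra; exists k => //=; rewrite -leqNgt.
    exact: (gmeas_sigma_gen_sub sG sub (i := tt)).
  apply/funext => w; rewrite -ps -(telescope_sumr (fun k => B (tau k) w) pl).
  by rewrite (@big_nat_widenl _ _ _ p 0%N l)//= (big_nat_widen _ _ m)//= big_mkord; apply: eq_bigl => k; rewrite andbC.
Qed.

Lemma pastinc_future (s : R) A C : 0 <= s -> pastinc s A -> future s C -> P (A `&` C) = (P A * P C)%E.
Proof.
move=> s0 /sigma_gen_finite hA /sigma_gen_finite hC.
have mGn D X E : (forall i, D i -> measurable_fun setT (X i)) ->
    [set E | exists2 s : seq R, (forall i, i \in s -> D i) & sigma_gen [set` s] (X : R -> Omega -> R) E] E -> measurable E.
  move=> mX [us hus hE]; apply: (subsigma_sigma_gen (D := [set` us]) _).2 hE => i /= /hus; exact: mX.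
have mi a i (D : set R) : D i -> measurable_fun setT (fun w => B i w - B a w) by move=> _; exact: measurable_increment.
have TG (D : set R) X : [set E | exists2 s : seq R, (forall i, i \in s -> D i) & sigma_gen [set` s] (X : R -> Omega -> R) E] setT.
  by exists [::] => //; apply: (@measurableT _ (g_sigma_algebraType _)).
apply: (indep_gen (@sigma_gen_seqI _ _ _ _ _ _) (TG _ _) (fun E => @mGn _ _ E (fun i => @mi 0 i _)) _ _ hA).
  by apply: (subsigma_gen _).2 hC => E; apply: mGn => i; exact: mi.
move=> {hA}A hA; rewrite setIC [RHS]muleC.
apply: (indep_gen (@sigma_gen_seqI _ _ _ _ _ _) (TG _ _) (fun E => @mGn _ _ E (fun i => @mi s i _)) _ _ hC).
  by apply: mGn hA => i; exact: mi.
move=> {hC}C [vs hvs hC]; have [us hus {}hA] := hA.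
rewrite setIC [RHS]muleC; apply: (@pastinc_future_seq s us vs) => //.
by move=> v /hvs; rewrite /= in_itv /= andbT.
Qed.

(** The initial value is almost surely 0, so the events it generates have probability 0 or 1. *)
Lemma initial_trivial A C : sigma_gen [set: unit] (fun _ w => B 0 w) A -> measurable C ->
  P (A `&` C) = (P A * P C)%E.
Proof.
have [B0 _ _ _] := hB.
move=> hA mC; apply: (indep_gen _ _ _ mC _ hA).
- move=> X Y [_ _ [X' mX <-]] [_ _ [Y' mY <-]]; exists tt => //; exists (X' `&` Y'); first exact: measurableI.
  by rewrite !setTI preimage_setI.
- by exists tt => //; exists setT => //; rewrite setTI preimage_setT.
- by move=> X [_ _ [X' mX <-]]; exact: measurable_funP.
move=> X [_ _ [X' mX <-]]; rewrite setTI.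
have mX' : measurable ((B 0 : Omega -> R) @^-1` X') by rewrite -[X in measurable X]setTI; exact: measurable_funP.
have [h|h] := pselect (X' 0).
- have e C' : measurable C' -> P ((B 0 : Omega -> R) @^-1` X' `&` C') = P C'.
    move=> mC'; apply: ae_eq_P => //; first exact: measurableI.
    by apply: ae_imp B0 => w e; split => [[]|]//; split => //=; rewrite e.
  by rewrite e// -[X in (P X * _)%E]setIT e// probability_setT mul1e.
- have e C' : measurable C' -> P ((B 0 : Omega -> R) @^-1` X' `&` C') = 0%E.
    move=> mC'; rewrite -(measure0 P); apply: ae_eq_P => //; first exact: measurableI.
    by apply: ae_imp B0 => w e; split => //= -[]; rewrite e.
  by rewrite e// -[X in (P X * _)%E]setIT e// mul0e.
Qed.

Lemma past_future (s : R) A C : 0 <= s -> sigma_gen `[0, s] (fun u w => B u w) A -> future s C ->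
  P (A `&` C) = (P A * P C)%E.
Proof.
move=> s0 hA hC.
have sP : subsigma (pastinc s) by apply: subsigma_sigma_gen => u _; exact: measurable_increment.
have sC : subsigma (future s) by apply: subsigma_sigma_gen => u _; exact: measurable_increment.
have s00 : subsigma (sigma_gen [set: unit] (fun _ w => B 0 w)) by apply: subsigma_sigma_gen => u _.
apply: (indep_join s00.1 sP.1 s00.2 sP.2 (sC.2 _ hC)).
  move=> X Y hX hY; have mX := s00.2 _ hX; have mY := sP.2 _ hY; have mC := sC.2 _ hC.
  rewrite -setIA (initial_trivial hX (measurableI _ _ mY mC)) (initial_trivial hX mY).
  by rewrite (pastinc_future s0 hY hC) muleA.
have sG : sigma_algebra setT <<s sigma_gen [set: unit] (fun _ w => B 0 w) `|` pastinc s >> by exact: smallest_sigma_algebra.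
apply: (sigma_gen_sub sG) hA => u us.
rewrite (_ : [eta B u] = fun w => (B u w - B 0 w) + B 0 w); last by apply/funext => w; rewrite subrK.
have subl : sigma_gen [set: unit] (fun _ w => B 0 w) `<=` <<s sigma_gen [set: unit] (fun _ w => B 0 w) `|` pastinc s >>.
  by move=> E hE; apply: sub_sigma_algebra; left.
have subr : pastinc s `<=` <<s sigma_gen [set: unit] (fun _ w => B 0 w) `|` pastinc s >>.
  by move=> E hE; apply: sub_sigma_algebra; right.
apply: gmeasD; first exact: gmeas_sigma_gen_sub sG subr us.
exact: (gmeas_sigma_gen_sub sG subl (i := tt)).
Qed.

End OneBrownian.

(** * The filtration generated by all agents, and the zero-one law at time 0 *)

Section BrownianFiltration.
Context d (Omega : measurableType d) (R : realType) (P : probability Omega R).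
Variables (N n : nat) (x0 : 'I_N -> Omega -> 'cV[R]_n) (W : 'I_N -> R -> {RV P >-> R}).
Hypothesis hW : forall i, is_brownian (W i).
Hypothesis hWind : mutually_independent P (sigma_noise W).
Hypothesis hx0meas : forall i k, measurable_fun setT (fun w => x0 i w k 0).
Hypothesis hx0W : independent2 P (<<s \bigcup_(i in [set: 'I_N]) sigma_init x0 i >>)
     (<<s \bigcup_(i in [set: 'I_N]) sigma_noise W i >>).
Local Notation F := (filtration x0 W).
Local Notation sx := (<<s \bigcup_(i in [set: 'I_N]) sigma_init x0 i >>).

Let ssa (G : set (set Omega)) : sigma_algebra setT <<s G >>.
Proof. exact: smallest_sigma_algebra. Qed.

Lemma subsigma_init i : subsigma (sigma_init x0 i).
Proof. by apply: subsigma_sigma_gen => k _; exact: hx0meas. Qed.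

Lemma subsigma_past j s : subsigma (sigma_gen `[0, s] (fun u w => W j u w)).
Proof. by apply: subsigma_sigma_gen. Qed.

Lemma subsigma_noise j : subsigma (sigma_noise W j).
Proof. by apply: subsigma_sigma_gen. Qed.

Lemma subsigma_agent i t : subsigma (agent_filtration x0 W i t).
Proof.
by apply: subsigma_gen => A [/(subsigma_init _).2|/(subsigma_past _ _).2].
Qed.

Lemma subsigma_filtration t : subsigma (F t).
Proof. by apply: subsigma_gen => A [i _ /(subsigma_agent _ _).2]. Qed.

Lemma filtration_mono s t : s <= t -> F s `<=` F t.
Proof.
move=> st; apply: sub_smallest2r => // A [i _ hA]; exists i => //.
apply: sub_smallest2r hA => // B [?|hB]; [by left|right].
apply: sub_smallest2r hB => // C [u us hC]; exists u => //.
by move: us; rewrite /= !in_itv /= => /andP[-> /le_trans->].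
Qed.

Lemma gmeas_x0 i k : gmeas (F 0) (fun w => x0 i w k 0).
Proof.
apply: (@gmeas_sigma_gen_sub _ _ _ _ [set: 'I_n] (fun k w => x0 i w k 0) _ k (ssa _)) => //.
move=> A hA; apply: sub_sigma_algebra; exists i => //.
by apply: sub_sigma_algebra; left.
Qed.

Lemma gmeas_W i t : 0 <= t -> gmeas (F t) (W i t).
Proof.
move=> t0; apply: (@gmeas_sigma_gen_sub _ _ _ _ `[0, t] (fun u w => W i u w)) => //.
- exact: ssa.
- move=> A hA; apply: sub_sigma_algebra; exists i => //.
  by apply: sub_sigma_algebra; right.
- by rewrite /= in_itv /= t0 lexx.
Qed.

Definition others j : set (set Omega) := <<s \bigcup_(i in [set i | i != j]) sigma_noise W i >>.

(** F_s enlarged by the entire trajectories of the other noises. It remains independent of the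
    increments of W_j after s, so in mixed moments every W_i with i != j can be treated as already
    known. *)
Definition allbut j s : set (set Omega) :=
  <<s <<s sx `|` others j >> `|` sigma_gen `[0, s] (fun u w => W j u w) >>.

Lemma subsigma_sx : subsigma sx.
Proof. by apply: subsigma_gen => A [i _ /(subsigma_init _).2]. Qed.

Lemma subsigma_others j : subsigma (others j).
Proof. by apply: subsigma_gen => A [i _ /(subsigma_noise _).2]. Qed.

Lemma subsigma_sxo j : subsigma <<s sx `|` others j >>.
Proof. by apply: subsigma_gen => A [/subsigma_sx.2|/(subsigma_others _).2]. Qed.

Lemma subsigma_allbut j s : subsigma (allbut j s).
Proof. by apply: subsigma_gen => A [/(subsigma_sxo _).2|/(subsigma_past _ _).2]. Qed.

Lemma noise_past j s : sigma_gen `[0, s] (fun u w => W j u w) `<=` sigma_noise W j.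
Proof.
apply: sub_smallest2r => // A [u us hA]; exists u => //.
by move: us; rewrite /= !in_itv /= => /andP[->].
Qed.

Lemma noise_future j s : 0 <= s -> future (W j) s `<=` sigma_noise W j.
Proof.
move=> s0; apply: sigma_gen_sub => [|v]; first exact: ssa.
rewrite /= in_itv /= andbT => sv.
by apply: gmeasB; apply: (@gmeas_sigma_gen _ _ _ _ `[0, +oo[ (fun u w => W j u w));
  rewrite /= in_itv /= ?s0// (le_trans s0).
Qed.

Lemma allbut_noise i j s : i != j -> sigma_noise W i `<=` allbut j s.
Proof.
move=> ij A hA; apply: sub_sigma_algebra; left; apply: sub_sigma_algebra; right.
by apply: sub_sigma_algebra; exists i.
Qed.

Lemma allbut_past j s : sigma_gen `[0, s] (fun u w => W j u w) `<=` allbut j s.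
Proof. by move=> A hA; apply: sub_sigma_algebra; right. Qed.

Lemma filtration_allbut j s : F s `<=` allbut j s.
Proof.
have sA := (subsigma_allbut j s).1.
apply: smallest_sub => // A [i _]; apply: smallest_sub A => // A [hA|hA].
  apply: sub_sigma_algebra; left; apply: sub_sigma_algebra; left.
  by apply: sub_sigma_algebra; exists i.
have [ij|ij] := eqVneq i j; first by rewrite -ij; apply: allbut_past; rewrite ij; rewrite ij in hA.
exact: (allbut_noise ij) (noise_past hA).
Qed.

Lemma sxo_noise j A D : <<s sx `|` others j >> A -> sigma_noise W j D -> P (A `&` D) = (P A * P D)%E.
Proof.
move=> hA hD.
apply: (indep_join subsigma_sx.1 (subsigma_others j).1 subsigma_sx.2 (subsigma_others j).2 ((subsigma_noise j).2 _ hD) _ hA) => X Y hX hY.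
have sub i : sigma_noise W i `<=` <<s \bigcup_(i in [set: 'I_N]) sigma_noise W i >>.
  by move=> E hE; apply: sub_sigma_algebra; exists i.
have subo : others j `<=` <<s \bigcup_(i in [set: 'I_N]) sigma_noise W i >>.
  by apply: sub_smallest2r => // E [i _ hE]; exists i.
have YD : <<s \bigcup_(i in [set: 'I_N]) sigma_noise W i >> (Y `&` D).
  by apply: (@measurableI _ (g_sigma_algebraType _)); [exact: subo|exact: sub hD].
rewrite -setIA (hx0W hX YD) (hx0W hX (subo _ hY)).
suff -> : P (Y `&` D) = (P Y * P D)%E by rewrite muleA.
apply: (mutually_independent_group (J := fun i => i != j) subsigma_noise hWind) => //.
by apply: sub_sigma_algebra; exists j => //=; rewrite negbK.
Qed.

Lemma allbut_future j s A C : 0 <= s -> allbut j s A -> future (W j) s C -> P (A `&` C) = (P A * P C)%E.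
Proof.
move=> s0 hA hC.
have mC := (subsigma_noise j).2 _ (noise_future s0 hC).
apply: (indep_join (subsigma_sxo j).1 (subsigma_past j s).1 (subsigma_sxo j).2 (subsigma_past j s).2 mC _ hA) => X Y hX hY.
have YC : sigma_noise W j (Y `&` C).
  by apply: (@measurableI _ (g_sigma_algebraType _)); [exact: noise_past hY|exact: noise_future hC].
rewrite -setIA (sxo_noise hX YC) (sxo_noise hX (noise_past hY)).
by rewrite (past_future (hW j) s0 hY hC) muleA.
Qed.

Lemma gmeas_W_allbut i j s t : i != j -> 0 <= t -> gmeas (allbut j s) (W i t).
Proof.
move=> ij t0; apply: (gmeas_sigma_gen_sub (subsigma_allbut j s).1 (allbut_noise ij)).
by rewrite /= in_itv /= t0.
Qed.

Lemma gmeas_future j s v : s <= v -> gmeas (future (W j) s) (fun w => W j v w - W j s w).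
Proof. by move=> sv; apply: gmeas_sigma_gen; rewrite /= in_itv /= sv. Qed.

Lemma increment_moments j s t : 0 <= s -> s < t ->
  let D := fun w => W j t w - W j s w in
  [/\ L2s P setT D, \int[P]_w D w = 0 & \int[P]_w (D w ^+ 2) = t - s].
Proof.
move=> s0 st D; have [_ _ law _] := hW j.
have h0 : Num.sqrt (t - s) != 0 by rewrite sqrtr_eq0 -ltNge subr_gt0.
have mD : measurable_fun setT D by apply: measurable_funB.
have [a b c] := normal_law_moments h0 mD (fun B => law s t s0 st B).
by split=> //; rewrite c sqr_sqrtr// subr_ge0 ltW.
Qed.

Lemma increment_L2s j s t : 0 <= s -> s <= t -> L2s P setT (fun w => W j t w - W j s w).
Proof.
move=> s0; rewrite le_eqVlt => /orP[/eqP<-|st]; last by have [] := increment_moments j s0 st.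
by apply: (L2s_eq measurableT _ (L2s_0 P measurableT)) => w _; rewrite subrr.
Qed.

Lemma increment_orth j s t : 0 <= s -> s <= t -> orth P (allbut j s) (fun w => W j t w - W j s w).
Proof.
move=> s0; rewrite le_eqVlt => /orP[/eqP<-|st] A hA.
  by rewrite (Int_eq P (g := fun=> 0)) ?Int_0// => w _; rewrite subrr.
have [l2 i0 _] := increment_moments j s0 st.
have sf : subsigma (future (W j) s).
  by split; [exact: smallest_sigma_algebra|move=> E /(noise_future s0)/(subsigma_noise j).2].
rewrite (indep_Int sf ((subsigma_allbut j s).2 _ hA)) ?i0 ?mulr0//.
- by move=> B; exact: allbut_future.
- exact: gmeas_future (ltW st).
- by apply: (L2s_L1P).
Qed.

Lemma increment_sq_orth j s t : 0 <= s -> s <= t ->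
  orth P (allbut j s) (fun w => (W j t w - W j s w) ^+ 2 - (t - s)).
Proof.
move=> s0; rewrite le_eqVlt => /orP[/eqP<-|st] A hA.
  by rewrite (Int_eq P (g := fun=> 0)) ?Int_0// => w _; rewrite !subrr expr0n subrr.
have mA := (subsigma_allbut j s).2 _ hA.
have [l2 _ i2] := increment_moments j s0 st.
have sf : subsigma (future (W j) s).
  by split; [exact: smallest_sigma_algebra|move=> E /(noise_future s0)/(subsigma_noise j).2].
rewrite (IntB mA); last 2 first.
- exact: L1_setT l2.2.
- by apply: L1_setT => //; exact: L1_cst measurableT _ (P_lty P).
rewrite (indep_Int sf mA _ _ l2.2) ?i2 ?Rintegral_cst//.
- by rewrite mulrC subrr.
- by move=> B; exact: allbut_future.
- exact: (gmeasM (gmeas_future (ltW st)) (gmeas_future (ltW st))).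
Qed.

Definition futures s : set (set Omega) := <<s \bigcup_(j in [set: 'I_N]) future (W j) s >>.

Lemma subsigma_future j s : 0 <= s -> subsigma (future (W j) s).
Proof.
by move=> s0; split; [exact: ssa|move=> E /(noise_future s0)/(subsigma_noise j).2].
Qed.

Lemma subsigma_futures s : 0 <= s -> subsigma (futures s).
Proof. by move=> s0; apply: subsigma_gen => A [j _ /(subsigma_future j s0).2]. Qed.

Lemma futures_anti s t : s <= t -> futures t `<=` futures s.
Proof.
move=> st; apply: smallest_sub; first exact: ssa.
move=> A [j _]; apply: sigma_gen_sub A; first exact: ssa.
have sub : future (W j) s `<=` futures s.
  by move=> E hE; apply: sub_sigma_algebra; exists j.
move=> v; rewrite /= in_itv /= andbT => tv.
rewrite (_ : (fun w => _) = fun w => (W j v w - W j s w) - (W j t w - W j s w)); last first.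
  by apply/funext => w; ring.
apply: gmeasB; apply: (gmeas_sigma_gen_sub (ssa _) sub);
  by rewrite /= in_itv /= ?st// (le_trans st).
Qed.

(** Induction on the number of noises: the events about the first k of them belong to [allbut j s]
    for the next noise j, whose future event therefore splits off as a factor. *)
Lemma filtration_future_prod s A (E : 'I_N -> set Omega) : 0 <= s -> F s A ->
  (forall j, future (W j) s (E j)) ->
  P (A `&` \bigcap_(j in [set: 'I_N]) E j) = (P A * \prod_(j < N) P (E j))%E.
Proof.
move=> s0 hA hE.
suff H k : (k <= N)%N -> P (A `&` \bigcap_(j in [set j : 'I_N | (j < k)%N]) E j) =
    (P A * \prod_(j < N | (j < k)%N) P (E j))%E.
  have -> : [set: 'I_N] = [set j : 'I_N | (j < N)%N] by apply/seteqP; split=> j //= _; exact: ltn_ord.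
  by rewrite H//; congr (_ * _)%E; apply: eq_bigl => j; rewrite ltn_ord.
elim: k => [_|k IH kN].
  rewrite big_pred0// mule1 (_ : \bigcap_(j in _) _ = setT) ?setIT//.
  by apply/seteqP; split.
pose j := Ordinal kN.
have -> : \bigcap_(i in [set i : 'I_N | (i < k.+1)%N]) E i = \bigcap_(i in [set i : 'I_N | (i < k)%N]) E i `&` E j.
  apply/seteqP; split=> w.
    by move=> h; split=> [i /= ik|]; apply: h; rewrite /= ltnS//; exact: ltnW.
  move=> [h hj] i /=; rewrite ltnS leq_eqVlt => /orP[/eqP ik|ik]; last exact: h.
  by rewrite (_ : i = j)//; exact: val_inj.
rewrite setIA (@allbut_future j s _ (E j) s0)//; last first.
  apply: (@measurableI _ (g_sigma_algebraType _)); first exact: filtration_allbut hA.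
  apply: (@fin_bigcap_measurable _ (g_sigma_algebraType _)) => // i /= ik.
  have ij : i != j by apply/eqP => e; move: ik; rewrite e /= ltnn.
  exact: (allbut_noise ij) (noise_future s0 (hE i)).
rewrite IH ?(ltnW kN)// -muleA; congr (_ * _)%E.
rewrite [RHS](bigD1 j)//= muleC; congr (_ * _)%E; apply: eq_bigl => i.
by rewrite ltnS ltn_neqAle andbC; congr andb.
Qed.

Lemma filtration_futures s A C : 0 <= s -> F s A -> futures s C -> P (A `&` C) = (P A * P C)%E.
Proof.
move=> s0 hA hC; rewrite setIC [RHS]muleC.
pose Pi : set (set Omega) := [set X | exists E : 'I_N -> set Omega,
  (forall j, future (W j) s (E j)) /\ X = \bigcap_(j in [set: 'I_N]) E j].
have fT j : future (W j) s setT by apply: (@measurableT _ (g_sigma_algebraType _)).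
have PiT : Pi setT by exists (fun=> setT); split=> //; apply/seteqP; split.
have sub : futures s `<=` <<s Pi >>.
  apply: smallest_sub; first exact: ssa.
  move=> X [i _ FX]; apply: sub_sigma_algebra.
  exists (fun j => if j == i then X else setT); split.
    by move=> j; case: eqP => // ->.
  apply/seteqP; split=> w; first by move=> Xw j _; case: ifP.
  by move=> /(_ i Logic.I); rewrite eqxx.
apply: (indep_gen _ PiT _ ((subsigma_filtration s).2 _ hA) _ (sub _ hC)).
- move=> _ _ [E1 [h1 ->]] [E2 [h2 ->]]; exists (fun j => E1 j `&` E2 j); split; last by rewrite bigcapI.
  by move=> j; exact: (@measurableI _ (g_sigma_algebraType _) _ _ (h1 j) (h2 j)).
- move=> _ [E [h ->]]; apply: fin_bigcap_measurable => // j _.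
  exact: (subsigma_future j s0).2.
- move=> _ [E [h ->]]; rewrite setIC (filtration_future_prod s0 hA h) [RHS]muleC; congr (_ * _)%E.
  have FT : F s setT by apply: (@measurableT _ (g_sigma_algebraType _)).
  by rewrite -[X in P X]setTI (filtration_future_prod s0 FT h) probability_setT mul1e.
Qed.

Let FT s : F s setT.
Proof. exact: (@measurableT _ (g_sigma_algebraType _)). Qed.

Lemma Int_bigcup0 zeta (A : nat -> set Omega) : L1 P setT zeta -> (forall k, measurable (A k)) ->
  trivIset setT A -> (forall k, \int[P]_(w in A k) zeta w = 0) ->
  \int[P]_(w in \bigcup_k A k) zeta w = 0.
Proof.
move=> Lz mA tA A0; have mU : measurable (\bigcup_k A k) by exact: bigcupT_measurable.
rewrite /Rintegral integral_bigcup//; last exact: L1_setT.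
rewrite (_ : (fun n => _) = fun=> 0%E); first by rewrite lim_cst.
apply/funext => m; apply: big1 => k _.
by rewrite (Int_E (mA k)) ?A0//; exact: L1_setT.
Qed.

(* Blumenthal's zero-one law: the increments after time 0+ generate, together
   with F_0 and up to null sets, all of F_T, and are independent of F_(0+). *)
Lemma blumenthal T xi : 0 < T -> L1 P setT xi ->
  (forall e, 0 < e -> e <= T -> AM P (F e) xi) -> AM P (F 0) xi.
Proof.
move=> T0 Lxi h.
have [eta [geta Leta oeta]] := condexp (subsigma_filtration 0) Lxi.
(* The goal becomes that this residual vanishes almost surely. *)
pose zeta w := xi w - eta w.
have Lz : L1 P setT zeta := L1B measurableT Lxi Leta.
have AMz e : 0 < e -> e <= T -> AM P (F e) zeta.
  move=> e0 eT; apply: AM_ae (AMD (h e e0 eT) (AMZ (-1) (AM_gmeas P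
    (gmeas_mono (subsigma_filtration 0).1 (subsigma_filtration e).1 (filtration_mono (ltW e0)) geta)))).
  by apply: ae_true => w; rewrite mulN1r.
(* Up to null sets zeta is F_e-measurable, C is independent of F_e, and the integral of zeta over A
   in F_0 is 0. *)
have orthC e A C : 0 < e -> e <= T -> F 0 A -> futures e C -> \int[P]_(w in A `&` C) zeta w = 0.
  move=> e0 eT hA hC; have [z gz ez] := AMz e e0 eT.
  have sF := subsigma_filtration e.
  have mA : measurable A := (subsigma_filtration 0).2 _ hA.
  have mC : measurable C := (subsigma_futures (ltW e0)).2 _ hC.
  have gA : gmeas (F e) (\1_A : Omega -> R).
    by apply: gmeas_ind; [exact: sF.1|exact: filtration_mono (ltW e0) _ hA].
  have Lz' : L1 P setT z.
    by apply: (L1_ae measurableT _ _ Lz); [exact: gmeas_meas gz|apply: ae_imp ez].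
  have E B : measurable B -> \int[P]_(w in B) (\1_A w * zeta w) = \int[P]_(w in B) (\1_A w * z w).
    move=> mB; apply: (Int_ae mB).
    - by apply: measurable_funTS; exact: (L1_meas measurableT (L1_ind mA Lz)).
    - by apply: measurable_funTS; exact: (L1_meas measurableT (L1_ind mA Lz')).
    - by apply: ae_imp ez => w -> _.
  rewrite setIC (_ : \int[P]_(w in C `&` A) zeta w = \int[P]_(w in C) (\1_A w * zeta w)); last first.
    rewrite -(Int_ind P _ (measurableI _ _ mC mA)) -(Int_ind P _ mC).
    by apply: Int_eq => w _; rewrite indicI/= mulrA.
  rewrite E// (indep_Int sF mC _ (gmeasM gA gz) (L1_ind mA Lz')).
    rewrite -E// Int_ind// oeta ?mulr0//.
  by move=> B hB; rewrite setIC [RHS]muleC (filtration_futures (ltW e0) hB hC).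
pose e k : R := T / k.+1%:R.
have e0 k : 0 < e k by rewrite divr_gt0 ?ltr0Sn.
have eT k : e k <= T by rewrite ler_pdivrMr ?ltr0Sn// ler_peMr ?(ltW T0) ?ler1n.
have ele k l : (k <= l)%N -> e l <= e k.
  by move=> kl; rewrite ler_wpM2l ?(ltW T0)// lef_pV2 ?posrE ?ltr0Sn// ler_nat ltnS.
(* Closed under intersection: two sets of increments are compared by passing to the earlier of their
   starting times, whose sigma-algebra is the larger one. *)
pose Pi : set (set Omega) := [set X | exists A C k, [/\ F 0 A, futures (e k) C & X = A `&` C]].
pose H := <<s Pi >>.
have mPi X : Pi X -> measurable X.
  move=> [A [C [k [hA hC ->]]]]; apply: measurableI; first exact: (subsigma_filtration 0).2.
  exact: (subsigma_futures (ltW (e0 k))).2.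
have sH : subsigma H := subsigma_gen mPi.
have orthH : orth P H zeta.
  apply: (@dynkin_induction _ (g_sigma_algebraType Pi) Pi (fun X => \int[P]_(w in (X : set Omega)) zeta w = 0)) => //.
  - move=> _ _ [A [C [k [hA hC ->]]]] [A' [C' [k' [hA' hC' ->]]]].
    exists (A `&` A'), (C `&` C'), (maxn k k'); split; last by rewrite setIACA.
      exact: (@measurableI _ (g_sigma_algebraType _) _ _ hA hA').
    apply: (@measurableI _ (g_sigma_algebraType _)).
      by apply: futures_anti hC; apply: ele; exact: leq_maxl.
    by apply: futures_anti hC'; apply: ele; exact: leq_maxr.
  - by have := oeta setT (@FT 0).
  - by move=> _ [A [C [k [hA hC ->]]]]; exact: (orthC (e k)).
  - move=> S /sH.2 mS S0.
    have I0 := oeta setT (@FT 0).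
    have := Rintegral_setU (mu := P) mS (measurableC mS) (f := zeta).
    rewrite setUv S0 add0r -/zeta => <-//.
    by apply/disj_set2P; rewrite setICr.
  - move=> S mS tS S0; apply: Int_bigcup0 => // k.
    exact: sH.2 _ (mS k).
have F0H : F 0 `<=` H.
  move=> A hA; apply: sub_sigma_algebra; exists A, setT, 0%N; split=> //; last by rewrite setIT.
  exact: (@measurableT _ (g_sigma_algebraType _)).
have futH k : futures (e k) `<=` H.
  move=> C hC; apply: sub_sigma_algebra; exists setT, C, k; split=> //; last by rewrite setTI.
(* The completion of H inside the measurable sets; the aim is that it contains F_T. *)
pose cpl : set (set Omega) := [set A | measurable A /\ exists2 A', H A' & {ae P, forall w, A w <-> A' w}].
have scpl : sigma_algebra setT cpl.
  split.
  - by split=> //; exists set0; [have [] := sH.1|exact: ae_true].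
  - move=> A [mA [A' hA' AA']]; rewrite setTD; split; first exact: measurableC.
    exists (~` A'); first by rewrite -setTD; have [_ + _] := sH.1; apply.
    by apply: ae_imp AA' => w e' /=; rewrite /setC /=; tauto.
  - move=> A hA; split; first by apply: bigcupT_measurable => k; exact: (hA k).1.
    pose A' k := projT1 (cid2 (hA k).2).
    have hA' k : H (A' k) /\ {ae P, forall w, A k w <-> A' k w}.
      by rewrite /A'; case: cid2.
    exists (\bigcup_k A' k); first by have [_ _] := sH.1; apply => k; exact: (hA' k).1.
    have := ae_nat (fun k => (hA' k).2); apply: ae_imp => w e'.
    by split=> -[k _ hk]; exists k => //; apply/e'.
have Hcpl : H `<=` cpl.
  by move=> A hA; split; [exact: sH.2|exists A => //; exact: ae_true].
have cplW j u : 0 <= u <= T -> exists2 Z, gmeas H Z & {ae P, forall w, W j u w = Z w}.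
  move=> /andP[]; rewrite le_eqVlt => /orP[/eqP<- _|u0 uT].
    exists (W j 0); last exact: ae_true.
    exact: gmeas_mono (subsigma_filtration 0).1 sH.1 F0H (gmeas_W j (lexx 0)).
  (* The guard makes Y k depend on increments after e k for every k. For u > 0 it holds eventually,
     and W_j at e k tends to W_j at 0, so the limit of Y k is the increment of W_j over [0, u]. *)
  pose Y k w : R := if e k <= u then W j u w - W j (e k) w else 0.
  have gY k : gmeas H (Y k).
    have [eu|eu] := boolP (e k <= u); last by rewrite /Y (negbTE eu); exact: gmeas_cst.
    rewrite /Y eu.
    apply: (@gmeas_sigma_gen_sub _ _ _ _ `[e k, +oo[ (fun v w => W j v w - W j (e k) w) _ u sH.1).
      move=> A hA; apply: (futH k); apply: sub_sigma_algebra; exists j => //.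
    by rewrite /= in_itv /= eu.
  exists (fun w => fine (limn_esup (fun k => (Y k w)%:E)) + W j 0 w).
    apply: gmeasD; last exact: gmeas_mono (subsigma_filtration 0).1 sH.1 F0H (gmeas_W j (lexx 0)).
    have gl : @measurable_fun _ _ (g_sigma_algebraType H) (\bar R) setT
      (fun w => limn_esup (fun k => (Y k w)%:E)).
      apply: (@measurable_fun_limn_esup _ (g_sigma_algebraType H)) => k.
      by apply/measurable_EFinP; exact: gY.
    exact: measurableT_comp (fine_measurable measurableT) gl.
  have [_ _ _ cW] := hW j.
  apply: ae_imp cW => w cw.
  have eto0 : e @ \oo --> (0 : R).
    by rewrite -(mulr0 T); apply: cvgMr; exact: cvg_harmonic.
  have c0 : (fun k => W j (e k) w) @ \oo --> W j 0 w.
    have cw' : {within `[0, T], continuous (fun t => W j t w)}.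
      by apply: continuous_subspaceW cw => t; rewrite /= !in_itv /= => /andP[->].
    apply: (within_cvg_seq cw') => //; first by rewrite in_itv /= lexx (ltW T0).
    by move=> k; rewrite in_itv /= (ltW (e0 k)) eT.
  have cY : (fun k => (Y k w)%:E) @ \oo --> (W j u w - W j 0 w)%:E.
    apply/fine_cvgP; split; first exact: nearW.
    have cY' : (fun k => W j u w - W j (e k) w) @ \oo --> W j u w - W j 0 w.
      by apply: cvgB => //; exact: cvg_cst.
    apply: cvg_trans cY'; apply: near_eq_cvg.
    have /cvgrPdist_lt/(_ _ u0) := eto0; apply: filterS => k /=.
    by rewrite sub0r normrN gtr0_norm// /Y => /ltW ->.
  by rewrite (cvg_limn_einf_sup cY).2/= subrK.
have FTcpl : F T `<=` cpl.
  apply: smallest_sub => // A [j _]; apply: smallest_sub A => // A [hA|].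
    apply: Hcpl; apply: F0H; apply: sub_sigma_algebra; exists j => //.
    by apply: sub_sigma_algebra; left.
  apply: smallest_sub A => // A [u uT [B mB <-]].
  move: uT; rewrite /= in_itv /= => uT; rewrite setTI.
  have [Z gZ eZ] := cplW j u uT.
  split; first by rewrite -[X in measurable X]setTI; exact: measurable_funP.
  exists (Z @^-1` B); first exact: (gmeasP _ sH.1).1.
  by apply: ae_imp eZ => w /= ->.
have orthT : orth P (F T) zeta.
  move=> A /FTcpl[mA [A' hA' AA']]; rewrite -(orthH A')//.
  have mA' := sH.2 _ hA'.
  rewrite -(Int_ind P _ mA) -(Int_ind P _ mA'); apply: (Int_ae measurableT).
  - exact: (L1_meas measurableT (L1_ind mA Lz)).
  - exact: (L1_meas measurableT (L1_ind mA' Lz)).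
  - apply: ae_imp AA' => w e' _; rewrite !indicE; congr (_%:R * _); congr nat_of_bool.
    by apply/idP/idP; rewrite !inE => /e'.
have [z gz ez] := AMz T T0 (lexx T).
have Lz' : L1 P setT z.
  by apply: (L1_ae measurableT _ _ Lz); [exact: gmeas_meas (subsigma_filtration T) gz|apply: ae_imp ez].
have oz : orth P (F T) z.
  move=> A hA; rewrite -(orthT A hA); have mA := (subsigma_filtration T).2 _ hA.
  apply: (Int_ae mA);
    [by apply: measurable_funTS; exact: (L1_meas measurableT Lz')|by apply: measurable_funTS; exact: (L1_meas measurableT Lz)|].
  by apply: ae_imp ez => w -> _.
exists eta => //.
apply: ae_imp2 ez (orth_gmeas_ae0 (subsigma_filtration T) Lz' gz oz) => w.
by rewrite /zeta => <- /eqP; rewrite subr_eq0 => /eqP.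
Qed.

End BrownianFiltration.

(** * Mean-square limits *)

Section L2Limits.
Context d (X : measurableType d) (R : realType) (mu : {measure set X -> \bar R}).
Variables (D : set X).
Hypothesis mD : measurable D.
Implicit Types (f g : X -> R).

Definition L2lim (f_ : nat -> X -> R) f := [/\ forall n, L2s mu D (f_ n), L2s mu D f &
  (fun n => \int[mu]_(x in D) ((f_ n x - f x) ^+ 2)) @ \oo --> (0 : R)].

Lemma sqr_cvg0 (u v : nat -> R) : (forall n, u n ^+ 2 <= v n) -> v @ \oo --> (0 : R) -> u @ \oo --> (0 : R).
Proof.
move=> uv v0; apply/cvgrPdist_lt => e e0.
have /cvgrPdist_lt/(_ _ (exprn_gt0 2 e0)) := v0; apply: filterS => n.
rewrite !sub0r !normrN => h; rewrite -ltr_sqr ?nnegrE ?(ltW e0)// real_normK ?num_real//.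
by apply: le_lt_trans (uv n) _; apply: le_lt_trans h; exact: ler_norm.
Qed.

Lemma L2lim_dot (f_ : nat -> X -> R) f g : L2lim f_ f -> L2s mu D g ->
  (fun n => \int[mu]_(x in D) (f_ n x * g x)) @ \oo --> \int[mu]_(x in D) (f x * g x).
Proof.
move=> [hn h c] hg; apply/subr_cvg0.
apply: (@sqr_cvg0 _ (fun n => (\int[mu]_(x in D) ((f_ n x - f x) ^+ 2)) * \int[mu]_(x in D) (g x ^+ 2))).
  move=> n; apply: le_trans (Cauchy_Schwarz mD (L2sB mD (hn n) h) hg).
  rewrite -(IntB mD (L2sM mD (hn n) hg) (L2sM mD h hg)).
  by rewrite (Int_eq mu (g := fun x => (f_ n x - f x) * g x))// => x _; rewrite mulrBl.
by rewrite -[X in _ --> X](mul0r (\int[mu]_(x in D) (g x ^+ 2))); apply: cvgM => //; exact: cvg_cst.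
Qed.

(** The product is expanded around the limits: the quadratic remainder is small by Cauchy-Schwarz,
    the two linear terms converge weakly. *)
Lemma L2limM (f_ : nat -> X -> R) f (g_ : nat -> X -> R) g : L2lim f_ f -> L2lim g_ g ->
  (fun n => \int[mu]_(x in D) (f_ n x * g_ n x)) @ \oo --> \int[mu]_(x in D) (f x * g x).
Proof.
move=> hf hg; have [hn h c] := hf; have [gn g0 cg] := hg.
have E n : \int[mu]_(x in D) (f_ n x * g_ n x) =
    \int[mu]_(x in D) ((f_ n x - f x) * (g_ n x - g x)) +
    (\int[mu]_(x in D) (f_ n x * g x) + (\int[mu]_(x in D) (g_ n x * f x) - \int[mu]_(x in D) (f x * g x))).
  have L1a := L2sM mD (L2sB mD (hn n) h) (L2sB mD (gn n) g0).
  have L1b := L2sM mD (hn n) g0; have L1c := L2sM mD (gn n) h; have L1d := L2sM mD h g0.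
  rewrite -(IntB mD L1c L1d) -(IntD mD L1b (L1B mD L1c L1d)) -(IntD mD L1a (L1D mD L1b (L1B mD L1c L1d))).
  by apply: Int_eq => x _; ring.
rewrite (_ : (fun n => _) = fun n => \int[mu]_(x in D) ((f_ n x - f x) * (g_ n x - g x)) +
    (\int[mu]_(x in D) (f_ n x * g x) + (\int[mu]_(x in D) (g_ n x * f x) - \int[mu]_(x in D) (f x * g x)))); last first.
  by apply/funext.
have E2 : \int[mu]_(x in D) (f x * g x) = 0 + (\int[mu]_(x in D) (f x * g x) +
   (\int[mu]_(x in D) (g x * f x) - \int[mu]_(x in D) (f x * g x))).
  have -> : \int[mu]_(x in D) (g x * f x) = \int[mu]_(x in D) (f x * g x).
    by apply: Int_eq => x _; rewrite mulrC.
  by rewrite subrr addr0 add0r.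
rewrite [X in _ --> X]E2; apply: cvgD; last apply: cvgD; last apply: cvgB.
- apply: (@sqr_cvg0 _ (fun n => (\int[mu]_(x in D) ((f_ n x - f x) ^+ 2)) * \int[mu]_(x in D) ((g_ n x - g x) ^+ 2))).
    by move=> n; apply: Cauchy_Schwarz => //; exact: L2sB.
  by rewrite -[X in _ --> X](mul0r (0 : R)); exact: cvgM.
- exact: L2lim_dot.
- exact: L2lim_dot.
- exact: cvg_cst.
Qed.

Lemma L2lim_lin (c : R) (f_ : nat -> X -> R) f (g_ : nat -> X -> R) g : L2lim f_ f -> L2lim g_ g ->
  L2lim (fun n x => f_ n x + c * g_ n x) (fun x => f x + c * g x).
Proof.
move=> [hn h ch] [gn g0 cg]; split.
- by move=> n; apply: (L2sD mD) => //; exact: (L2sZ mD).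
- by apply: (L2sD mD) => //; exact: (L2sZ mD).
apply: (@squeeze_cvgr _ _ _ _ (fun=> 0) (fun n => 2 * (\int[mu]_(x in D) ((f_ n x - f x) ^+ 2)) +
    (2 * c ^+ 2) * (\int[mu]_(x in D) ((g_ n x - g x) ^+ 2)))); last 2 first.
- exact: cvg_cst.
- rewrite -[X in _ --> X](_ : 2 * 0 + 2 * c ^+ 2 * 0 = 0 :> R); last by rewrite !mulr0 addr0.
  by apply: cvgD; apply: cvgM => //; exact: cvg_cst.
apply: nearW => n; apply/andP; split; first by apply: Int_ge0 => x _; exact: sqr_ge0.
have La := (L2sB mD (hn n) h).2; have Lb := (L2sB mD (gn n) g0).2.
rewrite -(IntZ mD _ La) -(IntZ mD _ Lb) -(IntD mD (L1Z mD _ La) (L1Z mD _ Lb)).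
apply: (Int_le mD); last by move=> x _; have := sqr_ge0 ((f_ n x - f x) - c * (g_ n x - g x)); nra.
- exact: (L2sB mD (L2sD mD (hn n) (L2sZ mD c (gn n))) (L2sD mD h (L2sZ mD c g0))).2.
- by apply: (L1D mD); exact: (L1Z mD).
Qed.

Lemma L2lim_cst f : L2s mu D f -> L2lim (fun=> f) f.
Proof.
move=> hf; split=> //; rewrite (_ : (fun n => _) = fun=> 0); first exact: cvg_cst.
by apply/funext => n; rewrite (Int_eq mu (g := fun=> 0)) ?Int_0// => x _; rewrite subrr expr0n.
Qed.

Lemma L2lim_eq (f_ g_ : nat -> X -> R) f g : (forall n x, D x -> f_ n x = g_ n x) -> (forall x, D x -> f x = g x) ->
  L2lim f_ f -> L2lim g_ g.
Proof.
move=> e e' [hn h c]; split.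
- by move=> n; apply: (L2s_eq mD (e n)).
- exact: (L2s_eq mD e').
- rewrite (_ : (fun n => _) = fun n => \int[mu]_(x in D) ((f_ n x - f x) ^+ 2))//.
  by apply/funext => n; apply: Int_eq => x Dx; rewrite e// e'.
Qed.

End L2Limits.

(** * The Ito integral *)

Section Ito.
Context d (Omega : measurableType d) (R : realType) (P : probability Omega R).
Variables (F : R -> set (set Omega)) (T : R) (J : finType) (W : J -> R -> {RV P >-> R}).
Variable K : J -> R -> set (set Omega).
Local Notation lam := (@lebesgue_measure R).
Hypothesis sF : forall t, subsigma (F t).
Hypothesis mF : forall s t, s <= t -> F s `<=` F t.
Hypothesis T0 : 0 <= T.
Hypothesis gW : forall j t, 0 <= t -> gmeas (F t) (W j t).
Hypothesis sK : forall j s, subsigma (K j s).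
Hypothesis FK : forall j s, F s `<=` K j s.
Hypothesis KW : forall i j s t, i != j -> 0 <= t -> gmeas (K j s) (W i t).
Hypothesis incL : forall j s t, 0 <= s -> s <= t -> L2s P setT (fun w => W j t w - W j s w).
Hypothesis incO : forall j s t, 0 <= s -> s <= t -> orth P (K j s) (fun w => W j t w - W j s w).
Hypothesis incS : forall j s t, 0 <= s -> s <= t ->
  orth P (K j s) (fun w => (W j t w - W j s w) ^+ 2 - (t - s)).
Local Notation DD := (`[0, T] `*` [set: Omega]).
Implicit Types (z : R -> Omega -> R) (eta xi f g : Omega -> R).

Lemma gmeas_K j s f : gmeas (F s) f -> gmeas (K j s) f.
Proof. by apply: gmeas_mono; [exact: (sF s).1|exact: (sK j s).1|exact: FK]. Qed.

Lemma inc_orth_ext j s t f : 0 <= s -> s <= t -> gmeas (K j s) f ->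
  L2s P setT f -> \int[P]_w (f w * (W j t w - W j s w)) = 0.
Proof.
move=> s0 st gf Lf; apply: (orth_ext (sK j s)) => //.
- by apply: (L2s_L1P); exact: incL.
- exact: incO.
- by apply: (L2sM measurableT) => //; exact: incL.
Qed.

Definition bdd (f : Omega -> R) := exists C : R, forall w : Omega, `|f w| <= C.

Lemma bdd_L2sM f g : bdd f -> measurable_fun setT f -> L2s P setT g -> L2s P setT (fun w => f w * g w).
Proof. by move=> [C hC] mf; apply: (L2s_bddM measurableT (c := C)). Qed.

(* Same left endpoint: only the common part of the two increments contributes. *)
Lemma inc_inc_aux i j c x y eta : 0 <= c -> c <= x -> x <= y -> gmeas (F c) eta -> bdd eta ->
  \int[P]_w ((W i x w - W i c w) * (W j y w - W j c w) * eta w) =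
  if i == j then (x - c) * \int[P]_w eta w else 0.
Proof.
move=> c0 cx xy ge be.
have x0 : 0 <= x := le_trans c0 cx.
have me := gmeas_meas (sF c) ge.
have Le : L1 P setT eta.
  have [C hC] := be; apply: (L1_le measurableT me _ (L1_cst measurableT C (P_lty P))) => w _; exact: hC.
have Li := incL i c0 cx; have Lj := incL j c0 cx; have Ly := incL j x0 xy.
have Lei := bdd_L2sM be me Li.
have La := L2sM measurableT Lei Lj; have Lb := L2sM measurableT Lei Ly.
rewrite (Int_eq P (g := fun w => (eta w * (W i x w - W i c w)) * (W j x w - W j c w) +
    (eta w * (W i x w - W i c w)) * (W j y w - W j x w))); last by move=> w _; ring.
rewrite (IntD measurableT La Lb) [X in _ + X]inc_orth_ext// ?addr0; last first.
  apply: gmeasM; first by apply: gmeas_K; exact: (gmeas_le sF mF cx ge).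
  apply: gmeasB; apply: gmeas_K; first exact: gW.
  by apply: (gmeas_le sF mF cx); exact: gW.
have [->|ij] := eqVneq i j; last first.
  apply: inc_orth_ext => //; apply: gmeasM; first exact: gmeas_K.
  by apply: gmeasB; apply: KW.
have Lj2 := Lj.2.
have Lx : L1 P setT (fun w => (W j x w - W j c w) ^+ 2 - (x - c)).
  by apply: (L1B measurableT) => //; exact: L1_cst measurableT _ (P_lty P).
have Lex : L1 P setT (fun w => eta w * ((W j x w - W j c w) ^+ 2 - (x - c))).
  by have [C hC] := be; apply: (L1_bddM measurableT (c := C)).
have Lxe : L1 P setT (fun w => (x - c) * eta w) by exact: (L1Z measurableT).
rewrite (Int_eq P (g := fun w => eta w * ((W j x w - W j c w) ^+ 2 - (x - c)) + (x - c) * eta w)); last by move=> w _; ring.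
rewrite (IntD measurableT Lex Lxe) (IntZ measurableT _ Le).
by rewrite (orth_ext (sK j c) Lx (incS c0 cx) (gmeas_K ge) Lex) add0r.
Qed.

Lemma inc_inc_aux2 i j c x y eta : 0 <= c -> c <= x -> c <= y -> gmeas (F c) eta -> bdd eta ->
  \int[P]_w ((W i x w - W i c w) * (W j y w - W j c w) * eta w) =
  if i == j then (Num.min x y - c) * \int[P]_w eta w else 0.
Proof.
move=> c0 cx cy ge be; have [xy|/ltW yx] := leP x y; first exact: inc_inc_aux.
rewrite eq_sym -(@inc_inc_aux j i c y x)//.
by apply: Int_eq => w _; ring.
Qed.

Lemma bddM f g : bdd f -> bdd g -> bdd (fun w => f w * g w).
Proof.
move=> [C hC] [C' hC']; exists (C * C') => w; rewrite normrM ler_pM//.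
Qed.

Lemma bdd_L2s f : bdd f -> measurable_fun setT f -> L2s P setT f.
Proof. by move=> [C hC] mf; apply: (L2s_bdd measurableT (c := C)) => //; exact: P_lty. Qed.

(** The increment of W_i is cut at c. Its part before c is known when the increment of W_j starts
    and contributes nothing; its part after c has the same left endpoint c as that of W_j. *)
Lemma inc_inc_le i j a b c e xi xi' : 0 <= a -> a <= b -> a <= c -> c <= e ->
  gmeas (F a) xi -> bdd xi -> gmeas (F c) xi' -> bdd xi' ->
  \int[P]_w (((W i b w - W i a w) * xi w) * ((W j e w - W j c w) * xi' w)) =
  if i == j then Num.max 0 (Num.min b e - Num.max a c) * \int[P]_w (xi w * xi' w) else 0.
Proof.
move=> a0 ab ac ce gx bx gx' bx'.
have c0 : 0 <= c := le_trans a0 ac.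
have gx1 : gmeas (F c) xi := gmeas_le sF mF ac gx.
have ge : gmeas (F c) (fun w => xi w * xi' w) by exact: gmeasM.
have be := bddM bx bx'.
have me := gmeas_meas (sF c) ge.
pose b1 := Num.min b c; pose b2 := Num.max b c.
have ab1 : a <= b1 by rewrite le_min ab ac.
have cb2 : c <= b2 by rewrite le_max lexx orbT.
have b1c : b1 <= c by rewrite ge_min lexx orbT.
have E w : W i b w - W i a w = (W i b1 w - W i a w) + (W i b2 w - W i c w).
  by rewrite /b1 /b2; case: (leP b c) => h; ring.
have L1i := bdd_L2sM be me (incL i a0 ab1).
have L2i := bdd_L2sM be me (incL i c0 cb2).
have Lj := incL j c0 ce.
rewrite (Int_eq P (g := fun w => (xi w * xi' w * (W i b1 w - W i a w)) * (W j e w - W j c w) +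
   (xi w * xi' w * (W i b2 w - W i c w)) * (W j e w - W j c w))); last by move=> w _; rewrite E; ring.
rewrite (IntD measurableT (L2sM measurableT L1i Lj) (L2sM measurableT L2i Lj)) inc_orth_ext// ?add0r; last first.
  apply: gmeasM; first exact: gmeas_K.
  apply: gmeasB; apply: gmeas_K.
    by apply: (gmeas_le sF mF b1c); apply: gW; rewrite (le_trans a0).
  by apply: (gmeas_le sF mF ac); apply: gW.
rewrite (Int_eq P (g := fun w => (W i b2 w - W i c w) * (W j e w - W j c w) * (xi w * xi' w))); last by move=> w _; ring.
rewrite (inc_inc_aux2 i j c0 cb2 ce ge be); case: eqP => // _; congr (_ * _).
rewrite (max_r ac) /b2; case: (leP b c) => h.
  by rewrite (min_l ce) subrr max_l// subr_le0 ge_min h.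
by rewrite max_r// subr_ge0 le_min ce ltW.
Qed.

Lemma inc_inc i j a b c e xi xi' : 0 <= a -> a <= b -> 0 <= c -> c <= e ->
  gmeas (F a) xi -> bdd xi -> gmeas (F c) xi' -> bdd xi' ->
  \int[P]_w (((W i b w - W i a w) * xi w) * ((W j e w - W j c w) * xi' w)) =
  if i == j then Num.max 0 (Num.min b e - Num.max a c) * \int[P]_w (xi w * xi' w) else 0.
Proof.
move=> a0 ab c0 ce gx bx gx' bx'; have [ac|] := boolP (a <= c); first exact: (inc_inc_le i j a0 ab ac ce gx bx gx' bx').
rewrite -ltNge => /ltW ca.
rewrite (Int_eq P (g := fun w => ((W j e w - W j c w) * xi' w) * ((W i b w - W i a w) * xi w))); last by move=> w _; rewrite mulrC.
rewrite inc_inc_le// eq_sym; case: eqP => // _.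
rewrite (minC e b) (maxC c a); congr (_ * _).
by apply: Int_eq => w _; rewrite mulrC.
Qed.

(* [((a, b), xi)] stands for the elementary integrand xi 1_]a, b]. *)
Definition atom := (R * R * (Omega -> R))%type.
Implicit Types (q : atom) (L : seq atom).

Definition wfa q := [/\ 0 <= q.1.1, q.1.1 <= q.1.2, q.1.2 <= T, gmeas (F q.1.1) q.2 & bdd q.2].

Fixpoint wfl L : Prop := if L is q :: L' then wfa q /\ wfl L' else True.

Definition aint j q w := (W j q.1.2 w - W j q.1.1 w) * q.2 w.
Definition aval q (s : R) (w : Omega) : R := (q.1.1 < s <= q.1.2)%R%:R * q.2 w.
Definition sint j L w := \sum_(q <- L) aint j q w.
Definition sval L s w := \sum_(q <- L) aval q s w.

(** The elementary integrand stopped at t. If t precedes the left endpoint, the clipped left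
    endpoint is t, at which the coefficient need not be known yet; it is replaced by 0, which keeps
    the atom well formed. *)
Definition clip t q : atom :=
  (Num.min q.1.1 t, Num.min q.1.2 t, if q.1.1 <= t then q.2 else fun=> 0).

Lemma wfa_clip t q : 0 <= t -> wfa q -> wfa (clip t q).
Proof.
move: q => [[a b] xi] t0 [/= a0 ab bT gx bx]; split => /=.
- by rewrite le_min a0.
- by rewrite le_min !ge_min lexx ab !orbT.
- by rewrite ge_min bT.
- case: (leP a t) => // _; exact: gmeas_cst.
- by case: (leP a t) => // _; exists 0 => w; rewrite normr0.
Qed.

Lemma wfl_clip t L : 0 <= t -> wfl L -> wfl (map (clip t) L).
Proof. by move=> t0; elim: L => //= q L IH [hq /IH hL]; split=> //; exact: wfa_clip. Qed.

Lemma wfl_cat L L' : wfl L -> wfl L' -> wfl (L ++ L').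
Proof. by elim: L => //= q L IH [hq /IH hL] /hL. Qed.

Lemma wfl_map (g : atom -> atom) L : (forall q, wfa q -> wfa (g q)) -> wfl L -> wfl (map g L).
Proof. by move=> h; elim: L => //= q L IH [/h hq /IH hL]. Qed.

Lemma sint_clip j t L w : sint j (map (clip t) L) w =
  \sum_(q <- L) (W j (Num.min q.1.2 t) w - W j (Num.min q.1.1 t) w) * (if q.1.1 <= t then q.2 w else 0).
Proof.
rewrite /sint big_map; apply: eq_bigr => q _.
by rewrite /aint /=; case: ifP.
Qed.

Lemma sval_clip t L s w : sval (map (clip t) L) s w = (s <= t)%R%:R * sval L s w.
Proof.
rewrite /sval big_map mulr_sumr; apply: eq_bigr => -[[a b] xi] _.
rewrite /aval /= mulrA -natrM mulnb gt_min le_min.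
have [h'|h'] := boolP (s <= t); last by rewrite !andbF !mul0r.
have -> : (t < s) = false by rewrite ltNge h'.
rewrite orbF andbT /=.
have [h|h] := boolP (a <= t); first by [].
suff -> : (a < s) = false by rewrite !mul0r.
by apply/negbTE; rewrite -leNgt (le_trans h')// ltW// ltNge.
Qed.

Lemma aint_meas j q : wfa q -> L2s P setT (aint j q).
Proof.
move=> [a0 ab bT gx bx].
apply: (L2s_eq measurableT _ (bdd_L2sM bx (gmeas_meas (sF _) gx) (incL j a0 ab))) => w _.
by rewrite mulrC.
Qed.

Lemma sint_L2 j L : wfl L -> L2s P setT (sint j L).
Proof.
elim: L => [_|q L IH /= [hq /IH hL]].
  by apply: (L2s_eq measurableT _ (L2s_0 P measurableT)) => w _; rewrite /sint big_nil.
apply: (L2s_eq measurableT _ (L2sD measurableT (aint_meas j hq) hL)) => w _.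
by rewrite /sint big_cons.
Qed.

Lemma aval_ind_meas (a b : R) : measurable_fun setT (fun s : R => (a < s <= b)%R%:R : R).
Proof.
rewrite (_ : (fun s => _) = \1_`]a, b]).
  by apply: measurable_indic; exact: measurable_itv.
by apply/funext => s; rewrite indicE mem_setE in_itv.
Qed.

Lemma aval_L2 q : wfa q -> L2s (lam \x P)%E DD (fun p : R * Omega => aval q p.1 p.2).
Proof.
move=> [a0 ab bT gx [C hC]].
apply: (L2s_bdd (mDD T) (c := C) (DD_lty P T)).
  apply: measurable_funTS; apply: measurable_funM.
    exact: measurableT_comp (aval_ind_meas _ _) measurable_fst.
  exact: measurableT_comp (gmeas_meas (sF _) gx) measurable_snd.
move=> -[s w] _; rewrite /aval /= normrM ger0_norm//.
by case: (_ && _); rewrite ?mul1r// mul0r (le_trans _ (hC w)).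
Qed.

Lemma sval_L2 L : wfl L -> L2s (lam \x P)%E DD (fun p : R * Omega => sval L p.1 p.2).
Proof.
elim: L => [_|q L IH /= [hq /IH hL]].
  by apply: (L2s_eq (mDD T) _ (L2s_0 (lam \x P)%E (mDD T))) => p _; rewrite /sval big_nil.
apply: (L2s_eq (mDD T) _ (L2sD (mDD T) (aval_L2 hq) hL)) => p _.
by rewrite /sval big_cons.
Qed.

Lemma Int_overlap a b c e : 0 <= a -> b <= T ->
  \int[lam]_(s in `[0, T]) ((a < s <= b)%R%:R * (c < s <= e)%R%:R) = Num.max 0 (Num.min b e - Num.max a c).
Proof.
move=> a0 bT; set m := Num.max a c; set M := Num.min b e.
have E : (fun s => if s \in `[0, T] then (a < s <= b)%R%:R * (c < s <= e)%R%:R else 0) = \1_`]m, M] :> (R -> R).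
  apply/funext => s; rewrite indicE mem_setE !in_itv /= /m /M gt_max le_min -natrM mulnb.
  case: (ltP a s) => as_; rewrite ?andbF ?if_same //=.
  case: (leP s b) => sb; rewrite ?andbF ?if_same //=.
  by rewrite (le_trans (ltW (le_lt_trans a0 as_)) (lexx s)) (le_trans sb bT).
have mI : @measurable _ (measurableTypeR R) `]m, M] by exact: measurable_itv.
rewrite Int_patch E; transitivity (fine (lam `]m, M]%classic)).
  congr fine; etransitivity; first exact: (integral_indic lam measurableT mI).
  by rewrite setIT.
rewrite lebesgue_measure_itv /= lte_fin; case: (ltP m M) => h.
  by rewrite /= max_r// subr_ge0 ltW.
by rewrite max_l// subr_le0.
Qed.

Lemma aval_iso q q' : wfa q -> wfa q' ->
  \int[(lam \x P)%E]_(p in DD) (aval q p.1 p.2 * aval q' p.1 p.2) =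
  Num.max 0 (Num.min q.1.2 q'.1.2 - Num.max q.1.1 q'.1.1) * \int[P]_w (q.2 w * q'.2 w).
Proof.
move=> hq hq'; have [a0 ab bT gx bx] := hq; have [c0 ce eT gx' bx'] := hq'.
have L := L2sM (mDD T) (aval_L2 hq) (aval_L2 hq').
have := fubini_slab2 (itv_meas 0 T) (fun s w => aval q s w * aval q' s w) L => <-.
have Lx := L2sM measurableT (bdd_L2s bx (gmeas_meas (sF _) gx)) (bdd_L2s bx' (gmeas_meas (sF _) gx')).
rewrite -(Int_overlap q'.1.1 q'.1.2 a0 bT) -(IntZr (itv_meas 0 T)); last first.
  apply: (L1_le (itv_meas 0 T) _ _ (L1_cst (itv_meas 0 T) 1 (lam_itv_lty 0 T))).
    by apply: measurable_funTS; apply: measurable_funM; exact: aval_ind_meas.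
  by move=> s _; rewrite normrM !ger0_norm//; do 2 case: (_ && _); rewrite ?mulr1 ?mulr0.
apply: Int_eq => s _; rewrite -(IntZ measurableT _ Lx); apply: Int_eq => w _.
by rewrite /aval; ring.
Qed.

(** Both sides are bilinear in the lists, so pairs of atoms suffice: [inc_inc] on the left, and on
    the right the overlap of the two intervals times the mean product of the coefficients. *)
Lemma sint_iso i j L L' : wfl L -> wfl L' ->
  \int[P]_w (sint i L w * sint j L' w) =
  if i == j then \int[(lam \x P)%E]_(p in DD) (sval L p.1 p.2 * sval L' p.1 p.2) else 0.
Proof.
elim: L => [_ _|q L IH /= [hq hL] hL'].
  rewrite (Int_eq P (g := fun=> 0)) ?Int_0; last by move=> w _; rewrite /sint big_nil mul0r.
  by case: ifP => // _; rewrite (Int_eq _ (g := fun=> 0)) ?Int_0// => p _; rewrite /sval big_nil mul0r.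
have La := aint_meas i hq; have Ls := sint_L2 i hL; have Ls' := sint_L2 j hL'.
rewrite (Int_eq P (g := fun w => aint i q w * sint j L' w + sint i L w * sint j L' w)); last first.
  by move=> w _; rewrite /sint big_cons mulrDl.
rewrite (IntD measurableT (L2sM measurableT La Ls') (L2sM measurableT Ls Ls')) IH//.
have Va := aval_L2 hq; have Vs := sval_L2 hL; have Vs' := sval_L2 hL'.
have -> : \int[(lam \x P)%E]_(p in DD) (sval (q :: L) p.1 p.2 * sval L' p.1 p.2) =
    \int[(lam \x P)%E]_(p in DD) (aval q p.1 p.2 * sval L' p.1 p.2) +
    \int[(lam \x P)%E]_(p in DD) (sval L p.1 p.2 * sval L' p.1 p.2).
  rewrite -(IntD (mDD T) (L2sM (mDD T) Va Vs') (L2sM (mDD T) Vs Vs')).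
  by apply: Int_eq => p _; rewrite /sval big_cons mulrDl.
suff -> : \int[P]_w (aint i q w * sint j L' w) =
    if i == j then \int[(lam \x P)%E]_(p in DD) (aval q p.1 p.2 * sval L' p.1 p.2) else 0.
  by case: ifP => // _; rewrite addr0.
elim: {IH Ls' Vs'} L' hL' => [_|q' L' IH /= [hq' hL']].
  rewrite (Int_eq P (g := fun=> 0)) ?Int_0; last by move=> w _; rewrite /sint big_nil mulr0.
  by case: ifP => // _; rewrite (Int_eq _ (g := fun=> 0)) ?Int_0// => p _; rewrite /sval big_nil mulr0.
have La' := aint_meas j hq'; have Ls' := sint_L2 j hL'.
rewrite (Int_eq P (g := fun w => aint i q w * aint j q' w + aint i q w * sint j L' w)); last first.
  by move=> w _; rewrite /sint big_cons mulrDr.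
rewrite (IntD measurableT (L2sM measurableT La La') (L2sM measurableT La Ls')) IH//.
have Va' := aval_L2 hq'; have Vs' := sval_L2 hL'.
have -> : \int[(lam \x P)%E]_(p in DD) (aval q p.1 p.2 * sval (q' :: L') p.1 p.2) =
    \int[(lam \x P)%E]_(p in DD) (aval q p.1 p.2 * aval q' p.1 p.2) +
    \int[(lam \x P)%E]_(p in DD) (aval q p.1 p.2 * sval L' p.1 p.2).
  rewrite -(IntD (mDD T) (L2sM (mDD T) Va Va') (L2sM (mDD T) Va Vs')).
  by apply: Int_eq => p _; rewrite /sval big_cons mulrDr.
have [a0 ab bT gx bx] := hq; have [c0 ce eT gx' bx'] := hq'.
rewrite (inc_inc i j a0 ab c0 ce gx bx gx' bx') aval_iso//.
by case: ifP => // _; rewrite addr0.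
Qed.

(** Scalar form of [is_ito_integral] with real-valued mean-square limits; vector integrals are
    handled componentwise through [is_ito_sito]. *)
Definition sito j (b Z : R -> Omega -> R) := [/\ SL2 P F T b,
  (forall t, 0 <= t <= T -> gmeas (F t) (Z t)), acont P T Z &
  exists L_ : nat -> seq atom, [/\ forall m, wfl (L_ m),
    L2lim (lam \x P)%E DD (fun m (p : R * Omega) => sval (L_ m) p.1 p.2) (fun p : R * Omega => b p.1 p.2) &
    forall t, 0 <= t <= T -> L2lim P setT (fun m => sint j (map (clip t) (L_ m))) (Z t)]].

Lemma sito_L2 j b Z t : sito j b Z -> 0 <= t <= T -> L2s P setT (Z t).
Proof. by move=> [_ _ _ [L_ [_ _ h]]] /h[]. Qed.

Let meas_le t : measurable_fun DD (fun p : R * Omega => (p.1 <= t)%R%:R : R).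
Proof.
apply: measurable_funTS; apply: (measurableT_comp (f := fun s : R => (s <= t)%R%:R : R)) measurable_fst.
rewrite (_ : (fun s => _) = \1_`]-oo, t]); first by apply: measurable_indic; exact: measurable_itv.
by apply/funext => s; rewrite indicE mem_setE in_itv.
Qed.

Lemma L2lim_cut t (L_ : nat -> seq atom) (b : R -> Omega -> R) :
  L2lim (lam \x P)%E DD (fun m (p : R * Omega) => sval (L_ m) p.1 p.2) (fun p : R * Omega => b p.1 p.2) ->
  L2lim (lam \x P)%E DD (fun m (p : R * Omega) => sval (map (clip t) (L_ m)) p.1 p.2)
    (fun p : R * Omega => (p.1 <= t)%R%:R * b p.1 p.2).
Proof.
move=> [hn h c].
have bt (p : R * Omega) : DD p -> `|(p.1 <= t)%R%:R : R| <= 1 by move=> _; case: (p.1 <= t)%R; rewrite ?normr1 ?normr0.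
have A (f : R * Omega -> R) : L2s (lam \x P)%E DD f -> L2s (lam \x P)%E DD (fun p : R * Omega => (p.1 <= t)%R%:R * f p).
  by exact: (L2s_bddM (mDD T) (meas_le t) bt).
have E m (p : R * Omega) : sval (map (clip t) (L_ m)) p.1 p.2 = (p.1 <= t)%R%:R * sval (L_ m) p.1 p.2 by exact: sval_clip.
split.
- by move=> m; apply: (L2s_eq (mDD T) _ (A _ (hn m))) => p _; rewrite E.
- exact: A.
apply: (@squeeze_cvgr _ _ _ _ (fun=> 0)) c; last exact: cvg_cst.
apply: nearW => m; apply/andP; split; first by apply: Int_ge0 => p _; exact: sqr_ge0.
apply: (Int_le (mDD T)).
- have := (L2sB (mDD T) (A _ (hn m)) (A _ h)).2.
  by apply: (L1_eq (mDD T)) => p _; rewrite E.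
- exact: (L2sB (mDD T) (hn m) h).2.
- move=> p _; rewrite E -mulrBr exprMn; case: (p.1 <= t)%R; first by rewrite expr1n mul1r.
  by rewrite expr0n mul0r sqr_ge0.
Qed.

Lemma sito_iso i j b b' Z Z' t : sito i b Z -> sito j b' Z' -> 0 <= t <= T ->
  \int[P]_w (Z t w * Z' t w) =
  if i == j then \int[(lam \x P)%E]_(p in DD) (((p.1 <= t)%R%:R * b p.1 p.2) * ((p.1 <= t)%R%:R * b' p.1 p.2)) else 0.
Proof.
move=> [_ _ _ [L_ [wL hb hZ]]] [_ _ _ [L_' [wL' hb' hZ']]] tT.
have t0 : 0 <= t by case/andP: tT.
have c := L2limM measurableT (hZ t tT) (hZ' t tT).
apply: (cvg_unique (@Rhausdorff R) c).
rewrite (_ : (fun n => _) = fun n => if i == j then \int[(lam \x P)%E]_(p in DD) (sval (map (clip t) (L_ n)) p.1 p.2 * sval (map (clip t) (L_' n)) p.1 p.2) else 0); last first.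
  by apply/funext => n; apply: sint_iso; exact: wfl_clip.
case: ifP => _; last exact: cvg_cst.
exact: (L2limM (mDD T) (L2lim_cut t hb) (L2lim_cut t hb')).
Qed.

Lemma sito_sub j b b' Z Z' : sito j b Z -> sito j b' Z' ->
  sito j (fun t w => b t w - b' t w) (fun t w => Z t w - Z' t w).
Proof.
move=> [Lb aZ cZ [L_ [wL hb hZ]]] [Lb' aZ' cZ' [L_' [wL' hb' hZ']]]; split.
- exact: SL2B.
- by move=> t tT; apply: gmeasB; [exact: aZ|exact: aZ'].
- apply: ae_imp2 cZ cZ' => w h h' t; apply: cvgB; [exact: h|exact: h'].
pose ng q : atom := (q.1, fun w => - q.2 w).
exists (fun m => L_ m ++ map ng (L_' m)); split.
- move=> m; apply: wfl_cat => //; apply: wfl_map (wL' m) => q [a0 ab bT gx [C hC]].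
  by split=> //=; [exact: gmeasN|exists C => w; rewrite normrN].
- apply: (L2lim_eq (mDD T) _ _ (L2lim_lin (mDD T) (-1) hb hb')) => [m p _|p _]; last by rewrite mulN1r.
  rewrite /sval big_cat big_map /= mulN1r -sumrN; congr (_ + _); apply: eq_bigr => q _.
  by rewrite /aval /= mulrN.
- move=> t tT; apply: (L2lim_eq measurableT _ _ (L2lim_lin measurableT (-1) (hZ t tT) (hZ' t tT))) => [m w _|w _]; last by rewrite mulN1r.
  rewrite map_cat /sint big_cat -map_comp !big_map /= mulN1r -sumrN; congr (_ + _); apply: eq_bigr => q _.
  by rewrite /aint /=; case: ifP => _; rewrite ?mulrN ?mulr0 ?oppr0.
Qed.

(** The difference integrates 0, so it is null at each time by the isometry, and at all times by
    continuity. *)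
Lemma sito_uniq j b b' Z Z' : sito j b Z -> sito j b' Z' ->
  (forall t w, 0 <= t <= T -> b t w = b' t w) ->
  {ae P, forall w, forall t, 0 <= t <= T -> Z t w = Z' t w}.
Proof.
move=> h h' e; have hd := sito_sub h h'.
have [_ _ cZ _] := h; have [_ _ cZ' _] := h'.
apply: ae_grid => // t tT.
have L2 := sito_L2 hd tT.
have := sito_iso hd hd tT; rewrite eqxx.
rewrite [RHS](Int_eq _ (g := fun=> 0)) ?Int_0; last first.
  move=> [s w] [/= + _]; rewrite in_itv /= => sT.
  by rewrite e// subrr mulr0 mul0r.
have -> : \int[P]_w ((Z t w - Z' t w) * (Z t w - Z' t w)) = \int[P]_w ((Z t w - Z' t w) ^+ 2) by [].
move=> I0; have := Int_ge0_ae0 measurableT L2.2 (fun w _ => sqr_ge0 _).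
rewrite I0 => /(_ (lexx _)); apply: ae_imp => w /(_ Logic.I) /eqP.
by rewrite sqrf_eq0 subr_eq0 => /eqP.
Qed.

(** An atom that ends before s or starts after t does not change between s and t. Otherwise the
    change is a single increment of W_j starting at the later of a and s, with a coefficient known
    by then. *)
Lemma aint_mart j q s t zeta : 0 <= s -> s <= t -> t <= T -> wfa q -> gmeas (F s) zeta -> L2s P setT zeta ->
  \int[P]_w (zeta w * (aint j (clip t q) w - aint j (clip s q) w)) = 0.
Proof.
move: q => [[a b] xi] s0 st tT [/= a0 ab bT gx bx] gz Lz.
have mx := gmeas_meas (sF a) gx.
have Lxz : L2s P setT (fun w => xi w * zeta w) by exact: bdd_L2sM.
have [as_|sa] := leP a s.
  have at_ := le_trans as_ st.
  have [bs|/ltW sb] := leP b s.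
    rewrite (Int_eq P (g := fun=> 0)) ?Int_0// => w _.
    by rewrite /aint /= as_ at_ !(min_l bs) !(min_l (le_trans bs st)) (min_l as_) (min_l at_) subrr mulr0.
  have sbt : s <= Num.min b t by rewrite le_min sb st.
  rewrite (Int_eq P (g := fun w => (xi w * zeta w) * (W j (Num.min b t) w - W j s w))); last first.
    move=> w _; rewrite /aint /= as_ at_ (min_r sb) (min_l as_) (min_l at_); ring.
  apply: inc_orth_ext => //; apply: gmeas_K; apply: gmeasM => //.
  exact: (gmeas_le sF mF as_).
have [at_|ta] := leP a t; last first.
  rewrite (Int_eq P (g := fun=> 0)) ?Int_0// => w _.
  by rewrite /aint /= (lt_geF sa) (lt_geF ta) !mulr0 subrr mulr0.
have abt : a <= Num.min b t by rewrite le_min ab at_.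
rewrite (Int_eq P (g := fun w => (xi w * zeta w) * (W j (Num.min b t) w - W j a w))); last first.
  by move=> w _; rewrite /aint /= at_ (lt_geF sa) (min_l at_); ring.
apply: inc_orth_ext => //; apply: gmeas_K; apply: gmeasM => //.
exact: (gmeas_le sF mF (ltW sa)).
Qed.

Lemma sint_mart j L s t zeta : 0 <= s -> s <= t -> t <= T -> wfl L -> gmeas (F s) zeta -> L2s P setT zeta ->
  \int[P]_w (zeta w * (sint j (map (clip t) L) w - sint j (map (clip s) L) w)) = 0.
Proof.
move=> s0 st tT + gz Lz; have t0 := le_trans s0 st.
elim: L => [_|q L IH /= [hq hL]].
  by rewrite (Int_eq P (g := fun=> 0)) ?Int_0// => w _; rewrite /sint !big_nil subrr mulr0.
have A := L2sM measurableT Lz (L2sB measurableT (aint_meas j (wfa_clip t0 hq)) (aint_meas j (wfa_clip s0 hq))).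
have B := L2sM measurableT Lz (L2sB measurableT (sint_L2 j (wfl_clip t0 hL)) (sint_L2 j (wfl_clip s0 hL))).
rewrite -[RHS]addr0 -{1}(aint_mart j s0 st tT hq gz Lz) -(IH hL) -(IntD measurableT A B).
by apply: Int_eq => w _; rewrite /sint !big_cons; ring.
Qed.

Lemma sito_mart j b Z s t zeta : sito j b Z -> 0 <= s -> s <= t -> t <= T ->
  gmeas (F s) zeta -> L2s P setT zeta -> \int[P]_w (zeta w * (Z t w - Z s w)) = 0.
Proof.
move=> [Lb aZ cZ [L_ [wL hb hZ]]] s0 st tT gz Lz; have t0 := le_trans s0 st.
have sT := le_trans st tT.
have hd := L2lim_lin measurableT (-1) (hZ t (introT andP (conj t0 tT))) (hZ s (introT andP (conj s0 sT))).
have c := L2limM measurableT (L2lim_cst Lz) hd.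
rewrite (Int_eq P (g := fun w => zeta w * (Z t w + -1 * Z s w))); last by move=> w _; rewrite mulN1r.
apply: (cvg_unique (@Rhausdorff R) c).
rewrite (_ : (fun n => _) = fun=> 0); first exact: cvg_cst.
apply/funext => n; rewrite -[RHS](sint_mart j s0 st tT (wL n) gz Lz).
by apply: Int_eq => w _; rewrite mulN1r.
Qed.

Lemma sito_orth j b Z s t : sito j b Z -> 0 <= s -> s <= t -> t <= T ->
  orth P (F s) (fun w => Z t w - Z s w).
Proof.
move=> h s0 st tT A hA; have mA := (sF s).2 _ hA.
rewrite -(Int_ind P _ mA); apply: (sito_mart h) => //.
  by apply: gmeas_ind => //; exact: (sF s).1.
apply: (L2s_bdd measurableT (c := 1) (P_lty P)); first exact: measurable_indic.
by move=> w _; exact: ind_le1.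
Qed.

Lemma sito_cov i j b b' Z Z' s t : sito i b Z -> sito j b' Z' -> 0 <= s -> s <= t -> t <= T ->
  \int[P]_w (Z s w * Z' t w) = \int[P]_w (Z s w * Z' s w).
Proof.
move=> h h' s0 st tT.
have sT : 0 <= s <= T by rewrite s0 (le_trans st).
have tT' : 0 <= t <= T by rewrite (le_trans s0).
have L := sito_L2 h sT; have L's := sito_L2 h' sT; have L't := sito_L2 h' tT'.
have [_ aZ _ _] := h.
apply/eqP; rewrite -subr_eq0 -(IntB measurableT (L2sM measurableT L L't) (L2sM measurableT L L's)); apply/eqP.
rewrite -[RHS](sito_mart h' s0 st tT (aZ s sT) L).
by apply: Int_eq => w _; rewrite mulrBr.
Qed.

Lemma Int_cut t (h : R -> R) : 0 <= t <= T ->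
  \int[lam]_(s in `[0, T]) ((s <= t)%R%:R * h s) = \int[lam]_(s in `[0, t]) h s.
Proof.
move=> /andP[t0 tT]; rewrite !Int_patch; apply: Int_eq => s _.
rewrite !in_itv /=; have [st|st] := boolP (s <= t).
  by rewrite (le_trans st tT) mul1r.
by rewrite mul0r andbF if_same.
Qed.

Lemma sito_iso_det i j (k k' : R -> R) Z Z' t : sito i (fun t _ => k t) Z -> sito j (fun t _ => k' t) Z' -> 0 <= t <= T ->
  \int[P]_w (Z t w * Z' t w) = if i == j then \int[lam]_(s in `[0, t]) (k s * k' s) else 0.
Proof.
move=> h h' tT; rewrite (sito_iso h h' tT); case: ifP => // _.
have [[mk _ Lk] _ _ _] := h; have [[mk' _ Lk'] _ _ _] := h'.
have L : L1 (lam \x P)%E DD (fun p : R * Omega => (p.1 <= t)%R%:R * (k p.1 * k' p.1)).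
  apply: (L1_bddM (mDD T) (c := 1) (meas_le t) _ (L2sM (mDD T) Lk Lk')) => p _.
  by case: (p.1 <= t)%R; rewrite ?normr1 ?normr0.
have -> : \int[(lam \x P)%E]_(p in DD) (((p.1 <= t)%R%:R * k p.1) * ((p.1 <= t)%R%:R * k' p.1)) =
    \int[(lam \x P)%E]_(p in DD) ((p.1 <= t)%R%:R * (k p.1 * k' p.1)).
  by apply: Int_eq => p _; case: (p.1 <= t)%R; rewrite ?mul1r ?mul0r.
have := fubini_slab2 (itv_meas 0 T) (fun s (w : Omega) => (s <= t)%R%:R * (k s * k' s)) L => <-.
rewrite -Int_cut//; apply: Int_eq => s _.
transitivity (\int[P]_w ((s <= t)%R%:R * (k s * k' s) * 1)); first by apply: Int_eq => w _; rewrite mulr1.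
have -> : \int[P]_w ((s <= t)%R%:R * (k s * k' s) * 1) = (s <= t)%R%:R * (k s * k' s) * fine (P setT).
  by rewrite -(Rintegral_cst P measurableT); apply: Int_eq => w _; rewrite mulr1.
rewrite -[RHS]mulr1; congr (_ * _); rewrite -[RHS]/(fine 1%E); congr fine; exact: probability_setT.
Qed.

Lemma within_sum (I : Type) (A : set R) (s : seq I) (f : I -> R -> R) :
  (forall i, {within A, continuous (f i)}) -> {within A, continuous (fun t => \sum_(i <- s) f i t)}.
Proof.
move=> h; elim: s => [|i s IH].
  by rewrite (_ : (fun t => _) = fun=> 0); [exact: cst_continuous|apply/funext => t; rewrite big_nil].
rewrite (_ : (fun t => _) = fun t => f i t + \sum_(i <- s) f i t); last by apply/funext => t; rewrite big_cons.
by move=> t; apply: cvgD; [exact: h|exact: IH].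
Qed.

(** Recovers integrability of deterministic functions from the almost sure integrability of sections
    given by Fubini. *)
Lemma ae_const (Q : Prop) : {ae P, forall w : Omega, Q} -> Q.
Proof.
move=> [A [mA A0 QA]]; apply: contrapT => nQ.
have : (P setT <= P A)%E by apply: le_measure; rewrite ?inE// => w _; exact: QA.
by rewrite probability_setT A0 lee_fin ler10.
Qed.

Lemma SL2_L2s_w (D : Omega -> R) : L2s P setT D -> L2s (lam \x P)%E DD (fun p : R * Omega => D p.2).
Proof.
move=> [mD LD]; have mD' : measurable_fun DD (fun p : R * Omega => D p.2).
  by apply: measurable_funTS; exact: measurableT_comp mD measurable_snd.
split=> //; apply: (tonelli_slab1 (itv_meas 0 T) (fun (_ : R) w => D w ^+ 2)).
  exact: measurable_funX.
rewrite (_ : (\int[_]_(t in _) _)%E = (\int[lam]_(t in `[0%R, T]) (\int[P]_w (D w ^+ 2))%:E)%E).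
  by rewrite (Int_E (itv_meas 0 T) (L1_cst (itv_meas 0 T) _ (lam_itv_lty 0 T))) ltry.
apply: eq_integral => t _; rewrite -(Int_E measurableT LD).
by apply: eq_integral => w _; rewrite ger0_norm ?sqr_ge0.
Qed.

Lemma sito_cov_min j (k k' : R -> R) Z Z' s r : sito j (fun t _ => k t) Z -> sito j (fun t _ => k' t) Z' ->
  0 <= s <= T -> 0 <= r <= T ->
  \int[P]_w (Z s w * Z' r w) = \int[lam]_(x in `[0, Num.min s r]) (k x * k' x).
Proof.
move=> h h' /andP[s0 sT] /andP[r0 rT]; have [sr|/ltW rs] := leP s r.
  by rewrite (sito_cov h h' s0 sr rT) (sito_iso_det h h') ?s0// eqxx.
rewrite (Int_eq P (g := fun w => Z' r w * Z s w)); last by move=> w _; rewrite mulrC.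
rewrite (sito_cov h' h r0 rs sT) (sito_iso_det h' h) ?r0// eqxx.
by apply: Int_eq => x _; rewrite mulrC.
Qed.

(** * Product rule for deterministic functions and stochastic integrals *)

Section ProductRule.
Variables (j : J) (n : nat) (g g' k : 'I_n -> R -> R) (b : R -> R).
Variables (M : 'I_n -> R -> Omega -> R) (Z : R -> Omega -> R) (e : R).
Hypothesis e0T : 0 <= e <= T.
Hypothesis hM : forall l, sito j (fun t _ => k l t) (M l).
Hypothesis sM : forall l, SL2 P F T (M l).
Hypothesis hZ : sito j (fun t _ => b t) Z.
Hypothesis hg : forall l, AC e T (g l) (g' l).
Hypothesis mg' : forall l, measurable_fun setT (g' l).
Hypothesis bg' : forall l, exists C, forall s, 0 <= s <= T -> `|g' l s| <= C.
Hypothesis hb : forall s, e <= s <= T -> b s = \sum_(l < n) g l s * k l s.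

Section FixedTime.
Variable t : R.
Hypothesis etT : e <= t <= T.

Let e0 : 0 <= e. Proof. by case/andP: e0T. Qed.
Let et : e <= t. Proof. by case/andP: etT. Qed.
Let tT : t <= T. Proof. by case/andP: etT. Qed.
Let t0T : 0 <= t <= T. Proof. by rewrite (le_trans e0 et) tT. Qed.

Let c l s : R := (e <= s <= t)%R%:R * g' l s.
Let I l w := \int[lam]_(s in `[0, T]) (c l s * M l s w).
(** Residual of the product rule between e and t. It will turn out to be orthogonal to every
    integral of a deterministic function against W_j at times in [e, t], hence to itself. *)
Let D w := \sum_(l < n) (g l t * M l t w - g l e * M l e w - I l w) - (Z t w - Z e w).

Let SM l : SL2 P F T (fun s w => c l s * M l s w).
Proof.
have [C hC] := bg' l; apply: (SL2_detM (C := C)) => // [|s sT].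
  apply: measurable_funTS; apply: measurable_funM => //.
  rewrite (_ : (fun s => _) = \1_`[e, t]); first by apply: measurable_indic; exact: measurable_itv.
  by apply/funext => s; rewrite indicE mem_setE in_itv.
rewrite normrM; have := hC s sT; case: (_ <= _ <= _); rewrite ?normr1 ?mul1r// normr0 mul0r.
exact: le_trans.
Qed.

Let LI l : L2s P setT (I l).
Proof.
have [V [_ eV LV]] := SL2_int sF mF T0 (SM l).
have TT : 0 <= T <= T by rewrite lexx T0.
apply: (L2s_ae measurableT _ _ (LV T TT)).
  exact (L1_meas measurableT (slab_L1_int1 (itv_meas 0 T) (fun s w => c l s * M l s w) (SL2_L1 (SM l)))).
by apply: ae_imp eV => w h _; rewrite h.
Qed.

Let LM l s : 0 <= s <= T -> L2s P setT (M l s).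
Proof. exact: sito_L2 (hM l). Qed.

Let LZ s : 0 <= s <= T -> L2s P setT (Z s).
Proof. exact: sito_L2 hZ. Qed.

Let LD : L2s P setT D.
Proof.
apply: (L2sB measurableT); last by apply: (L2sB measurableT); exact: LZ.
apply: (L2s_sum measurableT) => l _; apply: (L2sB measurableT) => //.
by apply: (L2sB measurableT); apply: (L2sZ measurableT); exact: LM.
Qed.

Let Int_I (f : Omega -> R) l : L2s P setT f ->
  \int[P]_w (I l w * f w) = \int[lam]_(s in `[e, t]) (g' l s * \int[P]_w (M l s w * f w)).
Proof.
move=> Lf; have [_ _ LSM] := SM l.
have L := L2sM (mDD T) LSM (SL2_L2s_w Lf).
transitivity (\int[P]_w \int[lam]_(s in `[0, T]) (c l s * M l s w * f w)).
  apply: (Int_ae measurableT).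
  - exact (L1_meas measurableT (L2sM measurableT (LI l) Lf)).
  - exact (L1_meas measurableT (slab_L1_int1 (itv_meas 0 T) (fun s w => c l s * M l s w * f w) L)).
  - apply: ae_imp (slab_L1_1 (itv_meas 0 T) (fun s w => c l s * M l s w) (SL2_L1 (SM l))) => w h _.
    by rewrite (IntZr (itv_meas 0 T)).
have := fubini_slab (itv_meas 0 T) (fun s w => c l s * M l s w * f w) L => ->.
rewrite !Int_patch; apply: Int_eq => s _; rewrite !in_itv /=.
case: (boolP (0 <= s <= T)) => sT; last first.
  case: ifP => // /andP[es st]; move: sT.
  by rewrite (le_trans e0 es) (le_trans st tT).
have LMf : L1 P setT (fun w => M l s w * f w) by apply: (L2sM measurableT) => //; exact: LM.
transitivity (\int[P]_w (c l s * (M l s w * f w))); first by apply: Int_eq => w _; rewrite mulrA.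
by rewrite (IntZ measurableT _ LMf) /c; case: (_ <= _ <= _); rewrite ?mul1r// !mul0r.
Qed.

(** Covariances are explicit: E[M_s Z'_r] is the integral of k k' over [0, min(s, r)]. The claim
    becomes integration by parts on [e, r] for g and the primitive [Cl] of k k', while on [r, t] the
    covariance is frozen at Cl(r). *)
Let D_orth (k' : R -> R) Z' r : sito j (fun t _ => k' t) Z' -> e <= r <= t ->
  \int[P]_w (D w * Z' r w) = 0.
Proof.
move=> h' /andP[er rt].
have r0T : 0 <= r <= T by rewrite (le_trans e0 er) (le_trans rt tT).
have LZ' := sito_L2 h' r0T.
have A l : L1 P setT (fun w => (g l t * M l t w - g l e * M l e w - I l w) * Z' r w).
  apply: (L2sM measurableT) => //; apply: (L2sB measurableT) => //.
  by apply: (L2sB measurableT); apply: (L2sZ measurableT); exact: LM.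
have B s : 0 <= s <= T -> L1 P setT (fun w => Z s w * Z' r w).
  by move=> sT; apply: (L2sM measurableT) => //; exact: LZ.
have Bm l s : 0 <= s <= T -> L1 P setT (fun w => M l s w * Z' r w).
  by move=> sT; apply: (L2sM measurableT) => //; exact: LM.
have BI l : L1 P setT (fun w => I l w * Z' r w) by exact: (L2sM measurableT).
rewrite (Int_eq P (g := fun w => \sum_(l < n) (g l t * M l t w - g l e * M l e w - I l w) * Z' r w -
   (Z t w * Z' r w - Z e w * Z' r w))); last first.
  by move=> w _; rewrite /D mulrBl mulr_suml mulrBl.
rewrite (IntB measurableT (L1_sum measurableT _ (fun l _ => A l)) (L1B measurableT (B t t0T) (B e e0T))).
rewrite (IntB measurableT (B t t0T) (B e e0T)) (Int_sum measurableT _ (fun l _ => A l)).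
rewrite (sito_cov_min hZ h')// (sito_cov_min hZ h')// (min_r rt) (min_l er).
have C l : L1 lam `[0, T] (fun x => k l x * k' x).
  have [[_ _ L1k] _ _ _] := hM l; have [[_ _ L1k'] _ _ _] := h'.
  have := slab_L1_1 (itv_meas 0 T) (fun s (_ : Omega) => k l s * k' s) (L2sM (mDD T) L1k L1k').
  by move/ae_const.
pose Cl l x := \int[lam]_(y in `[0, x]) (k l y * k' y).
have ACC l : AC e r (Cl l) (fun x => k l x * k' x).
  have := AC_prim 0 (C l); move/(AC_sub e0 (le_trans rt tT)).
  by apply: AC_eq => // x _; rewrite add0r.
have ACg l : AC e r (g l) (g' l) by apply: AC_sub (hg l) => //; exact: le_trans tT.
have gC l := AC_mul (ACg l) (ACC l).
have Lb l : L1 lam `[e, r] (fun x => g l x * (k l x * k' x)).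
  by apply: (AC_L1M er (ACg l)); apply: L1_sub (C l) => //; exact: le_trans tT.
have E l : \int[P]_w ((g l t * M l t w - g l e * M l e w - I l w) * Z' r w) =
    \int[lam]_(x in `[e, r]) (g l x * (k l x * k' x)).
  have Bt := Bm l t t0T; have Be := Bm l e e0T.
  rewrite (Int_eq P (g := fun w => (g l t * (M l t w * Z' r w) - g l e * (M l e w * Z' r w)) - I l w * Z' r w)); last by move=> w _; ring.
  rewrite (IntB measurableT (L1B measurableT (L1Z measurableT _ Bt) (L1Z measurableT _ Be)) (BI l)).
  rewrite (IntB measurableT (L1Z measurableT _ Bt) (L1Z measurableT _ Be)) (IntZ measurableT _ Bt) (IntZ measurableT _ Be).
  rewrite (sito_cov_min (hM l) h')// (sito_cov_min (hM l) h')// (min_r rt) (min_l er) Int_I//.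
  rewrite (_ : \int[lam]_(s in `[e, t]) (g' l s * \int[P]_w (M l s w * Z' r w)) =
     \int[lam]_(s in `[e, t]) (g' l s * Cl l (Num.min s r))); last first.
    apply: Int_eq => s; rewrite /= in_itv /= => /andP[es st].
    by rewrite (sito_cov_min (hM l) h')// (le_trans e0 es) (le_trans st tT).
  have [K0 hK0] := bg' l.
  have ACT : AC 0 T (Cl l) (fun x => k l x * k' x).
    by have := AC_prim 0 (C l); apply: AC_eq => // x _; rewrite add0r.
  have [K1 hK1] := AC_bdd ACT.
  have Lg' a' b' : 0 <= a' -> b' <= T -> L1 lam `[a', b'] (g' l).
    move=> a0 b0; apply: (L1_le (itv_meas a' b') _ _ (L1_cst (itv_meas a' b') K0 (lam_itv_lty _ _))).
      by apply: measurable_funTS; exact: mg'.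
    move=> x; rewrite /= in_itv /= => /andP[ax xb]; apply: hK0.
    by rewrite (le_trans a0 ax) (le_trans xb b0).
  have Lm : L1 lam `[e, t] (fun s => g' l s * Cl l (Num.min s r)).
    have mC : measurable_fun `[e, t] (fun s => Cl l (Num.min s r)).
      have mC0 : measurable_fun `[0, T] (Cl l) := AC_meas T0 ACT.
      apply: (measurable_comp (F := `[0, T]) (itv_meas 0 T) _ mC0).
        move=> _ [s /= + <-]; rewrite !in_itv /= => /andP[es st].
        by rewrite le_min (le_trans e0 es) (le_trans e0 er) ge_min (le_trans st tT).
      by apply: measurable_funTS; apply: measurable_minr.
    apply: (L1_eq (itv_meas e t) _ (L1_bddM (itv_meas e t) (c := K1) mC _ (Lg' e t e0 tT))).
      by move=> s _; rewrite mulrC.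
    move=> s; rewrite /= in_itv /= => /andP[es st]; apply: hK1.
    by rewrite in_itv /= le_min (le_trans e0 es) (le_trans e0 er) ge_min (le_trans st tT).
  rewrite (Int_add er rt Lm).
  rewrite (_ : \int[lam]_(s in `[r, t]) (g' l s * Cl l (Num.min s r)) = (g l t - g l r) * Cl l r); last first.
    rewrite (AC_int (hg l) er rt tT) addrC addKr -(IntZr (itv_meas r t)); last exact: Lg' (le_trans e0 er) tT.
    by apply: Int_eq => s; rewrite /= in_itv /= => /andP[rs _]; rewrite min_r.
  rewrite (_ : \int[lam]_(s in `[e, r]) (g' l s * Cl l (Num.min s r)) = \int[lam]_(s in `[e, r]) (g' l s * Cl l s)); last first.
    by apply: Int_eq => s; rewrite /= in_itv /= => /andP[_ sr]; rewrite min_l.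
  have := (gC l).2 r; rewrite er lexx => /(_ isT) gCr.
  have Lgc : L1 lam `[e, r] (fun s => g' l s * Cl l s).
    by have := AC_L1M er (ACC l) (Lg' e r e0 (le_trans rt tT)); apply: (L1_eq (itv_meas e r)) => s _; rewrite mulrC.
  rewrite (IntD (itv_meas e r) Lgc (Lb l)) in gCr.
  rewrite -/(Cl l r) -/(Cl l e).
  move: gCr; set X1 := \int[lam]_(x in `[e, r]) _; set X2 := \int[lam]_(x in `[e, r]) _ => gCr.
  by rewrite -[X2](addKr X1) -[X1 + X2](addKr (g l e * Cl l e)) addrA -gCr; ring.
rewrite (eq_bigr _ (fun l _ => E l)) -(Int_sum (itv_meas e r)); last by move=> l _; exact: Lb.
have Lbk : L1 lam `[0, T] (fun x => b x * k' x).
  have [[_ _ L1k] _ _ _] := hZ; have [[_ _ L1k'] _ _ _] := h'.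
  have := slab_L1_1 (itv_meas 0 T) (fun s (_ : Omega) => b s * k' s) (L2sM (mDD T) L1k L1k').
  by move/ae_const.
have rT := le_trans rt tT.
rewrite (Int_add e0 er (L1_sub (lexx 0) rT Lbk)); set A0 := \int[lam]_(x in `[0, e]) _.
rewrite (addrC A0) addrK.
apply/eqP; rewrite subr_eq0; apply/eqP/Int_eq => x; rewrite /= in_itv /= => /andP[ex xr].
by rewrite hb ?ex ?(le_trans xr)// mulr_suml; apply: eq_bigr => l _; rewrite mulrA.
Qed.

(** D is assembled from values of M_l and Z at times in [e, t], all of them orthogonal to D, so
    E[D^2] = 0. *)
Lemma product_rule_at : {ae P, forall w, D w = 0}.
Proof.
suff I0 : \int[P]_w (D w ^+ 2) = 0.
  have := Int_ge0_ae0 measurableT LD.2 (fun w _ => sqr_ge0 _).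
  by rewrite I0 => /(_ (lexx _)); apply: ae_imp => w /(_ Logic.I) /eqP; rewrite sqrf_eq0 => /eqP.
have LMD l s : 0 <= s <= T -> L1 P setT (fun w => M l s w * D w).
  by move=> sT; apply: (L2sM measurableT) => //; exact: LM.
have LZD s : 0 <= s <= T -> L1 P setT (fun w => Z s w * D w).
  by move=> sT; apply: (L2sM measurableT) => //; exact: LZ.
have LID l : L1 P setT (fun w => I l w * D w) by exact: (L2sM measurableT).
have M0 l s : e <= s <= t -> \int[P]_w (M l s w * D w) = 0.
  by move=> es; rewrite -[RHS](D_orth (hM l) es); apply: Int_eq => w _; rewrite mulrC.
have Z0 s : e <= s <= t -> \int[P]_w (Z s w * D w) = 0.
  by move=> es; rewrite -[RHS](D_orth hZ es); apply: Int_eq => w _; rewrite mulrC.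
have tt : e <= t <= t by rewrite et lexx.
have ee : e <= e <= t by rewrite et lexx.
have LA l : L1 P setT (fun w => (g l t * (M l t w * D w) - g l e * (M l e w * D w)) - I l w * D w).
  by apply: (L1B measurableT) => //; apply: (L1B measurableT); apply: (L1Z measurableT); exact: LMD.
rewrite (Int_eq P (g := fun w => \sum_(l < n) ((g l t * (M l t w * D w) - g l e * (M l e w * D w)) - I l w * D w) -
   (Z t w * D w - Z e w * D w))); last first.
  move=> w _; rewrite expr2 {1}/D mulrBl mulr_suml mulrBl; congr (_ - _).
  by apply: eq_bigr => l _; ring.
rewrite (IntB measurableT (L1_sum measurableT _ (fun l _ => LA l)) (L1B measurableT (LZD t t0T) (LZD e e0T))).
rewrite (IntB measurableT (LZD t t0T) (LZD e e0T)) !Z0// (Int_sum measurableT _ (fun l _ => LA l)) !subr0.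
apply: big1 => l _.
have Bt := LMD l t t0T; have Be := LMD l e e0T.
rewrite (IntB measurableT (L1B measurableT (L1Z measurableT _ Bt) (L1Z measurableT _ Be)) (LID l)).
rewrite (IntB measurableT (L1Z measurableT _ Bt) (L1Z measurableT _ Be)) (IntZ measurableT _ Bt) (IntZ measurableT _ Be).
rewrite !M0// !mulr0 subr0 sub0r Int_I// (Int_eq _ (g := fun=> 0)) ?Int_0 ?oppr0// => s.
by rewrite /= in_itv /= => es; rewrite M0 ?mulr0.
Qed.

Lemma product_rule_int w l : I l w = \int[lam]_(s in `[e, t]) (g' l s * M l s w).
Proof.
rewrite /I !Int_patch; apply: Int_eq => s _; rewrite !in_itv /= /c.
case: (boolP (e <= s <= t)) => h.
  by case/andP: h => es st; rewrite (le_trans e0 es) (le_trans st tT) mul1r.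
by rewrite !mul0r if_same.
Qed.

End FixedTime.

(** Freezing a path before e extends continuity from [e, T] to [0, T], the interval on which
    [ae_grid] operates. *)
Lemma within_max_comp (f : R -> R) : {within `[e, T], continuous f} ->
  {within `[0, T], continuous (fun t => f (Num.max e t))}.
Proof.
move=> /subspace_continuousP cf; apply/subspace_continuousP => x x0T.
have /andP[e0 eT] := e0T; move: x0T; rewrite /= in_itv /= => /andP[x0 xT].
have hx : `[e, T]%classic (Num.max e x) by rewrite /= in_itv /= le_max lexx ge_max eT.
apply: (cvg_comp (fun t => Num.max e t) f _ (cf _ hx)).
move=> S; rewrite /within /= => hS.
have cm : (fun t : R => Num.max e t) @ x --> Num.max e x.
  by apply: continuous_max; [exact: cvg_cst|exact: cvg_id].
rewrite /nbhs /= /within /=; near=> t => /andP[t0 tT].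
have ht : `[e, T]%classic (Num.max e t) -> S (Num.max e t) by near: t; exact: cm _ hS.
by apply: ht; rewrite /= in_itv /= le_max lexx ge_max eT.
Unshelve. all: by end_near. Qed.

Lemma product_rule : {ae P, forall w, forall t, e <= t <= T ->
  \sum_(l < n) (g l t * M l t w - g l e * M l e w) =
  \int[lam]_(s in `[e, t]) (\sum_(l < n) g' l s * M l s w) + (Z t w - Z e w)}.
Proof.
have /andP[e0 eT] := e0T.
pose h t := Num.max e t.
pose X t w := \sum_(l < n) (g l (h t) * M l (h t) w - g l e * M l e w).
pose Y t w := \int[lam]_(s in `[e, h t]) (\sum_(l < n) g' l s * M l s w) + (Z (h t) w - Z e w).
have cM : {ae P, forall w, forall l, {within `[0, T], continuous (M l ^~ w)}}.
  by apply: ae_fin => l; have [_ _ + _] := hM l.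
have sub : `[e, T] `<=` `[0, T] by apply: subset_itvScc; rewrite bnd_simp.
have L1Ml : {ae P, forall w, forall l, L1 lam `[e, T] (fun s => g' l s * M l s w)}.
  apply: ae_imp cM => w cw l.
  have [C hC] := bg' l; apply: (L1_bddM (itv_meas e T) (c := C)).
  - by apply: measurable_funTS; exact: mg'.
  - move=> s; rewrite /= in_itv /= => /andP[es sT]; apply: hC.
    by rewrite (le_trans e0 es).
  - by apply: cont_L1; apply: continuous_subspaceW (cw l).
have L1M : {ae P, forall w, L1 lam `[e, T] (fun s => \sum_(l < n) g' l s * M l s w)}.
  by apply: ae_imp L1Ml => w Lw; apply: (L1_sum (itv_meas e T)) => l _.
have cX : acont P T X.
  apply: ae_imp cM => w cw.
  apply: (@within_max_comp (fun t => \sum_(l < n) (g l t * M l t w - g l e * M l e w))).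
  apply: within_sum => l t; apply: cvgB; last exact: cvg_cst.
  apply: cvgM; first exact: AC_cont eT (hg l) t.
  by apply: (continuous_subspaceW sub) (cw l) t.
have cY : acont P T Y.
  have [_ _ cZ _] := hZ; apply: ae_imp2 L1M cZ => w Lw cw.
  apply: (@within_max_comp (fun t => \int[lam]_(s in `[e, t]) (\sum_(l < n) g' l s * M l s w) + (Z t w - Z e w))).
  move=> t; apply: cvgD; first exact: parameterized_integral_continuous eT Lw t.
  by apply: cvgB; [apply: (continuous_subspaceW sub) cw t|exact: cvg_cst].
have := ae_grid cX cY; move=> H; have {}H := H _.
have E t : 0 <= t <= T -> {ae P, forall w, X t w = Y t w}.
  move=> /andP[t0 tT]; have ht : e <= h t <= T by rewrite le_max lexx ge_max eT.
  have := product_rule_at ht; apply: ae_imp2 L1Ml => w Lw /eqP; rewrite subr_eq0 sumrB subr_eq => /eqP e'.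
  rewrite /X e' /Y addrC; congr (_ + _).
  rewrite (Int_sum (itv_meas e (h t))); last first.
    by move=> l _; apply: L1_sub (Lw l) => //; case/andP: ht.
  by apply: eq_bigr => l _; rewrite product_rule_int.
apply: ae_imp (H E) => w hw t /andP[et tT]; have := hw t.
by rewrite /X /Y /h (max_r et) (le_trans e0 et) tT; exact.
Qed.

End ProductRule.

(** * From vector-valued to scalar stochastic integrals *)

Lemma sqnormE (q : nat) (z : 'cV[R]_q) : sqnorm z = \sum_(l < q) z l 0 ^+ 2.
Proof. by rewrite /sqnorm mxE; apply: eq_bigr => l _; rewrite mxE expr2. Qed.

Lemma sqnorm_ge0 (q : nat) (z : 'cV[R]_q) : 0 <= sqnorm z.
Proof. by rewrite sqnormE; apply: sumr_ge0 => l _; exact: sqr_ge0. Qed.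

Lemma sqr_le_sqnorm (q : nat) (z : 'cV[R]_q) l : z l 0 ^+ 2 <= sqnorm z.
Proof. by rewrite sqnormE (bigD1 l)//= lerDl; apply: sumr_ge0 => i _; exact: sqr_ge0. Qed.

Lemma measurable_sqnorm d' (X : measurableType d') (D : set X) (q : nat) (z : X -> 'cV[R]_q) :
  (forall l, measurable_fun D (fun x => z x l 0)) -> measurable_fun D (fun x => sqnorm (z x)).
Proof.
move=> h; rewrite (_ : (fun x => _) = fun x => \sum_(l < q) z x l 0 ^+ 2).
  by apply: measurable_sum => l; exact: measurable_funX.
by apply/funext => x; rewrite sqnormE.
Qed.

Lemma sqnormL2E (q : nat) (z : R -> Omega -> 'cV[R]_q) :
  (forall l, measurable_fun DD (fun p : R * Omega => z p.1 p.2 l 0)) ->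
  sqnormL2 P T z = (\int[(lam \x P)%E]_(p in DD) (sqnorm (z p.1 p.2))%:E)%E.
Proof.
move=> mz; apply: (tonelli_slabE (itv_meas 0 T) (fun t w => sqnorm (z t w))).
  exact: (measurable_sqnorm (z := fun p : R * Omega => z p.1 p.2)).
by move=> t w _; exact: sqnorm_ge0.
Qed.

Lemma L2F_SL2 (q : nat) (z : R -> Omega -> 'cV[R]_q) :
  L2F P F T z <-> forall l, SL2 P F T (fun t w => z t w l 0).
Proof.
split=> [[mz az fz] l|h].
  split=> //.
  - by move=> t tT; apply/gmeasP; [exact: (sF t).1|exact: az].
  - have m2 : measurable_fun DD (fun p : R * Omega => z p.1 p.2 l 0 ^+ 2) by apply: measurable_funX; exact: mz.
    split; first exact: mz.
    apply/integrableP; split; first by apply/measurable_EFinP; exact m2.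
    apply: le_lt_trans fz; rewrite sqnormL2E//; apply: ge0_le_integral => //.
    + exact: (mDD T).
    + by apply/measurable_EFinP; apply: measurableT_comp => //; exact: measurable_funX.
    + by apply/measurable_EFinP; exact: (measurable_sqnorm (z := fun p : R * Omega => z p.1 p.2)).
    + by move=> p _; rewrite /= lee_fin ger0_norm ?sqr_ge0// sqr_le_sqnorm.
have mz l : measurable_fun DD (fun p : R * Omega => z p.1 p.2 l 0) by have [] := h l.
split=> //.
  by move=> t tT l B mB; have [_ az _] := h l; apply: (gmeasP _ (sF t).1).1 => //; exact: az.
rewrite sqnormL2E//.
have L : L1 (lam \x P)%E DD (fun p : R * Omega => \sum_(l < q) z p.1 p.2 l 0 ^+ 2).
  by apply: (L1_sum (mDD T)) => l _; have [_ _ []] := h l.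
rewrite (_ : (\int[_]_(p in _) _)%E = (\int[(lam \x P)%E]_(p in DD) (\sum_(l < q) z p.1 p.2 l 0 ^+ 2)%:E)%E).
  by rewrite (Int_E (mDD T) L) ltry.
by apply: eq_integral => p _; rewrite sqnormE.
Qed.

(** Square integrability of the limit is part of the conclusion: some v n is finite, and f is f_ n
    minus a square-integrable difference. *)
Lemma L2lim_intro d' (X : measurableType d') (mu : {measure set X -> \bar R}) (D : set X)
  (f_ : nat -> X -> R) (f : X -> R) (v : nat -> \bar R) : measurable D ->
  (forall n, L2s mu D (f_ n)) -> measurable_fun D f ->
  (forall n, (\int[mu]_(x in D) ((f_ n x - f x) ^+ 2)%:E <= v n)%E) ->
  v @ \oo --> 0%E -> L2lim mu D f_ f.
Proof.
move=> mD hn mf le v0.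
have mfn n : measurable_fun D (fun x => f_ n x - f x) by apply: measurable_funB => //; have [] := hn n.
have fin n : (v n < +oo)%E -> L2s mu D (fun x => f_ n x - f x).
  move=> vn; split=> //; apply/integrableP; split; first by apply/measurable_EFinP; exact: measurable_funX.
  apply: le_lt_trans vn; apply: le_trans (le n).
  rewrite le_eqVlt; apply/orP; left; apply/eqP; apply: eq_integral => x _ /=.
  by rewrite ger0_norm ?sqr_ge0.
have v0' : \forall n \near \oo, (v n < +oo)%E.
  by have /fine_cvgP[+ _] := v0; apply: filterS => n; rewrite fin_numE -ltey => /andP[].
have Lf : L2s mu D f.
  case: v0' => m _ /(_ m (leqnn m)) /= /fin h.
  apply: (L2s_eq mD _ (L2sB mD (hn m) h)) => x _; ring.
split=> //; apply: (@squeeze_cvgr _ _ _ _ (fun=> 0) (fine \o v)); last 2 first.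
- exact: cvg_cst.
- by have /fine_cvgP[] := v0.
near=> n; apply/andP; split; first by apply: Int_ge0 => x _; exact: sqr_ge0.
have vn : (v n < +oo)%E by near: n.
have E := Int_E mD (L2sB mD (hn n) Lf).2.
rewrite -lee_fin -E fineK//.
rewrite ge0_fin_numE//; apply: le_trans (le n); apply: integral_ge0 => x _.
by rewrite lee_fin sqr_ge0.
Unshelve. all: by end_near. Qed.

Definition atoms (q : nat) (S : @simple_process _ Omega R q) l : seq atom :=
  [seq ((sp_t S i, sp_t S i.+1), (fun w => sp_x S i w l 0)) | i <- iota 0 (sp_m S)].

Lemma wfl_atoms (q : nat) (S : @simple_process _ Omega R q) l : simple_wf F T S -> wfl (atoms S l).
Proof.
move=> h; have : forall i, i \in iota 0 (sp_m S) -> (i < sp_m S)%N by move=> i; rewrite mem_iota.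
rewrite /atoms; elim: (iota _ _) => //= i s IH hs; split; last by apply: IH => i' h'; apply: hs; rewrite inE h' orbT.
have [|t0 tt tT mx [C hC]] := h i; first by apply: hs; rewrite mem_head.
split=> //=; first by apply/gmeasP; [exact: (sF _).1|exact: mx].
(* By |y| <= y^2 + 1 the bound on the squared norm bounds each component. *)
exists (C + 1) => w; have := le_trans (sqr_le_sqnorm (sp_x S i w) l) (hC w).
rewrite -real_normK ?num_real//; have := normr_ge0 (sp_x S i w l 0); nra.
Qed.

Lemma sval_atoms (q : nat) (S : @simple_process _ Omega R q) l t w : sval (atoms S l) t w = simple_val S t w l 0.
Proof.
rewrite /sval big_map /simple_val summxE -{1}(subn0 (sp_m S)) -/(index_iota 0 (sp_m S)) big_mkord [RHS]big_mkcond /=.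
by apply: eq_bigr => i _; rewrite /aval /=; case: ifP; rewrite ?mul1r ?mul0r.
Qed.

Lemma sint_atoms (q : nat) (S : @simple_process _ Omega R q) j l t w : simple_wf F T S ->
  sint j (map (clip t) (atoms S l)) w = simple_int (W j) S t w l 0.
Proof.
move=> h; rewrite sint_clip big_map /simple_int summxE -{1}(subn0 (sp_m S)) -/(index_iota 0 (sp_m S)) big_mkord /=.
apply: eq_bigr => i _; rewrite !mxE; have [_ tt _ _ _] := h i (ltn_ord i).
by case: (leP (sp_t S i) t) => h' //; rewrite (min_r (ltW (lt_le_trans h' tt))) subrr !mul0r.
Qed.

Lemma is_ito_sito j (q : nat) (b Z : R -> Omega -> 'cV[R]_q) l : is_ito_integral F T (W j) b Z ->
  sito j (fun t w => b t w l 0) (fun t w => Z t w l 0).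
Proof.
move=> [/L2F_SL2 hb aZ cZ [S [wS cb cI]]].
have wL m := wfl_atoms l (wS m).
have gZ l' t : 0 <= t <= T -> gmeas (F t) (fun w => Z t w l' 0).
  by move=> tT; apply/gmeasP; [exact: (sF t).1|exact: aZ].
split=> //; first exact: gZ.
  apply: ae_imp cZ => w cw t.
  apply: (@cvg_comp _ _ _ (fun t => Z t w) (fun z : 'cV[R]_q => z l 0) _ _ _ (cw t)).
  exact: coord_continuous.
exists (fun m => atoms (S m) l); split=> //.
- apply: (L2lim_intro (mDD T) _ _ _ cb) => m.
  + exact: sval_L2.
  + by have [mb _ _] := hb l; exact: mb.
  + have mS l' : measurable_fun DD (fun p : R * Omega => (b p.1 p.2 - simple_val (S m) p.1 p.2) l' 0).
      rewrite (_ : (fun p => _) = fun p : R * Omega => b p.1 p.2 l' 0 - sval (atoms (S m) l') p.1 p.2).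
        by apply: measurable_funB; [have [] := hb l'|have [] := sval_L2 (wfl_atoms l' (wS m))].
      by apply/funext => p; rewrite sval_atoms !mxE.
    rewrite (sqnormL2E (z := fun t w => b t w - simple_val (S m) t w))//; apply: ge0_le_integral => //.
    * exact: (mDD T).
    * by move=> p _; rewrite lee_fin sqr_ge0.
    * apply/measurable_EFinP; apply: measurable_funX; apply: measurable_funB.
        by have [] := sval_L2 (wL m).
      by have [] := hb l.
    * by apply/measurable_EFinP; exact: (measurable_sqnorm (z := fun p : R * Omega => b p.1 p.2 - simple_val (S m) p.1 p.2)).
    * move=> p _; rewrite lee_fin; apply: le_trans (sqr_le_sqnorm _ l).
      by rewrite sval_atoms !mxE -sqrrN opprB.
- move=> t tT; have t0 : 0 <= t by case/andP: tT.
  have mZ l' : measurable_fun setT (fun w => Z t w l' 0) := gmeas_meas (sF t) (gZ l' t tT).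
  apply: (L2lim_intro measurableT _ (mZ l) _ (cI t tT)) => m.
  + by apply: sint_L2; exact: wfl_clip.
  + have mS l' : measurable_fun setT (fun w => (Z t w - simple_int (W j) (S m) t w) l' 0).
      rewrite (_ : (fun w => _) = fun w => Z t w l' 0 - sint j (map (clip t) (atoms (S m) l')) w).
        by apply: measurable_funB => //; have [] := sint_L2 j (wfl_clip t0 (wfl_atoms l' (wS m))).
      by apply/funext => w; rewrite sint_atoms// !mxE.
    apply: ge0_le_integral => //.
    * by move=> w _; rewrite lee_fin sqr_ge0.
    * apply/measurable_EFinP; apply: measurable_funX; apply: measurable_funB => //.
      by have [] := sint_L2 j (wfl_clip t0 (wL m)).
    * by apply/measurable_EFinP; exact: measurable_sqnorm.
    * move=> w _; rewrite lee_fin; apply: le_trans (sqr_le_sqnorm _ l).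
      by rewrite sint_atoms// !mxE -sqrrN opprB.
Qed.

(** * Continuous versions *)

Section Doob.
Hypothesis Tgt0 : 0 < T.
Implicit Types X : R -> Omega -> R.

(** Continuous square-integrable martingales; the [orth] clause is the martingale property. *)
Definition mart X := [/\ (forall t, 0 <= t <= T -> gmeas (F t) (X t)),
  (forall t, 0 <= t <= T -> L2s P setT (X t)),
  (forall s t, 0 <= s -> s <= t -> t <= T -> orth P (F s) (fun w => X t w - X s w)) & acont P T X].

Lemma martB X Y : mart X -> mart Y -> mart (fun t w => X t w - Y t w).
Proof.
move=> [aX LX oX cX] [aY LY oY cY]; split.
- by move=> t tT; apply: gmeasB; [exact: aX|exact: aY].
- by move=> t tT; apply: (L2sB measurableT); [exact: LX|exact: LY].
- move=> s t s0 st tT A hA; have mA := (sF s).2 _ hA.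
  have sT : 0 <= s <= T by rewrite s0 (le_trans st).
  have tT' : 0 <= t <= T by rewrite (le_trans s0).
  have L1X r : 0 <= r <= T -> L1 P A (X r).
    by move=> h; apply: L1_setT => //; exact (L2s_L1P (LX r h)).
  have L1Y r : 0 <= r <= T -> L1 P A (Y r).
    by move=> h; apply: L1_setT => //; exact (L2s_L1P (LY r h)).
  rewrite (Int_eq P (g := fun w => (X t w - X s w) - (Y t w - Y s w))); last by move=> w _; ring.
  rewrite (IntB mA (L1B mA (L1X t tT') (L1X s sT)) (L1B mA (L1Y t tT') (L1Y s sT))).
  by rewrite oX// oY// subrr.
- by apply: ae_imp2 cX cY => w h h' t; apply: cvgB; [exact: h|exact: h'].
Qed.

(** X_t^2 - X_s^2 = 2 X_s (X_t - X_s) + (X_t - X_s)^2, and the first term integrates to 0 over A. *)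
Lemma submart X s t A : mart X -> 0 <= s -> s <= t -> t <= T -> F s A ->
  \int[P]_(w in A) (X s w ^+ 2) <= \int[P]_(w in A) (X t w ^+ 2).
Proof.
move=> [aX LX oX cX] s0 st tT hA; have mA := (sF s).2 _ hA.
have sT : 0 <= s <= T by rewrite s0 (le_trans st).
have tT' : 0 <= t <= T by rewrite (le_trans s0).
have Ls := LX s sT; have Lt := LX t tT'; have Ld := L2sB measurableT Lt Ls.
have gA : gmeas (F s) (\1_A : Omega -> R) by apply: gmeas_ind => //; exact: (sF s).1.
have bA : bdd (\1_A : Omega -> R).
  by exists 1 => w; exact: ind_le1.
have LAs := bdd_L2sM bA (measurable_indic mA) Ls.
have I0 : \int[P]_w ((\1_A w * X s w) * (X t w - X s w)) = 0.
  apply: (orth_ext (sF s) (L2s_L1P Ld)) => //.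
  - exact: oX.
  - by apply: gmeasM => //; exact: aX.
  - exact: (L2sM measurableT).
rewrite -(Int_ind P _ mA) -(Int_ind P _ mA) -subr_ge0.
have La := L1_ind mA Ls.2; have Lb := L1_ind mA Lt.2; have Lc := L1_ind mA Ld.2.
rewrite -(IntB measurableT Lb La).
have -> : \int[P]_w (\1_A w * X t w ^+ 2 - \1_A w * X s w ^+ 2) =
   2 * (\int[P]_w ((\1_A w * X s w) * (X t w - X s w))) + \int[P]_w (\1_A w * (X t w - X s w) ^+ 2).
  have L := L2sM measurableT LAs Ld.
  rewrite -(IntZ measurableT _ L) -(IntD measurableT (L1Z measurableT _ L) Lc).
  by apply: Int_eq => w _; ring.
rewrite I0 mulr0 add0r; apply: Int_ge0 => w _.
by rewrite mulr_ge0 ?sqr_ge0// indicE ler0n.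
Qed.

(** Induction on the number of grid times. The event that the level is first exceeded at tau m
    belongs to F (tau m); there Chebyshev's bound holds at time tau m and [submart] carries it to
    T. *)
Lemma doob_grid X (tau : nat -> R) (c : R) m : mart X -> 0 < c ->
  (forall i, 0 <= tau i <= T) -> (forall i, tau i <= tau i.+1) ->
  let B := \big[setU/set0]_(i < m) [set w | c < `|X (tau i) w|] in
  measurable B /\ c ^+ 2 * fine (P B) <= \int[P]_(w in B) (X T w ^+ 2).
Proof.
move=> hX c0 t0 tt; have [aX LX oX cX] := hX.
have TT : 0 <= T <= T by rewrite lexx T0.
pose G i := [set w | c < `|X (tau i) w|].
have mon i i' : (i <= i')%N -> tau i <= tau i' by move: i i'; apply: (homo_leq le_refl le_trans).
have GF i i' : (i <= i')%N -> F (tau i') (G i).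
  move=> ii; apply: (mF (mon _ _ ii)); apply: gmeas_gt; first exact: (sF _).1.
  by apply: measurableT_comp => //; exact: aX.
have BF m' i' : (forall i, (i < m')%N -> (i <= i')%N) -> F (tau i') (\big[setU/set0]_(i < m') G i).
  move=> h; apply/(gmeas_set _ (sF _).1); apply: bigsetU_measurable => i _.
  by apply/(gmeas_set _ (sF _).1); apply: GF; exact: h.
have mG i : measurable (G i) := (sF _).2 _ (GF i i (leqnn i)).
have mB m' : measurable (\big[setU/set0]_(i < m') G i) by apply: bigsetU_measurable => i _.
have LT := (LX T TT).2.
move=> B; split; first exact: mB.
rewrite /B -/(G _); elim: m {B} => [|m IH].
  by rewrite big_ord0 measure0 mulr0 Rintegral_set0.
rewrite big_ord_recr /=; set Bm := \big[setU/set0]_(i < m) _; rewrite -/(G m).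
have mBm : measurable Bm by exact: mB.
have mD : measurable (G m `\` Bm) by exact: measurableD.
have FD : F (tau m) (G m `\` Bm).
  apply/(gmeas_set _ (sF _).1); apply: measurableD; apply/(gmeas_set _ (sF _).1); first exact: GF.
  by apply: BF => i /ltnW.
have dis : Bm `&` (G m `\` Bm) = set0 by apply/seteqP; split=> w //= [h [_ /(_ h)]].
have -> : Bm `|` G m = Bm `|` (G m `\` Bm).
  apply/seteqP; split=> w [h|h]; [by left| |by left|by right; case: h].
  by have [b|b] := pselect (Bm w); [left|right].
rewrite measureU// fineD ?fin_num_measure// mulrDr.
rewrite Rintegral_setU//; last 2 first.
- by apply: L1_setT LT; exact: measurableU.
- by apply/disj_set2P.
apply: lerD => //; have /andP[tm0 tmT] := t0 m.
apply: le_trans (submart hX tm0 tmT (lexx T) FD).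
rewrite -(Rintegral_cst P mD).
apply: (Int_le mD).
- exact: L1_cst mD _ (le_lt_trans (le_measure P (mem_set mD) (mem_set measurableT) (@subsetT _ _)) (P_lty P)).
- by apply: L1_setT => //; exact: (LX _ (t0 m)).2.
- move=> w [/= cw _]; rewrite -[X in _ <= X]real_normK ?num_real//.
  by rewrite ler_sqr ?nnegrE// ltW.
Qed.

(** Dyadic grids are nested, so the exceedance events increase to their union and the grid bound
    passes to the limit. Outside the union, continuity extends the bound from dyadic times to all
    times. *)
Lemma doob X (c : R) : mart X -> 0 < c -> exists A, [/\ measurable A,
  fine (P A) <= (\int[P]_w (X T w ^+ 2)) / c ^+ 2 &
  {ae P, forall w, ~ A w -> forall t, 0 <= t <= T -> `|X t w| <= c}].
Proof.
move=> hX c0; have [aX LX oX cX] := hX.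
have TT : 0 <= T <= T by rewrite lexx T0.
pose tau p i : R := Num.min (i%:R * T / (2 ^ p)%:R) T.
have p2 p : 0 < (2 ^ p)%:R :> R by rewrite ltr0n expn_gt0.
have t0 p i : 0 <= tau p i <= T.
  by rewrite /tau le_min ge_min lexx orbT T0 !andbT divr_ge0 ?mulr_ge0.
have tt p i : tau p i <= tau p i.+1.
  have h : i%:R * T / (2 ^ p)%:R <= i.+1%:R * T / (2 ^ p)%:R.
    by rewrite ler_pM2r ?invr_gt0// ler_pM2r// ler_nat.
  by rewrite /tau le_min !ge_min h lexx orbT.
pose B p := \big[setU/set0]_(i < (2 ^ p).+1) [set w | c < `|X (tau p i) w|].
have hB p := doob_grid (2 ^ p).+1 hX c0 (t0 p) (tt p).
have mB p : measurable (B p) := (hB p).1.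
have mU : measurable (\bigcup_p B p) by exact: bigcupT_measurable.
have LT := (LX T TT).2.
have BE p w : B p w <-> exists2 i, (i <= 2 ^ p)%N & c < `|X (tau p i) w|.
  rewrite /B -(bigcup_mkord _ (fun i => [set w | c < `|X (tau p i) w|])); split=> [[i /= ip h]|[i ip h]]; exists i => //.
have Bmon p : B p `<=` B p.+1.
  move=> w /BE[i ip h]; apply/BE; exists (2 * i)%N.
    by rewrite expnS leq_mul2l.
  rewrite (_ : tau p.+1 (2 * i)%N = tau p i)//; congr Num.min.
  by rewrite expnS !natrM; field; rewrite pnatr_eq0 expn_eq0.
exists (\bigcup_p B p); split => //.
  have cv : (fun p => fine (P (B p))) @ \oo --> fine (P (\bigcup_p B p)).
    apply: fine_cvg; rewrite fineK ?fin_num_measure//; apply: nondecreasing_cvg_mu => //.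
    by apply/nondecreasing_seqP => p; apply/subsetPset; exact: Bmon.
  apply: (cvgr_to_le cv); apply: nearW => p.
  rewrite ler_pdivlMr ?exprn_gt0// mulrC; apply: le_trans (hB p).2 _.
  rewrite -(Int_ind P _ (mB p)); apply: (Int_le measurableT) => //; first exact: L1_ind.
  by move=> w _; rewrite ler_piMl ?sqr_ge0// indicE; case: (_ \in _).
apply: ae_imp cX => w cw nA t /andP[t0' tT].
have H p i : (i <= 2 ^ p)%N -> `|X (tau p i) w| <= c.
  move=> ip; rewrite leNgt; apply/negP => h; apply: nA; exists p => //.
  by apply/BE; exists i.
pose i p := Num.trunc ((2 ^ p)%:R * t / T).
have hi p : (i p)%:R <= (2 ^ p)%:R * t / T < (i p).+1%:R.
  by apply: truncn_itv; rewrite divr_ge0 ?mulr_ge0.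
have ip p : (i p <= 2 ^ p)%N.
  rewrite -(ler_nat R); have /andP[h _] := hi p; apply: le_trans h _.
  by rewrite ler_pdivrMr// ler_pM2l.
have ct : (fun p => tau p (i p)) @ \oo --> t.
  have bd p : t - T * (2 ^ p)%:R^-1 <= tau p (i p) <= t.
    have /andP[h1 h2] := hi p; rewrite /tau le_min ge_min; apply/andP; split; last first.
      by apply/orP; left; rewrite ler_pdivrMr// [t * _]mulrC -ler_pdivlMr.
    apply/andP; split; last first.
      by rewrite lerBlDr (le_trans tT)// lerDl mulr_ge0 ?invr_ge0 ?ltW.
    rewrite ltr_pdivrMr// in h2.
    rewrite lerBlDr -mulrDl ler_pdivlMr// -{2}[T]mul1r -mulrDl natr1 [t * _]mulrC.
    exact: ltW.
  apply: (@squeeze_cvgr _ _ _ _ (fun p => t - T * (2 ^ p)%:R^-1) (cst t)).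
  - by apply: nearW => p; exact: bd.
  - rewrite -[X in _ --> X]subr0 -[X in _ --> _ - X](mulr0 T); apply: cvgB; first exact: cvg_cst.
    apply: cvgMr; rewrite (_ : (fun p => _) = fun p => 2^-1 ^+ p :> R).
      by apply: cvg_expr; rewrite ger0_norm ?invr_ge0// invf_lt1// ltr1n.
    by apply/funext => p; rewrite natrX exprVn.
  - exact: cvg_cst.
have c1 : (fun p => X (tau p (i p)) w) @ \oo --> X t w.
  apply: (within_cvg_seq cw) => //; first by rewrite in_itv /= t0'.
  by move=> p; rewrite in_itv /= t0.
apply: (cvgr_to_le (cvg_norm c1)); apply: nearW => p; exact: H.
Qed.

Let ex0 : (fun n => 2 * 2^-1 ^+ n : R) @ \oo --> 0.
Proof.
rewrite -[X in _ --> X](mulr0 2); apply: cvgMr.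
by apply: cvg_expr; rewrite ger0_norm ?invr_ge0// invf_lt1// ltr1n.
Qed.

(** Subtracting the tail bound makes the sequence monotone: u(p) - 2 * 2^-p is nondecreasing from N
    on and bounded above, which produces the limit. *)
Lemma geometric_cauchy (u : nat -> R) N : (forall p, (N <= p)%N -> `|u p.+1 - u p| <= 2^-1 ^+ p) ->
  exists2 l, u @ \oo --> l & forall n, (N <= n)%N -> `|l - u n| <= 2 * 2^-1 ^+ n.
Proof.
move=> h; have h2 n : 2^-1 ^+ n.+1 = 2^-1 * 2^-1 ^+ n :> R by rewrite exprS.
have e0 n : 0 <= 2^-1 ^+ n :> R by rewrite exprn_ge0// invr_ge0.
have bd n k : (N <= n)%N -> `|u (n + k)%N - u n| <= 2 * 2^-1 ^+ n - 2 * 2^-1 ^+ (n + k).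
  move=> Nn; elim: k => [|k IH]; first by rewrite addn0 !subrr normr0.
  rewrite addnS; have := h (n + k)%N (leq_trans Nn (leq_addr _ _)); have := h2 (n + k)%N.
  move: IH; rewrite !ler_norml => /andP[a b] E /andP[a' b']; rewrite E; apply/andP; split; lra.
have bd' n p : (N <= n)%N -> (n <= p)%N -> `|u p - u n| <= 2 * 2^-1 ^+ n.
  move=> Nn np; rewrite -(subnKC np); apply: le_trans (bd n _ Nn) _.
  by rewrite gerBl mulr_ge0.
pose v p := u (N + p)%N - 2 * 2^-1 ^+ (N + p).
have vmon : nondecreasing_seq v.
  apply/nondecreasing_seqP => p; rewrite /v addnS h2.
  have := h (N + p)%N (leq_addr _ _); rewrite ler_norml => /andP[a _]; lra.
have vb : has_ubound (range v).
  exists (u N + 2 * 2^-1 ^+ N) => _ [p _ <-]; rewrite /v.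
  have := bd' N (N + p)%N (leqnn _) (leq_addr _ _); rewrite ler_norml => /andP[_ b].
  have := e0 (N + p)%N; lra.
have cv := nondecreasing_cvgn vmon vb.
pose l := sup (range v).
have cu : (fun p => u (N + p)%N) @ \oo --> l.
  rewrite (_ : (fun p => _) = fun p => v p + 2 * 2^-1 ^+ (N + p)); last by apply/funext => p; rewrite /v subrK.
  rewrite -[X in _ --> X]addr0; apply: cvgD => //.
  by have := ex0; rewrite -(cvg_shiftn N); under eq_fun do rewrite addnC.
have cu' : u @ \oo --> l.
  by rewrite -(cvg_shiftn N); under eq_fun do rewrite addnC.
exists l => // n Nn.
have c1 : (fun p => `|u p - u n|) @ \oo --> `|l - u n|.
  by apply: cvg_norm; apply: cvgB => //; exact: cvg_cst.
by apply: (cvgr_to_le c1); exists n => // p /=; exact: bd'.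
Qed.

Lemma within_unif_limit (a b : R) (f_ : nat -> R -> R) (f : R -> R) N :
  (forall n, {within `[a, b], continuous (f_ n)}) ->
  (forall n t, (N <= n)%N -> a <= t <= b -> `|f t - f_ n t| <= 2 * 2^-1 ^+ n) ->
  {within `[a, b], continuous f}.
Proof.
move=> cf h; apply/subspace_continuousP => x xab; apply/cvgrPdist_le => e e0.
have e3 : 0 < e / 3 by rewrite divr_gt0.
have [n Nn hn] : exists2 n, (N <= n)%N & 2 * 2^-1 ^+ n <= e / 3 :> R.
  have /cvgrPdist_le/(_ _ e3)[m _ hm] := ex0; exists (maxn N m); first exact: leq_maxl.
  by have := hm _ (leq_maxr N m); rewrite /= sub0r normrN ger0_norm// mulr_ge0// exprn_ge0// invr_ge0.
have /subspace_continuousP/(_ x xab)/cvgrPdist_le/(_ _ e3) := cf n.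
move=> c; near=> y.
have yab : `[a, b]%classic y by near: y; exact: withinT.
have hy : `|f_ n x - f_ n y| <= e / 3 by near: y; exact: c.
move: xab yab; rewrite /= !in_itv /= => xab yab.
have hx := le_trans (h n x Nn xab) hn; have hy' := le_trans (h n y Nn yab) hn.
rewrite /from_subspace; move: hx hy' hy; rewrite !ler_norml => /andP[a1 b1] /andP[a2 b2] /andP[a3 b3].
apply/andP; split; lra.
Unshelve. all: by end_near. Qed.

(** Doob's inequality at level 2^-n turns the rate 4 * 8^-n into probabilities 4 * 2^-n. These are
    summable, so Borel-Cantelli gives almost sure uniform convergence at a geometric rate, and Fatou
    returns the mean-square bound for the limit. *)
Lemma mart_limit (X : nat -> R -> Omega -> R) : (forall n, mart (X n)) ->
  (forall n p, (n <= p)%N -> \int[P]_w ((X p T w - X n T w) ^+ 2) <= 4 * 8^-1 ^+ n) ->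
  exists Z, [/\ forall t, 0 <= t <= T -> gmeas (F t) (Z t), acont P T Z &
    forall n t, 0 <= t <= T -> (\int[P]_w ((Z t w - X n t w) ^+ 2)%:E <= (4 * 8^-1 ^+ n)%:E)%E].
Proof.
move=> hX hI.
have FT : F 0 setT by apply/(gmeas_set _ (sF 0).1); exact: measurableT.
have hIt n p t : (n <= p)%N -> 0 <= t <= T -> \int[P]_w ((X p t w - X n t w) ^+ 2) <= 4 * 8^-1 ^+ n.
  move=> np /andP[t0 tT]; apply: le_trans (hI n p np).
  by apply: (submart (martB (hX p) (hX n)) t0 tT (lexx T)); exact: (mF t0).
have c0 n : 0 < 2^-1 ^+ n :> R by rewrite exprn_gt0// invr_gt0.
have /choice[A hA] n : exists A, [/\ measurable A, fine (P A) <= 4 * 2^-1 ^+ n &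
  {ae P, forall w, ~ A w -> forall t, 0 <= t <= T -> `|X n.+1 t w - X n t w| <= 2^-1 ^+ n}].
  have [A [mA PA h]] := doob (martB (hX n.+1) (hX n)) (c0 n).
  exists A; split => //; apply: le_trans PA _; rewrite ler_pdivrMr ?exprn_gt0//.
  apply: le_trans (hI n n.+1 (leqnSn n)) _; rewrite -mulrA ler_pM2l// -exprM -exprD.
  have -> : 8^-1 = 2^-1 ^+ 3 :> R by rewrite !exprS expr0; field.
  by rewrite -exprM (_ : (3 * n)%N = (n + n * 2)%N)// mulSn mulnC.
have mA n : measurable (A n) by have [] := hA n.
have P0 : P (lim_sup_set A) = 0%E.
  apply: lim_sup_set_cvg0 => //.
  have cg := @cvg_geometric_eseries_half R 8 0.
  apply: (@le_lt_trans _ _ (\sum_(k <oo) (8 / (2 ^ (k + 1))%:R)%:E)%E).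
    apply: lee_nneseries => [k _ _|k _]; first exact: measure_ge0.
    apply: (@le_trans _ _ (fine (P (A k)))%:E); first by rewrite fineK ?fin_num_measure.
    rewrite lee_fin; have [_ h _] := hA k.
    apply: le_trans h _; rewrite addn1 expnS natrM natrX exprVn invfM mulrA.
    by rewrite (_ : 8 / 2 = 4 :> R)//; field.
  by rewrite (cvg_lim _ cg)// ltry.
have good : {ae P, forall w, exists N, forall n, (N <= n)%N -> forall t, 0 <= t <= T -> `|X n.+1 t w - X n t w| <= 2^-1 ^+ n}.
  have h1 : {ae P, forall w, exists N, forall n, (N <= n)%N -> ~ A n w}.
    exists (lim_sup_set A); split => //.
      by apply: bigcapT_measurable => n; apply: bigcup_measurable.
    move=> w /= nN n _; apply: contrapT => nA; apply: nN; exists n => k nk Ak.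
    by apply: nA; exists k.
  have h2 : {ae P, forall w, forall n, ~ A n w -> forall t, 0 <= t <= T -> `|X n.+1 t w - X n t w| <= 2^-1 ^+ n}.
    by apply: ae_nat => n; have [] := hA n.
  by apply: ae_imp2 h1 h2 => w [N hN] h; exists N => n Nn; apply: h; exact: hN.
(* The limsup exists at every point and is F_t-measurable, so the limit is exactly adapted without
   completing the filtration. *)
pose Z t w := fine (limn_esup (fun n => (X n t w)%:E)).
have lim : {ae P, forall w, exists N, forall n t, (N <= n)%N -> 0 <= t <= T ->
    `|Z t w - X n t w| <= 2 * 2^-1 ^+ n}.
  apply: ae_imp good => w [N hN]; exists N => n t Nn tT.
  have [l cl hl] := @geometric_cauchy (fun n => X n t w) N (fun p Np => hN p Np t tT).
  have cl' : (fun n => (X n t w)%:E) @ \oo --> l%:E by apply/fine_cvgP; split; [exact: nearW|].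
  by rewrite /Z (cvg_limn_einf_sup cl').2 /=; exact: hl.
exists Z; split.
- move=> t tT; have h : @measurable_fun _ _ (g_sigma_algebraType (F t)) (\bar R) setT
      (fun w => limn_esup (fun n => (X n t w)%:E)).
    apply: (@measurable_fun_limn_esup _ (g_sigma_algebraType (F t))) => n.
    by apply/measurable_EFinP; have [aX _ _ _] := hX n; exact: aX.
  exact: measurableT_comp (fine_measurable measurableT) h.
- have cX : {ae P, forall w, forall n, {within `[0, T], continuous (X n ^~ w)}}.
    by apply: ae_nat => n; have [] := hX n.
  apply: ae_imp2 lim cX => w [N hN] cw.
  by apply: (@within_unif_limit 0 T (fun n t => X n t w) (Z^~ w) N).
- move=> n t tT.
  pose f p w := ((X (n + p)%N t w - X n t w) ^+ 2)%:E.
  have LX m : L2s P setT (X m t) by have [_ + _ _] := hX m; exact.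
  have mf p : measurable_fun setT (f p).
    by apply/measurable_EFinP; apply: measurable_funX; apply: measurable_funB; [have [] := LX (n + p)%N|have [] := LX n].
  have gZ : measurable_fun setT (Z t).
    apply: (gmeas_meas (sF t)).
    have h : @measurable_fun _ _ (g_sigma_algebraType (F t)) (\bar R) setT
      (fun w => limn_esup (fun n => (X n t w)%:E)).
      apply: (@measurable_fun_limn_esup _ (g_sigma_algebraType (F t))) => m.
      by apply/measurable_EFinP; have [aX _ _ _] := hX m; exact: aX.
    exact: measurableT_comp (fine_measurable measurableT) h.
  have E : (\int[P]_w ((Z t w - X n t w) ^+ 2)%:E = \int[P]_w limn_einf (fun p => f p w))%E.
    apply: ae_eq_integral => //.
    - by apply/measurable_EFinP; apply: measurable_funX; apply: measurable_funB => //; have [] := LX n.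
    - rewrite (_ : (fun w => _) = fun w => (- limn_esup (fun p => (- f p w)%E))%E).
        apply: measurableT_comp => //; apply: measurable_fun_limn_esup => p.
        by apply: measurableT_comp => //; exact: mf.
      by apply/funext => w; rewrite (limn_esupN (fun p => f p w)) oppeK.
    - apply: ae_imp lim => w [N hN] _.
      have c1 : (fun m => X m t w) @ \oo --> Z t w.
        apply/cvgrPdist_le => e e0.
        have /cvgrPdist_le/(_ _ e0)[m _ hm] := ex0.
        exists (maxn N m) => // k /= hk; apply: le_trans (hN k t (leq_trans (leq_maxl _ _) hk) tT) _.
        have := hm k (leq_trans (leq_maxr _ _) hk).
        by rewrite /= sub0r normrN ger0_norm// mulr_ge0// exprn_ge0// invr_ge0.
      have c2 : (fun p => f p w) @ \oo --> ((Z t w - X n t w) ^+ 2)%:E.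
        apply/fine_cvgP; split; first exact: nearW.
        have c3 : (fun p => X (n + p)%N t w - X n t w) @ \oo --> Z t w - X n t w.
          apply: cvgB; last exact: cvg_cst.
          by have := c1; rewrite -(cvg_shiftn n); under eq_fun do rewrite addnC.
        by rewrite (_ : (Z t w - X n t w) ^+ 2 = (Z t w - X n t w) * (Z t w - X n t w))//; exact: (cvgM c3 c3).
      by rewrite (cvg_limn_einf_sup c2).1.
  rewrite E; apply: (le_trans (fatou P measurableT mf _)).
    by move=> p w _; rewrite lee_fin sqr_ge0.
  have bnd p : (\int[P]_w f p w <= (4 * 8^-1 ^+ n)%:E)%E.
    by rewrite (Int_E measurableT (L2sB measurableT (LX _) (LX n)).2) lee_fin; apply: hIt => //; exact: leq_addr.
  rewrite limn_einf_lim; apply: lime_le; first exact: is_cvg_einfs.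
  apply: nearW => k; apply: le_trans (bnd k); apply: ereal_inf_lbound.
  by exists k => /=.
Qed.

Lemma within_mx (a b : R) (q : nat) (z : R -> 'cV[R]_q) :
  (forall l, {within `[a, b], continuous (fun t => z t l 0)}) -> {within `[a, b], continuous z}.
Proof.
move=> h; apply/subspace_continuousP => x xab; apply/cvgrPdist_le => e e0.
have c : \forall y \near within `[a, b] (nbhs x), forall l, `|z x l 0 - z y l 0| <= e.
  apply: filter_forall => l; have /subspace_continuousP/(_ x xab)/cvgrPdist_le/(_ _ e0) := h l.
  exact.
near=> y; rewrite /Num.norm /= mx_normrE; apply: bigmax_le; first exact: ltW.
move=> -[l i] _; rewrite /= !mxE /from_subspace ord1.
by move: l; near: y; exact: c.
Unshelve. all: by end_near. Qed.

Lemma Int_det_sqr (c : R -> R) : L2s lam `[0, T] c ->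
  \int[(lam \x P)%E]_(p in DD) (c p.1 ^+ 2) = \int[lam]_(t in `[0, T]) (c t ^+ 2).
Proof.
move=> hc; have [_ _ [_ L]] := SL2_det P F hc.
have := fubini_slab2 (itv_meas 0 T) (fun t (w : Omega) => c t ^+ 2) L => <-.
apply: Int_eq => t _.
have -> : \int[P]_w (c t ^+ 2) = c t ^+ 2 * fine (P setT) by exact: (Rintegral_cst P measurableT).
rewrite -[RHS]mulr1; congr (_ * _); rewrite -[RHS]/(fine 1%E); congr fine; exact: probability_setT.
Qed.

Lemma sum_cvg0 (q : nat) (u : 'I_q -> nat -> R) : (forall l, u l @ \oo --> (0 : R)) ->
  (fun m => \sum_(l < q) u l m) @ \oo --> (0 : R).
Proof.
move=> h; elim: (index_enum _) => [|l s IH].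
  by rewrite (_ : (fun m => _) = fun=> 0); [exact: cvg_cst|apply/funext => m; rewrite big_nil].
rewrite (_ : (fun m => _) = fun m => u l m + \sum_(i <- s) u i m); last by apply/funext => m; rewrite big_cons.
by rewrite -[X in _ --> X]addr0; apply: cvgD.
Qed.

(** * Step-function approximation of a deterministic integrand that may be unbounded near 0 *)

Section Steps.
Variables (q : nat) (k : R -> 'cV[R]_q).
Hypothesis ck : forall l delta, 0 < delta -> {within `[delta, T], continuous (fun t => k t l 0)}.
Hypothesis Lk : forall l, L2s lam `[0, T] (fun t => k t l 0).

Let tau (m i : nat) : R := i%:R * T / m.+1%:R.
Let h (delta u : R) : 'cV[R]_q := if delta < u then k u else 0.
Let S delta m : @simple_process _ Omega R q := SimpleProcess m.+1 (tau m) (fun i _ => h delta (tau m i)).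
Let sv delta m t : 'cV[R]_q := \sum_(i < m.+1 | tau m i < t <= tau m i.+1) h delta (tau m i).

Let tau0 m i : 0 <= tau m i. Proof. by rewrite /tau divr_ge0 ?mulr_ge0. Qed.

Let tauS m i : tau m i.+1 = tau m i + T / m.+1%:R.
Proof. by rewrite /tau -natr1 mulrDl mul1r mulrDl. Qed.

Let tauT m i : (i <= m.+1)%N -> tau m i <= T.
Proof. by move=> im; rewrite /tau ler_pdivrMr ?ltr0n// mulrC ler_pM2l// ler_nat. Qed.

Let tau_lt m i i' : (i <= i')%N -> tau m i <= tau m i'.
Proof. by move=> ii; rewrite /tau ler_pM2r ?invr_gt0 ?ltr0n// ler_pM2r// ler_nat. Qed.

Let wfS delta m : simple_wf F T (S delta m).
Proof.
move=> i /= im; split => //.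
- by rewrite tauS lerDl divr_ge0.
- exact: tauT.
- move=> l B mB.
  have g : gmeas (F (tau m i)) ((fun=> h delta (tau m i) l 0) : Omega -> R) by exact: gmeas_cst.
  exact: ((gmeasP _ (sF _).1).1 g B mB).
- by exists (sqnorm (h delta (tau m i))).
Qed.

(** The step function takes at t a value of h at a grid point not after t. Sampling on the left
    matters at the jump of h: for t <= delta the sample vanishes exactly as h does. *)
Let sv_pt delta m t : 0 < delta -> 0 <= t <= T -> exists2 u, sv delta m t = h delta u &
  [/\ 0 <= u, u <= t & t <= u + T / m.+1%:R].
Proof.
move=> d0 /andP[]; rewrite le_eqVlt => /orP[/eqP<- _|t0 tT].
  (* No half-open cell contains 0; the empty sum agrees with h at 0, which is below the cut. *)
  exists 0; last by split=> //; rewrite add0r divr_ge0.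
  rewrite /h (lt_gtF d0) /sv big_pred0// => i; apply/negbTE; rewrite negb_and -leNgt tau0//.
have [n tn nmin] : exists2 n, t <= tau m n.+1 & forall n', t <= tau m n'.+1 -> (n <= n')%N.
  have ex : exists n, t <= tau m n.+1 by exists m; rewrite (le_trans tT)// /tau mulrAC divff ?mul1r.
  by exists (ex_minn ex); case: ex_minnP.
have tn' : tau m n < t.
  case: (n) nmin => [_|n' nm]; first by rewrite /tau !mul0r.
  by rewrite ltNge; apply/negP => /nm; rewrite ltnn.
have nm : (n < m.+1)%N by rewrite ltnS; apply: nmin; rewrite (le_trans tT)// /tau mulrAC divff ?mul1r.
exists (tau m n); last by split; rewrite -?tauS// ltW.
rewrite /sv (big_pred1 (Ordinal nm))// => i; apply/idP/eqP => [/andP[a b]|->]; last by rewrite tn' tn.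
apply/val_inj/anti_leq; rewrite (nmin _ b) andbT /= leqNgt; apply/negP => ni.
by have := lt_le_trans a (le_trans tn (tau_lt m ni)); rewrite ltxx.
Qed.

Let mh delta l : measurable_fun `[0, T] (fun t => h delta t l 0).
Proof.
rewrite (_ : (fun t => _) = fun t => (delta < t)%R%:R * k t l 0).
  apply: measurable_funM; last by have [] := Lk l.
  apply: measurable_funTS; rewrite (_ : (fun t => _) = \1_`]delta, +oo[).
    by apply: measurable_indic; exact: measurable_itv.
  by apply/funext => s; rewrite indicE mem_setE in_itv /= andbT.
by apply/funext => t; rewrite /h; case: ifP; rewrite ?mul1r// mul0r mxE.
Qed.

Let msv delta m l : measurable_fun `[0, T] (fun t => sv delta m t l 0).
Proof.
rewrite (_ : (fun t => _) = fun t => \sum_(i < m.+1) ((tau m i < t <= tau m i.+1)%R%:R * h delta (tau m i) l 0)).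
  apply: measurable_sum => i; apply: measurable_funTS.
  by apply: measurable_funM => //; exact: aval_ind_meas.
apply/funext => t; rewrite /sv summxE big_mkcond /=; apply: eq_bigr => i _.
by case: ifP; rewrite ?mul1r ?mul0r.
Qed.

Let bh delta l : 0 < delta -> exists C, forall u, 0 <= u <= T -> `|h delta u l 0| <= C.
Proof.
move=> d0; have [dT|Td] := leP delta T; last first.
  by exists 0 => u /andP[_ uT]; rewrite /h (lt_gtF (le_lt_trans uT Td)) mxE normr0.
have cn : {within `[delta, T], continuous (fun t => `|k t l 0|)}.
  by move=> t; apply: cvg_norm; exact: (@ck l delta d0 t).
have [c _ hc] := EVT_max dT cn.
exists `|k c l 0| => u /andP[u0 uT]; rewrite /h; case: (ltP delta u) => du; last by rewrite mxE normr0.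
by apply: hc; rewrite in_itv /= (ltW du).
Qed.

Let sv_cvg delta l t : 0 < delta -> 0 <= t <= T -> (fun m => sv delta m t l 0) @ \oo --> h delta t l 0.
Proof.
move=> d0 tT; have /choice[u hu] : forall m, exists u, sv delta m t = h delta u /\ [/\ 0 <= u, u <= t & t <= u + T / m.+1%:R].
  by move=> m; have [u e1 e2] := sv_pt m d0 tT; exists u.
have /andP[t0 tT'] := tT.
have ut : u @ \oo --> t.
  apply: (@squeeze_cvgr _ _ _ _ (fun m => t - T * m.+1%:R^-1) (cst t)).
  - by apply: nearW => m; have [_ [_ -> h']] := hu m; rewrite lerBlDr andbT.
  - rewrite -[X in _ --> X]subr0 -[X in _ --> _ - X](mulr0 T); apply: cvgB; first exact: cvg_cst.
    by apply: cvgMr; exact: cvg_harmonic.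
  - exact: cvg_cst.
rewrite (_ : (fun m => _) = fun m => h delta (u m) l 0); last by apply/funext => m; have [-> _] := hu m.
have [dt|td] := ltP delta t; last first.
  rewrite (_ : (fun m => _) = fun=> h delta t l 0); first exact: cvg_cst.
  apply/funext => m; have [_ [_ um _]] := hu m.
  by rewrite /h !ltNge td (le_trans um td).
have dT : delta <= T by rewrite (le_trans (ltW dt)).
have c1 : (fun m => k (Num.max (u m) delta) l 0) @ \oo --> k t l 0.
  apply: (within_cvg_seq (@ck l delta d0)).
  - by rewrite in_itv /= ltW.
  - move=> m; have [_ [_ um _]] := hu m.
    by rewrite in_itv /= le_max lexx orbT ge_max dT (le_trans um tT').
  - rewrite -[X in _ --> X](max_l (ltW dt)).
    have cm : (fun x : R => Num.max x delta) @ t --> Num.max t delta.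
      by apply: continuous_max; [exact: cvg_id|exact: cvg_cst].
    exact: (cvg_comp _ _ ut cm).
rewrite {2}/h dt; apply: cvg_trans c1; apply: near_eq_cvg.
have td0 : 0 < t - delta by rewrite subr_gt0.
have /cvgrPdist_lt/(_ _ td0) := ut; apply: filterS => m /=; rewrite ltr_norml => /andP[_ b].
have dm : delta < u m by lra.
by rewrite /h dm (max_l (ltW dm)).
Qed.

Let L2h delta l : 0 < delta -> L2s lam `[0, T] (fun t => h delta t l 0).
Proof.
move=> d0; have [C hC] := bh l d0; apply: (L2s_bdd (itv_meas 0 T) (c := C) (lam_itv_lty 0 T) (mh delta l)) => t.
by rewrite /= in_itv /=; exact: hC.
Qed.

Let bsv delta m l C : 0 < delta -> (forall u, 0 <= u <= T -> `|h delta u l 0| <= C) ->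
  forall t, 0 <= t <= T -> `|sv delta m t l 0| <= C.
Proof.
move=> d0 hC t tT; have [u -> [u0 ut _]] := sv_pt m d0 tT; apply: hC.
by rewrite u0; case/andP: tT => _; exact: le_trans.
Qed.

Let L2sv delta m l : 0 < delta -> L2s lam `[0, T] (fun t => sv delta m t l 0).
Proof.
move=> d0; have [C hC] := bh l d0; apply: (L2s_bdd (itv_meas 0 T) (c := C) (lam_itv_lty 0 T) (msv delta m l)) => t.
by rewrite /= in_itv /=; exact: bsv.
Qed.

Let sv_L2cvg delta l : 0 < delta ->
  (fun m => \int[lam]_(t in `[0, T]) ((h delta t l 0 - sv delta m t l 0) ^+ 2)) @ \oo --> (0 : R).
Proof.
move=> d0; have [C hC] := bh l d0.
have mf m : measurable_fun `[0, T] (fun t => (h delta t l 0 - sv delta m t l 0) ^+ 2).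
  by apply: measurable_funX; apply: measurable_funB.
have L m := (L2sB (itv_meas 0 T) (L2h l d0) (L2sv m l d0)).2.
have := @dominated_convergence _ _ R lam `[0, T] (itv_meas 0 T)
  (fun m t => ((h delta t l 0 - sv delta m t l 0) ^+ 2)%:E) (cst 0%E) (fun=> (4 * C ^+ 2)%:E).
case.
- by move=> m; apply/measurable_EFinP; exact: mf.
- exact: measurable_cst.
- apply: aeW => t tT; apply/fine_cvgP; split; first exact: nearW.
  have tT' : 0 <= t <= T by move: tT; rewrite /= in_itv.
  have c1 : (fun m => h delta t l 0 - sv delta m t l 0) @ \oo --> (0 : R).
    by rewrite -[X in _ --> X](subrr (h delta t l 0)); apply: cvgB; [exact: cvg_cst|exact: sv_cvg].
  by rewrite -[X in _ --> X](mulr0 (0 : R)); exact: (cvgM c1 c1).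
- exact: L1_cst (itv_meas 0 T) _ (lam_itv_lty 0 T).
- apply: aeW => t m tT; have tT' : 0 <= t <= T by move: tT; rewrite /= in_itv.
  rewrite /= lee_fin ger0_norm ?sqr_ge0//.
  have := hC t tT'; have := bsv m d0 hC tT'; rewrite !ler_norml => /andP[a1 b1] /andP[a2 b2].
  set x := h _ _ _ _ in a2 b2 *; set y := sv _ _ _ _ _ in a1 b1 *.
  have : (2 * C - (x - y)) * (2 * C + (x - y)) >= 0 by rewrite mulr_ge0//; lra.
  nra.
move=> _ _ c; have c2 : (fun m => (\int[lam]_(t in `[0%R, T]) ((h delta t l 0 - sv delta m t l 0) ^+ 2)%:E)%E) @ \oo --> 0%E.
  by have := c; rewrite integral0.
have /fine_cvgP[_] := c2; exact.
Qed.

(** There are two errors, the mass of |k|^2 on [0, delta] and the sampling error of the truncated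
    function. Each is at most e / 4, and (a + b)^2 <= 2 a^2 + 2 b^2 doubles both. *)
Lemma step_approx (e : R) : 0 < e -> exists S : @simple_process _ Omega R q,
  [/\ simple_wf F T S, (sqnormL2 P T (fun t w => (k t - simple_val S t w)%R) <= e%:E)%E &
   forall l, \int[(lam \x P)%E]_(p in DD) ((k p.1 l 0 - simple_val S p.1 p.2 l 0) ^+ 2) <= e].
Proof.
move=> e0; have L1K : L1 lam `[0, T] (fun t => \sum_(l < q) k t l 0 ^+ 2).
  by apply: (L1_sum (itv_meas 0 T)) => l _; have [] := Lk l.
have e4 : 0 < e / 4 by rewrite divr_gt0.
have [delta d0 hd] : exists2 delta, 0 < delta <= T & \int[lam]_(t in `[0, delta]) (\sum_(l < q) k t l 0 ^+ 2) <= e / 4.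
  pose Fk x := \int[lam]_(t in `[0, x]) (\sum_(l < q) k t l 0 ^+ 2).
  have F0 : Fk 0 = 0 by exact: Int_pt.
  have cF : {within `[0, T], continuous Fk} := parameterized_integral_continuous (ltW Tgt0) L1K.
  have z0T : `[0, T]%classic 0 by rewrite /= in_itv /= lexx ltW.
  have /subspace_continuousP/(_ 0 z0T)/cvgrPdist_le/(_ _ e4)[r /= r0 hr] := cF.
  have hr' y : `|0 - y| < r -> 0 <= y <= T -> Fk y <= e / 4.
    move=> a b; have yT : `[0, T]%classic y by rewrite /= in_itv.
    by have := hr y a yT; rewrite /from_subspace F0 sub0r normrN => /(le_trans (ler_norm _)).
  exists (Num.min T (r / 2)); first by rewrite lt_min Tgt0 divr_gt0// ge_min lexx.
  have m0 : 0 <= Num.min T (r / 2) by rewrite le_min (ltW Tgt0) divr_ge0// ltW.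
  apply: hr'; last by rewrite m0 ge_min lexx.
  rewrite sub0r normrN ger0_norm// gt_min; apply/orP; right; lra.
have /andP[dp dT] := d0.
have := sum_cvg0 (fun l => sv_L2cvg l dp) => /cvgrPdist_le/(_ _ e4)[m _ /(_ m (leqnn m))] /=.
rewrite sub0r normrN ger0_norm; last by apply: sumr_ge0 => l _; apply: Int_ge0 => t _; exact: sqr_ge0.
move=> hm.
have svE t w : simple_val (S delta m) t w = sv delta m t by [].
have Ld l := L2sB (itv_meas 0 T) (Lk l) (L2sv m l dp).
have Il : \sum_(l < q) \int[lam]_(t in `[0, T]) ((k t l 0 - sv delta m t l 0) ^+ 2) <= e.
  apply: (@le_trans _ _ (\sum_(l < q) (2 * \int[lam]_(t in `[0, delta]) (k t l 0 ^+ 2) +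
      2 * \int[lam]_(t in `[0, T]) ((h delta t l 0 - sv delta m t l 0) ^+ 2)))).
    apply: ler_sum => l _; have [mk L1k] := Lk l.
    have La := (L2sB (itv_meas 0 T) (L2h l dp) (L2sv m l dp)).2.
    have dTT : 0 <= delta <= T by rewrite ltW.
    rewrite -(Int_cut _ dTT).
    have Lc : L1 lam `[0, T] (fun t => (t <= delta)%R%:R * k t l 0 ^+ 2).
      apply: (L1_bddM (itv_meas 0 T) (c := 1)) => //.
        apply: measurable_funTS; rewrite (_ : (fun t => _) = \1_`]-oo, delta]).
          by apply: measurable_indic; exact: measurable_itv.
        by apply/funext => s; rewrite indicE mem_setE in_itv.
      by move=> t _; case: (t <= delta)%R; rewrite ?normr1 ?normr0.
    rewrite -(IntZ (itv_meas 0 T) _ Lc) -(IntZ (itv_meas 0 T) _ La) -(IntD (itv_meas 0 T) (L1Z (itv_meas 0 T) _ Lc) (L1Z (itv_meas 0 T) _ La)).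
    apply: (Int_le (itv_meas 0 T)).
    - exact: (Ld l).2.
    - by apply: (L1D (itv_meas 0 T)); exact: (L1Z (itv_meas 0 T)).
    - move=> t _; rewrite /h leNgt; case: (ltP delta t) => dt /=; rewrite ?mul0r ?mulr0 ?add0r ?mul1r.
        by have := sqr_ge0 (k t l 0 - sv delta m t l 0); nra.
      by rewrite mxE; have := sqr_ge0 (k t l 0 + sv delta m t l 0); nra.
  rewrite big_split /= -!mulr_sumr.
  have L1k' l : L1 lam `[0, delta] (fun t => k t l 0 ^+ 2).
    by apply: L1_sub (Lk l).2.
  rewrite -(Int_sum (itv_meas 0 delta))//; lra.
have Ed l : \int[(lam \x P)%E]_(p in DD) ((k p.1 l 0 - sv delta m p.1 l 0) ^+ 2) =
   \int[lam]_(t in `[0, T]) ((k t l 0 - sv delta m t l 0) ^+ 2) := Int_det_sqr (Ld l).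
exists (S delta m); split; first exact: wfS.
- rewrite sqnormL2E; last first.
    move=> l; have [+ _ _] := SL2_det P F (Ld l).
    by apply: eq_measurable_fun => p _; rewrite svE !mxE.
  have LD l : L1 (lam \x P)%E DD (fun p : R * Omega => (k p.1 l 0 - sv delta m p.1 l 0) ^+ 2).
    by have [_ _ []] := SL2_det P F (Ld l).
  rewrite (_ : (\int[_]_(p in _) _)%E = (\int[(lam \x P)%E]_(p in DD) (\sum_(l < q) (k p.1 l 0 - sv delta m p.1 l 0) ^+ 2)%:E)%E); last first.
    by apply: eq_integral => p _; rewrite sqnormE; congr (_%:E); apply: eq_bigr => l _; rewrite svE !mxE.
  rewrite (Int_E (mDD T) (L1_sum (mDD T) _ (fun l _ => LD l))) lee_fin (Int_sum (mDD T) _ (fun l _ => LD l)).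
  by rewrite (eq_bigr _ (fun l _ => Ed l)).
- move=> l; apply: le_trans Il; rewrite (bigD1 l)//= -Ed.
  rewrite lerDl; apply: sumr_ge0 => i _; apply: Int_ge0 => t _; exact: sqr_ge0.
Qed.

End Steps.

Hypothesis cW : forall j, acont P T (fun t w => W j t w).

Lemma mart_sint j (q : nat) (S : @simple_process _ Omega R q) l : simple_wf F T S ->
  mart (fun t w => simple_int (W j) S t w l 0).
Proof.
move=> wS; have wL := wfl_atoms l wS.
have E t : (fun w => simple_int (W j) S t w l 0) = sint j (map (clip t) (atoms S l)).
  by apply/funext => w; rewrite sint_atoms.
split.
- move=> t /andP[t0 tT].
  rewrite (_ : (fun w => _) = fun w => \sum_(i < sp_m S)
     (W j (Num.min (sp_t S i.+1) t) w - W j (Num.min (sp_t S i) t) w) * sp_x S i w l 0); last first.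
    by apply/funext => w; rewrite /simple_int summxE; apply: eq_bigr => i _; rewrite !mxE.
  apply: gmeas_sum => i _; have [s0 ss sT mx [C hC]] := wS i (ltn_ord i).
  have [it|ti] := leP (sp_t S i) t; last first.
    rewrite (_ : (fun w => _) = fun=> 0); first exact: gmeas_cst.
    by apply/funext => w; rewrite (min_r (ltW (lt_le_trans ti ss))) subrr mul0r.
  have gw u : 0 <= u -> u <= t -> gmeas (F t) (W j u) by move=> u0 ut; apply: (gmeas_le sF mF ut); exact: gW.
  apply: gmeasM; last first.
    apply: (gmeas_le sF mF it); apply/gmeasP; [exact: (sF _).1|exact: mx].
  apply: gmeasB; apply: gw => //; last by rewrite ge_min lexx orbT.
  by rewrite le_min (le_trans s0 ss).
- by move=> t /andP[t0 tT]; rewrite E; apply: sint_L2; exact: wfl_clip.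
- move=> s t s0 st tT A hA; have mA := (sF s).2 _ hA.
  rewrite -(Int_ind P _ mA).
  have gA : gmeas (F s) (\1_A : Omega -> R) by apply: gmeas_ind => //; exact: (sF s).1.
  have LA := ind_L2s P mA.
  rewrite -[RHS](sint_mart j s0 st tT wL gA LA).
  by apply: Int_eq => w _; rewrite !sint_atoms.
- apply: ae_imp (cW j) => w cw.
  rewrite (_ : (fun t => _) = fun t => \sum_(i < sp_m S)
     (W j (Num.min (sp_t S i.+1) t) w - W j (Num.min (sp_t S i) t) w) * sp_x S i w l 0); last first.
    by apply/funext => t; rewrite /simple_int summxE; apply: eq_bigr => i _; rewrite !mxE.
  have cm a : 0 <= a -> {within `[0, T], continuous (fun t => W j (Num.min a t) w)}.
    move=> a0; apply/subspace_continuousP => x x0T; have /subspace_continuousP cw' := cw.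
    have h t : `[0, T]%classic t -> `[0, T]%classic (Num.min a t).
      by rewrite /= !in_itv /= => /andP[t0 tT]; rewrite le_min a0 t0 ge_min tT orbT.
    apply: (cvg_comp (fun t => Num.min a t) (fun t => W j t w) _ (cw' _ (h x x0T))).
    move=> U; rewrite /within /= => hU.
    have cc : (fun t : R => Num.min a t) @ x --> Num.min a x.
      by apply: continuous_min; [exact: cvg_cst|exact: cvg_id].
    rewrite /nbhs /= /within /=; near=> t => tT.
    have ht : `[0, T]%classic (Num.min a t) -> U (Num.min a t) by near: t; exact: cc _ hU.
    by apply: ht; exact: h.
  apply: within_sum => i; have [s0 ss sT mx _] := wS i (ltn_ord i).
  move=> t; apply: cvgM; last exact: cvg_cst.
  apply: cvgB; first exact: (cm _ (le_trans s0 ss) t).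
  exact: (cm _ s0 t).
Unshelve. all: by end_near. Qed.

(** Continuity away from 0 is the regularity that Y^-1 sigma will have. Step approximations with
    error 8^-n have terminal differences of at most 2 * 8^-n + 2 * 8^-p <= 4 * 8^-n for p >= n, the
    rate asked for by [mart_limit]. *)
Lemma ito_exists j (q : nat) (k : R -> 'cV[R]_q) :
  (forall l delta, 0 < delta -> {within `[delta, T], continuous (fun t => k t l 0)}) ->
  (forall l, L2s lam `[0, T] (fun t => k t l 0)) ->
  exists Z, is_ito_integral F T (W j) (fun t (_ : Omega) => k t) Z.
Proof.
move=> ck Lk.
have e0 n : 0 < 8^-1 ^+ n :> R by rewrite exprn_gt0// invr_gt0.
have /choice[S hS] : forall n, exists S : @simple_process _ Omega R q,
  [/\ simple_wf F T S, (sqnormL2 P T (fun t w => (k t - simple_val S t w)%R) <= (8^-1 ^+ n)%:E)%E &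
   forall l, \int[(lam \x P)%E]_(p in DD) ((k p.1 l 0 - simple_val S p.1 p.2 l 0) ^+ 2) <= 8^-1 ^+ n].
  by move=> n; apply: step_approx.
have wS n : simple_wf F T (S n) by have [] := hS n.
have Lkk l : L2s (lam \x P)%E DD (fun p : R * Omega => k p.1 l 0) by have [_ _] := SL2_det P F (Lk l).
have Lsv n l : L2s (lam \x P)%E DD (fun p : R * Omega => simple_val (S n) p.1 p.2 l 0).
  by apply: (L2s_eq (mDD T) _ (sval_L2 (wfl_atoms l (wS n)))) => p _; rewrite sval_atoms.
have dif l n p : (n <= p)%N ->
   \int[P]_w ((simple_int (W j) (S p) T w l 0 - simple_int (W j) (S n) T w l 0) ^+ 2) <= 4 * 8^-1 ^+ n.
  move=> np.
  pose ng (a : atom) : atom := (a.1, fun w => - a.2 w).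
  pose L := atoms (S p) l ++ map ng (atoms (S n) l).
  have wL : wfl L.
    apply: wfl_cat; first exact: wfl_atoms.
    apply: wfl_map (wfl_atoms l (wS n)) => a [a0 ab bT gx [C hC]].
    by split=> //=; [exact: gmeasN|exists C => w; rewrite normrN].
  have wLT := wfl_clip (ltW Tgt0) wL.
  have E w : sint j (map (clip T) L) w = simple_int (W j) (S p) T w l 0 - simple_int (W j) (S n) T w l 0.
    rewrite -!(@sint_atoms _ _ j l T w)// map_cat /sint big_cat -map_comp !big_map /= -sumrN.
    by congr (_ + _); apply: eq_bigr => i _; rewrite /aint /=; case: ifP => _; rewrite ?mulrN ?mulr0 ?oppr0.
  have V (x : R * Omega) : DD x -> sval (map (clip T) L) x.1 x.2 = simple_val (S p) x.1 x.2 l 0 - simple_val (S n) x.1 x.2 l 0.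
    move=> [/= + _]; rewrite in_itv /= => /andP[_ xT].
    rewrite sval_clip xT mul1r -!sval_atoms /sval big_cat !big_map /= -sumrN.
    by congr (_ + _); apply: eq_bigr => i _; rewrite /aval /= mulrN.
  have I := sint_iso j j wLT wLT; rewrite eqxx in I.
  have -> : \int[P]_w ((simple_int (W j) (S p) T w l 0 - simple_int (W j) (S n) T w l 0) ^+ 2) =
     \int[P]_w (sint j (map (clip T) L) w * sint j (map (clip T) L) w).
    by apply: Int_eq => w _; rewrite !E expr2.
  rewrite I.
  have Ln := (L2sB (mDD T) (Lkk l) (Lsv n l)).2; have Lp := (L2sB (mDD T) (Lkk l) (Lsv p l)).2.
  apply: (@le_trans _ _ (2 * \int[(lam \x P)%E]_(x in DD) ((k x.1 l 0 - simple_val (S n) x.1 x.2 l 0) ^+ 2) +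
     2 * \int[(lam \x P)%E]_(x in DD) ((k x.1 l 0 - simple_val (S p) x.1 x.2 l 0) ^+ 2))).
    rewrite -(IntZ (mDD T) _ Ln) -(IntZ (mDD T) _ Lp) -(IntD (mDD T) (L1Z (mDD T) _ Ln) (L1Z (mDD T) _ Lp)).
    apply: (Int_le (mDD T)).
    - exact: (L2sM (mDD T) (sval_L2 wLT) (sval_L2 wLT)).
    - by apply: (L1D (mDD T)); exact: (L1Z (mDD T)).
    - move=> x xD; rewrite V//; set a := simple_val (S n) _ _ _ _; set b := simple_val (S p) _ _ _ _.
      by have := sqr_ge0 ((k x.1 l 0 - a) + (k x.1 l 0 - b)); nra.
  have [_ _ /(_ l) hn] := hS n; have [_ _ /(_ l) hp] := hS p.
  have le8 : 8^-1 ^+ p <= 8^-1 ^+ n :> R.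
    by apply: ler_wiXn2l => //; rewrite ?invr_ge0// invf_le1// ler1n.
  lra.
have /choice[Zl hZl] : forall l : 'I_q, exists Z, [/\ forall t, 0 <= t <= T -> gmeas (F t) (Z t), acont P T Z &
    forall n t, 0 <= t <= T -> (\int[P]_w ((Z t w - simple_int (W j) (S n) t w l 0) ^+ 2)%:E <= (4 * 8^-1 ^+ n)%:E)%E].
  move=> l; apply: (@mart_limit (fun n t w => simple_int (W j) (S n) t w l 0)) => [n|]; first exact: mart_sint.
  exact: dif.
pose Z t w : 'cV[R]_q := \col_l Zl l t w.
have cv8 : (fun n => 8^-1 ^+ n : R) @ \oo --> 0.
  by apply: cvg_expr; rewrite ger0_norm ?invr_ge0// invf_lt1// ltr1n.
exists Z; split.
- by apply/L2F_SL2 => l; exact: SL2_det.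
- move=> t tT l B mB.
  have g : gmeas (F t) (fun w => Z t w l 0).
    rewrite (_ : (fun w => _) = Zl l t); last by apply/funext => w; rewrite mxE.
    by have [h _ _] := hZl l; exact: h.
  exact: ((gmeasP _ (sF _).1).1 g B mB).
- have : {ae P, forall w, forall l, {within `[0, T], continuous (fun t => Zl l t w)}}.
    by apply: ae_fin => l; have [] := hZl l.
  apply: ae_imp => w cw; apply: within_mx => l.
  by rewrite (_ : (fun t => _) = (fun t => Zl l t w))//; apply/funext => t; rewrite mxE.
exists S; split => //.
- apply: (@squeeze_cvge _ _ _ _ (fun=> 0%E) _ (fun n => (8^-1 ^+ n)%:E)); last 2 first.
  + exact: cvg_cst.
  + by apply/fine_cvgP; split; [exact: nearW|].
  apply: nearW => n; have [_ -> _] := hS n; rewrite andbT.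
  apply: integral_ge0 => w _; apply: integral_ge0 => t _; rewrite lee_fin; exact: sqnorm_ge0.
- move=> t tT.
  apply: (@squeeze_cvge _ _ _ _ (fun=> 0%E) _ (fun n => ((q%:R * 4) * 8^-1 ^+ n)%:E)); last 2 first.
  + exact: cvg_cst.
  + apply/fine_cvgP; split; first exact: nearW.
    by rewrite -[X in _ --> X](mulr0 (q%:R * 4)); apply: cvgMr.
  apply: nearW => n; apply/andP; split.
    by apply: integral_ge0 => w _; rewrite lee_fin; exact: sqnorm_ge0.
  have mS l : measurable_fun setT (fun w => ((Zl l t w - simple_int (W j) (S n) t w l 0) ^+ 2)%:E).
    apply/measurable_EFinP; apply: measurable_funX; apply: measurable_funB.
      by apply: (gmeas_meas (sF t)); have [h _ _] := hZl l; exact: h.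
    by have [_ /(_ t tT) [] ] := mart_sint j l (wS n).
  rewrite (_ : (\int[P]_w _)%E = (\int[P]_w (\sum_(l < q) ((Zl l t w - simple_int (W j) (S n) t w l 0) ^+ 2)%:E))%E); last first.
    by apply: eq_integral => w _; rewrite sqnormE sumEFin; congr (_%:E); apply: eq_bigr => l _; rewrite !mxE.
  rewrite ge0_integral_sum//; last by move=> l w _; rewrite lee_fin sqr_ge0.
  apply: (@le_trans _ _ (\sum_(l < q) (4 * 8^-1 ^+ n)%:E)%E).
    by apply: lee_sum => l _; have [_ _ h] := hZl l; exact: h.
  by rewrite sumEFin sumr_const card_ord lee_fin -mulrA -[X in X <= _]mulr_natl.
Qed.

(** * Vector processes, scalar products and path integrals *)

Lemma L2Fc (q : nat) (z : R -> Omega -> 'cV[R]_q) l : L2F P F T z -> SL2 P F T (fun t w => z t w l 0).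
Proof. by move/L2F_SL2. Qed.

Lemma L2F_eq (q : nat) (a b : R -> Omega -> 'cV[R]_q) : (forall t w, 0 <= t <= T -> a t w = b t w) ->
  L2F P F T a -> L2F P F T b.
Proof.
move=> ab La; apply/L2F_SL2 => l; apply: (SL2_eq _ (L2Fc l La)) => t w tT.
by rewrite ab.
Qed.

Lemma L2FD (q : nat) (a b : R -> Omega -> 'cV[R]_q) : L2F P F T a -> L2F P F T b ->
  L2F P F T (fun t w => a t w + b t w).
Proof.
move=> La Lb; apply/L2F_SL2 => l; apply: (SL2_eq _ (SL2D (L2Fc l La) (L2Fc l Lb))) => t w _.
by rewrite mxE.
Qed.

Lemma L2FZ (q : nat) c (a : R -> Omega -> 'cV[R]_q) : L2F P F T a ->
  L2F P F T (fun t w => c *: a t w).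
Proof.
move=> La; apply/L2F_SL2 => l; apply: (SL2_eq _ (SL2Z c (L2Fc l La))) => t w _.
by rewrite mxE.
Qed.

Lemma L2FN (q : nat) (a : R -> Omega -> 'cV[R]_q) : L2F P F T a ->
  L2F P F T (fun t w => - a t w).
Proof. by move=> /(L2FZ (-1)); apply: L2F_eq => t w _; rewrite scaleN1r. Qed.

Lemma L2FB (q : nat) (a b : R -> Omega -> 'cV[R]_q) : L2F P F T a -> L2F P F T b ->
  L2F P F T (fun t w => a t w - b t w).
Proof. by move=> La /L2FN; exact: L2FD. Qed.

Lemma L2F0 (q : nat) : L2F P F T (fun _ _ => 0 : 'cV[R]_q).
Proof.
apply/L2F_SL2 => l; apply: (SL2_eq _ (SL2_0 P F T)) => t w _; by rewrite mxE.
Qed.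

Lemma L2F_sum (I : Type) (s : seq I) (Q : pred I) (q : nat) (h : I -> R -> Omega -> 'cV[R]_q) :
  (forall i, Q i -> L2F P F T (h i)) -> L2F P F T (fun t w => \sum_(i <- s | Q i) h i t w).
Proof.
move=> hh; apply/L2F_SL2 => l.
apply: (SL2_eq _ (SL2_sum s (Q := Q) (h := fun i t w => h i t w l 0) _)) => [t w _|i /hh]; last exact: L2Fc.
by rewrite summxE.
Qed.

Lemma L2F_det (q : nat) (k : R -> 'cV[R]_q) : (forall l, L2s lam `[0, T] (fun t => k t l 0)) ->
  L2F P F T (fun t _ => k t).
Proof. by move=> hk; apply/L2F_SL2 => l; exact: (SL2_det P F (hk l)). Qed.

Lemma L2F_detM (p q : nat) (M M' : R -> 'M[R]_(p, q)) (z : R -> Omega -> 'cV[R]_q) :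
  ACm 0 T M M' -> L2F P F T z -> L2F P F T (fun t w => M t *m z t w).
Proof.
move=> hM Lz; apply/L2F_SL2 => l.
apply: (SL2_eq (z := fun t w => \sum_k M t l k * z t w k 0)) => [t w _|]; first by rewrite mxE.
apply: SL2_sum => k _; have [C hC] := AC_bdd (hM l k).
by apply: (SL2_detM (C := C) (AC_meas T0 (hM l k)) _ (L2Fc k Lz)) => t tT; apply: hC; rewrite in_itv.
Qed.

Lemma L2FM (p q : nat) (M : 'M[R]_(p, q)) (z : R -> Omega -> 'cV[R]_q) :
  L2F P F T z -> L2F P F T (fun t w => M *m z t w).
Proof. exact: (L2F_detM (ACm_cst 0 T M)). Qed.

Lemma slab_meas_int (f : R -> Omega -> R) : measurable_fun DD (fun p : R * Omega => f p.1 p.2) ->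
  (forall t w, 0 <= f t w) ->
  measurable_fun `[0, T] (fun t => (\int[P]_w (f t w)%:E)%E).
Proof.
move=> mf f0; pose g : R * Omega -> \bar R := (EFin \o (fun p => f p.1 p.2)) \_ DD.
have mE : measurable_fun DD (EFin \o (fun p : R * Omega => f p.1 p.2)) by exact/measurable_EFinP.
have mg : measurable_fun setT g by exact: ((measurable_restrictT _ (mDD T)).1 mE).
have g0 p : (0 <= g p)%E by rewrite /g patchE; case: ifP => // _; rewrite /= lee_fin.
have := @measurable_fun_fubini_tonelli_F _ _ (measurableTypeR R) Omega R P g mg g0 => /(measurable_funS measurableT (@subsetT _ `[0, T])).
apply: eq_measurable_fun => t; rewrite inE => tT; apply: eq_integral => w _.
by rewrite /g patchE ifT// inE; split.
Qed.

Lemma SL2_bound (C : R) (z : R -> Omega -> R) :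
  measurable_fun DD (fun p : R * Omega => z p.1 p.2) ->
  (forall t, 0 <= t <= T -> gmeas (F t) (z t)) ->
  (forall t, 0 <= t <= T -> L2s P setT (z t) /\ \int[P]_w (z t w ^+ 2) <= C) -> SL2 P F T z.
Proof.
move=> mz gz hz; split=> //; split=> //.
have C0 : 0 <= C.
  have [_ h] := hz 0 (introT andP (conj (lexx _) T0)).
  by apply: le_trans h; apply: Int_ge0 => w _; exact: sqr_ge0.
apply: (tonelli_slab1 (itv_meas 0 T) (fun t w => z t w ^+ 2)); first exact: measurable_funX.
apply: (@le_lt_trans _ _ (\int[lam]_(t in `[0%R, T]) C%:E)%E); last first.
  rewrite integral_cst; last exact: itv_meas.
  by apply: lte_mul_pinfty; rewrite ?lee_fin ?lam_itv_lty.
apply: ge0_le_integral => //.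
- by move=> t _; apply: integral_ge0.
- have h : measurable_fun DD (fun p : R * Omega => z p.1 p.2 ^+ 2) by exact: measurable_funX.
  have := @slab_meas_int (fun t w => z t w ^+ 2) h (fun t w => sqr_ge0 _).
  by apply: eq_measurable_fun => t _; apply: eq_integral => w _; rewrite ger0_norm ?sqr_ge0.
- move=> t /=; rewrite in_itv /= => tT; have [[mt Lt] h] := hz t tT.
  rewrite (_ : (\int[P]_w _)%E = (\int[P]_w (z t w ^+ 2)%:E)%E); first by rewrite (Int_E measurableT Lt) lee_fin.
  by apply: eq_integral => w _; rewrite ger0_norm ?sqr_ge0.
Qed.

Lemma is_ito_ae j (q : nat) (b Z Z' : R -> Omega -> 'cV[R]_q) : is_ito_integral F T (W j) b Z ->
  (forall t, 0 <= t <= T -> vmeas (F t) (Z' t)) ->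
  {ae P, forall w, forall t, 0 <= t <= T -> Z t w = Z' t w} -> is_ito_integral F T (W j) b Z'.
Proof.
move=> [Lb aZ cZ [S [wS cb cS]]] aZ' ZZ'; split => //.
  apply: ae_imp2 cZ ZZ' => w cw ew.
  by apply: subspace_eq_continuous cw => t; rewrite inE /= in_itv /= => /ew.
exists S; split=> // t tT; rewrite (_ : (fun m => _) = fun m => \int[P]_w (sqnorm (Z t w - simple_int (W j) (S m) t w))%:E)%E; first exact: cS.
apply/funext => m.
have gZ (Y : R -> Omega -> 'cV[R]_q) l : vmeas (F t) (Y t) -> measurable_fun setT (fun w => Y t w l 0).
  by move=> hY; apply: (gmeas_meas (sF t)); apply/gmeasP; [exact: (sF _).1|exact: hY].
have ms l : measurable_fun setT (fun w => simple_int (W j) (S m) t w l 0).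
  by have [_ /(_ t tT) [] ] := mart_sint j l (wS m).
apply: ae_eq_integral => //.
- apply/measurable_EFinP; apply: measurable_sqnorm => l.
  rewrite (_ : (fun w => _) = fun w => Z' t w l 0 - simple_int (W j) (S m) t w l 0); last by apply/funext => w; rewrite !mxE.
  by apply: measurable_funB => //; exact: (gZ _ _ (aZ' t tT)).
- apply/measurable_EFinP; apply: measurable_sqnorm => l.
  rewrite (_ : (fun w => _) = fun w => Z t w l 0 - simple_int (W j) (S m) t w l 0); last by apply/funext => w; rewrite !mxE.
  by apply: measurable_funB => //; exact: (gZ _ _ (aZ t tT)).
- by apply: ae_imp ZZ' => w ew _; rewrite ew.
Qed.

Lemma sito_Int_sqr j (k : R -> R) Z t : sito j (fun t _ => k t) Z -> 0 <= t <= T ->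
  \int[P]_w (Z t w ^+ 2) = \int[lam]_(s in `[0, t]) (k s ^+ 2).
Proof.
move=> hZ tT; have := sito_iso_det hZ hZ tT; rewrite eqxx => h.
rewrite (Int_eq P (D := setT) (g := fun w => Z t w * Z t w)) => [|w _]; last by rewrite expr2.
by rewrite h; apply: Int_eq => s _; rewrite expr2.
Qed.

(** The continuous integral is replaced by a jointly measurable version, as membership in [L2F]
    requires. *)
Lemma ito_exists_L2F j (q : nat) (k : R -> 'cV[R]_q) :
  (forall l delta, 0 < delta -> {within `[delta, T], continuous (fun t => k t l 0)}) ->
  (forall l, L2s lam `[0, T] (fun t => k t l 0)) ->
  exists2 Z, is_ito_integral F T (W j) (fun t (_ : Omega) => k t) Z & L2F P F T Z.
Proof.
move=> ck Lk; have [Z hZ] := ito_exists j ck Lk.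
have cZ l : acont P T (fun t w => Z t w l 0) by have [] := is_ito_sito l hZ.
have /choice[Y hY] : forall l : 'I_q, exists I : R -> Omega -> R, [/\ measurable_fun setT (fun p : R * Omega => I p.1 p.2),
    (forall t, 0 <= t <= T -> gmeas (F t) (I t)) &
    {ae P, forall w, forall t, 0 <= t <= T -> Z t w l 0 = I t w}].
  move=> l; apply: (version sF mF (X := fun t w => Z t w l 0)) => // t tT.
  by apply: AM_gmeas; have [_ h _ _] := is_ito_sito l hZ; exact: h.
have hZ' : is_ito_integral F T (W j) (fun t (_ : Omega) => k t) (fun t w => \col_l Y l t w).
  apply: (is_ito_ae hZ) => [t tT l B mB|].
    rewrite (_ : (fun w => _) = Y l t); last by apply/funext => w; rewrite mxE.
    by have [_ /(_ t tT) g _] := hY l; exact: ((gmeasP _ (sF t).1).1 g).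
  have : {ae P, forall w, forall l, forall t, 0 <= t <= T -> Z t w l 0 = Y l t w}.
    by apply: ae_fin => l; have [] := hY l.
  apply: ae_imp => w h t tT; apply/matrixP => l c; rewrite ord1 mxE; exact: h.
exists (fun t w => \col_l Y l t w) => //; apply/L2F_SL2 => l.
have s := is_ito_sito l hZ'.
apply: (SL2_bound (C := \int[lam]_(s in `[0, T]) (k s l 0 ^+ 2))) => [|t tT|t tT].
- apply: (measurable_funS measurableT (@subsetT _ _)).
  rewrite (_ : (fun p => _) = fun p : R * Omega => Y l p.1 p.2); last by apply/funext => p; rewrite mxE.
  by have [] := hY l.
- by have [_ g _ _] := s; exact: g.
- split; first exact: (sito_L2 s).
  rewrite (sito_Int_sqr s)//; case/andP: tT => t0 tT.
  rewrite [leRHS](Int_add t0 tT (Lk l).2) lerDl; apply: Int_ge0 => u _; exact: sqr_ge0.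
Qed.

Definition dot (q : nat) (a b : 'cV[R]_q) : R := (a^T *m b) 0 0.

Lemma dotE (q : nat) (a b : 'cV[R]_q) : dot a b = \sum_l a l 0 * b l 0.
Proof. by rewrite /dot !mxE; apply: eq_bigr => l _; rewrite mxE. Qed.

Lemma dotC (q : nat) (a b : 'cV[R]_q) : dot a b = dot b a.
Proof. by rewrite !dotE; apply: eq_bigr => l _; rewrite mulrC. Qed.

Lemma dotDr (q : nat) (a b c : 'cV[R]_q) : dot a (b + c) = dot a b + dot a c.
Proof. by rewrite /dot mulmxDr mxE. Qed.

Lemma dotZr (q : nat) (a b : 'cV[R]_q) (c : R) : dot a (c *: b) = c * dot a b.
Proof. by rewrite /dot -scalemxAr mxE. Qed.

Lemma dotDl (q : nat) (a b c : 'cV[R]_q) : dot (b + c) a = dot b a + dot c a.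
Proof. by rewrite dotC dotDr !(dotC a). Qed.

Lemma dotZl (q : nat) (a b : 'cV[R]_q) (c : R) : dot (c *: b) a = c * dot b a.
Proof. by rewrite dotC dotZr (dotC a). Qed.

Lemma dotNl (q : nat) (a b : 'cV[R]_q) : dot (- b) a = - dot b a.
Proof. by rewrite -scaleN1r dotZl mulN1r. Qed.

Lemma dotNr (q : nat) (a b : 'cV[R]_q) : dot b (- a) = - dot b a.
Proof. by rewrite dotC dotNl dotC. Qed.

Lemma dot0r (q : nat) (a : 'cV[R]_q) : dot a 0 = 0.
Proof. by rewrite /dot mulmx0 mxE. Qed.

Lemma dotMl (q q' : nat) (M : 'M[R]_(q, q')) a b : dot (M *m a) b = dot a (M^T *m b).
Proof. by rewrite /dot trmx_mul mulmxA. Qed.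

Lemma dotMr (q q' : nat) (M : 'M[R]_(q, q')) a b : dot b (M *m a) = dot (M^T *m b) a.
Proof. by rewrite dotC dotMl dotC. Qed.

Definition L2P (q : nat) (z : R -> Omega -> 'cV[R]_q) :=
  forall l, L2s (lam \x P)%E DD (fun p : R * Omega => z p.1 p.2 l 0).

Lemma L2F_L2P (q : nat) (z : R -> Omega -> 'cV[R]_q) : L2F P F T z -> L2P z.
Proof. by move=> /L2F_SL2 hz l; have [] := hz l. Qed.

Lemma L2PB (q : nat) (a b : R -> Omega -> 'cV[R]_q) : L2P a -> L2P b -> L2P (fun t w => a t w - b t w).
Proof.
move=> La Lb l; apply: (L2s_eq (mDD T) _ (L2sB (mDD T) (La l) (Lb l))) => p _.
by rewrite !mxE.
Qed.

Lemma L2F_path (q : nat) (z : R -> Omega -> 'cV[R]_q) : L2F P F T z ->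
  {ae P, forall w, forall l, L1 lam `[0, T] (fun s => z s w l 0)}.
Proof. by move=> Lz; apply: ae_fin => l; exact: (SL2_aeL1 (L2Fc l Lz)). Qed.

Lemma vintD (q : nat) (a b : R) (f g : R -> 'cV[R]_q) :
  (forall l, L1 lam `[a, b] (fun s => f s l 0)) -> (forall l, L1 lam `[a, b] (fun s => g s l 0)) ->
  vint a b (fun s => f s + g s) = vint a b f + vint a b g.
Proof.
move=> Lf Lg; apply/matrixP => l c; rewrite !mxE -(IntD (itv_meas a b) (Lf l) (Lg l)).
by apply: Int_eq => s _; rewrite mxE.
Qed.

Lemma vintZ (q : nat) (a b c : R) (f : R -> 'cV[R]_q) :
  (forall l, L1 lam `[a, b] (fun s => f s l 0)) ->
  vint a b (fun s => c *: f s) = c *: vint a b f.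
Proof.
move=> Lf; apply/matrixP => l k; rewrite !mxE -(IntZ (itv_meas a b) c (Lf l)).
by apply: Int_eq => s _; rewrite mxE.
Qed.

Lemma eq_vint (q : nat) (a b : R) (f g : R -> 'cV[R]_q) : (forall s, a <= s <= b -> f s = g s) ->
  vint a b f = vint a b g.
Proof.
move=> fg; apply/matrixP => l k; rewrite !mxE; apply: Int_eq => s.
by rewrite /= in_itv /= => /fg ->.
Qed.

Lemma vint_pt (q : nat) (a : R) (f : R -> 'cV[R]_q) : vint a a f = 0.
Proof. by apply/matrixP => l k; rewrite !mxE Int_pt. Qed.

Lemma vint_ACm (q : nat) (a b : R) (y0 : 'cV[R]_q) (Y f : R -> 'cV[R]_q) : a <= b ->
  (forall l, L1 lam `[a, b] (fun s => f s l 0)) ->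
  (forall t, a <= t <= b -> Y t = y0 + vint a t f) -> ACm a b Y f.
Proof.
move=> ab Lf hY l c; rewrite ord1; split=> // t tab.
by rewrite (hY t tab) (hY a) ?lexx// vint_pt addr0 !mxE.
Qed.

Lemma ACm_vint (q : nat) (a b : R) (Y f : R -> 'cV[R]_q) : ACm a b Y f ->
  forall s t, a <= s -> s <= t -> t <= b -> Y t = Y s + vint s t f.
Proof.
move=> h s t as_ st tb; apply/matrixP => l c; rewrite ord1 !mxE.
exact: (AC_int (h l 0) as_ st tb).
Qed.

(** * Linear-quadratic control *)

Section LQ.
Variable rho : R.
Let wt (t : R) : R := expR (- rho * t).

Lemma wt_AC a b : AC a b wt (fun t => - rho * wt t).
Proof.
apply: AC_C1 => x.
  by rewrite /wt; apply: is_derive_eq; rewrite /GRing.scale /= mulr1 mulrC.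
apply: cvgM; first exact: cvg_cst.
by apply: continuous_comp; [exact: mulrl_continuous|exact: continuous_expR].
Qed.

Lemma wt_gt0 t : 0 < wt t. Proof. exact: expR_gt0. Qed.

Lemma wt_bdd : exists C, forall t, 0 <= t <= T -> `|wt t| <= C.
Proof. by have [C hC] := AC_bdd (wt_AC 0 T); exists C => t tT; apply: hC; rewrite in_itv. Qed.

Lemma wtM (f : R * Omega -> R) : L1 (lam \x P)%E DD f -> L1 (lam \x P)%E DD (fun p => wt p.1 * f p).
Proof.
move=> Lf; have [C hC] := wt_bdd.
have Lw : L2s lam `[0, T] wt.
  by apply: (L2s_bdd (itv_meas 0 T) (c := C) (lam_itv_lty 0 T) (AC_meas T0 (wt_AC 0 T))) => t; rewrite /= in_itv /= => /hC.
have [mw _ _] := SL2_det P F Lw.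
apply: (L1_bddM (mDD T) (c := C) mw _ Lf) => -[t w] [/= + _]; rewrite in_itv /=; exact: hC.
Qed.

Definition ip (q : nat) (a b : R -> Omega -> 'cV[R]_q) : R :=
  \int[(lam \x P)%E]_(p in DD) (wt p.1 * dot (a p.1 p.2) (b p.1 p.2)).

Lemma ip_L1 (q : nat) (a b : R -> Omega -> 'cV[R]_q) : L2P a -> L2P b ->
  L1 (lam \x P)%E DD (fun p : R * Omega => wt p.1 * dot (a p.1 p.2) (b p.1 p.2)).
Proof.
move=> La Lb; apply: wtM.
apply: (L1_eq (mDD T) (f := fun p : R * Omega => \sum_l a p.1 p.2 l 0 * b p.1 p.2 l 0)) => [p _|]; first by rewrite dotE.
by apply: (L1_sum (mDD T)) => l _; exact: (L2sM (mDD T)).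
Qed.

Lemma wt_dot_L1 (q : nat) (a b : R -> 'cV[R]_q) : (forall l, L2s lam `[0, T] (fun t => a t l 0)) ->
  (forall l, L2s lam `[0, T] (fun t => b t l 0)) -> L1 lam `[0, T] (fun t => wt t * dot (a t) (b t)).
Proof.
move=> La Lb; apply: (AC_L1M T0 (wt_AC 0 T)).
apply: (L1_eq (itv_meas 0 T) (f := fun t => \sum_l a t l 0 * b t l 0)) => [t _|]; first by rewrite dotE.
by apply: (L1_sum (itv_meas 0 T)) => l _; exact: (L2sM (itv_meas 0 T)).
Qed.

Lemma ip_eq (q : nat) (a b a' b' : R -> Omega -> 'cV[R]_q) :
  (forall t w, 0 <= t <= T -> dot (a t w) (b t w) = dot (a' t w) (b' t w)) -> ip a b = ip a' b'.
Proof.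
move=> h; apply: Int_eq => -[t w] [/= + _]; rewrite in_itv /= => tT; by rewrite h.
Qed.

Lemma ipM (q q' : nat) (M : 'M[R]_(q, q')) a b : ip (fun t w => M *m a t w) b = ip a (fun t w => M^T *m b t w).
Proof. by apply: Int_eq => p _; rewrite dotMl. Qed.

Lemma ipMr (q q' : nat) (M : 'M[R]_(q, q')) a b : ip b (fun t w => M *m a t w) = ip (fun t w => M^T *m b t w) a.
Proof. by apply: Int_eq => p _; rewrite dotMr. Qed.

Lemma ipDr (q : nat) (a b c : R -> Omega -> 'cV[R]_q) : L2P a -> L2P b -> L2P c ->
  ip a (fun t w => b t w + c t w) = ip a b + ip a c.
Proof.
move=> La Lb Lc; rewrite -(IntD (mDD T) (ip_L1 La Lb) (ip_L1 La Lc)).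
by apply: Int_eq => p _; rewrite dotDr mulrDr.
Qed.

Lemma ipDl (q : nat) (a b c : R -> Omega -> 'cV[R]_q) : L2P a -> L2P b -> L2P c ->
  ip (fun t w => b t w + c t w) a = ip b a + ip c a.
Proof.
move=> La Lb Lc; rewrite -(IntD (mDD T) (ip_L1 Lb La) (ip_L1 Lc La)).
by apply: Int_eq => p _; rewrite dotDl mulrDr.
Qed.

Lemma ipBl (q : nat) (a b c : R -> Omega -> 'cV[R]_q) : L2P a -> L2P b -> L2P c ->
  ip (fun t w => b t w - c t w) a = ip b a - ip c a.
Proof.
move=> La Lb Lc; rewrite -(IntB (mDD T) (ip_L1 Lb La) (ip_L1 Lc La)).
by apply: Int_eq => p _; rewrite dotDl dotNl mulrDr mulrN.
Qed.

Lemma ip_ae0 (q : nat) (a : R -> Omega -> 'cV[R]_q) : L2P a -> ip a a = 0 ->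
  {ae (lam \x P)%E, forall p : R * Omega, DD p -> a p.1 p.2 = 0}.
Proof.
move=> La h.
have g0 (p : R * Omega) : 0 <= dot (a p.1 p.2) (a p.1 p.2) by exact: sqnorm_ge0.
have := Int_ge0_ae0 (mDD T) (ip_L1 La La) (fun p _ => mulr_ge0 (ltW (wt_gt0 p.1)) (g0 p)).
rewrite -/(ip a a) h => /(_ (lexx _)); apply: ae_imp => p hp Dp.
have /eqP := hp Dp; rewrite mulf_eq0 gt_eqF ?wt_gt0//= => /eqP e.
apply/matrixP => l c; rewrite ord1 mxE.
have := sqr_le_sqnorm (a p.1 p.2) l; rewrite /sqnorm -/(dot _ _) e => s.
by apply/eqP; rewrite -sqrf_eq0 eq_le s sqr_ge0.
Qed.

(** Fundamental theorem of calculus for the weighted product wt(t) dot(p, y), which vanishes at both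
    ends; the rho term is the derivative of the weight. *)
Lemma pairing (q : nat) (a b : R) (p p' y y' : R -> 'cV[R]_q) : a <= b ->
  ACm a b p p' -> ACm a b y y' -> p b = 0 -> y a = 0 ->
  \int[lam]_(t in `[a, b]) (wt t * (dot (p' t) (y t) + dot (p t) (y' t) - rho * dot (p t) (y t))) = 0.
Proof.
move=> ab hp hy pb ya.
have h := AC_mul (wt_AC a b) (AC_sum (index_enum _) (P := predT) (fun l _ => AC_mul (hp l 0) (hy l 0))).
have := AC_int h (lexx a) ab (lexx b).
rewrite pb ya big1 => [|l _]; last by rewrite !mxE mul0r.
rewrite mulr0 big1 => [|l _]; last by rewrite !mxE mulr0.
rewrite mulr0 add0r => /esym <-; apply: Int_eq => t _.
rewrite -!dotE (_ : \sum_(i < q) _ = dot (p' t) (y t) + dot (p t) (y' t)); last first.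
  by rewrite !dotE -big_split.
by ring.
Qed.

Lemma pairing_L1 (q : nat) (a b : R) (p p' y y' : R -> 'cV[R]_q) : a <= b ->
  ACm a b p p' -> ACm a b y y' ->
  L1 lam `[a, b] (fun t => wt t * (dot (p' t) (y t) + dot (p t) (y' t) - rho * dot (p t) (y t))).
Proof.
move=> ab hp hy.
have h := AC_mul (wt_AC a b) (AC_sum (index_enum _) (P := predT) (fun l _ => AC_mul (hp l 0) (hy l 0))).
apply: (L1_eq (itv_meas a b) _ h.1) => t _.
rewrite -!dotE (_ : \sum_(i < q) (p' t i 0 * _ + _) = dot (p' t) (y t) + dot (p t) (y' t)); last first.
  by rewrite !dotE -big_split.
by ring.
Qed.

Variables (m r : nat) (AA : 'M[R]_m) (BB : 'M[R]_(m, r)) (QQ : 'M[R]_m) (RR : 'M[R]_r).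
Hypothesis QQs : QQ^T = QQ.
Hypothesis RRp : posdef RR.
Local Notation AR := ((AA - rho%:M)^T).
Local Notation proc k := (R -> Omega -> 'cV[R]_k).

Implicit Types (phi : R -> 'cV[R]_m) (Nn x y : proc m) (U V : proc r) (ini : Omega -> 'cV[R]_m).

Lemma posdef_unit : RR \in unitmx.
Proof.
rewrite -row_free_unit -kermx_eq0; apply/rowV0P => v /sub_kermxP hv; apply/eqP/contraT => v0.
have [_ /(_ v^T)] := RRp; rewrite -(inj_eq (@trmx_inj _ _ _)) trmxK trmx0 => /(_ v0).
by rewrite /qform trmxK hv mul0mx mxE ltxx.
Qed.

(** Initial value, deterministic forcing and noise path are parameters, so that states, variations
    of states (all three equal to 0, [hsol]) and their linear combinations fall under one notion. *)
Definition solves (ini : Omega -> 'cV[R]_m) (phi : R -> 'cV[R]_m) (Nn : proc m) (U : proc r) (x : proc m) :=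
  L2F P F T x /\ {ae P, forall w, forall t, 0 <= t <= T ->
    x t w = ini w + vint 0 t (fun s => AA *m x s w + BB *m U s w + phi s) + Nn t w}.

Local Notation hsol := (solves (fun=> 0) (fun=> 0) (fun _ _ => 0)).

Lemma solves_path ini phi Nn U x : (forall l, L2s lam `[0, T] (fun t => phi t l 0)) ->
  L2F P F T U -> solves ini phi Nn U x ->
  {ae P, forall w, (forall l, L1 lam `[0, T] (fun s => (AA *m x s w + BB *m U s w + phi s) l 0)) /\
    (forall t, 0 <= t <= T ->
      x t w = ini w + vint 0 t (fun s => AA *m x s w + BB *m U s w + phi s) + Nn t w)}.
Proof.
move=> Lg LU [Lx eX]; apply: ae_and => //.
exact: (L2F_path (L2FD (L2FD (L2FM AA Lx) (L2FM BB LU)) (L2F_det Lg))).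
Qed.

Lemma solves_D (c : R) ini phi Nn U x ini1 phi1 N1 V y : (forall l, L2s lam `[0, T] (fun t => phi t l 0)) ->
  (forall l, L2s lam `[0, T] (fun t => phi1 t l 0)) -> L2F P F T U -> L2F P F T V ->
  solves ini phi Nn U x -> solves ini1 phi1 N1 V y ->
  solves (fun w => ini w + c *: ini1 w) (fun t => phi t + c *: phi1 t) (fun t w => Nn t w + c *: N1 t w)
    (fun t w => U t w + c *: V t w) (fun t w => x t w + c *: y t w).
Proof.
move=> Lg Lphi1 LU LV hX hY; split; first by apply: L2FD; [exact: hX.1|apply: L2FZ; exact: hY.1].
apply: ae_imp2 (solves_path Lg LU hX) (solves_path Lphi1 LV hY) => w [L eX] [L' eY] t tT.
have /andP[t0 tT'] := tT.
have sub (f : R -> 'cV[R]_m) : (forall l, L1 lam `[0, T] (fun s => f s l 0)) ->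
    forall l, L1 lam `[0, t] (fun s => f s l 0) by move=> h l; apply: L1_sub (h l).
rewrite (eX t tT) (eY t tT).
transitivity (ini w + c *: ini1 w + (vint 0 t (fun s => AA *m x s w + BB *m U s w + phi s) +
  c *: vint 0 t (fun s => AA *m y s w + BB *m V s w + phi1 s)) + (Nn t w + c *: N1 t w)).
  by apply/matrixP => i j; rewrite !mxE; ring.
congr (_ + _ + _); rewrite -vintZ; last exact: sub.
rewrite -vintD; [|exact: sub|]; last first.
  move=> l; apply: (L1_eq (itv_meas 0 t) _ (L1Z (itv_meas 0 t) c (sub _ L' l))) => s _.
  by rewrite [RHS]mxE.
apply: eq_vint => s _; rewrite !mulmxDr -!scalemxAr !scalerDr.
by apply/matrixP => i j; rewrite !mxE; ring.
Qed.

Lemma solves_eq ini phi Nn U x ini1 phi1 N1 V y : (forall w, ini w = ini1 w) -> (forall t, 0 <= t <= T -> phi t = phi1 t) ->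
  (forall t w, 0 <= t <= T -> Nn t w = N1 t w) -> (forall t w, 0 <= t <= T -> U t w = V t w) ->
  (forall t w, 0 <= t <= T -> x t w = y t w) -> solves ini phi Nn U x -> solves ini1 phi1 N1 V y.
Proof.
move=> e0 eg eN eU eX [Lx hX]; split; first exact: L2F_eq Lx.
apply: ae_imp hX => w h t tT; have /andP[t0 tT'] := tT.
rewrite -eX// h// -e0 -eN//; congr (_ + _ + _); apply: eq_vint => s /andP[s0 st].
by rewrite eX ?eU ?eg// s0 (le_trans st tT').
Qed.

Lemma L2s0 (q : nat) (l : 'I_q) : L2s lam `[0, T] (fun t => (0 : 'cV[R]_q) l 0).
Proof. by apply: (L2s_eq (itv_meas 0 T) _ (L2s_0 lam (itv_meas 0 T))) => t _; rewrite mxE. Qed.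

Lemma hsol_path V y : L2F P F T V -> hsol V y ->
  {ae P, forall w, ACm 0 T (fun t => y t w) (fun t => AA *m y t w + BB *m V t w) /\ y 0 w = 0}.
Proof.
move=> LV hY; apply: ae_imp (solves_path (@L2s0 m) LV hY) => w [L h].
have h' t : 0 <= t <= T -> y t w = 0 + vint 0 t (fun s => AA *m y s w + BB *m V s w + 0).
  by move=> tT; rewrite [LHS]h// addr0.
split; last by rewrite h' ?lexx// vint_pt addr0.
apply: ACm_eq (vint_ACm T0 L h') => // t tT; by rewrite addr0.
Qed.

Lemma solves_diff ini phi Nn U x V y : (forall l, L2s lam `[0, T] (fun t => phi t l 0)) ->
  L2F P F T U -> L2F P F T V -> solves ini phi Nn U x -> solves ini phi Nn V y ->
  hsol (fun t w => U t w - V t w) (fun t w => x t w - y t w).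
Proof.
move=> Lg LU LV hX hY; have := solves_D (-1) Lg Lg LU LV hX hY.
by apply: solves_eq => *; rewrite scaleN1r// subrr.
Qed.

Lemma solves_perturb c ini phi Nn U x V y : (forall l, L2s lam `[0, T] (fun t => phi t l 0)) ->
  L2F P F T U -> L2F P F T V -> solves ini phi Nn U x -> hsol V y ->
  solves ini phi Nn (fun t w => U t w + c *: V t w) (fun t w => x t w + c *: y t w).
Proof.
move=> Lg LU LV hX hY; have := solves_D c Lg (@L2s0 m) LU LV hX hY.
by apply: solves_eq => *; rewrite ?scaler0 ?addr0.
Qed.

Lemma solves_uniq ini phi Nn U x y : (forall l, L2s lam `[0, T] (fun t => phi t l 0)) ->
  L2F P F T U -> solves ini phi Nn U x -> solves ini phi Nn U y ->
  {ae P, forall w, forall t, 0 <= t <= T -> x t w = y t w}.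
Proof.
move=> Lg LU hX hY; have h := solves_diff Lg LU LU hX hY.
apply: ae_imp (hsol_path (L2FB LU LU) h) => w [hac h0] t /andP[t0 tT].
have /(ode_unique t0) : ACm 0 t (fun t => x t w - y t w) (fun t => AA *m (x t w - y t w)).
  apply: ACm_itv (lexx 0) tT _; apply: ACm_eq hac => // s _.
  by rewrite subrr mulmx0 addr0.
by rewrite h0 mulmx0 => /eqP; rewrite subr_eq0 => /eqP.
Qed.

(** x - Nn solves a linear equation path by path, with source AA Nn + BB U + phi. The primitive in
    the variation of constants formula is taken in its adapted version. *)
Lemma solves_exists (ini : Omega -> 'cV[R]_m) phi Nn U : (forall l, gmeas (F 0) (fun w => ini w l 0)) ->
  (forall l, L2s P setT (fun w => ini w l 0)) -> (forall l, L2s lam `[0, T] (fun t => phi t l 0)) ->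
  L2F P F T Nn -> L2F P F T U -> exists x, solves ini phi Nn U x.
Proof.
move=> gx0 Lx0 Lg LN LU.
pose G t w := AA *m Nn t w + BB *m U t w + phi t.
have LG : L2F P F T G := L2FD (L2FD (L2FM AA LN) (L2FM BB LU)) (L2F_det Lg).
have eN := expm_ACN AA 0 T 0; have eP := expm_AC AA 0 T 0.
have /L2F_SL2 LE := L2F_detM eN LG.
have /choice[I hI] := fun l => SL2_int sF mF T0 (LE l).
pose x t w : 'cV[R]_m := Nn t w + expm AA (t - 0) *m (ini w + \col_l I l t w).
have LFx : L2F P F T (fun _ w => ini w).
  apply/L2F_SL2 => l; split; first exact: ((SL2_L2s_w (Lx0 l)).1).
    by move=> t /andP[t0 _]; apply: (gmeas_le sF mF t0).
  exact: (SL2_L2s_w (Lx0 l)).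
have LI : L2F P F T (fun t w => \col_l I l t w).
  by apply/L2F_SL2 => l; have [h _ _] := hI l; apply: SL2_eq h => t w _; rewrite mxE.
exists x; split; first exact: (L2FD LN (L2F_detM eP (L2FD LFx LI))).
have hI' : {ae P, forall w, forall l, forall t, 0 <= t <= T -> I l t w =
    \int[lam]_(s in `[0, t]) (expm AA (0 - s) *m G s w) l 0}.
  by apply: ae_fin => l; have [] := hI l.
apply: ae_imp2 hI' (L2F_path LG) => w eI LGw t tT.
have Xo s : 0 <= s <= T -> x s w = Nn s w + ode_sol AA 0 (ini w) (fun s => G s w) s.
  move=> sT; congr (_ + _ *m (_ + _)); apply/matrixP => l c; rewrite ord1 !mxE; exact: eI.
have /andP[t0 tT'] := tT.
have := ACm_vint (@ode_solP R m AA 0 T (ini w) (fun s => G s w) T0 LGw) (lexx 0) t0 tT'.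
rewrite (Xo t tT) ode_sol0 => ->; rewrite addrC; congr (_ + _ + _); apply: eq_vint => s /andP[s0 st].
rewrite (Xo s); last by rewrite s0 (le_trans st).
by rewrite /G mulmxDr !addrA (addrC (AA *m Nn s w)).
Qed.

Definition cost (h : 'cV[R]_m) (x : proc m) (U : proc r) : R :=
  ip (fun t w => QQ *m x t w - 2 *: h) x + ip (fun t w => RR *m U t w) U.

(** Half of the derivative of [cost] at (x, U) in the direction (y, V). *)
Definition dcost (h : 'cV[R]_m) (x : proc m) (U : proc r) (y : proc m) (V : proc r) : R :=
  ip (fun t w => QQ *m x t w - h) y + ip (fun t w => RR *m U t w) V.

Lemma L2F_cst (q : nat) (h : 'cV[R]_q) : L2F P F T (fun _ _ => h).
Proof. by apply: L2F_det => l; exact: (L2s_cst (itv_meas 0 T) _ (lam_itv_lty 0 T)). Qed.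

Lemma cost_expand h x U y V c : L2F P F T x -> L2F P F T U -> L2F P F T y -> L2F P F T V ->
  cost h (fun t w => x t w + c *: y t w) (fun t w => U t w + c *: V t w) =
  cost h x U + 2 * c * dcost h x U y V + c ^+ 2 * cost 0 y V.
Proof.
move=> Lx LU LY LV.
have LK (q : nat) (a b : proc q) : L2F P F T a -> L2F P F T b ->
  L1 (lam \x P)%E DD (fun p : R * Omega => wt p.1 * dot (a p.1 p.2) (b p.1 p.2)).
  by move=> La Lb; apply: ip_L1; exact: L2F_L2P.
have Lh := L2F_cst h.
have L2h : L2F P F T (fun t w => QQ *m x t w - 2 *: h) := L2FB (L2FM QQ Lx) (L2F_cst (2 *: h)).
have L1h : L2F P F T (fun t w => QQ *m x t w - h) := L2FB (L2FM QQ Lx) Lh.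
have L0h : L2F P F T (fun t w => QQ *m y t w - 2 *: 0) := L2FB (L2FM QQ LY) (L2F_cst (2 *: 0)).
have LRU := L2FM RR LU; have LRV := L2FM RR LV.
rewrite /cost /dcost {1 2}/ip.
have LXY : L2F P F T (fun t w => x t w + c *: y t w) := L2FD Lx (L2FZ c LY).
have LUV : L2F P F T (fun t w => U t w + c *: V t w) := L2FD LU (L2FZ c LV).
rewrite -(IntD (mDD T) (LK _ _ _ (L2FB (L2FM QQ LXY) (L2F_cst (2 *: h))) LXY) (LK _ _ _ (L2FM RR LUV) LUV)).
rewrite /ip -(IntD (mDD T) (LK _ _ _ L2h Lx) (LK _ _ _ LRU LU)) -(IntD (mDD T) (LK _ _ _ L1h LY) (LK _ _ _ LRU LV)).
rewrite -(IntD (mDD T) (LK _ _ _ L0h LY) (LK _ _ _ LRV LV)).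
have M1 := L1D (mDD T) (LK _ _ _ L2h Lx) (LK _ _ _ LRU LU).
have M2 := L1D (mDD T) (LK _ _ _ L1h LY) (LK _ _ _ LRU LV).
have M3 := L1D (mDD T) (LK _ _ _ L0h LY) (LK _ _ _ LRV LV).
rewrite -(IntZ (mDD T) (2 * c) M2) -(IntZ (mDD T) (c ^+ 2) M3) -(IntD (mDD T) M1 (L1Z (mDD T) (2 * c) M2)).
rewrite -(IntD (mDD T) (L1D (mDD T) M1 (L1Z (mDD T) (2 * c) M2)) (L1Z (mDD T) (c ^+ 2) M3)).
apply: Int_eq => -[t w] _ /=; have [RRs _] := RRp.
rewrite scaler0 subr0 !mulmxDr -!scalemxAr !(dotDl, dotDr, dotZl, dotZr, dotNl, dotNr).
rewrite (dotMl QQ (y t w) (x t w)) QQs (dotC (y t w)).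
rewrite (dotMl RR (V t w) (U t w)) RRs (dotC (V t w)).
by ring.
Qed.

Lemma quad_min (l q : R) : (forall c : R, 0 <= 2 * c * l + c ^+ 2 * q) -> l = 0 /\ 0 <= q.
Proof.
move=> H.
have q0 : 0 <= q by have := H 1; have := H (-1); lra.
(* The shift by 1 allows q = 0; the polynomial takes the value -l^2 (q + 2) / (q + 1)^2. *)
split=> //; have := H (- l / (q + 1)).
have q1 : 0 < q + 1 by lra.
rewrite (_ : _ + _ = - (l ^+ 2 * (q + 2) / (q + 1) ^+ 2)); last by field; rewrite gt_eqF.
rewrite oppr_ge0 pmulr_lle0 ?invr_gt0 ?exprn_gt0// pmulr_lle0; last lra.
by move=> h; apply/eqP; rewrite -sqrf_eq0 eq_le h sqr_ge0.
Qed.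

Lemma first_order ini phi Nn U x (h : 'cV[R]_m) : (forall l, L2s lam `[0, T] (fun t => phi t l 0)) ->
  L2F P F T U -> solves ini phi Nn U x ->
  (forall V y, L2F P F T V -> solves ini phi Nn V y -> cost h x U <= cost h y V) ->
  forall V y, L2F P F T V -> hsol V y -> dcost h x U y V = 0 /\ 0 <= cost 0 y V.
Proof.
move=> Lphi LU hx hopt V y LV hy; apply: quad_min => c.
have := hopt _ _ (L2FD LU (L2FZ c LV)) (solves_perturb c Lphi LU LV hx hy).
rewrite (cost_expand h c hx.1 LU hy.1 LV); lra.
Qed.

Lemma L2FgmeasE (q : nat) (z : proc q) t l : L2F P F T z -> 0 <= t <= T -> gmeas (F t) (fun w => z t w l 0).
Proof. by move=> /(L2Fc l)[_ h _] tT; exact: (h t tT). Qed.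

Lemma L2F_int (q : nat) (z : proc q) : L2F P F T z -> exists I : proc q, [/\ L2F P F T I,
  {ae P, forall w, forall t, 0 <= t <= T -> I t w = vint 0 t (fun s => z s w)} &
  forall t l, 0 <= t <= T -> L2s P setT (fun w => I t w l 0)].
Proof.
move=> /L2F_SL2 Lz; have /choice[I hI] := fun l => SL2_int sF mF T0 (Lz l).
have E l : (fun t w => (\col_l I l t w) l 0) = I l by apply/funext => t; apply/funext => w; rewrite mxE.
exists (fun t w => \col_l I l t w); split.
- by apply/L2F_SL2 => l; rewrite E; have [] := hI l.
- have h : {ae P, forall w, forall l, forall t, 0 <= t <= T -> I l t w =
     \int[lam]_(s in `[0, t]) z s w l 0} by apply: ae_fin => l; have [] := hI l.
  by apply: ae_imp h => w h t tT; apply/matrixP => l c; rewrite ord1 !mxE h.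
- move=> t l tT; have [_ _ h] := hI l.
  have -> : (fun w => (\col_l I l t w) l 0) = I l t by apply/funext => w; rewrite mxE.
  exact: h.
Qed.

(** Membership in [L2F] controls second moments at almost every time only; the integral equation
    yields them at every time. *)
Lemma solves_L2s ini phi Nn U x t l : (forall l, L2s lam `[0, T] (fun t => phi t l 0)) ->
  (forall l, L2s P setT (fun w => ini w l 0)) -> (forall t l, 0 <= t <= T -> L2s P setT (fun w => Nn t w l 0)) ->
  L2F P F T U -> solves ini phi Nn U x -> 0 <= t <= T -> L2s P setT (fun w => x t w l 0).
Proof.
move=> Lphi Li LN LU hx tT.
have [I [LI eI SI]] := L2F_int (L2FD (L2FD (L2FM AA hx.1) (L2FM BB LU)) (L2F_det Lphi)).
apply: (@L2s_ae _ _ _ _ _ measurableT (fun w => ini w l 0 + I t w l 0 + Nn t w l 0)).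
- exact: (gmeas_meas (sF t) (L2FgmeasE l hx.1 tT)).
- by apply: ae_imp2 eI hx.2 => w e1 e2 _; rewrite e2// mxE mxE e1.
- by apply: (L2sD measurableT _ (LN t l tT)); apply: (L2sD measurableT (Li l)); exact: SI.
Qed.

(* The adjoint p is the optional projection of the anticipating backward
   integral I_T - I_t of gam. *)
Lemma duality (gam p I y : proc m) V : L2F P F T gam -> L2F P F T p -> L2F P F T I ->
  {ae P, forall w, forall t, 0 <= t <= T -> I t w = vint 0 t (fun s => gam s w)} ->
  (forall t l, 0 <= t <= T -> L2s P setT (fun w => I t w l 0)) ->
  (forall t l, 0 < t <= T -> L2s P setT (fun w => p t w l 0) /\
     orth P (F t) (fun w => I T w l 0 - I t w l 0 - p t w l 0)) ->
  L2F P F T V -> hsol V y ->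
  ip (fun t w => gam t w - AR *m p t w) y = ip (fun t w => BB^T *m p t w) V.
Proof.
move=> Lg Lp LI eI SI op LV hy.
have TT : 0 <= T <= T by rewrite T0 lexx.
pose G : proc m := fun t w => I T w - I t w.
pose Zp : proc m := fun t w => (AA - rho%:M) *m y t w + BB *m V t w.
have LZ : L2F P F T Zp := L2FD (L2FM _ hy.1) (L2FM BB LV).
have LIT : L2P (fun _ : R => I T) by move=> l; exact: (SL2_L2s_w (SI T l TT)).
have LG : L2P G := L2PB LIT (L2F_L2P LI).
(* Pathwise pairing of the anticipating G, which vanishes at T, with y, which vanishes at 0. *)
have step1 : ip G Zp = ip gam y.
  apply/eqP; rewrite -subr_eq0 -(IntB (mDD T) (ip_L1 LG (L2F_L2P LZ)) (ip_L1 (L2F_L2P Lg) (L2F_L2P hy.1))).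
  have L := L1B (mDD T) (ip_L1 LG (L2F_L2P LZ)) (ip_L1 (L2F_L2P Lg) (L2F_L2P hy.1)).
  have := fubini_slab1 (itv_meas 0 T) (fun t w => wt t * dot (G t w) (Zp t w) - wt t * dot (gam t w) (y t w)) L.
  move=> <-; apply/eqP; rewrite -[RHS](Int_0 P setT); apply: Int_ae => //.
  - exact: (L1_meas measurableT (slab_L1_int1 (itv_meas 0 T) (fun t w => wt t * dot (G t w) (Zp t w) - wt t * dot (gam t w) (y t w)) L)).
  - apply: ae_imp2 (ae_and (L2F_path Lg) eI) (hsol_path LV hy) => w [Lgw eIw] [hy' y0] _.
    have hG : ACm 0 T (fun t => G t w) (fun t => - gam t w).
      have hI : ACm 0 T (fun t => I t w) (fun t => gam t w).
        by apply: (vint_ACm (y0 := 0) T0 Lgw) => t tT; rewrite add0r; exact: eIw.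
      by apply: ACm_eq (ACm_sub (ACm_cst 0 T (I T w)) hI) => // t _; rewrite sub0r.
    rewrite -[RHS](pairing T0 hG hy' (subrr _) y0); apply: Int_eq => t _.
    rewrite /Zp mulmxBl mul_scalar_mx !dotDr !dotNr dotNl dotZr; ring.
(* At every t > 0, G - p has conditional mean 0 given F_t, and Zp is F_t-measurable; time 0 is
   discarded as a null set. *)
have step2 : ip G Zp = ip p Zp.
  apply/eqP; rewrite -subr_eq0 -(IntB (mDD T) (ip_L1 LG (L2F_L2P LZ)) (ip_L1 (L2F_L2P Lp) (L2F_L2P LZ))).
  have L := L1B (mDD T) (ip_L1 LG (L2F_L2P LZ)) (ip_L1 (L2F_L2P Lp) (L2F_L2P LZ)).
  rewrite -(fubini_slab2 (itv_meas 0 T) (fun t w => wt t * dot (G t w) (Zp t w) - wt t * dot (p t w) (Zp t w)) L).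
  apply/eqP; rewrite -[RHS](Int_0 lam `[0, T]); apply: (Int_ae (itv_meas 0 T)).
  - exact: (L1_meas (itv_meas 0 T) (slab_L1_int2 (itv_meas 0 T) (fun t w => wt t * dot (G t w) (Zp t w) - wt t * dot (p t w) (Zp t w)) L)).
  - exact: measurable_cst.
  have Z2 : {ae lam, forall t, forall l, `[0, T]%classic t -> L2s P setT (fun w => Zp t w l 0)}.
    apply: ae_fin => l; have := slab_L1_2 (itv_meas 0 T) (fun t w => Zp t w l 0 ^+ 2) (L2F_L2P LZ l).2.
    apply: ae_imp => t ht tT; split; last exact: ht.
    by apply: (gmeas_meas (sF t)); apply: (L2FgmeasE l LZ); move: tT; rewrite /= in_itv.
  have nz : {ae lam, forall t : R, t != 0}.
    exists [set 0 : R]; split; [exact: measurable_set1|exact: lebesgue_measure_set1|].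
    by move=> t /= /negP; rewrite negbK => /eqP.
  apply: ae_imp2 nz Z2 => t tn0 ht tT.
  have t0T : 0 <= t <= T by move: tT; rewrite /= in_itv.
  have tgt : 0 < t <= T by case/andP: t0T => t0 ->; rewrite lt_neqAle eq_sym tn0 t0.
  pose e l w := I T w l 0 - I t w l 0 - p t w l 0.
  have Le l : L2s P setT (e l).
    by have [hp _] := op t l tgt; apply: (L2sB measurableT _ hp); apply: L2sB => //; apply: SI.
  have LM l : L1 P setT (fun w => Zp t w l 0 * e l w) by apply: L2sM => //; exact: ht.
  rewrite (Int_eq P (g := fun w => wt t * \sum_l Zp t w l 0 * e l w)) => [|w _]; last first.
    rewrite -mulrBr -dotNl -dotDl dotC dotE; congr (_ * _).
    by apply: eq_bigr => l _; rewrite /e !mxE.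
  rewrite (IntZ measurableT); last exact: (L1_sum measurableT).
  rewrite (Int_sum measurableT)// big1 ?mulr0// => l _.
  have [_ o] := op t l tgt.
  by apply: (orth_ext (sF t) (L2s_L1P (Le l)) o _ (LM l)); exact: (L2FgmeasE l LZ).
rewrite (ipBl (L2F_L2P hy.1) (L2F_L2P Lg) (L2F_L2P (L2FM _ Lp))) -step1 step2.
rewrite (ipDr (L2F_L2P Lp) (L2F_L2P (L2FM _ hy.1)) (L2F_L2P (L2FM _ LV))).
rewrite (ipM AR) trmxK ipMr.
by rewrite addrAC subrr add0r ipMr.
Qed.

(** E[z_t 1_A], a deterministic function of time. Letting A range over F_a recovers conditional
    expectations given F_a from ordinary differential equations. *)
Definition mean (A : set Omega) (q : nat) (z : proc q) (t : R) : 'cV[R]_q :=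
  \col_l \int[P]_(w in A) z t w l 0.

Lemma L2F_aeL1 (q : nat) (z : proc q) : L2F P F T z ->
  {ae lam, forall t, forall l, `[0, T]%classic t -> L1 P setT (fun w => z t w l 0)}.
Proof.
move=> Lz; apply: ae_fin => l.
exact: (slab_L1_2 (itv_meas 0 T) (fun t w => z t w l 0) (SL2_L1 (L2Fc l Lz))).
Qed.

Lemma mean_lin (A : set Omega) (p q : nat) (M : 'M[R]_(p, q)) (h : 'cV[R]_p) (z : proc q) t : measurable A ->
  (forall l, L1 P setT (fun w => z t w l 0)) ->
  mean A (fun t w => M *m z t w + h) t = M *m mean A z t + fine (P A) *: h.
Proof.
move=> mA Lz; have Lz' l := L1_setT mA (Lz l).
apply/matrixP => l c; rewrite ord1 !mxE.
rewrite (Int_eq P (g := fun w => \sum_k M l k * z t w k 0 + h l 0)) => [|w _]; last by rewrite !mxE.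
rewrite (IntD mA); [|by apply: (L1_sum mA) => k _; exact: (L1Z mA)|]; last first.
  by apply: (L1_cst mA); apply: le_lt_trans (P_lty P); apply: le_measure; rewrite ?inE.
rewrite (Int_sum mA) => [|k _]; last exact: (L1Z mA).
rewrite (Rintegral_cst P mA) mulrC; congr (_ + _); apply: eq_bigr => k _.
by rewrite (IntZ mA) ?mxE.
Qed.

Lemma meanM (A : set Omega) (p q : nat) (M : 'M[R]_(p, q)) (z : proc q) t : measurable A ->
  (forall l, L1 P setT (fun w => z t w l 0)) -> mean A (fun t w => M *m z t w) t = M *m mean A z t.
Proof.
move=> mA Lz; have := mean_lin M 0 mA Lz; rewrite scaler0 addr0 => <-.
by apply/matrixP => l c; rewrite !mxE; apply: Int_eq => w _; rewrite addr0.
Qed.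

Lemma L1_ind_DD A (q : nat) (z : proc q) l : measurable A -> L2F P F T z ->
  L1 (lam \x P)%E DD (fun p : R * Omega => \1_A p.2 * z p.1 p.2 l 0).
Proof.
move=> mA Lz; apply: (L1_bddM (mDD T) (SL2_L2s_w (ind_L2s P mA)).1 (c := 1)) => [p _|].
  exact: ind_le1.
exact: (SL2_L1 (L2Fc l Lz)).
Qed.

Lemma mean_L2s A (q : nat) (z : proc q) l : measurable A -> L2F P F T z -> L2s lam `[0, T] (fun t => mean A z t l 0).
Proof.
move=> mA Lz.
have mI0 := itv_meas 0 T.
have LA := L1_ind_DD l mA Lz.
have mm : measurable_fun `[0, T] (fun t => mean A z t l 0).
  have := L1_meas mI0 (slab_L1_int2 mI0 (fun t w => \1_A w * z t w l 0) LA).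
  by apply: eq_measurable_fun => t _; rewrite mxE Int_ind.
split=> //.
have Lsq := slab_L1_int2 mI0 (fun t w => z t w l 0 ^+ 2) (L2F_L2P Lz l).2.
have := slab_L1_2 mI0 (fun t w => z t w l 0 ^+ 2) (L2F_L2P Lz l).2.
move=> h.
(* The bound of (E[z 1_A])^2 by E[z^2] is available at almost every t only; the minimum of the two
   sides is dominated everywhere. *)
apply: (L1_ae mI0 (f := fun t => Num.min (mean A z t l 0 ^+ 2) (\int[P]_w (z t w l 0 ^+ 2)))); first exact: measurable_funX.
  apply: ae_imp h => t ht tT; rewrite min_l// mxE -(Int_ind P _ mA).
  have L2z : L2s P setT (fun w => z t w l 0).
    by split; [apply: (gmeas_meas (sF t)); apply: (L2FgmeasE l Lz); move: tT; rewrite /= in_itv|exact: ht].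
  have L2A := ind_L2s P mA.
  apply: le_trans (Cauchy_Schwarz measurableT L2A L2z) _; rewrite ler_piMl//.
    by apply: Int_ge0 => w _; exact: sqr_ge0.
  have := Int_le measurableT L2A.2 (L1_cst measurableT 1 (P_lty P)) => /(_ _)/le_trans; apply.
    by move=> w _; rewrite indicE; case: (_ \in _); rewrite ?expr1n ?expr0n.
  have PT : fine (P setT) = 1 by rewrite probability_setT.
  by rewrite (Rintegral_cst P measurableT) mul1r PT.
apply: (L1_le mI0 _ _ Lsq); first by apply: measurable_minr; [exact: measurable_funX|exact: (L1_meas mI0 Lsq)].
move=> t _; rewrite ger0_norm ?ge_min ?lexx ?orbT// le_min sqr_ge0.
by apply: Int_ge0 => w _; exact: sqr_ge0.
Qed.

(** The process is adapted because A is already known whenever k is different from 0. *)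
Lemma L2F_tensor A a (q : nat) (k : R -> 'cV[R]_q) : F a A -> (forall t, t <= a -> k t = 0) ->
  (forall l, L2s lam `[0, T] (fun t => k t l 0)) -> L2F P F T (fun t w => \1_A w *: k t).
Proof.
move=> FA k0 Lk; apply/L2F_SL2 => l; have mA := (sF a).2 _ FA.
have h := ind_L2s P mA.
have [mk _ L2k] := SL2_det P F (Lk l).
apply: (SL2_eq (z := fun t w => \1_A w * k t l 0)) => [t w _|]; first by rewrite mxE.
split.
- by apply: measurable_funM => //; exact: (SL2_L2s_w h).1.
- move=> t _; have [ta|at_] := leP t a.
    rewrite (_ : (fun w => _) = fun=> 0); first exact: gmeas_cst.
    by apply/funext => w; rewrite k0// mxE mulr0.
  apply: gmeasM; last exact: gmeas_cst.
  by apply: (gmeas_le sF mF (ltW at_)); apply: gmeas_ind => //; exact: (sF a).1.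
- apply: (L2s_bddM (mDD T) (c := 1) (SL2_L2s_w h).1 _ L2k) => p _.
  by exact: ind_le1.
Qed.

Lemma ip_tensor A a (q : nat) (k : R -> 'cV[R]_q) (z : proc q) : F a A -> (forall t, t <= a -> k t = 0) ->
  (forall l, L2s lam `[0, T] (fun t => k t l 0)) -> L2F P F T z ->
  ip z (fun t w => \1_A w *: k t) = \int[lam]_(t in `[0, T]) (wt t * dot (mean A z t) (k t)).
Proof.
move=> FA k0 Lk Lz; have mA := (sF a).2 _ FA.
have L := ip_L1 (L2F_L2P Lz) (L2F_L2P (L2F_tensor FA k0 Lk)).
have L1m := wt_dot_L1 (fun l => mean_L2s l mA Lz) Lk.
rewrite /ip -(fubini_slab2 (itv_meas 0 T) (fun t w => wt t * dot (z t w) (\1_A w *: k t)) L).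
apply: (Int_ae (itv_meas 0 T) _ (L1_meas (itv_meas 0 T) L1m)).
  exact: (L1_meas (itv_meas 0 T) (slab_L1_int2 (itv_meas 0 T) (fun t w => wt t * dot (z t w) (\1_A w *: k t)) L)).
apply: ae_imp (L2F_aeL1 Lz) => t ht tT.
rewrite (Int_eq P (g := fun w => \sum_l (wt t * k t l 0) * (\1_A w * z t w l 0))) => [|w _]; last first.
  by rewrite dotE mulr_sumr; apply: eq_bigr => l _; rewrite mxE; ring.
have Lz' l := ht l tT.
rewrite (Int_sum measurableT) => [|l _]; last by apply: (L1Z measurableT); exact: L1_ind.
rewrite dotE mulr_sumr; apply: eq_bigr => l _.
rewrite (IntZ measurableT); last exact: L1_ind.
by rewrite Int_ind// [mean _ _ _ _ _]mxE; ring.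
Qed.

(** p is the deterministic adjoint driven by the mean of the gradient on A. The defect v = BB^T p +
    E[RR U 1_A], cut to times after a and multiplied by 1_A, is itself used as direction:
    stationarity and [pairing] give that the weighted integral of |v|^2 after a is 0. *)
Lemma mean_optimality A a (gam : proc m) U : 0 <= a -> F a A -> L2F P F T gam -> L2F P F T U ->
  (forall V y, L2F P F T V -> hsol V y -> ip gam y + ip (fun t w => RR *m U t w) V = 0) ->
  exists p : R -> 'cV[R]_m, [/\ ACm 0 T p (fun t => - (AR *m p t) - mean A gam t), p T = 0 &
    {ae lam, forall t, a < t <= T -> RR *m mean A U t = - (BB^T *m p t)}].
Proof.
move=> a0 FA Lgam LU H; have mA := (sF a).2 _ FA.
have mI0 := itv_meas 0 T.
have LRU := L2FM RR LU.
have Lg' l : L1 lam `[0, T] (fun t => (- mean A gam t) l 0).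
  apply: (L1_eq mI0 _ (L1N mI0 (L2s_L1 mI0 (lam_itv_lty 0 T) (mean_L2s l mA Lgam)))) => t _.
  by rewrite [RHS]mxE.
have [p [hp pT]] := ode_backward (- AR) 0 T0 Lg'.
have {}hp : ACm 0 T p (fun t => - (AR *m p t) - mean A gam t).
  by apply: ACm_eq hp => // t _; rewrite mulNmx.
pose v t := BB^T *m p t + mean A (fun t w => RR *m U t w) t.
pose c t : 'cV[R]_r := (a < t)%R%:R *: v t.
have Lv l : L2s lam `[0, T] (fun t => v t l 0).
  have [C hC] := AC_bdd (ACm_mull BB^T hp l 0).
  apply: (L2s_eq mI0 _ (L2sD mI0 (L2s_bdd mI0 (c := C) (lam_itv_lty 0 T) (AC_meas T0 (ACm_mull BB^T hp l 0)) _) (mean_L2s l mA LRU))).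
    by move=> t _; rewrite [RHS]mxE.
  by move=> t tT; apply: hC.
have Lc l : L2s lam `[0, T] (fun t => c t l 0).
  apply: (L2s_eq mI0 (f := fun t => (a < t)%R%:R * v t l 0)) => [t _|]; first by rewrite [RHS]mxE.
  apply: (L2s_bddM mI0 (c := 1) _ _ (Lv l)).
    apply: (measurable_funS measurableT (@subsetT _ _)).
    rewrite (_ : (fun t : R => _) = \1_(`]a, +oo[%classic : set R)); last first.
      by apply/funext => t; rewrite indicE mem_setE in_itv /= andbT.
    by apply: measurable_indic; exact: measurable_itv.
  by move=> t _; case: (_ < _); rewrite ?normr1 ?normr0.
have c0 t : t <= a -> c t = 0 by move=> ta; rewrite /c ltNge ta scale0r.
have LBc l : L1 lam `[0, T] (fun t => (BB *m c t) l 0).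
  apply: (L1_eq mI0 (f := fun t => \sum_k BB l k * c t k 0)) => [t _|]; first by rewrite [RHS]mxE.
  by apply: (L1_sum mI0) => k _; apply: (L1Z mI0); exact: (L2s_L1 mI0 (lam_itv_lty 0 T)).
pose y := ode_sol AA 0 0 (fun t => BB *m c t).
have hy : ACm 0 T y (fun t => AA *m y t + BB *m c t) := @ode_solP R m AA 0 T 0 (fun t => BB *m c t) T0 LBc.
have y0 t : t <= a -> y t = 0.
  move=> ta; rewrite /y /ode_sol (eq_vint (g := fun=> 0)) => [|s /andP[_ st]].
    rewrite add0r (_ : vint _ _ _ = 0) ?mulmx0//.
    by apply/matrixP => i j; rewrite !mxE (Int_eq _ (g := fun=> 0)) ?Int_0// => s _; rewrite mxE.
  by rewrite c0 ?mulmx0 ?mulmx0// (le_trans st).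
have Ly l : L2s lam `[0, T] (fun t => y t l 0).
  exact: (AC_L2s T0 (hy l 0)).
have hs : hsol (fun t w => \1_A w *: c t) (fun t w => \1_A w *: y t).
  split; first exact: (L2F_tensor FA y0 Ly).
  apply: ae_true => w t /andP[t0 tT].
  rewrite (ACm_vint hy (lexx 0) t0 tT) y0// !add0r addr0 -vintZ => [|l].
    by apply: eq_vint => s _; rewrite -!scalemxAr -scalerDr addr0.
  by apply: (L1_sub (lexx 0) tT); exact: (hy l 0).1.
have := H _ _ (L2F_tensor FA c0 Lc) hs.
rewrite (ip_tensor FA y0 Ly Lgam) (ip_tensor FA c0 Lc LRU).
have L3 := wt_dot_L1 (fun l => mean_L2s l mA Lgam) Ly.
have L4 := wt_dot_L1 (fun l => mean_L2s l mA LRU) Lc.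
have := pairing T0 hp hy pT (y0 0 a0); have L5 := pairing_L1 T0 hp hy.
move=> e1 e2.
have e3 : \int[lam]_(t in `[0, T]) (wt t * dot (c t) (c t)) = 0.
  rewrite -[RHS](etrans (congr2 +%R e1 e2) (addr0 0)).
  rewrite -(IntD mI0 L3 L4) -(IntD mI0 L5 (L1D mI0 L3 L4)).
  apply: Int_eq => t _; rewrite !dotDr !dotDl !dotNl (dotMl AR) trmxK mulmxBl mul_scalar_mx dotDr dotNr dotZr.
  rewrite /c !dotZr !dotZl (dotMr BB) /v dotDl dotDr dotDr.
  by rewrite dotZr dotDr; case: (a < t); rewrite /= ?mulr1n ?mulr0n; ring.
exists p; split=> //.
have c00 t : 0 <= wt t * dot (c t) (c t) by apply: mulr_ge0; [exact: ltW (wt_gt0 t)|exact: sqnorm_ge0].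
have := Int_ge0_ae0 mI0 (wt_dot_L1 Lc Lc) (fun t _ => c00 t); rewrite e3 => /(_ (lexx _)) hc.
apply: ae_imp2 hc (L2F_aeL1 LU) => t h1 h2 /andP[at_ tT].
have tI : `[0, T]%classic t by rewrite /= in_itv /= tT (le_trans a0 (ltW at_)).
have := h1 tI => /eqP; rewrite mulf_eq0 gt_eqF ?wt_gt0//= => /eqP ec.
have : c t = 0.
  apply/matrixP => l k; rewrite ord1 [RHS]mxE.
  have := sqr_le_sqnorm (c t) l; rewrite /sqnorm -/(dot _ _) ec => s.
  by apply/eqP; rewrite -sqrf_eq0 eq_le s sqr_ge0.
rewrite /c at_ scale1r /v (meanM RR mA (fun l => h2 l tI)) => /eqP.
by rewrite addrC addr_eq0 => /eqP.
Qed.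

Definition sitov (q : nat) j (b Z : proc q) := forall l, sito j (fun t w => b t w l 0) (fun t w => Z t w l 0).

Lemma mean_int A (q : nat) (z : proc q) t l : measurable A -> L2F P F T z -> 0 <= t <= T ->
  \int[P]_(w in A) (vint 0 t (fun s => z s w) l 0) = vint 0 t (mean A z) l 0.
Proof.
move=> mA Lz /andP[t0 tT]; have mI := itv_meas 0 t.
have LA : L1 (lam \x P)%E (`[0, t] `*` [set: Omega]) (fun p : R * Omega => \1_A p.2 * z p.1 p.2 l 0).
  apply: integrableS (L1_ind_DD l mA Lz); [exact: (mDD T)|exact: (mDD t)|].
  by move=> -[s w] [/= + _]; rewrite !in_itv /= => /andP[-> st]; split=> //; exact: le_trans tT.
rewrite -(Int_ind P _ mA) mxE.
rewrite (Int_eq P (g := fun w => \int[lam]_(s in `[0, t]) (\1_A w * z s w l 0))) => [|w _]; last first.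
  rewrite mxE indicE; case: (_ \in _); rewrite ?mul1r ?mul0r.
    by apply: Int_eq => s _; rewrite mul1r.
  by rewrite (Int_eq _ (g := fun=> 0)) ?Int_0// => s _; rewrite mul0r.
rewrite (fubini_slab mI (fun s w => \1_A w * z s w l 0) LA).
by apply: Int_eq => s _; rewrite mxE Int_ind.
Qed.

Lemma mean_primitive A (q : nat) (z I : proc q) t l : measurable A -> L2F P F T z ->
  {ae P, forall w, forall t, 0 <= t <= T -> I t w = vint 0 t (fun s => z s w)} ->
  L2s P setT (fun w => I t w l 0) -> 0 <= t <= T ->
  \int[P]_(w in A) I t w l 0 = vint 0 t (mean A z) l 0.
Proof.
move=> mA Lz eI SI tT; rewrite -(mean_int l mA Lz tT); have /andP[t0 tT'] := tT.
apply: (Int_ae mA).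
- by apply: (measurable_funS measurableT (@subsetT _ _)); exact: SI.1.
- apply: (measurable_funS measurableT (@subsetT _ _)).
  have hh : L1 P setT (fun w => \int[lam]_(u in `[0, t]) z u w l 0).
    apply: (slab_L1_int1 (itv_meas 0 t) (fun u w => z u w l 0)).
    apply: integrableS (SL2_L1 (L2Fc l Lz)); [exact: (mDD T)|exact: (mDD t)|].
    by move=> -[u w] [/= + _]; rewrite !in_itv /= => /andP[-> us]; split=> //; exact: le_trans tT'.
  by apply: eq_measurable_fun (L1_meas measurableT hh) => w _; rewrite mxE.
- by apply: ae_imp eI => w e _; rewrite e.
Qed.

Variables (phi : R -> 'cV[R]_m) (h : 'cV[R]_m) (ini : Omega -> 'cV[R]_m).
Variables (sg : J -> R -> 'cV[R]_m) (Zs : J -> proc m).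
Hypothesis Lphi : forall l, L2s lam `[0, T] (fun t => phi t l 0).
Hypothesis csg : forall j l, {within `[0, T], continuous (fun t => sg j t l 0)}.
Hypothesis Lini : forall l, L2s P setT (fun w => ini w l 0).
Hypothesis hZs : forall j, sitov j (fun t _ => sg j t) (Zs j).
Let Nn : proc m := fun t w => \sum_j Zs j t w.

Lemma ito_sum_L2s (q : nat) (b Z : J -> proc q) t l : (forall j, sitov j (b j) (Z j)) ->
  0 <= t <= T -> L2s P setT (fun w => (\sum_j Z j t w) l 0).
Proof.
move=> hZ tT; apply: (L2s_eq measurableT (f := fun w => \sum_j Z j t w l 0)) => [w _|].
  by rewrite summxE.
by apply: (L2s_sum measurableT) => j _; exact: (sito_L2 (hZ j l) tT).
Qed.

Lemma ito_sum_orth (q : nat) (b Z : J -> proc q) s t l : (forall j, sitov j (b j) (Z j)) ->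
  0 <= s -> s <= t -> t <= T ->
  orth P (F s) (fun w => (\sum_j Z j t w) l 0 - (\sum_j Z j s w) l 0).
Proof.
move=> hZ s0 st tT A FA; have mA := (sF s).2 _ FA.
have LZ u j : 0 <= u <= T -> L1 P A (fun w => Z j u w l 0).
  by move=> uT; apply: (L1_setT mA); apply: (L2s_L1P); exact: (sito_L2 (hZ j l) uT).
have sT : 0 <= s <= T by rewrite s0 (le_trans st).
have tT' : 0 <= t <= T by rewrite tT (le_trans s0).
rewrite (Int_eq P (g := fun w => \sum_j (Z j t w l 0 - Z j s w l 0))) => [|w _]; last first.
  by rewrite !summxE sumrB.
rewrite (Int_sum mA) => [|j _]; last by apply: (L1B mA); exact: LZ.
by rewrite big1// => j _; exact: (sito_orth (hZ j l) s0 st tT).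
Qed.

(** After a the noise has increments of zero mean on A, so only the drift survives. *)
Lemma mean_solves A a U x : 0 <= a <= T -> F a A -> L2F P F T U -> solves ini phi Nn U x ->
  ACm a T (mean A x) (fun t => AA *m mean A x t + BB *m mean A U t + fine (P A) *: phi t).
Proof.
move=> /andP[a0 aT] FA LU hx; have mA := (sF a).2 _ FA.
pose b : proc m := fun t w => AA *m x t w + BB *m U t w + phi t.
have Lb : L2F P F T b := L2FD (L2FD (L2FM AA hx.1) (L2FM BB LU)) (L2F_det Lphi).
have [I [LI eI SI]] := L2F_int Lb.
have LN t l (tT : 0 <= t <= T) := ito_sum_L2s l hZs tT.
have key t : a <= t <= T -> mean A x t = (mean A (fun _ => ini) 0 + mean A Nn a) + vint 0 t (mean A b).
  move=> /andP[at_ tT]; have t0 := le_trans a0 at_.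
  have t0T : 0 <= t <= T by rewrite t0.
  have a0T : 0 <= a <= T by rewrite a0.
  apply/matrixP => l c; rewrite ord1 [RHS]mxE -(mean_primitive mA Lb eI (SI t l t0T) t0T) !mxE.
  rewrite (Int_ae mA (g := fun w => ini w l 0 + I t w l 0 + Nn t w l 0)); last 3 first.
  - apply: (measurable_funS measurableT (@subsetT _ _)); exact: (gmeas_meas (sF t) (L2FgmeasE l hx.1 t0T)).
  - apply: (measurable_funS measurableT (@subsetT _ _)).
    by apply: measurable_funD; [apply: measurable_funD; [exact: (Lini l).1|exact: (SI t l t0T).1]|exact: (LN t l t0T).1].
  - by apply: ae_imp2 eI hx.2 => w e1 e2 _; rewrite e2// !mxE e1// mxE.
  rewrite (IntD mA (L1D mA (L2s_L1A mA (Lini l)) (L2s_L1A mA (SI t l t0T))) (L2s_L1A mA (LN t l t0T))).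
  rewrite (IntD mA (L2s_L1A mA (Lini l)) (L2s_L1A mA (SI t l t0T))) addrAC; congr (_ + _ + _).
  apply/eqP; rewrite -subr_eq0 -(IntB mA (L2s_L1A mA (LN t l t0T)) (L2s_L1A mA (LN a l a0T))); apply/eqP.
  exact: (ito_sum_orth l hZs a0 at_ tT).
have Lmb l : L1 lam `[0, T] (fun t => mean A b t l 0) := L2s_L1 (itv_meas 0 T) (lam_itv_lty 0 T) (mean_L2s l mA Lb).
have h1 : ACm a T (mean A x) (mean A b).
  have hh : ACm 0 T (fun t => (mean A (fun _ => ini) 0 + mean A Nn a) + vint 0 t (mean A b)) (mean A b).
    by apply: (vint_ACm T0 Lmb) => t _.
  by apply: ACm_eq (ACm_itv a0 (lexx T) hh) => // t tT; rewrite key.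
(* Splitting the mean of the drift requires integrability at fixed times, known for almost every
   time; the density is adjusted on the remaining null set. *)
move=> l c; apply: AC_aed (h1 l c).
  rewrite ord1; apply: (measurable_funS (itv_meas 0 T)) => [t|].
    by rewrite /= !in_itv /= => /andP[at_ ->]; rewrite (le_trans a0).
  have -> : (fun t => (AA *m mean A x t + BB *m mean A U t + fine (P A) *: phi t) l 0) =
    (fun t => \sum_k AA l k * mean A x t k 0 + \sum_k BB l k * mean A U t k 0 + fine (P A) * phi t l 0).
    by apply/funext => t; rewrite !mxE.
  have mI := itv_meas 0 T.
  have L (q : nat) (z : proc q) k : L2F P F T z -> L1 lam `[0, T] (fun t => mean A z t k 0).
    by move=> Lz; exact: (L2s_L1 mI (lam_itv_lty 0 T) (mean_L2s k mA Lz)).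
  have La : L1 lam `[0, T] (fun t => \sum_k AA l k * mean A x t k 0).
    by apply: (L1_sum mI (index_enum _) (P := predT)) => k _; exact: (L1Z mI (AA l k) (L _ x k hx.1)).
  have Lb' : L1 lam `[0, T] (fun t => \sum_k BB l k * mean A U t k 0).
    by apply: (L1_sum mI (index_enum _) (P := predT)) => k _; exact: (L1Z mI (BB l k) (L _ U k LU)).
  exact: (L1_meas mI (L1D mI (L1D mI La Lb') (L1Z mI (fine (P A)) (L2s_L1 mI (lam_itv_lty 0 T) (Lphi l))))).
apply: ae_imp2 (L2F_aeL1 hx.1) (L2F_aeL1 LU) => t hxt hUt; rewrite in_itv /= => /andP[at_ tT].
have tI : `[0, T]%classic t by rewrite /= in_itv /= tT (le_trans a0).
congr (fun_of_matrix _ l c); rewrite -(meanM AA mA (fun k => hxt k tI)) -(meanM BB mA (fun k => hUt k tI)).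
apply/matrixP => i k; rewrite !mxE.
have LAx : L1 P A (fun w => (AA *m x t w) i 0).
  apply: (L1_eq mA (f := fun w => \sum_j AA i j * x t w j 0)) => [w _|]; first by rewrite mxE.
  by apply: (L1_sum mA) => j _; apply: (L1Z mA); apply: (L1_setT mA); exact: hxt.
have LBU : L1 P A (fun w => (BB *m U t w) i 0).
  apply: (L1_eq mA (f := fun w => \sum_j BB i j * U t w j 0)) => [w _|]; first by rewrite mxE.
  by apply: (L1_sum mA) => j _; apply: (L1Z mA); apply: (L1_setT mA); exact: hUt.
rewrite (Int_eq P (g := fun w => (AA *m x t w) i 0 + (BB *m U t w) i 0 + phi t i 0)) => [|w _]; last by rewrite /b !mxE.
rewrite (IntD mA (L1D mA LAx LBU)); last first.
  by apply: (L1_cst mA); apply: le_lt_trans (P_lty P); apply: le_measure; rewrite ?inE.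
by rewrite (IntD mA LAx LBU) (Rintegral_cst P mA) ord1 mulrC.
Qed.

(** Hamiltonian matrix of the discounted problem in coordinates (state, adjoint). *)
Definition Ham : 'M[R]_(m + m) :=
  block_mx AA (- (BB *m invmx RR *m BB^T)) (- QQ) (- AR).

Lemma ACm_col (p1 p2 q : nat) a b (u u' : R -> 'M[R]_(p1, q)) (v v' : R -> 'M[R]_(p2, q)) :
  ACm a b u u' -> ACm a b v v' -> ACm a b (fun t => col_mx (u t) (v t)) (fun t => col_mx (u' t) (v' t)).
Proof.
move=> hu hv i j; case: (split_ordP i) => k ->.
  by apply: AC_eq (hu k j) => t _; rewrite col_mxEu.
by apply: AC_eq (hv k j) => t _; rewrite col_mxEd.
Qed.

Lemma ae_neq (a : R) : {ae lam, forall t : R, t != a}.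
Proof.
exists [set a]; split; [exact: measurable_set1|exact: lebesgue_measure_set1|].
by move=> t /= /negP; rewrite negbK => /eqP.
Qed.

(** The control is eliminated through RR c = -BB^T v, which holds at almost every time and is enough
    to change the densities. *)
Lemma hamiltonian_system a (k : R) (psi : R -> 'cV[R]_m) (u v ga : R -> 'cV[R]_m) (c : R -> 'cV[R]_r) (hh : 'cV[R]_m) :
  a <= T -> (forall l, L1 lam `[a, T] (fun t => psi t l 0)) ->
  ACm a T u (fun t => AA *m u t + BB *m c t + k *: psi t) ->
  ACm a T v (fun t => - (AR *m v t) - ga t) ->
  {ae lam, forall t, a < t <= T -> RR *m c t = - (BB^T *m v t) /\ ga t = QQ *m u t - k *: hh} ->
  ACm a T (fun t => col_mx (u t) (v t)) (fun t => Ham *m col_mx (u t) (v t) + k *: col_mx (psi t) hh).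
Proof.
move=> aT Lpsi hu hv hae; have mI := itv_meas a T.
pose u' t := AA *m u t + - (BB *m invmx RR *m BB^T) *m v t + k *: psi t.
pose v' t := - QQ *m u t + - AR *m v t + k *: hh.
have mM (q : nat) (M : 'M[R]_(m, q)) (z z' : R -> 'cV[R]_q) l : ACm a T z z' -> measurable_fun `[a, T] (fun t => (M *m z t) l 0).
  by move=> hz; exact: (AC_meas aT (ACm_mull M hz l 0)).
have ae' : {ae lam, forall t, t \in `[a, T] -> RR *m c t = - (BB^T *m v t) /\ ga t = QQ *m u t - k *: hh}.
  apply: ae_imp2 (ae_neq a) hae => t ta hst; rewrite in_itv /= => /andP[at_ tT]; apply: hst.
  by rewrite tT lt_neqAle eq_sym ta at_.
have hu' : ACm a T u u'.
  move=> l c'; rewrite ord1; apply: AC_aed (hu l 0).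
    have E : (fun t => u' t l 0) = (fun t => (AA *m u t) l 0 + (- (BB *m invmx RR *m BB^T) *m v t) l 0 + k * psi t l 0).
      by apply/funext => t; rewrite /u' !mxE.
    rewrite E; apply: measurable_funD; first by apply: measurable_funD; [exact: mM hu|exact: mM hv].
    by apply: measurable_funM; [exact: measurable_cst|exact: (L1_meas mI (Lpsi l))].
  apply: ae_imp ae' => t hst tI; have [h1 _] := hst tI.
  suff -> : BB *m c t = - (BB *m invmx RR *m BB^T) *m v t by [].
  rewrite mulNmx -!mulmxA -mulmxN -(mulmxN (invmx RR)) -h1; congr (_ *m _).
  by rewrite mulKmx// posdef_unit.
have hv' : ACm a T v v'.
  move=> l c'; rewrite ord1; apply: AC_aed (hv l 0).
    have E : (fun t => v' t l 0) = (fun t => (- QQ *m u t) l 0 + (- AR *m v t) l 0 + k * hh l 0).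
      by apply/funext => t; rewrite /v' !mxE.
    rewrite E; apply: measurable_funD; last exact: measurable_cst.
    by apply: measurable_funD; [exact: mM hu|exact: mM hv].
  apply: ae_imp ae' => t hst tI; have [_ ->] := hst tI; congr (fun_of_matrix _ l 0).
  by rewrite /v' !mulNmx opprB addrA addrAC [- (AR *m _) - _]addrC.
apply: ACm_eq (ACm_col hu' hv') => // t _.
by rewrite /Ham mul_block_col scale_col_mx add_col_mx.
Qed.

Lemma AC_extend0 a (Y f : R -> R) : 0 <= a -> a <= T -> AC a T Y f -> Y a = 0 ->
  AC 0 T (fun t => if a <= t then Y t else 0) (fun t => if a <= t then f t else 0).
Proof.
move=> a0 aT [Lf hY] Ya.
have L : L1 lam `[0, T] (fun t => if a <= t then f t else 0).
  have L0 : L1 lam `[0, T] (fun t => if t \in `[a, T] then f t else 0).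
    by apply: integrableS (L1_patch Lf); [exact: measurableT|exact: itv_meas|].
  apply: (L1_eq (itv_meas 0 T) _ L0) => t; rewrite /= in_itv /= => /andP[_ tT].
  by rewrite in_itv /= tT andbT.
have Z c : 0 <= c -> c <= a -> \int[lam]_(s in `[0, c]) (if a <= s then f s else 0) = 0.
  move=> c0 ca; rewrite -[RHS](Int_0 lam `[0, c]).
  apply: (Int_ae (itv_meas 0 c)); [|exact: measurable_cst|].
    by apply: (L1_meas (itv_meas 0 c)); apply: (L1_sub (lexx 0) (le_trans ca aT)); exact: L.
  apply: ae_imp (ae_neq a) => s sa; rewrite /= in_itv /= => /andP[_ sc].
  by case: leP => // as_; move: sa; rewrite eq_le as_ (le_trans sc ca).
split=> // t /andP[t0 tT].
have -> : (if a <= 0 then Y 0 else 0) = 0.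
  by case: leP => // a0'; rewrite (_ : 0 = a) ?Ya//; apply/eqP; rewrite eq_le a0 a0'.
rewrite add0r; case: (leP a t) => at_; last by rewrite Z// ltW.
rewrite (Int_add a0 at_ (L1_sub (lexx 0) tT L)) Z// add0r.
rewrite (hY t) ?at_// Ya add0r; apply: Int_eq => s; rewrite /= in_itv /= => /andP[-> _] //.
Qed.

Lemma P_setT1 : fine (P setT) = 1. Proof. by rewrite probability_setT. Qed.

Lemma ip_det (q : nat) (a b : R -> 'cV[R]_q) : (forall l, L2s lam `[0, T] (fun t => a t l 0)) ->
  (forall l, L2s lam `[0, T] (fun t => b t l 0)) ->
  ip (fun t _ => a t) (fun t _ => b t) = \int[lam]_(t in `[0, T]) (wt t * dot (a t) (b t)).
Proof.
move=> La Lb; have L := ip_L1 (L2F_L2P (L2F_det La)) (L2F_L2P (L2F_det Lb)).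
rewrite /ip -(fubini_slab2 (itv_meas 0 T) (fun t _ => wt t * dot (a t) (b t)) L).
by apply: Int_eq => t _; rewrite (Rintegral_cst P measurableT) P_setT1 mulr1.
Qed.

Lemma mean_det (q : nat) (k : R -> 'cV[R]_q) t : mean setT (fun t _ => k t) t = k t.
Proof.
by apply/matrixP => l c; rewrite ord1 mxE (Rintegral_cst P measurableT) P_setT1 mulr1.
Qed.

(** (Ym t z, Pm t z) is the Hamiltonian trajectory with state z and adjoint 0 at time T. *)
Definition Ym t : 'M[R]_m := ulsubmx (expm Ham (t - T)).
Definition Pm t : 'M[R]_m := dlsubmx (expm Ham (t - T)).

Lemma expm_Ham t (z : 'cV[R]_m) : expm Ham (t - T) *m col_mx z 0 = col_mx (Ym t *m z) (Pm t *m z).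
Proof. by rewrite -{1}[expm Ham _]submxK mul_block_col !mulmx0 !addr0. Qed.

(* A conjugate point of the horizon T in (0, T) would give a control of zero
   cost vanishing near 0; minimality of the cost makes the associated
   Hamiltonian trajectory exist on all of [0, T], against unique continuation. *)
Lemma no_conjugate_point s (z : 'cV[R]_m) :
  (forall V y, L2F P F T V -> hsol V y -> 0 <= cost 0 y V) -> 0 < s -> s <= T ->
  Ym s *m z = 0 -> z = 0.
Proof.
move=> q0 s0 sT Yz; have mI := itv_meas 0 T.
pose z1 t := expm Ham (t - T) *m col_mx z 0.
pose y1 t := Ym t *m z; pose p1 t := Pm t *m z.
have z1E t : z1 t = col_mx (y1 t) (p1 t) by exact: expm_Ham.
have hz1 a b : ACm a b z1 (fun t => Ham *m z1 t).
  by apply: ACm_eq (ACm_mul (expm_AC Ham a b T) (ACm_cst a b (col_mx z 0))) => // t _; rewrite mulmx0 addr0 /z1 mulmxA.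
have dz1 t : Ham *m z1 t = col_mx (AA *m y1 t + BB *m (- (invmx RR *m BB^T *m p1 t))) (- (AR *m p1 t) - QQ *m y1 t).
  by rewrite z1E /Ham mul_block_col !mulNmx mulmxN -[BB *m invmx RR *m BB^T]mulmxA -[BB *m (_ *m _) *m _]mulmxA (addrC (- (QQ *m y1 t))).
have hy1 a b : ACm a b y1 (fun t => AA *m y1 t + BB *m (- (invmx RR *m BB^T *m p1 t))).
  by move=> i j; apply: AC_eq (hz1 a b (lshift m i) j) => t _; rewrite ?dz1 ?z1E col_mxEu.
have hp1 a b : ACm a b p1 (fun t => - (AR *m p1 t) - QQ *m y1 t).
  by move=> i j; apply: AC_eq (hz1 a b (rshift m i) j) => t _; rewrite ?dz1 ?z1E col_mxEd.
have z1T : z1 T = col_mx z 0 by rewrite /z1 subrr expm0 mul1mx.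
have [y1T p1T] : y1 T = z /\ p1 T = 0 by apply: eq_col_mx; rewrite -z1E.
pose v1 t := - (invmx RR *m BB^T *m p1 t).
(* The trajectory is switched on at s; the state does not jump there because Ym s z = 0. *)
pose v t := if s <= t then v1 t else 0.
pose y t := if s <= t then y1 t else 0.
have hy : ACm 0 T y (fun t => AA *m y t + BB *m v t).
  move=> i j; have := AC_extend0 (ltW s0) sT (hy1 s T i j); rewrite {1}/y1 Yz mxE => /(_ erefl).
  by apply: AC_eq => t _; rewrite /y /v; case: (s <= t); rewrite ?mulmx0 ?addr0 ?mxE.
have y0 : y 0 = 0 by rewrite /y leNgt s0.
have Ly l : L2s lam `[0, T] (fun t => y t l 0).
  exact: (AC_L2s T0 (hy l 0)).
have Lv l : L2s lam `[0, T] (fun t => v t l 0).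
  have hv1 := ACm_opp (ACm_mull (invmx RR *m BB^T) (hp1 0 T)).
  have [C hC] := AC_bdd (hv1 l 0).
  apply: (L2s_eq mI (f := fun t => (s <= t)%R%:R * v1 t l 0)) => [t _|].
    by rewrite /v; case: (s <= t); rewrite ?mul1r ?mul0r ?mxE.
  apply: (L2s_bddM mI (c := 1)).
  - rewrite (_ : (fun t : R => _) = \1_(`[s, +oo[%classic : set R)); last first.
      by apply/funext => t; rewrite indicE mem_setE in_itv /= andbT.
    by apply: (measurable_funS measurableT (@subsetT _ _)); apply: measurable_indic; exact: measurable_itv.
  - by move=> t _; case: (s <= t); rewrite ?normr1 ?normr0.
  - by apply: (L2s_bdd mI (c := C) (lam_itv_lty 0 T) (AC_meas T0 (hv1 l 0))) => t tT; exact: hC.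
have LFv := L2F_det Lv.
have hs : hsol (fun t _ => v t) (fun t _ => y t).
  split; first exact: L2F_det.
  apply: ae_true => w t /andP[t0 tT]; rewrite (ACm_vint hy (lexx 0) t0 tT) y0 addr0.
  by congr (_ + _); apply: eq_vint => s' _; rewrite addr0.
have LM (p q : nat) (M : 'M[R]_(p, q)) (k : R -> 'cV[R]_q) : (forall l, L2s lam `[0, T] (fun t => k t l 0)) ->
    forall l, L2s lam `[0, T] (fun t => (M *m k t) l 0).
  move=> Lk l; apply: (L2s_eq mI (f := fun t => \sum_i M l i * k t i 0)) => [t _|]; first by rewrite mxE.
  by apply: (L2s_sum mI) => i _; exact: (L2sZ mI _ (Lk i)).
(* Pairing p1, null at T, with the extended state, null at 0, gives minus the cost. *)
have c0 : cost 0 (fun t _ => y t) (fun t _ => v t) = 0.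
  rewrite /cost (ip_eq (a' := fun t _ => QQ *m y t) (b' := fun t _ => y t)) => [|t w _]; last by rewrite scaler0 subr0.
  rewrite (ip_det (LM _ _ QQ _ Ly) Ly) (ip_det (LM _ _ RR _ Lv) Lv).
  rewrite -(IntD mI (wt_dot_L1 (LM _ _ QQ _ Ly) Ly) (wt_dot_L1 (LM _ _ RR _ Lv) Lv)).
  have := IntN mI (pairing_L1 T0 (hp1 0 T) hy); rewrite (pairing T0 (hp1 0 T) hy p1T y0) oppr0 => e0; rewrite -[RHS]e0.
  apply: Int_eq => t _; rewrite /y /v; case: (s <= t); last by rewrite !mulmx0 !dot0r addr0 dot0r; ring.
  have -> : RR *m v1 t = - (BB^T *m p1 t) by rewrite /v1 mulmxN -mulmxA mulKVmx ?posdef_unit.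
  rewrite dotDl !dotNl (dotMl AR) trmxK mulmxBl mul_scalar_mx !dotDr (dotNr (rho *: y1 t)) dotZr (dotMr BB (v1 t)).
  by ring.
(* The cost is nonnegative by [q0] and vanishes here, so this control is a minimiser and stationary;
   it thus has a deterministic adjoint on all of [0, T]. *)
have dc V y' : L2F P F T V -> hsol V y' -> dcost 0 (fun t _ => y t) (fun t _ => v t) y' V = 0.
  move=> LV hy'; have := first_order (h := 0) (@L2s0 m) LFv hs => /(_ _ V y' LV hy')[] //.
  by move=> V2 y2 LV2 hy2; rewrite c0; exact: q0.
have FT0 : F 0 setT by have [[h0 hC _] _] := sF 0; have := hC _ h0; rewrite setD0.
have Lg : L2F P F T (fun t (_ : Omega) => QQ *m y t - 0) := L2FB (L2FM QQ (L2F_det Ly)) (L2F_cst 0).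
have [p [hp pT hae]] := mean_optimality (lexx 0) FT0 Lg LFv dc.
have hz : ACm 0 T (fun t => col_mx (y t) (p t)) (fun t => Ham *m col_mx (y t) (p t)).
  apply: ACm_eq (@hamiltonian_system 0 0 (fun=> 0) y p _ v 0 T0 _ _ hp _) => // [t _|l||].
  - by rewrite scale0r addr0.
  - by apply: (L1_eq mI _ (L1_0 lam mI)) => t _; rewrite mxE.
  - by apply: ACm_eq hy => // t _; rewrite scale0r addr0.
  - by apply: ae_imp hae => t ht tT; split; [rewrite -ht// mean_det|rewrite (mean_det (fun t => QQ *m y t - 0)) scale0r].
(* The observed output is the state, which vanishes on [0, s] and equals z at T. *)
have := @unique_continuation R (m + m) m (row_mx 1%:M 0) Ham _ 0 s T s0 sT hz.
rewrite mul_row_col mul1mx mul0mx addr0 /y sT y1T; apply=> t /andP[t0 ts].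
rewrite mul_row_col mul1mx mul0mx addr0; case: (leP s t) => // st.
by rewrite (_ : t = s) ?Yz//; apply/eqP; rewrite eq_le ts st.
Qed.

(** * The adjoint process of an optimal control *)

Section OptimalAdjoint.

Lemma cont_det (k : nat) (M : R -> 'M[R]_k) : (forall i j, continuous (fun t => M t i j)) ->
  continuous (fun t => \det (M t)).
Proof.
move=> cM t; apply: cvg_big => [x|s _]; first exact: add_continuous.
apply: cvgM; first exact: cvg_cst.
apply: cvg_big => [x|i _]; last exact: cM.
exact: mul_continuous.
Qed.

Lemma cont_invmx (k : nat) (M : R -> 'M[R]_k) i j t : (forall i j, continuous (fun t => M t i j)) ->
  M t \in unitmx -> {for t, continuous (fun t => ((\det (M t))^-1 *: \adj (M t)) i j)}.
Proof.
move=> cM uM; rewrite /prop_for /continuous_at.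
rewrite (_ : (fun t => ((\det (M t))^-1 *: \adj (M t)) i j) = fun t => (\det (M t))^-1 * \adj (M t) i j); last first.
  by apply/funext => s; rewrite mxE.
rewrite [X in _ --> X]mxE; apply: cvgM; first by apply: cvgV; [rewrite -unitfE -unitmxE|exact: cont_det].
rewrite /adjugate (_ : (fun s => _) = fun s => (-1) ^+ (j + i) * \det (row' j (col' i (M s)))); last first.
  by apply/funext => s; rewrite mxE.
rewrite mxE; apply: cvgM; first exact: cvg_cst.
apply: cont_det => a b.
rewrite (_ : (fun s => _) = fun s => M s (lift j a) (lift i b)); first exact: cM.
by apply/funext => s; rewrite !mxE.
Qed.

(** [0, T] is the union of {0} and the intervals [1 / (n + 1), T]. *)
Lemma meas_open0 (u : R -> R) : (forall delta, 0 < delta -> {within `[delta, T], continuous u}) ->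
  measurable_fun `[0, T] u.
Proof.
move=> cu.
have -> : (`[0, T]%classic : set R) = [set 0] `|` \bigcup_n `[n.+1%:R^-1, T]%classic.
  apply/seteqP; split => t; rewrite /= in_itv /=.
    move=> /andP[]; rewrite le_eqVlt => /predU1P[<-|t0 tT]; [by left|right].
    have [n _ hn] : exists2 n : nat, True & n.+1%:R^-1 <= t.
      have := archi_boundP (ltW (_ : 0 < t^-1)); rewrite invr_gt0 => /(_ t0) hn.
      exists (Num.bound t^-1) => //; rewrite -[leRHS]invrK lef_pV2 ?posrE ?invr_gt0//.
      by rewrite (le_trans (ltW hn))// ler_nat.
    by exists n => //=; rewrite in_itv /= hn.
  move=> [->|[n _ /=]]; first by rewrite lexx T0.
  by rewrite in_itv /= => /andP[h1 ->]; rewrite andbT (le_trans _ h1).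
apply/measurable_funU; first exact: measurable_set1.
  by apply: bigcup_measurable => n _; exact: itv_meas.
split; first exact: measurable_fun_set1.
apply/measurable_fun_bigcup => n; first exact: itv_meas.
by apply: cont_meas; apply: cu; rewrite invr_gt0.
Qed.

Hypothesis q0 : forall V y, L2F P F T V -> hsol V y -> 0 <= cost 0 y V.

Lemma Ym_unit t : 0 < t -> t <= T -> Ym t \in unitmx.
Proof.
move=> t0 tT; rewrite -unitmx_tr -row_free_unit -kermx_eq0.
apply/rowV0P => v /sub_kermxP hv; apply: trmx_inj; rewrite trmx0.
by apply: (no_conjugate_point q0 t0 tT); rewrite -[Ym t]trmxK -trmx_mul hv trmx0.
Qed.

(** Inverse of [Ym] in adjugate form, from which continuity in t can be read off. At time 0, where
    [Ym] may be singular, the value is 0 by convention. *)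
Definition Yi t : 'M[R]_m := if 0 < t then (\det (Ym t))^-1 *: \adj (Ym t) else 0.

Lemma YiK t : 0 < t -> t <= T -> Yi t *m Ym t = 1%:M.
Proof. by move=> t0 tT; have u := Ym_unit t0 tT; have := mulVmx u; rewrite /invmx u /Yi t0. Qed.

Lemma YKi t : 0 < t -> t <= T -> Ym t *m Yi t = 1%:M.
Proof. by move=> t0 tT; have u := Ym_unit t0 tT; have := mulmxV u; rewrite /invmx u /Yi t0. Qed.

Lemma expmHam_cont i j : continuous (fun t => expm Ham (t - T) i j).
Proof.
move=> t; apply: (cvg_comp (fun t => t - T) (fun t => expm Ham t _ _)); last exact: expm_cont.
by apply: cvgB; [exact: cvg_id|exact: cvg_cst].
Qed.

Lemma Yi_cont i j delta : 0 < delta -> {within `[delta, T], continuous (fun t => Yi t i j)}.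
Proof.
move=> d0; have cY i' j' : continuous (fun t => Ym t i' j').
  rewrite (_ : (fun t => _) = fun t => expm Ham (t - T) (lshift m i') (lshift m j')); last first.
    by apply/funext => t; rewrite [LHS]mxE [LHS]mxE.
  exact: expmHam_cont.
apply/subspace_continuousP => t; rewrite /= in_itv /= => /andP[dt tT].
have t0 := lt_le_trans d0 dt.
have := @cont_invmx _ Ym i j t cY (Ym_unit t0 tT); rewrite /prop_for /continuous_at => cc.
rewrite /from_subspace [X in _ --> X](_ : _ = ((\det (Ym t))^-1 *: \adj (Ym t)) i j); last by rewrite /Yi t0.
apply: (cvg_trans _ (cvg_within_filter `[delta, T]%classic cc)); apply: near_eq_cvg.
rewrite near_withinE; apply: nearW => s sd.
rewrite /Yi ifT//; move: sd; rewrite /= in_itv /= => /andP[ds _]; exact: lt_le_trans d0 ds.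
Qed.

Lemma Yi_meas i j : measurable_fun `[0, T] (fun t => Yi t i j).
Proof. by apply: meas_open0 => delta; exact: Yi_cont. Qed.

Lemma Ym_T : Ym T = 1%:M.
Proof. by rewrite /Ym subrr expm0 (scalar_mx_block m m 1) block_mxKul. Qed.

Lemma Pm_T : Pm T = 0.
Proof. by rewrite /Pm subrr expm0 (scalar_mx_block m m 1) block_mxKdl. Qed.

Lemma Yi_T : Yi T = 1%:M.
Proof. by have := YiK Tgt0 (lexx T); rewrite Ym_T mulmx1. Qed.

Lemma expm_Ham_block t : expm Ham (t - T) = block_mx (Ym t) (ursubmx (expm Ham (t - T))) (Pm t) (drsubmx (expm Ham (t - T))).
Proof. by rewrite submxK. Qed.

Definition Ym' t := AA *m Ym t - BB *m invmx RR *m BB^T *m Pm t.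
Definition Pm' t := - QQ *m Ym t - AR *m Pm t.

Lemma Ham_Y t : (ulsubmx (Ham *m expm Ham (t - T)) = Ym' t) * (dlsubmx (Ham *m expm Ham (t - T)) = Pm' t).
Proof.
by rewrite expm_Ham_block /Ham mulmx_block block_mxKul block_mxKdl /Ym' /Pm' !mulNmx.
Qed.

Lemma Ym_AC a b : ACm a b Ym Ym'.
Proof.
move=> i j; apply: AC_eq (expm_AC Ham a b T (lshift m i) (lshift m j)) => t _.
  by rewrite [RHS]mxE [RHS]mxE.
by rewrite -(Ham_Y t).1 [RHS]mxE [RHS]mxE.
Qed.

Lemma Pm_AC a b : ACm a b Pm Pm'.
Proof.
move=> i j; apply: AC_eq (expm_AC Ham a b T (rshift m i) (lshift m j)) => t _.
  by rewrite [RHS]mxE [RHS]mxE.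
by rewrite -(Ham_Y t).2 [RHS]mxE [RHS]mxE.
Qed.

(** Particular solution, null at T, of the Hamiltonian system forced by (phi, h); [av] and [bv] are
    its state and adjoint parts. *)
Variable zp : R -> 'cV[R]_(m + m).
Hypothesis hzp : ACm 0 T zp (fun t => Ham *m zp t + col_mx (phi t) h).
Hypothesis zpT : zp T = 0.
Let av t := usubmx (zp t).
Let bv t := dsubmx (zp t).
Variables (U : proc r) (x : proc m).
Hypothesis LU : L2F P F T U.
Hypothesis hx : solves ini phi Nn U x.
Hypothesis hdc : forall V y, L2F P F T V -> hsol V y -> dcost h x U y V = 0.
Let gam : proc m := fun t w => QQ *m x t w - h.

Let Lgam : L2F P F T gam. Proof. exact: (L2FB (L2FM QQ hx.1) (L2F_cst h)). Qed.

Let Lx t l : 0 <= t <= T -> L2s P setT (fun w => x t w l 0).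
Proof. by apply: (solves_L2s l Lphi Lini _ LU hx) => s k; exact: (ito_sum_L2s k hZs). Qed.

(** The mean state and its adjoint, minus P(A) zp, solve the homogeneous Hamiltonian system with
    adjoint 0 at T. They are therefore the trajectory issued backwards from (E[x_T 1_A], 0). *)
Lemma mean_hamiltonian A a : 0 <= a <= T -> F a A -> exists p : R -> 'cV[R]_m,
  [/\ ACm 0 T p (fun t => - (AR *m p t) - mean A gam t), p T = 0 &
   forall s, a <= s <= T -> mean A x s = Ym s *m mean A x T + fine (P A) *: av s /\
     p s = Pm s *m mean A x T + fine (P A) *: bv s].
Proof.
move=> aT FA; have mA := (sF a).2 _ FA; have /andP[a0 aT'] := aT.
have [p [hp pT hae]] := mean_optimality a0 FA Lgam LU hdc.
exists p; split=> // s /andP[as_ sT].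
have hz := @hamiltonian_system a (fine (P A)) phi (mean A x) p (mean A gam) (mean A U) h aT'.
have {}hz : ACm a T (fun t => col_mx (mean A x t) (p t)) (fun t => Ham *m col_mx (mean A x t) (p t) + fine (P A) *: col_mx (phi t) h).
  apply: hz => [l|||].
  - by apply: (L1_sub a0 (lexx T)); exact: (L2s_L1 (itv_meas 0 T) (lam_itv_lty 0 T)).
  - exact: mean_solves aT FA LU hx.
  - exact: ACm_itv a0 (lexx T) hp.
  - apply: ae_imp hae => t ht /andP[at_ tT]; split; first by apply: ht; rewrite at_.
    have t0T : 0 <= t <= T by rewrite tT (le_trans a0 (ltW at_)).
    rewrite (mean_lin QQ (- h) mA) ?scalerN// => l.
    exact: (L2s_L1P (Lx l t0T)).
have hd : ACm s T (fun t => col_mx (mean A x t) (p t) - fine (P A) *: zp t) (fun t => Ham *m (col_mx (mean A x t) (p t) - fine (P A) *: zp t)).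
  have hzs : ACm s T (fun t => fine (P A) *: zp t) (fun t => fine (P A) *: (Ham *m zp t + col_mx (phi t) h)).
    by move=> i j; apply: AC_eq (AC_scale (fine (P A)) (ACm_itv (le_trans a0 as_) (lexx T) hzp i j)) => t _; rewrite !mxE.
  apply: ACm_eq (ACm_sub (ACm_itv as_ (lexx T) hz) hzs) => // t _.
  by rewrite scalerDr mulmxBr scalemxAr opprD addrACA subrr addr0.
have := ode_unique sT hd; rewrite zpT pT scaler0 subr0 => e.
have {}e : col_mx (mean A x s) (p s) - fine (P A) *: zp s = expm Ham (s - T) *m col_mx (mean A x T) 0.
  by rewrite e mulmxA -[s - T]opprB expm_invl mul1mx.
move: e; rewrite expm_Ham -[zp s]vsubmxK scale_col_mx opp_col_mx add_col_mx => /eq_col_mx[<- <-].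
by rewrite !subrK.
Qed.

Let hav a b : 0 <= a -> b <= T -> ACm a b av (fun t => AA *m av t - BB *m invmx RR *m BB^T *m bv t + phi t).
Proof.
move=> a0 bT i j; apply: AC_eq (ACm_itv a0 bT hzp (lshift m i) j) => t _; first by rewrite mxE.
rewrite -[zp t]vsubmxK /Ham mul_block_col add_col_mx col_mxEu.
by rewrite mulNmx.
Qed.

Let hbv a b : 0 <= a -> b <= T -> ACm a b bv (fun t => - (QQ *m av t) - AR *m bv t + h).
Proof.
move=> a0 bT i j; apply: AC_eq (ACm_itv a0 bT hzp (rshift m i) j) => t _; first by rewrite mxE.
rewrite -[zp t]vsubmxK /Ham mul_block_col add_col_mx col_mxEd.
by rewrite !mulNmx.
Qed.

(** For t > 0 this is E[x_T | F_t] ([mm_orth]): by [mean_hamiltonian] the state is Ym E[x_T | F_t] +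
    av, and the relation is solved for the conditional expectation. [pp] is the corresponding
    adjoint. *)
Definition mm : proc m := fun t w => Yi t *m (x t w - av t).
Definition pp : proc m := fun t w => Pm t *m mm t w + bv t.

Lemma mmE t w : 0 < t -> t <= T -> x t w = Ym t *m mm t w + av t.
Proof. by move=> t0 tT; rewrite /mm mulmxA YKi// mul1mx subrK. Qed.

Let TT : 0 <= T <= T. Proof. by rewrite T0 lexx. Qed.

Let Lxa t l : 0 <= t <= T -> L2s P setT (fun w => (x t w - av t) l 0).
Proof.
move=> tT; apply: (L2s_eq measurableT (f := fun w => x t w l 0 - av t l 0)) => [w _|]; first by rewrite !mxE.
by apply: (L2sB measurableT); [exact: Lx|apply: L2s_cst (P_lty P)].
Qed.

Lemma mm_L2s t l : 0 <= t <= T -> L2s P setT (fun w => mm t w l 0).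
Proof.
move=> tT; apply: (L2s_eq measurableT (f := fun w => \sum_k Yi t l k * (x t w - av t) k 0)) => [w _|]; first by rewrite mxE.
by apply: (L2s_sum measurableT) => k _; apply: (L2sZ measurableT); exact: Lxa.
Qed.

Lemma mm_gmeas t l : 0 <= t <= T -> gmeas (F t) (fun w => mm t w l 0).
Proof.
move=> tT; rewrite (_ : (fun w => _) = fun w => \sum_k Yi t l k * (x t w k 0 - av t k 0)).
  apply: gmeas_sum => k _; apply: gmeasZ; apply: gmeasB; last exact: gmeas_cst.
  exact: L2FgmeasE hx.1 tT.
by apply/funext => w; rewrite mxE; apply: eq_bigr => k _; rewrite !mxE.
Qed.

Lemma mean_mm A a t : F a A -> 0 <= a -> a <= t -> 0 < t -> t <= T -> mean A mm t = mean A x T.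
Proof.
move=> FA a0 at_ t0 tT; have mA := (sF a).2 _ FA.
have aT : 0 <= a <= T by rewrite a0 (le_trans at_).
have [p [_ _ /(_ t)]] := mean_hamiltonian aT FA; rewrite at_ tT => /(_ isT)[e _].
have tT' : 0 <= t <= T by rewrite ltW.
have Lx1 l : L1 P setT (fun w => x t w l 0) := L2s_L1P (Lx l tT').
transitivity (mean A (fun t w => Yi t *m x t w + - (Yi t *m av t)) t).
  by apply/matrixP => l c; rewrite !mxE; apply: Int_eq => w _; rewrite /mm mulmxBr.
have := mean_lin (Yi t) (- (Yi t *m av t)) mA Lx1; rewrite /mean => ->.
by rewrite -/(mean A x t) e mulmxDr mulmxA YiK// mul1mx -scalemxAr scalerN addrK.
Qed.

Lemma mm_orth t l : 0 < t -> t <= T -> orth P (F t) (fun w => x T w l 0 - mm t w l 0).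
Proof.
move=> t0 tT A FA; have mA := (sF t).2 _ FA; have tT' : 0 <= t <= T by rewrite ltW.
rewrite (IntB mA (L2s_L1A mA (Lx l TT)) (L2s_L1A mA (mm_L2s l tT'))); apply/eqP; rewrite subr_eq0; apply/eqP.
by have /matrixP/(_ l 0) := mean_mm FA (ltW t0) (lexx t) t0 tT; rewrite !mxE.
Qed.

(* mm is the conditional expectation of x_T: both mm and x_T - mm are bounded
   by x_T in L2. *)
Lemma mm_bound t l : 0 < t -> t <= T -> \int[P]_w (mm t w l 0 ^+ 2) <= \int[P]_w (x T w l 0 ^+ 2) /\
  \int[P]_w ((x T w l 0 - mm t w l 0) ^+ 2) <= \int[P]_w (x T w l 0 ^+ 2).
Proof.
move=> t0 tT; have tT' : 0 <= t <= T by rewrite ltW.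
have Lm := mm_L2s l tT'; have Lx' := Lx l TT; have LD := L2sB measurableT Lx' Lm.
have Lp := L2sM measurableT Lm LD.
have z0 := orth_ext (sF t) (L2s_L1P LD) (mm_orth l t0 tT) (mm_gmeas l tT') Lp.
have e : \int[P]_w (x T w l 0 ^+ 2) = \int[P]_w (mm t w l 0 ^+ 2) + \int[P]_w ((x T w l 0 - mm t w l 0) ^+ 2).
  rewrite -[LHS]subr0 -[X in _ - X](mulr0 2) -z0 -(IntZ measurableT 2 Lp) -(IntB measurableT Lx'.2 (L1Z measurableT 2 Lp)).
  by rewrite -(IntD measurableT Lm.2 LD.2); apply: Int_eq => w _; ring.
rewrite e; split; [rewrite lerDl|rewrite lerDr]; by apply: Int_ge0 => w _; exact: sqr_ge0.
Qed.

Lemma mm_L2F : L2F P F T mm.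
Proof.
apply/L2F_SL2 => l; apply: (SL2_bound (C := \int[P]_w (x T w l 0 ^+ 2))) => [|t tT|t tT].
- have mk k : measurable_fun DD (fun u : R * Omega => Yi u.1 l k * (x u.1 u.2 k 0 - av u.1 k 0)).
    have [mx _ _] := L2Fc k hx.1.
    have mav := AC_meas T0 (hav (lexx 0) (lexx T) k 0).
    have md (c : R -> R) : measurable_fun `[0, T] c -> measurable_fun DD (fun u : R * Omega => c u.1).
      move=> mu; apply: (measurable_comp (F := `[0, T]%classic)); [exact: itv_meas| |exact: mu|].
        by move=> _ [[s w] [/= h1 _] <-].
      by apply: (measurable_funS measurableT (@subsetT _ _)); exact: measurable_fst.
    by apply: measurable_funM; [exact: md (Yi_meas l k)|apply: measurable_funB; [exact: mx|exact: md mav]].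
  rewrite (_ : (fun u => _) = fun u : R * Omega => \sum_k Yi u.1 l k * (x u.1 u.2 k 0 - av u.1 k 0)).
    by apply: measurable_sum => k; exact: mk.
  by apply/funext => u; rewrite mxE; apply: eq_bigr => k _; rewrite !mxE.
- exact: mm_gmeas.
- split; first exact: mm_L2s.
  have /andP[] := tT; rewrite le_eqVlt => /predU1P[<- _|t0 tT']; last exact: (mm_bound l t0 tT').1.
  rewrite (Int_eq P (g := fun=> 0)) ?Int_0 => [|w _]; first by apply: Int_ge0 => w _; exact: sqr_ge0.
  by rewrite /mm /Yi ltxx mul0mx mxE expr0n.
Qed.

Lemma pp_L2F : L2F P F T pp.
Proof.
apply: L2FD; first exact: (L2F_detM (Pm_AC 0 T) mm_L2F).
apply: L2F_det => l; have hb := hbv (lexx 0) (lexx T) l 0; exact: (AC_L2s T0 hb).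
Qed.

Lemma pp_L2s t l : 0 <= t <= T -> L2s P setT (fun w => pp t w l 0).
Proof.
move=> tT; apply: (L2s_eq measurableT (f := fun w => \sum_k Pm t l k * mm t w k 0 + bv t l 0)) => [w _|].
  by rewrite /pp [RHS]mxE [in RHS]mxE.
apply: (L2sD measurableT); last exact: L2s_cst (P_lty P).
by apply: (L2s_sum measurableT) => k _; apply: (L2sZ measurableT); exact: mm_L2s.
Qed.

(** Over events of F_t the means of [pp] at later times are the deterministic adjoints of
    [mean_hamiltonian], so I_T - I_t - pp_t has zero conditional mean and [duality] applies.
    Stationarity tested in the direction BB^T pp + RR U then gives the weighted integral of its
    square. *)
Lemma optimal_feedback : {ae (lam \x P)%E, forall q : R * Omega, DD q ->
  U q.1 q.2 = - (invmx RR *m BB^T *m pp q.1 q.2)}.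
Proof.
pose gm : proc m := fun t w => AR *m pp t w + gam t w.
have Lgm : L2F P F T gm := L2FD (L2FM AR pp_L2F) Lgam.
have [I [LI eI SI]] := L2F_int Lgm.
have op t l : 0 < t <= T -> L2s P setT (fun w => pp t w l 0) /\
     orth P (F t) (fun w => I T w l 0 - I t w l 0 - pp t w l 0).
  move=> /andP[t0 tT]; have tT' : 0 <= t <= T by rewrite ltW.
  split; first exact: pp_L2s.
  move=> A FA; have mA := (sF t).2 _ FA.
  have [p [hp pT hp2]] := mean_hamiltonian tT' FA.
  have ppE s : t <= s <= T -> mean A pp s = p s.
    move=> /andP[ts sT]; have [_ ->] := hp2 s (introT andP (conj ts sT)).
    have s0 := lt_le_trans t0 ts; have sT' : 0 <= s <= T by rewrite (ltW s0).
    have := mean_lin (Pm s) (bv s) mA (fun l => L2s_L1P (mm_L2s l sT')).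
    rewrite (mean_mm FA (ltW t0) ts s0 sT) => <-.
    by rewrite /mean /pp.
  have Imean s (sT : 0 <= s <= T) := mean_primitive mA Lgm eI (SI s l sT) sT.
  rewrite (IntB mA (L1B mA (L2s_L1A mA (SI T l TT)) (L2s_L1A mA (SI t l tT'))) (L2s_L1A mA (pp_L2s l tT'))).
  rewrite (IntB mA (L2s_L1A mA (SI T l TT)) (L2s_L1A mA (SI t l tT'))) !Imean//.
  have -> : \int[P]_(w in A) pp t w l 0 = p t l 0 by rewrite -ppE ?lexx// mxE.
  have Lm : L1 lam `[0, T] (fun s => mean A gm s l 0) := L2s_L1 (itv_meas 0 T) (lam_itv_lty 0 T) (mean_L2s l mA Lgm).
  have -> : vint 0 T (mean A gm) l 0 - vint 0 t (mean A gm) l 0 = \int[lam]_(s in `[t, T]) mean A gm s l 0.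
    by rewrite mxE [X in _ - X]mxE (Int_add (ltW t0) tT Lm) addrC addKr.
  have := AC_int (hp l 0) (ltW t0) tT (lexx T); rewrite pT mxE => e.
  apply/eqP; rewrite subr_eq0; apply/eqP.
  have {}e : p t l 0 = - \int[lam]_(s in `[t, T]) (- (AR *m p s) - mean A gam s) l 0.
    by apply/eqP; rewrite -addr_eq0 -e.
  have L3 : L1 lam `[t, T] (fun s => (- (AR *m p s) - mean A gam s) l 0) := L1_sub (ltW t0) (lexx T) (hp l 0).1.
  rewrite e -(IntN (itv_meas t T) L3); apply: (Int_ae (itv_meas t T)).
  - exact: (L1_meas (itv_meas t T) (L1_sub (ltW t0) (lexx T) Lm)).
  - exact: (L1_meas (itv_meas t T) (L1N (itv_meas t T) L3)).
  apply: ae_imp2 (L2F_aeL1 pp_L2F) (L2F_aeL1 Lgam) => s h1 h2; rewrite /= in_itv /= => /andP[ts sT].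
  have sI : `[0, T]%classic s by rewrite /= in_itv /= sT (le_trans (ltW t0)).
  rewrite -ppE ?ts// -(meanM AR mA (fun k => h1 k sI)) !mxE -opprD opprK.
  have LA1 : L1 P A (fun w => (AR *m pp s w) l 0).
    apply: (L1_eq mA (f := fun w => \sum_j AR l j * pp s w j 0)) => [w _|]; first by rewrite [RHS]mxE.
    by apply: (L1_sum mA) => j _; apply: (L1Z mA); apply: (L1_setT mA); exact: h1.
  rewrite -(IntD mA LA1 (L1_setT mA (h2 l sI))).
  by apply: Int_eq => w _; rewrite /gm [LHS]mxE.
pose V : proc r := fun t w => BB^T *m pp t w + RR *m U t w.
have LV : L2F P F T V := L2FD (L2FM BB^T pp_L2F) (L2FM RR LU).
have [y hy] : exists y, hsol V y.
  have g0 (l : 'I_m) : gmeas (F 0) (fun _ : Omega => (0 : 'cV[R]_m) l 0) by exact: gmeas_cst.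
  have s0 (l : 'I_m) : L2s P setT (fun _ : Omega => (0 : 'cV[R]_m) l 0) by exact: (L2s_cst measurableT _ (P_lty P)).
  exact: (@solves_exists (fun=> 0) (fun=> 0) (fun _ _ => 0) V g0 s0 (@L2s0 m) (@L2F0 m) LV).
have du := duality Lgm pp_L2F LI eI SI op LV hy.
have e1 : ip (fun t w => gm t w - AR *m pp t w) y = ip gam y.
  by apply: ip_eq => t w _; rewrite /gm [AR *m _ + _]addrC addrK.
have e2 : ip V V = 0.
  rewrite {1}/V (ipDl (L2F_L2P LV) (L2F_L2P (L2FM BB^T pp_L2F)) (L2F_L2P (L2FM RR LU))).
  by rewrite -du e1; exact: hdc LV hy.
apply: ae_imp (ip_ae0 (L2F_L2P LV) e2) => q hq Dq.
have /eqP : BB^T *m pp q.1 q.2 + RR *m U q.1 q.2 = 0 := hq Dq.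
rewrite addrC addr_eq0 => /eqP e.
by rewrite -mulmxA -mulmxN -e mulKmx// posdef_unit.
Qed.

Lemma ae_DD_path (q : nat) (z : proc q) : L2F P F T z ->
  {ae (lam \x P)%E, forall u : R * Omega, DD u -> z u.1 u.2 = 0} ->
  {ae P, forall w, {ae lam, forall t, `[0, T]%classic t -> z t w = 0}}.
Proof.
move=> Lz z0.
have hzl : {ae P, forall w, forall l, {ae lam, forall t, `[0, T]%classic t -> z t w l 0 = 0}}.
  apply: ae_fin => l; have [mz Lz2] := L2F_L2P Lz l.
  have I0 : \int[(lam \x P)%E]_(u in DD) (z u.1 u.2 l 0 ^+ 2) = 0.
    rewrite -[RHS](Int_0 (lam \x P)%E DD); apply: (Int_ae (mDD T)); [exact: measurable_funX|exact: measurable_cst|].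
    by apply: ae_imp z0 => u hu Du; rewrite hu// mxE expr0n.
  have I1 := fubini_slab1 (itv_meas 0 T) (fun t w => z t w l 0 ^+ 2) Lz2.
  have L1' := slab_L1_int1 (itv_meas 0 T) (fun t w => z t w l 0 ^+ 2) Lz2.
  have ge w : 0 <= \int[lam]_(t in `[0, T]) (z t w l 0 ^+ 2) by apply: Int_ge0 => t _; exact: sqr_ge0.
  have := Int_ge0_ae0 measurableT L1' (fun w _ => ge w); rewrite I1 I0 => /(_ (lexx _)) a0.
  apply: ae_imp2 a0 (slab_L1_1 (itv_meas 0 T) (fun t w => z t w l 0 ^+ 2) Lz2) => w e L.
  have := Int_ge0_ae0 (itv_meas 0 T) L (fun t _ => sqr_ge0 _); rewrite (e Logic.I) => /(_ (lexx _)).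
  by apply: ae_imp => t ht tT; apply/eqP; rewrite -sqrf_eq0 ht.
apply: ae_imp hzl => w hw; have := ae_fin hw; apply: ae_imp => t ht tT.
by apply/matrixP => l c; rewrite ord1 mxE ht.
Qed.

Lemma solves_ae (psi : R -> 'cV[R]_m) (i0 : Omega -> 'cV[R]_m) (N0 : proc m) V V' y : (forall l, L2s lam `[0, T] (fun t => psi t l 0)) ->
  L2F P F T V -> L2F P F T V' ->
  {ae (lam \x P)%E, forall u : R * Omega, DD u -> V u.1 u.2 = V' u.1 u.2} ->
  solves i0 psi N0 V y -> solves i0 psi N0 V' y.
Proof.
move=> Lpsi LV LV' VV' hy; split; first exact: hy.1.
have z0 : {ae (lam \x P)%E, forall u : R * Omega, DD u -> V u.1 u.2 - V' u.1 u.2 = 0}.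
  by apply: ae_imp VV' => u e Du; rewrite e// subrr.
have L' := L2F_path (L2FD (L2FD (L2FM AA hy.1) (L2FM BB LV')) (L2F_det Lpsi)).
apply: ae_imp2 (ae_and L' (ae_DD_path (L2FB LV LV') z0)) (solves_path Lpsi LV hy) => w [Lw' e] [Lw h'] t tT.
have /andP[t0 tT'] := tT.
rewrite (h' t tT); congr (_ + _ + _); apply/matrixP => l c; rewrite ord1 [LHS]mxE [RHS]mxE.
have M1 : L1 lam `[0, t] (fun s => (AA *m y s w + BB *m V s w + psi s) l 0) := L1_sub (lexx 0) tT' (Lw l).
have M2 : L1 lam `[0, t] (fun s => (AA *m y s w + BB *m V' s w + psi s) l 0) := L1_sub (lexx 0) tT' (Lw' l).
apply: (Int_ae (itv_meas 0 t) (L1_meas (itv_meas 0 t) M1) (L1_meas (itv_meas 0 t) M2)).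
apply: ae_imp e => s es; rewrite /= in_itv /= => /andP[s0 st].
have e1 : V s w - V' s w = 0 by apply: es; rewrite /= in_itv /= s0 (le_trans st).
by have -> : V s w = V' s w by apply/eqP; rewrite -subr_eq0 e1.
Qed.

Let Up : proc r := fun t w => - (invmx RR *m BB^T *m pp t w).

Let LUp : L2F P F T Up. Proof. exact: (L2FN (L2FM _ pp_L2F)). Qed.

Let hxp : solves ini phi Nn Up x.
Proof. exact: (solves_ae Lphi LU LUp optimal_feedback hx). Qed.

Lemma HamexpmHam_meas i j : measurable_fun setT (fun t : R => (Ham *m expm Ham (t - T)) i j).
Proof.
apply: continuous_measurable_fun => t.
rewrite (_ : (fun t => _) = fun t => \sum_k Ham i k * expm Ham (t - T) k j); last first.
  by apply/funext => s; rewrite [LHS]mxE.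
apply: cvg_big => [u|k _]; first exact: add_continuous.
by apply: cvgM; [exact: cvg_cst|exact: expmHam_cont].
Qed.

Lemma Ym'_meas i j : measurable_fun setT (fun t : R => Ym' t i j).
Proof.
rewrite (_ : (fun t => _) = fun t => (Ham *m expm Ham (t - T)) (lshift m i) (lshift m j)).
  exact: HamexpmHam_meas.
by apply/funext => t; rewrite -(Ham_Y t).1 [LHS]mxE [LHS]mxE.
Qed.

Lemma Pm'_meas i j : measurable_fun setT (fun t : R => Pm' t i j).
Proof.
rewrite (_ : (fun t => _) = fun t => (Ham *m expm Ham (t - T)) (rshift m i) (lshift m j)).
  exact: HamexpmHam_meas.
by apply/funext => t; rewrite -(Ham_Y t).2 [LHS]mxE [LHS]mxE.
Qed.

Lemma ACm_Ym' a b : exists D, ACm a b Ym' D.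
Proof.
eexists; apply: ACm_sub; first exact: ACm_mull (Ym_AC a b).
exact: ACm_mull (Pm_AC a b).
Qed.

Lemma ACm_Pm' a b : exists D, ACm a b Pm' D.
Proof.
eexists; apply: ACm_sub; last exact: ACm_mull (Pm_AC a b).
exact: ACm_mull (Ym_AC a b).
Qed.

(** Matrix form of [product_rule]: Z carries the martingale part of the product, and what remains is
    absolutely continuous. *)
Lemma product_rule_mx (G G' : R -> 'M[R]_m) (kap b : J -> R -> 'cV[R]_m) (M Z : J -> proc m) e : 0 <= e <= T ->
  ACm e T G G' -> (forall i j, measurable_fun setT (fun t : R => G' t i j)) ->
  (forall i j, exists C, forall s, 0 <= s <= T -> `|G' s i j| <= C) ->
  (forall j, sitov j (fun t _ => kap j t) (M j)) -> (forall j, L2F P F T (M j)) ->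
  (forall j, sitov j (fun t _ => b j t) (Z j)) ->
  (forall j t, e <= t <= T -> b j t = G t *m kap j t) ->
  {ae P, forall w, ACm e T (fun t => G t *m (\sum_j M j t w) - \sum_j Z j t w) (fun t => G' t *m (\sum_j M j t w))}.
Proof.
move=> eT hG mG' bG' hM LM hZ hb; have /andP[e0 eT'] := eT.
have pr : {ae P, forall w, forall i, forall j, forall t, e <= t <= T ->
    \sum_l (G t i l * M j t w l 0 - G e i l * M j e w l 0) =
    \int[lam]_(s in `[e, t]) (\sum_l G' s i l * M j s w l 0) + (Z j t w i 0 - Z j e w i 0)}.
  apply: ae_fin => i; apply: ae_fin => j.
  apply: (@product_rule j m (fun l t => G t i l) (fun l t => G' t i l) (fun l t => kap j t l 0) (fun t => b j t i 0)
    (fun l t w => M j t w l 0) (fun t w => Z j t w i 0) e eT) => [l|l|//|l|l|l|s hs].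
  - exact: (hM j l).
  - exact: L2Fc.
  - exact: (hZ j i).
  - exact: hG.
  - exact: mG'.
  - exact: bG'.
  - by rewrite hb// mxE.
have LMp : {ae P, forall w, forall j l, L1 lam `[0, T] (fun s => M j s w l 0)}.
  by apply: ae_fin => j; exact: L2F_path.
apply: ae_imp2 pr LMp => w hp Lw i c; rewrite ord1; set A := (fun t => _ i 0); set B := (fun t => _ i 0).
have LB j : L1 lam `[e, T] (fun s => \sum_l G' s i l * M j s w l 0).
  apply: (L1_sum (itv_meas e T)) => l _; have [C hC] := bG' i l.
  apply: (L1_bddM (itv_meas e T) (c := C)); last exact: (L1_sub e0 (lexx T) (Lw j l)).
    exact: (measurable_funS measurableT (@subsetT _ _) (mG' i l)).
  by move=> s; rewrite /= in_itv /= => /andP[es sT]; apply: hC; rewrite sT (le_trans e0).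
have BE s : B s = \sum_j \sum_l G' s i l * M j s w l 0.
  rewrite /B mxE exchange_big; apply: eq_bigr => l _; by rewrite summxE mulr_sumr.
split.
  by apply: (L1_eq (itv_meas e T) _ (L1_sum (itv_meas e T) (index_enum _) (P := predT) (fun j _ => LB j))) => s _; rewrite BE.
move=> t /andP[et tT].
have -> : \int[lam]_(s in `[e, t]) B s = \int[lam]_(s in `[e, t]) (\sum_j \sum_l G' s i l * M j s w l 0).
  by apply: Int_eq.
rewrite (Int_sum (itv_meas e t)) => [|j _]; last exact: (L1_sub (lexx e) tT (LB j)).
have AE s : A s = \sum_j (\sum_l G s i l * M j s w l 0 - Z j s w i 0).
  rewrite /A mxE [X in _ + X]mxE sumrB summxE; congr (_ - _).
  by rewrite mxE exchange_big; apply: eq_bigr => l _; rewrite summxE mulr_sumr.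
rewrite (AE t) (AE e) -big_split; apply: eq_bigr => j _ /=.
have := hp i j t; rewrite et tT => /(_ isT); rewrite sumrB => e1; lra.
Qed.

Lemma sum_le_cst (q : nat) (u : 'I_q -> R) c : (forall i, u i <= c) -> \sum_i u i <= c *+ q.
Proof. by move=> hu; rewrite -[q in leRHS]card_ord -sumr_const; apply: ler_sum. Qed.

Lemma mx_cancel1 (q : nat) (a v n b c : 'cV[R]_q) : a + v - n - v - (b - n) - c = a - b - c.
Proof. by apply/matrixP => i j; rewrite !mxE; ring. Qed.

Lemma mx_cancel2 (q : nat) (a b c e k : 'cV[R]_q) : a + b + (- c - e) + k - (b - e + k) = a - c.
Proof. by apply/matrixP => i j; rewrite !mxE; ring. Qed.

(** Let D be the difference between mm and the sum of the integrals, normalised to be 0 at e. The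
    noise of Ym mm = x - av cancels against that of Ym M, and Ym D has density Ym' D. As D = Yi (Ym
    D) with Yi bounded on [e, T], this is a homogeneous linear equation for Ym D, and Gronwall gives
    D = 0. *)
Lemma mm_sde (kap : J -> R -> 'cV[R]_m) (M : J -> proc m) e : 0 < e -> e <= T ->
  (forall j, sitov j (fun t _ => kap j t) (M j)) -> (forall j, L2F P F T (M j)) ->
  (forall j t, e <= t <= T -> kap j t = Yi t *m sg j t) ->
  {ae P, forall w, forall t, e <= t <= T ->
    mm t w - mm e w = \sum_j M j t w - \sum_j M j e w}.
Proof.
move=> e0 eT hM LM hk; have eT' : 0 <= e <= T by rewrite ltW.
have [D' hD'] := ACm_Ym' 0 T.
have bY i j : exists C, forall s, 0 <= s <= T -> `|Ym' s i j| <= C.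
  by have [C hC] := AC_bdd (hD' i j); exists C => s sT; apply: hC; rewrite in_itv.
have pr := product_rule_mx eT' (Ym_AC e T) Ym'_meas bY hM LM hZs.
have {}pr : {ae P, forall w, ACm e T (fun t => Ym t *m (\sum_j M j t w) - Nn t w) (fun t => Ym' t *m (\sum_j M j t w))}.
  apply: pr => j t tT; rewrite hk// mulmxA YKi ?mul1mx//; case/andP: tT => // et _; exact: lt_le_trans et.
apply: ae_imp2 pr (solves_path Lphi LUp hxp) => w hP [Lw hw].
have h1 : ACm e T (fun t => x t w - Nn t w) (fun t => AA *m x t w + BB *m Up t w + phi t).
  apply: (ACm_itv (ltW e0) (lexx T)); apply: (vint_ACm (y0 := ini w) T0 Lw) => t tT.
  by rewrite hw// addrK.
pose c := mm e w - \sum_j M j e w.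
have h2 : ACm e T (fun t => Ym t *m c) (fun t => Ym' t *m c).
  by apply: ACm_eq (ACm_mul (Ym_AC e T) (ACm_cst e T c)) => // t _; rewrite mulmx0 addr0.
pose D t := mm t w - \sum_j M j t w - c.
have h3 : ACm e T (fun t => Ym t *m D t) (fun t => Ym' t *m D t).
  apply: ACm_eq (ACm_sub (ACm_sub (ACm_sub h1 (hav (ltW e0) (lexx T))) hP) h2) => t /andP[et tT].
    rewrite (mmE w (lt_le_trans e0 et) tT) /D !mulmxBr.
    exact: mx_cancel1.
  rewrite /D !mulmxBr; congr (_ - _ - _).
  rewrite {1}(mmE w (lt_le_trans e0 et) tT) mulmxDr.
  have -> : BB *m Up t w = - (BB *m invmx RR *m BB^T *m (Pm t *m mm t w)) - BB *m invmx RR *m BB^T *m bv t.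
    by rewrite /Up /pp mulmxN !mulmxA mulmxDr opprD !mulmxA.
  have -> : Ym' t *m mm t w = AA *m (Ym t *m mm t w) - BB *m invmx RR *m BB^T *m (Pm t *m mm t w).
    by rewrite /Ym' mulmxBl !mulmxA.
  exact: mx_cancel2.
have De : Ym e *m D e = 0 by rewrite /D /c subrr mulmx0.
have De0 : D e = 0 by rewrite /D /c subrr.
have bYi i k : exists C, forall s, e <= s <= T -> `|Yi s i k| <= C.
  have cn : {within `[e, T], continuous (fun t => `|Yi t i k|)}.
    by move=> t; apply: cvg_norm; exact: (@Yi_cont i k e e0 t).
  have [t0 _ ht] := EVT_max eT cn.
  by exists `|Yi t0 i k| => s sT; apply: ht; rewrite in_itv.
have [C1 hC1] : exists C, forall i k s, e <= s <= T -> `|Yi s i k| <= C.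
  have /choice[b1 hb1] := fun ik : 'I_m * 'I_m => bYi ik.1 ik.2.
  exists (\sum_ik `|b1 ik|) => i k s sT; apply: le_trans (hb1 (i, k) s sT) _.
  by rewrite (bigD1 (i, k))//= (le_trans (ler_norm _))// lerDl; apply: sumr_ge0.
have [C2 hC2] : exists C, forall i k s, e <= s <= T -> `|Ym' s i k| <= C.
  have /choice[b1 hb1] := fun ik : 'I_m * 'I_m => bY ik.1 ik.2.
  exists (\sum_ik `|b1 ik|) => i k s /andP[es sT]; apply: le_trans (hb1 (i, k) s _) _.
    by rewrite sT (le_trans (ltW e0)).
  by rewrite (bigD1 (i, k))//= (le_trans (ler_norm _))// lerDl; apply: sumr_ge0.
pose zz t := Ym t *m D t.
pose ff t := \sum_l `|zz t l 0|.
have ff0 t : 0 <= ff t by apply: sumr_ge0.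
have ffz t l : `|zz t l 0| <= ff t by rewrite /ff (bigD1 l)//= lerDl sumr_ge0.
have Dle s k : e <= s <= T -> `|D s k 0| <= C1 *+ m * ff s.
  move=> /andP[es sT]; rewrite -[D s]mul1mx -(YiK (lt_le_trans e0 es) sT) -mulmxA mxE.
  rewrite (le_trans (ler_norm_sum _ _ _))// mulrnAl.
  apply: sum_le_cst => l; rewrite normrM; apply: ler_pM => //; [by apply: hC1; rewrite es|exact: ffz].
have dle s l : e <= s <= T -> `|(Ym' s *m D s) l 0| <= (C2 *+ m * (C1 *+ m)) * ff s.
  move=> sT; rewrite mxE (le_trans (ler_norm_sum _ _ _))// -mulrA mulrnAl.
  by apply: sum_le_cst => k; rewrite normrM; apply: ler_pM => //; [exact: hC2|exact: Dle].
have mff : measurable_fun `[e, T] ff.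
  apply: measurable_sum => l; apply: measurableT_comp; first exact: normr_measurable.
  exact: (AC_meas eT (h3 l 0)).
have [B hB] : exists B, forall t, t \in `[e, T] -> `|ff t| <= B.
  have /choice[b1 hb1] : forall l, exists C, forall t, t \in `[e, T] -> `|zz t l 0| <= C.
    by move=> l; exact: (AC_bdd (h3 l 0)).
  by exists (\sum_l b1 l) => t tT; rewrite ger0_norm//; apply: ler_sum => l _; exact: hb1.
have Lff : L1 lam `[e, T] ff.
  by apply: (L1_le (itv_meas e T) mff (g := fun=> B)) => [t tT|]; [exact: hB|exact: (L1_cst (itv_meas e T) B (lam_itv_lty e T))].
have gr : forall t, t \in `[e, T] -> 0 <= ff t <= ((C2 *+ m * (C1 *+ m)) *+ m) * \int[lam]_(s in `[e, t]) ff s.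
  move=> t; rewrite in_itv /= => /andP[et tT]; rewrite ff0 mulrnAl.
  apply: sum_le_cst => l; rewrite (AC_int (h3 l 0) (lexx e) et tT) De mxE add0r.
  have Ll : L1 lam `[e, t] (fun s => (Ym' s *m D s) l 0) := L1_sub (lexx e) tT (h3 l 0).1.
  apply: le_trans (Int_norm (itv_meas e t) Ll) _.
  have Lf' := L1_sub (lexx e) tT Lff.
  rewrite -(IntZ (itv_meas e t) _ Lf').
  apply: (Int_le (itv_meas e t) (L1_norm (itv_meas e t) Ll) (L1Z (itv_meas e t) _ Lf')) => s.
  by rewrite /= in_itv /= => /andP[es st]; apply: dle; rewrite es (le_trans st).
move=> t tT.
have fz : ff t = 0 by apply: (gronwall mff (ex_intro _ B hB) gr); rewrite in_itv.
have : D t = 0.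
  apply/matrixP => k c'; rewrite ord1 [RHS]mxE; apply/eqP; rewrite -normr_le0.
  by have := Dle t k tT; rewrite fz mulr0.
rewrite /D /c => /eqP; rewrite subr_eq0 subr_eq => /eqP ->.
by rewrite addrAC [_ - _ - mm e w]addrAC subrr add0r addrC.
Qed.

(** Monotone convergence along the intervals [1 / (n + 1), T]. *)
Lemma L1_open0 (u : R -> R) (C : R) : (forall t, 0 <= u t) -> measurable_fun `[0, T] u ->
  (forall e, 0 < e -> e <= T -> L1 lam `[e, T] u /\ \int[lam]_(t in `[e, T]) u t <= C) -> L1 lam `[0, T] u.
Proof.
move=> u0 mu hu; apply/integrableP; split; first exact/measurable_EFinP.
have mo : measurable_fun `]0, T] u.
  by apply: measurable_funS mu; [exact: itv_meas|exact: subset_itv_oc_cc].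
rewrite (_ : (\int[lam]_(x in _) _)%E = (\int[lam]_(t in `[0%R, T]) (u t)%:E)%E); last first.
  by apply: eq_integral => t _ /=; rewrite ger0_norm.
rewrite -integral_itv_obnd_cbnd; last exact/measurable_EFinP.
pose Fn n := `[n.+1%:R^-1, T]%classic : set R.
have E : (`]0, T]%classic : set R) = \bigcup_n Fn n.
  apply/seteqP; split => t; rewrite /= in_itv /=.
    move=> /andP[t0 tT]; exists (Num.bound t^-1) => //; rewrite /Fn /= in_itv /= tT andbT.
    have ti : 0 < t^-1 by rewrite invr_gt0.
    rewrite -[leRHS]invrK lef_pV2 ?posrE//.
    by rewrite (le_trans (ltW (archi_boundP (ltW ti))))// ler_nat.
  by move=> [n _]; rewrite /Fn /= in_itv /= => /andP[h1 ->]; rewrite andbT (lt_le_trans _ h1)// invr_gt0.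
rewrite E; apply: (@le_lt_trans _ _ C%:E); last exact: ltry.
have C0 : 0 <= C by apply: le_trans (hu T Tgt0 (lexx T)).2; apply: Int_ge0.
have cv : (fun n => (\int[lam]_(t in Fn n) (u t)%:E)%E) @ \oo --> (\int[lam]_(t in \bigcup_n Fn n) (u t)%:E)%E.
  apply: ge0_nondecreasing_set_cvg_integral => [n k nk|n|n|n t _].
  - apply/subsetPset => t; rewrite /Fn /= !in_itv /= => /andP[h1 ->]; rewrite andbT.
    by apply: le_trans h1; rewrite lef_pV2 ?posrE ?ltr0n// ler_nat.
  - exact: itv_meas.
  - apply/measurable_EFinP; apply: measurable_funS mu; first exact: itv_meas.
    by move=> t; rewrite /Fn /= !in_itv /= => /andP[h1 ->]; rewrite andbT (le_trans _ h1)// invr_ge0.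
  - by rewrite lee_fin.
rewrite -(cvg_lim _ cv)//; apply: lime_le; first by apply/cvg_ex; eexists; exact: cv.
apply: nearW => n; have [nT|Tn] := leP n.+1%:R^-1 T; last first.
  rewrite (_ : Fn n = set0) ?integral_set0 ?lee_fin//.
  by apply/seteqP; split=> // t; rewrite /Fn /= in_itv /= => /andP[h1 h2]; have := le_lt_trans (le_trans h1 h2) Tn; rewrite ltxx.
have n0 : 0 < n.+1%:R^-1 :> R by rewrite invr_gt0.
have [Ln hn] := hu _ n0 nT.
by rewrite (Int_E (itv_meas _ T) Ln) lee_fin.
Qed.

Lemma cont_L2s (a b : R) (u : R -> R) : a <= b -> {within `[a, b], continuous u} -> L2s lam `[a, b] u.
Proof.
move=> ab cu; have cn : {within `[a, b], continuous (fun t => `|u t|)}.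
  by move=> t; apply: cvg_norm; exact: (cu t).
have [c _ hc] := EVT_max ab cn.
apply: (L2s_bdd (itv_meas a b) (c := `|u c|) (lam_itv_lty a b) (cont_meas cu)) => t tab.
exact: hc.
Qed.

Lemma sito_inc_cov i j b b' Z Z' s t : sito i b Z -> sito j b' Z' -> 0 <= s -> s <= t -> t <= T ->
  \int[P]_w ((Z t w - Z s w) * (Z' t w - Z' s w)) = \int[P]_w (Z t w * Z' t w) - \int[P]_w (Z s w * Z' s w).
Proof.
move=> hZ hZ' s0 st tT; have sT : 0 <= s <= T by rewrite s0 (le_trans st).
have tT' : 0 <= t <= T by rewrite tT (le_trans s0).
have M := @L2sM _ _ _ P _ (@measurableT _ Omega).
have L1' := M _ _ (sito_L2 hZ tT') (sito_L2 hZ' tT'); have L2' := M _ _ (sito_L2 hZ sT) (sito_L2 hZ' sT).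
have L3 := M _ _ (sito_L2 hZ sT) (sito_L2 hZ' tT'); have L4 := M _ _ (sito_L2 hZ' sT) (sito_L2 hZ tT').
rewrite (Int_eq P (g := fun w => (Z t w * Z' t w + Z s w * Z' s w) - (Z s w * Z' t w + Z' s w * Z t w))) => [|w _]; last by ring.
rewrite (IntB measurableT (L1D measurableT L1' L2') (L1D measurableT L3 L4)).
rewrite (IntD measurableT L1' L2') (IntD measurableT L3 L4) (sito_cov hZ hZ' s0 st tT) (sito_cov hZ' hZ s0 st tT).
have -> : \int[P]_w (Z' s w * Z s w) = \int[P]_w (Z s w * Z' s w) by apply: Int_eq => w _; rewrite mulrC.
lra.
Qed.

Let kap j t : 'cV[R]_m := Yi t *m sg j t.

Lemma kap_cont j l e : 0 < e -> {within `[e, T], continuous (fun t => kap j t l 0)}.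
Proof.
move=> e0; rewrite (_ : (fun t => _) = fun t => \sum_k Yi t l k * sg j t k 0); last first.
  by apply/funext => t; rewrite mxE.
apply: within_sum => k t; apply: cvgM; first exact: (@Yi_cont l k e e0 t).
have sub : `[e, T] `<=` `[0, T] by apply: subset_itvScc; rewrite bnd_simp// ltW.
have cs := continuous_subspaceW sub (@csg j k).
exact: (cs t).
Qed.

(** By the Ito isometry on [e, T], the integrals of kap_j^2 add up over j to the second moment of
    x_T - mm_e, which [mm_bound] controls independently of e. *)
Lemma kap_bound j l e : 0 < e -> e <= T ->
  \int[lam]_(t in `[e, T]) (kap j t l 0 ^+ 2) <= \int[P]_w (x T w l 0 ^+ 2).
Proof.
move=> e0 eT; have eT' : 0 <= e <= T by rewrite ltW.
(* The integrand is frozen before e; it becomes continuous on [0, T], so its stochastic integral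
   exists, and increments after e are those of kap. *)
pose ke j t : 'cV[R]_m := kap j (Num.max e t).
have cke j' l' : {within `[0, T], continuous (fun t => ke j' t l' 0)}.
  by apply: (within_max_comp eT' (f := fun t => kap j' t l' 0)); exact: kap_cont.
have Lke j' l' : L2s lam `[0, T] (fun t => ke j' t l' 0) := cont_L2s T0 (cke j' l').
have /choice[M hM] : forall j', exists Z, is_ito_integral F T (W j') (fun t (_ : Omega) => ke j' t) Z /\ L2F P F T Z.
  move=> j'; have [|Z hZ LZ] := ito_exists_L2F j' _ (Lke j'); last by exists Z.
  move=> l' delta d0; apply: continuous_subspaceW (cke j' l').
  by apply: subset_itvScc; rewrite bnd_simp// ltW.
have hs := mm_sde e0 eT (fun j l => is_ito_sito l (hM j).1) (fun j => (hM j).2).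
have {}hs : {ae P, forall w, forall t, e <= t <= T -> mm t w - mm e w = \sum_j M j t w - \sum_j M j e w}.
  by apply: hs => j' t /andP[et _]; rewrite /ke max_r.
have mT w : mm T w = x T w by rewrite /mm Yi_T mul1mx /av zpT linear0 subr0.
have ss j' := is_ito_sito l (hM j').1.
have LM j' t : 0 <= t <= T -> L2s P setT (fun w => M j' t w l 0) by exact: sito_L2 (ss j').
have LD j' : L2s P setT (fun w => M j' T w l 0 - M j' e w l 0) by apply: (L2sB measurableT); exact: LM.
have e1 : \int[P]_w ((x T w l 0 - mm e w l 0) ^+ 2) = \sum_j \int[lam]_(t in `[e, T]) (ke j t l 0 ^+ 2).
  transitivity (\int[P]_w (\sum_i \sum_j (M i T w l 0 - M i e w l 0) * (M j T w l 0 - M j e w l 0))).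
    apply: (Int_ae measurableT).
    - by apply: measurable_funX; apply: (measurable_funB (Lx l TT).1 (mm_L2s l eT').1).
    - by do 2 (apply: measurable_sum => ?); exact: measurable_funM (LD _).1 (LD _).1.
    apply: ae_imp hs => w /(_ T) hw _; have := hw _; rewrite eT lexx mT => /(_ isT) /matrixP/(_ l 0).
    rewrite !mxE => ->; rewrite !summxE -sumrB expr2 mulr_suml; apply: eq_bigr => i _.
    by rewrite mulr_sumr.
  rewrite (Int_sum measurableT) => [|i _]; last by apply: (L1_sum measurableT) => j' _; exact: L2sM.
  apply: eq_bigr => i _; rewrite (Int_sum measurableT) => [|j' _]; last exact: L2sM.
  rewrite (bigD1 i)//= big1 ?addr0 => [|j' ji].
    rewrite (sito_inc_cov (ss i) (ss i) (ltW e0) eT (lexx T)).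
    rewrite (sito_iso_det (ss i) (ss i) TT) (sito_iso_det (ss i) (ss i) eT') eqxx.
    have Lq := (Lke i l).2.
    have Eq a : \int[lam]_(s in `[0, a]) (ke i s l 0 * ke i s l 0) = \int[lam]_(s in `[0, a]) (ke i s l 0 ^+ 2).
      by apply: Int_eq => s _; rewrite expr2.
    rewrite !Eq.
    by rewrite (Int_add (ltW e0) eT Lq) addrC addKr.
  rewrite (sito_inc_cov (ss i) (ss j') (ltW e0) eT (lexx T)).
  by rewrite (sito_iso_det (ss i) (ss j') TT) (sito_iso_det (ss i) (ss j') eT') eq_sym (negbTE ji) subr0.
apply: le_trans (mm_bound l e0 eT).2; rewrite e1 (bigD1 j)//=.
have -> : \int[lam]_(t in `[e, T]) (kap j t l 0 ^+ 2) = \int[lam]_(t in `[e, T]) (ke j t l 0 ^+ 2).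
  by apply: Int_eq => t; rewrite /= in_itv /= /ke => /andP[et _]; rewrite max_r.
by rewrite lerDl; apply: sumr_ge0 => j' _; apply: Int_ge0 => t _; exact: sqr_ge0.
Qed.

Hypothesis blum : forall xi, L1 P setT xi -> (forall e, 0 < e -> e <= T -> AM P (F e) xi) -> AM P (F 0) xi.

Lemma kap_L2s j l : L2s lam `[0, T] (fun t => kap j t l 0).
Proof.
have mk : measurable_fun `[0, T] (fun t => kap j t l 0) by apply: meas_open0 => e; exact: kap_cont.
split=> //; apply: (@L1_open0 _ (\int[P]_w (x T w l 0 ^+ 2))) => [t||e e0 eT].
- exact: sqr_ge0.
- exact: measurable_funX.
- by split; [exact: (cont_L2s eT (@kap_cont j l e e0)).2|exact: kap_bound].
Qed.

Lemma ae_path_DD (q : nat) (z : proc q) : L2F P F T z ->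
  {ae P, forall w, forall t, 0 < t <= T -> z t w = 0} ->
  {ae (lam \x P)%E, forall u : R * Omega, DD u -> z u.1 u.2 = 0}.
Proof.
move=> Lz hz; apply: ip_ae0; first exact: L2F_L2P.
have L := ip_L1 (L2F_L2P Lz) (L2F_L2P Lz).
rewrite /ip -(fubini_slab1 (itv_meas 0 T) (fun t w => wt t * dot (z t w) (z t w)) L).
rewrite -[RHS](Int_0 P setT); apply: (Int_ae measurableT); last 2 first.
- exact: measurable_cst.
- apply: ae_imp2 hz (slab_L1_1 (itv_meas 0 T) (fun t w => wt t * dot (z t w) (z t w)) L) => w hw Lw _.
  rewrite -[RHS](Int_0 lam `[0, T]); apply: (Int_ae (itv_meas 0 T) (L1_meas (itv_meas 0 T) Lw)).
    exact: measurable_cst.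
  apply: ae_imp (ae_neq 0) => t t0; rewrite /= in_itv /= => /andP[t0' tT].
  by rewrite hw ?dot0r ?mulr0// tT lt_neqAle eq_sym t0 t0'.
- exact: (L1_meas measurableT (slab_L1_int1 (itv_meas 0 T) (fun t w => wt t * dot (z t w) (z t w)) L)).
Qed.

Lemma mx_cancel3 (q : nat) (a b c e k : 'cV[R]_q) : - a - b + (- c - e + k) = - (b + e) - (a + c - k).
Proof. by apply/matrixP => i j; rewrite !mxE; ring. Qed.

Lemma mx_cancel4 (q : nat) (a b c e : 'cV[R]_q) : a + (b - c) + e = a + b + e - c.
Proof. by apply/matrixP => i j; rewrite !mxE; ring. Qed.

Lemma colBE (q : nat) (a b : 'cV[R]_q) l : (a - b) l 0 = a l 0 - b l 0.
Proof. by rewrite !mxE. Qed.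

Lemma colDE (q : nat) (a b : 'cV[R]_q) l : (a + b) l 0 = a l 0 + b l 0.
Proof. by rewrite mxE. Qed.

(** On ]0, T] the difference between mm and the integrals Ms is constant in time. This constant is
    F_e-measurable for every e > 0, hence F_0-measurable up to a null set. Adding it to Ms extends
    mm to time 0, and the product rule with Pm gives the backward equation, with integrands Pm
    kap. *)
Theorem optimal_adjoint : exists (p : proc m) (be : J -> R -> 'cV[R]_m),
  [/\ L2F P F T p, forall j l e, 0 < e -> {within `[e, T], continuous (fun t => be j t l 0)},
    forall j l, L2s lam `[0, T] (fun t => be j t l 0),
    forall Z : J -> proc m, (forall j, sitov j (fun t _ => be j t) (Z j)) ->
    {ae P, forall w, forall t, 0 <= t <= T ->
      p t w = p 0 w + vint 0 t (fun s => - (AR *m p s w) - (QQ *m x s w - h)) + \sum_j Z j t w} &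
    (forall w, p T w = 0) /\
    {ae (lam \x P)%E, forall u : R * Omega, DD u -> U u.1 u.2 = - (invmx RR *m BB^T *m p u.1 u.2)}].
Proof.
have /choice[M hM] : forall j, exists Z, is_ito_integral F T (W j) (fun t (_ : Omega) => kap j t) Z /\ L2F P F T Z.
  move=> j; have [|Z hZ LZ] := ito_exists_L2F j _ (kap_L2s j); last by exists Z.
  by move=> l e e0; exact: kap_cont.
pose Ms t w := \sum_j M j t w.
have LMs : L2F P F T Ms by apply: L2F_sum => j _; exact: (hM j).2.
have sde e : 0 < e -> e <= T -> {ae P, forall w, forall t, e <= t <= T -> mm t w - mm e w = Ms t w - Ms e w}.
  by move=> e0 eT; apply: (mm_sde e0 eT (fun j l => is_ito_sito l (hM j).1) (fun j => (hM j).2)).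
pose en n : R := T / n.+1%:R.
have en0 n : 0 < en n by rewrite divr_gt0.
have enT n : en n <= T by rewrite ler_pdivrMr// ler_peMr// ler1n.
have sden : {ae P, forall w, forall n, forall t, en n <= t <= T -> mm t w - mm (en n) w = Ms t w - Ms (en n) w}.
  by apply: ae_nat => n; exact: sde.
have mMs t : 0 <= t <= T -> forall l, L2s P setT (fun w => Ms t w l 0).
  by move=> tT l; exact: (ito_sum_L2s l (fun j l => is_ito_sito l (hM j).1)).
(* The constant value of mm - Ms, read at time T. *)
pose xi_ l w := mm T w l 0 - Ms T w l 0.
have Lxi l : L2s P setT (xi_ l) by apply: (L2sB measurableT); [exact: mm_L2s|exact: mMs].
have /choice[zeta hzeta] : forall l, exists ze0 : Omega -> R, gmeas (F 0) ze0 /\ {ae P, forall w, xi_ l w = ze0 w}.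
  move=> l; have [|z gz az] := blum (L2s_L1P (Lxi l)); last by exists z.
  move=> e e0 eT; have eT' : 0 <= e <= T by rewrite ltW.
  apply: (AM_ae (xi := fun w => mm e w l 0 - Ms e w l 0)).
    apply: ae_imp (sde e e0 eT) => w /(_ T); rewrite eT lexx => /(_ isT) /matrixP/(_ l 0).
    by rewrite !colBE /xi_ => e1; lra.
  apply: AM_gmeas; apply: gmeasB; first exact: mm_gmeas.
  exact: (L2FgmeasE l LMs eT').
have gzeta l := (hzeta l).1.
have Lzeta l : L2s P setT (zeta l).
  by apply: (L2s_ae measurableT (gmeas_meas (sF 0) (gzeta l)) _ (Lxi l)); apply: ae_imp (hzeta l).2.
pose ze w : 'cV[R]_m := \col_l zeta l w.
have Lze : L2F P F T (fun _ w => ze w).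
  apply/L2F_SL2 => l; have Lz2 := SL2_L2s_w (Lzeta l).
  apply: (SL2_eq (z := fun _ => zeta l)) => [t w _|]; first by rewrite mxE.
  split; [exact: Lz2.1|by move=> t /andP[t0 _]; exact: (gmeas_le sF mF t0)|exact: Lz2].
have hze : {ae P, forall w, mm T w - Ms T w = ze w}.
  have : {ae P, forall w, forall l, xi_ l w = zeta l w} by apply: ae_fin => l; exact: (hzeta l).2.
  by apply: ae_imp => w hw; apply/matrixP => l c; rewrite ord1 [RHS]mxE -hw colBE.
(* Equal to mm on ]0, T] almost surely, but with the correct value at 0, where mm is 0 by the
   convention on Yi. *)
pose mb t w := ze w + Ms t w.
have Lmb : L2F P F T mb := L2FD Lze LMs.
have mbE : {ae P, forall w, forall t, 0 < t <= T -> mb t w = mm t w}.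
  apply: ae_imp2 hze sden => w e1 hn t /andP[t0 tT].
  have [n hnt] : exists n, en n <= t.
    exists (Num.bound (T / t)); rewrite ler_pdivrMr// mulrC -ler_pdivrMr//.
    have := archi_boundP (ltW (divr_gt0 Tgt0 t0)) => /ltW/le_trans; apply.
    by rewrite ler_nat.
  have := hn n t; rewrite hnt tT => /(_ isT) e2; have := hn n T; rewrite enT lexx => /(_ isT) e3.
  rewrite /mb -e1; apply/matrixP => l c; rewrite ord1.
  have /matrixP/(_ l 0) := e2; have /matrixP/(_ l 0) := e3; rewrite !colBE => h3 h2.
  by rewrite colDE ?colBE; lra.
pose p : proc m := fun t w => Pm t *m mb t w + bv t.
have Lbv : L2F P F T (fun t (_ : Omega) => bv t).
  apply: L2F_det => l; have hb := hbv (lexx 0) (lexx T) l 0; exact: (AC_L2s T0 hb).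
have Lp : L2F P F T p := L2FD (L2F_detM (Pm_AC 0 T) Lmb) Lbv.
pose be j t : 'cV[R]_m := Pm t *m kap j t.
have Lbel j l : L2s lam `[0, T] (fun t => be j t l 0).
  apply: (L2s_eq (itv_meas 0 T) (f := fun t => \sum_k Pm t l k * kap j t k 0)) => [t _|]; first by rewrite [RHS]mxE.
  apply: (L2s_sum (itv_meas 0 T)) => k _; have [C hC] := AC_bdd (Pm_AC 0 T l k).
  by apply: (L2s_bddM (itv_meas 0 T) (AC_meas T0 (Pm_AC 0 T l k)) (c := C) _ (kap_L2s j k)) => t tT; exact: hC.
have cbe j l e : 0 < e -> {within `[e, T], continuous (fun t => be j t l 0)}.
  move=> e0; rewrite (_ : (fun t => _) = fun t => \sum_k Pm t l k * kap j t k 0); last first.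
    by apply/funext => t; rewrite [LHS]mxE.
  have sub : `[e, T] `<=` `[0, T] by apply: subset_itvScc; rewrite bnd_simp// ltW.
  apply: within_sum => k t; apply: cvgM; last exact: (@kap_cont j k e e0 t).
  have cs := continuous_subspaceW sub (AC_cont T0 (Pm_AC 0 T l k)).
  exact: (cs t).
have [D' hD'] := ACm_Pm' 0 T.
have bP i j : exists C, forall s, 0 <= s <= T -> `|Pm' s i j| <= C.
  by have [C hC] := AC_bdd (hD' i j); exists C => s sT; apply: hC; rewrite in_itv.
exists p, be; split=> //.
- move=> Z hZ.
  have pr := product_rule_mx (introT andP (conj (lexx 0) T0)) (Pm_AC 0 T) Pm'_meas bP
    (fun j l => is_ito_sito l (hM j).1) (fun j => (hM j).2) hZ (fun j t _ => erefl).
  have Z0 : {ae P, forall w, forall j, Z j 0 w = 0}.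
    have : {ae P, forall w, forall j l, Z j 0 w l 0 = 0}.
      apply: ae_fin => j; apply: ae_fin => l; have s := hZ j l.
      have O : (0 : R) <= 0 <= T by rewrite lexx.
      have := Int_ge0_ae0 measurableT (sito_L2 s O).2 (fun w _ => sqr_ge0 _).
      rewrite (sito_Int_sqr s O) Int_pt => /(_ (lexx _)); apply: ae_imp => w /(_ Logic.I)/eqP.
      by rewrite sqrf_eq0 => /eqP.
    by apply: ae_imp => w hw j; apply/matrixP => l c; rewrite ord1 [RHS]mxE.
  have Lg := L2F_path (L2FB (L2FN (L2FM AR Lp)) (L2FB (L2FM QQ hx.1) (L2F_cst h))).
  apply: ae_imp2 (ae_and pr mbE) (ae_and Z0 Lg) => w [hP hmb] [hZ0 Lgw] t /andP[t0 tT].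
  have h1 : ACm 0 T (fun t => p t w - \sum_j Z j t w) (fun t => Pm' t *m mb t w + (- (QQ *m av t) - AR *m bv t + h)).
    have h2 : ACm 0 T (fun t => Pm t *m ze w) (fun t => Pm' t *m ze w).
      by apply: ACm_eq (ACm_mul (Pm_AC 0 T) (ACm_cst 0 T (ze w))) => // s _; rewrite mulmx0 addr0.
    apply: ACm_eq (ACm_add (ACm_add h2 hP) (hbv (lexx 0) (lexx T))) => s _.
      by rewrite /p /mb mulmxDr; exact: mx_cancel4.
    by rewrite /mb mulmxDr.
  have := ACm_vint h1 (lexx 0) t0 tT.
  have -> : \sum_j Z j 0 w = 0 by apply: big1 => j _; exact: hZ0.
  rewrite subr0.
  move=> /eqP; rewrite subr_eq => /eqP ->; congr (_ + _ + _).
  apply/matrixP => l c; rewrite ord1 [LHS]mxE [RHS]mxE; apply: (Int_ae (itv_meas 0 t)).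
  + exact: (L1_meas (itv_meas 0 t) (L1_sub (lexx 0) tT (h1 l 0).1)).
  + exact: (L1_meas (itv_meas 0 t) (L1_sub (lexx 0) tT (Lgw l))).
  (* Inside the time integral, the relation between state and mm is used only at s > 0. *)
  apply: ae_imp (ae_neq 0) => s sn0; rewrite /= in_itv /= => /andP[s0 st].
  have s0' : 0 < s by rewrite lt_neqAle eq_sym sn0 s0.
  have sT := le_trans st tT.
  rewrite (mmE w s0' sT) -hmb ?s0'// /p.
  have -> : Pm' s *m mb s w = - (QQ *m (Ym s *m mb s w)) - AR *m (Pm s *m mb s w).
    by rewrite /Pm' mulmxBl mulNmx mulmxA mulNmx !mulmxA.
  rewrite !(mulmxDr AR) !(mulmxDr QQ); congr (fun_of_matrix _ l 0); exact: mx_cancel3.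
- split.
    move=> w; rewrite /p Pm_T mul0mx add0r /bv zpT linear0.
    by [].
  have Ldp := L2FB Lp pp_L2F.
  have dp0 : {ae (lam \x P)%E, forall u : R * Omega, DD u -> p u.1 u.2 - pp u.1 u.2 = 0}.
    apply: (ae_path_DD Ldp); apply: ae_imp mbE => w hw t tT.
    by rewrite /p /pp hw// subrr.
  apply: ae_imp2 dp0 optimal_feedback => u e1 e2 Du; rewrite e2//.
  by have /eqP := e1 Du; rewrite subr_eq0 => /eqP ->.
Qed.

End OptimalAdjoint.

Lemma mx_cancel5 (q : nat) (p0 a b c e : 'cV[R]_q) : 0 = p0 - a + c -> a - b - (p0 - b + e) = c - e.
Proof.
move=> /esym/eqP; rewrite addrAC subr_eq0 => /eqP <-.
by apply/matrixP => i j; rewrite !mxE; ring.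
Qed.

(** With I the primitive of AR p plus the running gradient, the backward equation says that I_T -
    I_t - p_t is an increment of the martingale Zt after t. It is orthogonal to F_t, so [duality]
    applies to the given adjoint itself. *)
Lemma adjoint_stationary (y p : proc m) (V : proc r) (Zt : proc m) : L2F P F T y -> L2F P F T p ->
  (forall t l, 0 <= t <= T -> L2s P setT (fun w => Zt t w l 0)) ->
  (forall t l, 0 <= t -> t <= T -> orth P (F t) (fun w => Zt T w l 0 - Zt t w l 0)) ->
  {ae P, forall w, forall t, 0 <= t <= T ->
    p t w = p 0 w + vint 0 t (fun s => - (AR *m p s w) - (QQ *m y s w - h)) + Zt t w} ->
  {ae P, forall w, p T w = 0} -> (forall t w, V t w = - (invmx RR *m BB^T *m p t w)) ->
  forall V' y', L2F P F T V' -> hsol V' y' -> dcost h y V y' V' = 0.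
Proof.
move=> Ly Lp LZ oZ hp pT hV V' y' LV' hy'; have TT : 0 <= T <= T by rewrite T0 lexx.
pose gm : proc m := fun t w => AR *m p t w + (QQ *m y t w - h).
have Lgam : L2F P F T (fun t w => QQ *m y t w - h) := L2FB (L2FM QQ Ly) (L2F_cst h).
have Lgm : L2F P F T gm := L2FD (L2FM AR Lp) Lgam.
have [I [LI eI SI]] := L2F_int Lgm.
have key : {ae P, forall w, forall t, 0 <= t <= T -> I T w - I t w - p t w = Zt T w - Zt t w}.
  apply: ae_imp2 (ae_and eI (L2F_path Lgm)) (ae_and hp pT) => w [e1 Lw] [e2 e3] t tT.
  have pE s : 0 <= s <= T -> p s w = p 0 w - I s w + Zt s w.
    move=> sT; rewrite (e2 s sT) (e1 s sT); congr (_ + _ + _).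
    rewrite -[RHS]scaleN1r -vintZ => [|l]; last by apply: (L1_sub (lexx 0) _ (Lw l)); case/andP: sT.
    by apply: eq_vint => u _; rewrite [RHS]scaleN1r /gm [RHS]opprD.
  have := pE T TT; rewrite e3 => eT; rewrite (pE t tT).
  by move: eT; apply: mx_cancel5.
have op t l : 0 < t <= T -> L2s P setT (fun w => p t w l 0) /\
    orth P (F t) (fun w => I T w l 0 - I t w l 0 - p t w l 0).
  move=> /andP[t0 tT]; have tT' : 0 <= t <= T by rewrite ltW.
  have mp := gmeas_meas (sF t) (L2FgmeasE l Lp tT').
  have keyl : {ae P, forall w, I T w l 0 - I t w l 0 - p t w l 0 = Zt T w l 0 - Zt t w l 0}.
    by apply: ae_imp key => w /(_ t tT') /matrixP/(_ l 0); rewrite !colBE.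
  have LD := L2sB measurableT (SI T l TT) (SI t l tT').
  have LDZ := L2sB measurableT (LZ T l TT) (LZ t l tT').
  have Lpt : L2s P setT (fun w => p t w l 0).
    apply: (L2s_ae measurableT mp _ (L2sB measurableT LD LDZ)).
    by apply: ae_imp keyl => w e _; rewrite -e; ring.
  split=> // A FA; have mA := (sF t).2 _ FA.
  rewrite -[RHS](oZ t l (ltW t0) tT A FA); apply: (Int_ae mA).
  - by apply: (measurable_funS measurableT (@subsetT _ _)); exact: (L2sB measurableT LD Lpt).1.
  - by apply: (measurable_funS measurableT (@subsetT _ _)); exact: LDZ.1.
  - by apply: ae_imp keyl.
have e0 := duality Lgm Lp LI eI SI op LV' hy'.
have e1 : ip (fun t w => gm t w - AR *m p t w) y' = ip (fun t w => QQ *m y t w - h) y'.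
  by apply: ip_eq => t w _; rewrite /gm [AR *m _ + _]addrC addrK.
rewrite /dcost -e1 e0 -(ipDl (L2F_L2P LV') (L2F_L2P (L2FM _ Lp))); last first.
  by apply: L2F_L2P; apply: L2F_eq (L2FM (- BB^T) Lp) => t w _; rewrite hV mulmxN -mulmxA mulKVmx ?posdef_unit// mulNmx.
rewrite (ip_eq (a' := fun _ _ => 0) (b' := V')) => [|t w _]; last first.
  by rewrite hV mulmxN -mulmxA mulKVmx ?posdef_unit// subrr.
by rewrite /ip (Int_eq _ (g := fun=> 0)) ?Int_0// => u _; rewrite dotC dot0r mulr0.
Qed.

End LQ.
End Doob.
End Ito.

(** * Stacked coordinates *)

Section Stack.
Variables (R : realType) (N : nat).

Definition cmp (k : nat) (i : 'I_N) (X : 'cV[R]_(N * k)) : 'cV[R]_k := \col_j X (mxvec_index i j) 0.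

Definition stk (k : nat) (z : 'I_N -> 'cV[R]_k) : 'cV[R]_(N * k) :=
  (mxvec (\matrix_(i, j) z i j 0))^T.

(* The matrix with blocks M i j, acting on stacked vectors. *)
Definition blk (k l : nat) (M : 'I_N -> 'I_N -> 'M[R]_(k, l)) : 'M[R]_(N * k, N * l) :=
  \matrix_(a, b) let u := enum_val (cast_ord (esym (mxvec_cast N k)) a) in
    let v := enum_val (cast_ord (esym (mxvec_cast N l)) b) in M u.1 v.1 u.2 v.2.

Lemma blkE (k l : nat) (M : 'I_N -> 'I_N -> 'M[R]_(k, l)) i j a b :
  blk M (mxvec_index i a) (mxvec_index j b) = M i j a b.
Proof. by rewrite mxE /mxvec_index !cast_ordK !enum_rankK. Qed.

Lemma stkE (k : nat) (z : 'I_N -> 'cV[R]_k) i a : stk z (mxvec_index i a) 0 = z i a 0.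
Proof. by rewrite mxE mxvecE mxE. Qed.

Lemma cmp_stk (k : nat) (z : 'I_N -> 'cV[R]_k) i : cmp i (stk z) = z i.
Proof. by apply/matrixP => a c; rewrite ord1 mxE stkE. Qed.

Lemma eq_cmp (k : nat) (X Y : 'cV[R]_(N * k)) : (forall i, cmp i X = cmp i Y) -> X = Y.
Proof.
move=> h; apply/matrixP => a c; rewrite ord1; case/mxvec_indexP: a => i j.
by have /matrixP/(_ j 0) := h i; rewrite !mxE.
Qed.

Lemma sum_mxvec_index (V : nmodType) (k : nat) (u : 'I_(N * k) -> V) :
  \sum_a u a = \sum_i \sum_j u (mxvec_index i j).
Proof.
rewrite pair_bigA /= (reindex (fun p : 'I_N * 'I_k => mxvec_index p.1 p.2)) //=.
exists (fun a => enum_val (cast_ord (esym (mxvec_cast N k)) a)) => [[i j] _|a _].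
  by rewrite /mxvec_index cast_ordK enum_rankK.
by case/mxvec_indexP: a => i j; rewrite {1}/mxvec_index cast_ordK enum_rankK.
Qed.

Lemma cmp_blk (k l : nat) (M : 'I_N -> 'I_N -> 'M[R]_(k, l)) X i :
  cmp i (blk M *m X) = \sum_j M i j *m cmp j X.
Proof.
apply/matrixP => a c; rewrite ord1 !mxE summxE sum_mxvec_index; apply: eq_bigr => j _.
by rewrite mxE; apply: eq_bigr => b _; rewrite blkE mxE.
Qed.

Lemma blk_tr (k l : nat) (M : 'I_N -> 'I_N -> 'M[R]_(k, l)) : (blk M)^T = blk (fun i j => (M j i)^T).
Proof.
apply/matrixP => a b; case/mxvec_indexP: a => i j; case/mxvec_indexP: b => i' j'.
by rewrite mxE !blkE mxE.
Qed.

Lemma cmpD (k : nat) i (X Y : 'cV[R]_(N * k)) : cmp i (X + Y) = cmp i X + cmp i Y.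
Proof. by apply/matrixP => a c; rewrite !mxE. Qed.

Lemma cmpZ (k : nat) i c (X : 'cV[R]_(N * k)) : cmp i (c *: X) = c *: cmp i X.
Proof. by apply/matrixP => a b; rewrite !mxE. Qed.

Lemma cmpN (k : nat) i (X : 'cV[R]_(N * k)) : cmp i (- X) = - cmp i X.
Proof. by apply/matrixP => a b; rewrite !mxE. Qed.

Lemma cmp_sum (k : nat) i (I : Type) (s : seq I) (X : I -> 'cV[R]_(N * k)) :
  cmp i (\sum_(j <- s) X j) = \sum_(j <- s) cmp i (X j).
Proof. by apply/matrixP => a b; rewrite mxE !summxE; apply: eq_bigr => j _; rewrite mxE. Qed.

Lemma cmp_vint (k : nat) i a b (u : R -> 'cV[R]_(N * k)) : cmp i (vint a b u) = vint a b (fun t => cmp i (u t)).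
Proof. by apply/matrixP => j c; rewrite !mxE; apply: Int_eq => s _; rewrite mxE. Qed.

Lemma dot_cmp (k : nat) (X Y : 'cV[R]_(N * k)) : dot X Y = \sum_i dot (cmp i X) (cmp i Y).
Proof.
rewrite dotE sum_mxvec_index; apply: eq_bigr => i _; rewrite dotE.
by apply: eq_bigr => j _; rewrite !mxE.
Qed.

(** Block diagonal: acts on each agent separately. *)
Definition dblk (k l : nat) (M : 'M[R]_(k, l)) := blk (fun i j => (i == j)%:R *: M).

(** Coupling through the average: every agent receives M applied to the mean of all blocks. *)
Definition mblk (k l : nat) (M : 'M[R]_(k, l)) := blk (fun _ _ => N%:R^-1 *: M).

Lemma cmp_dblk (k l : nat) (M : 'M[R]_(k, l)) X i : cmp i (dblk M *m X) = M *m cmp i X.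
Proof.
rewrite cmp_blk (bigD1 i)//= eqxx scale1r big1 ?addr0// => j ji.
by rewrite eq_sym (negbTE ji) scale0r mul0mx.
Qed.

Lemma cmp_mblk (k l : nat) (M : 'M[R]_(k, l)) X i : cmp i (mblk M *m X) = M *m avg (fun j => cmp j X).
Proof.
rewrite cmp_blk /avg -scalemxAr mulmx_sumr scaler_sumr; apply: eq_bigr => j _.
by rewrite scalemxAl.
Qed.

Lemma dblk_tr (k l : nat) (M : 'M[R]_(k, l)) : (dblk M)^T = dblk M^T.
Proof.
by rewrite blk_tr; apply: congr1; apply/funext => i; apply/funext => j; rewrite linearZ /= eq_sym.
Qed.

Lemma mblk_tr (k l : nat) (M : 'M[R]_(k, l)) : (mblk M)^T = mblk M^T.
Proof. by rewrite blk_tr; apply: congr1; apply/funext => i; apply/funext => j; rewrite linearZ. Qed.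

Lemma cmp_const (k : nat) (h : 'cV[R]_k) i : cmp i (stk (fun=> h)) = h.
Proof. exact: cmp_stk. Qed.

Lemma dblk_posdef (k : nat) (M : 'M[R]_k) : posdef M -> posdef (dblk M).
Proof.
move=> [Ms Mp]; split; first by rewrite dblk_tr Ms.
move=> z z0.
have [i iz] : exists i, cmp i z != 0.
  apply/existsP; rewrite -negb_forall; apply: contra z0 => /forallP hz.
  by apply/eqP/eq_cmp => i; rewrite (eqP (hz i)); apply/matrixP => a c; rewrite !mxE.
have q (y : 'cV[R]_k) : qform M y = dot y (M *m y) by rewrite /qform /dot mulmxA.
have q0 (y : 'cV[R]_k) : 0 <= dot y (M *m y).
  rewrite -q; have [->|] := eqVneq y 0; first by rewrite /qform mulmx0 mxE.
  by move=> /Mp /ltW.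
rewrite /qform -mulmxA -/(dot z (dblk M *m z)) dot_cmp (bigD1 i)//= cmp_dblk.
apply: ltr_pwDl; first by rewrite -q; exact: Mp.
by apply: sumr_ge0 => j _; rewrite cmp_dblk.
Qed.

Lemma cmp_invmx_dblk (k l : nat) (M : 'M[R]_k) (B : 'M[R]_(l, k)) X i : posdef M ->
  cmp i (invmx (dblk M) *m (dblk B)^T *m X) = invmx M *m B^T *m cmp i X.
Proof.
move=> pM; have u := posdef_unit pM; have uD := posdef_unit (dblk_posdef pM).
have -> : invmx (dblk M) *m (dblk B)^T *m X = dblk (invmx M *m B^T) *m X.
  apply: (can_inj (mulKmx uD)); rewrite !mulmxA mulmxV// mul1mx.
  apply: eq_cmp => j; rewrite dblk_tr cmp_dblk -mulmxA !cmp_dblk.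
  by rewrite !mulmxA mulmxV// mul1mx.
by rewrite cmp_dblk.
Qed.

Lemma sum_avg (k : nat) (z : 'I_N -> 'cV[R]_k) : (0 < N)%N -> \sum_i z i = N%:R *: avg z.
Proof. by move=> N0; rewrite /avg scalerA divff ?scale1r// pnatr_eq0 -lt0n. Qed.

Lemma dot_suml (k : nat) (z : 'I_N -> 'cV[R]_k) c : \sum_i dot (z i) c = dot (\sum_i z i) c.
Proof. by rewrite /dot linear_sum mulmx_suml summxE. Qed.

Lemma sum_add0 (u v : 'I_N -> R) : \sum_i v i = 0 -> \sum_i u i = \sum_i (u i + v i).
Proof. by rewrite big_split /= => ->; rewrite addr0. Qed.

(** The two sides agree only after summation, where the scalar product of x_i with a vector
    independent of i may be replaced by that of the average. The terms d1 to d4 record these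
    replacements and sum to 0; with them added, the summands agree for each i. *)
Lemma stacked_cost (n : nat) (Q Gam : 'M[R]_n) (eta : 'cV[R]_n) (X : 'cV[R]_(N * n)) : (0 < N)%N -> Q^T = Q ->
  let QG := Gam^T *m Q + Q *m Gam - Gam^T *m Q *m Gam in
  \sum_i qform Q (cmp i X - Gam *m avg (fun j => cmp j X) - eta) =
  dot ((dblk Q - mblk QG) *m X - 2 *: stk (fun=> Q *m eta - Gam^T *m Q *m eta)) X + N%:R * qform Q eta.
Proof.
move=> N0 Qs QG; set a := avg _; rewrite dot_cmp.
have qE (y : 'cV[R]_n) : qform Q y = dot y (Q *m y) by rewrite /qform /dot mulmxA.
have NN : N%:R * qform Q eta = \sum_(i < N) qform Q eta by rewrite sumr_const card_ord mulr_natl.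
have S c : \sum_i dot (cmp i X) c = \sum_(i < N) dot a c.
  by rewrite dot_suml sum_avg// dotZl sumr_const card_ord mulr_natl.
have S1 := S (Gam^T *m (Q *m (Gam *m a))); have S2 := S (Gam^T *m (Q *m eta)).
have S3 := S (Q *m (Gam *m a)); have S4 := S (Gam^T *m (Q *m a)).
rewrite NN -big_split /=.
pose d1 i := dot (cmp i X) (Gam^T *m (Q *m (Gam *m a))) - dot a (Gam^T *m (Q *m (Gam *m a))).
pose d2 i := dot (cmp i X) (Gam^T *m (Q *m eta)) - dot a (Gam^T *m (Q *m eta)).
pose d3 i := dot (cmp i X) (Q *m (Gam *m a)) - dot a (Q *m (Gam *m a)).
pose d4 i := dot (cmp i X) (Gam^T *m (Q *m a)) - dot a (Gam^T *m (Q *m a)).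
have z1 : \sum_i d1 i = 0 by rewrite sumrB S1 subrr.
have z2 : \sum_i d2 i = 0 by rewrite sumrB S2 subrr.
have z3 : \sum_i d3 i = 0 by rewrite sumrB S3 subrr.
have z4 : \sum_i d4 i = 0 by rewrite sumrB S4 subrr.
have z : \sum_i (d1 i + 2 * d2 i + d3 i - d4 i) = 0.
  transitivity (\sum_i d1 i + 2 * (\sum_i d2 i) + \sum_i d3 i - \sum_i d4 i).
    by rewrite mulr_sumr -!big_split -sumrB.
  by rewrite z1 z2 z3 z4; ring.
transitivity (\sum_i (qform Q (cmp i X - Gam *m a - eta) + (d1 i + 2 * d2 i + d3 i - d4 i))).
  exact: sum_add0 z.
apply: eq_bigr => i _.
have -> : cmp i ((dblk Q - mblk QG) *m X - 2 *: stk (fun=> Q *m eta - Gam^T *m Q *m eta)) =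
  Q *m cmp i X - QG *m a - 2 *: (Q *m eta - Gam^T *m Q *m eta).
  by rewrite mulmxBl !cmpD !cmpN cmpZ cmp_const cmp_dblk cmp_mblk.
set u := cmp i X; clearbody a.
rewrite qE (qE eta) /d1 /d2 /d3 /d4 -/u /QG.
rewrite !mulmxBl mulmxDl -!mulmxA !(mulmxDr, mulmxN) scalerBr !(dotDl, dotNl, dotZl) !(dotDr, dotNr).
rewrite (dotMr Q u (Gam *m a)) (dotMr Q u eta) Qs (dotMr Q (Gam *m a) eta) Qs.
rewrite (dotC (Q *m eta) (Gam *m a)) !(dotMl Gam a) (dotC (Q *m u)) !(dotC (Gam^T *m _) u).
rewrite (dotC (Q *m (Gam *m a)) u) (dotC (Q *m eta) u).
have -> : dot a (Gam^T *m (Q *m a)) = dot a (Q *m (Gam *m a)).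
  by rewrite -dotMl (dotMr Q a) Qs dotC.
by ring.
Qed.

End Stack.

(** * From the stacked problem back to the agents *)

Section Transfer.
Context (R : realType) (d : measure_display) (Omega : measurableType d) (P : probability Omega R).
Variables (N n r : nat) (D : lq_data R n r) (x0 : 'I_N -> Omega -> 'cV[R]_n) (W : 'I_N -> R -> {RV P >-> R}).
Hypothesis hN : (0 < N)%N.
Hypothesis hT : 0 < lqT D.
Hypothesis hQ : (lqQ D)^T = lqQ D.
Hypothesis hf : {within `[0, +oo[, continuous (lqf D)}.
Hypothesis hsigma : {within `[0, +oo[, continuous (lqsigma D)}.
Hypothesis hW : forall i, is_brownian (W i).
Hypothesis hWind : mutually_independent P (sigma_noise W).
Hypothesis hx0meas : forall i k, measurable_fun setT (fun w => x0 i w k 0).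
Variable C0 : R.
Hypothesis hx0C0 : forall i, ('E_P[fun w => sqnorm (x0 i w)] < C0%:E)%E.
Hypothesis hx0W : independent2 P (<<s \bigcup_(i in [set: 'I_N]) sigma_init x0 i >>)
     (<<s \bigcup_(i in [set: 'I_N]) sigma_noise W i >>).
Hypothesis hR : posdef (lqR D).

Local Notation T := (lqT D).
Local Notation rho := (lqrho D).
Local Notation F := (filtration x0 W).
Local Notation lam := (@lebesgue_measure R).
Local Notation DD := (`[0, T] `*` [set: Omega]).
Local Notation AA := (dblk N (lqA D) + mblk N (lqG D)).
Local Notation BB := (dblk N (lqB D)).
Local Notation QQ := (dblk N (lqQ D) - mblk N (QGamma D)).
Local Notation RR := (dblk N (lqR D)).
Local Notation hh := (stk (fun _ : 'I_N => etabar D)).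
Local Notation phi := (fun t => stk (fun _ : 'I_N => lqf D t)).
Local Notation ini := (fun w => stk (fun i => x0 i w)).
Local Notation sg := (fun (j : 'I_N) t => stk (fun i => (i == j)%:R *: lqsigma D t)).
Local Notation stkp z := (fun t w => stk (fun i => z i t w)).
Local Notation cmpp X := (fun i t w => cmp i (X t w)).

Let T0 : 0 <= T := ltW hT.
Let sF : forall t, subsigma (F t). Proof. exact: subsigma_filtration. Qed.
Let mF : forall s t, s <= t -> F s `<=` F t. Proof. exact: filtration_mono. Qed.
Let gW : forall j t, 0 <= t -> gmeas (F t) (W j t). Proof. exact: gmeas_W. Qed.
Let sK : forall j s, subsigma (allbut x0 W j s). Proof. exact: subsigma_allbut. Qed.
Let FK : forall j s, F s `<=` allbut x0 W j s. Proof. exact: filtration_allbut. Qed.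
Let KW : forall i j s t, i != j -> 0 <= t -> gmeas (allbut x0 W j s) (W i t). Proof. exact: gmeas_W_allbut. Qed.
Let incL : forall j s t, 0 <= s -> s <= t -> L2s P setT (fun w => W j t w - W j s w).
Proof. by move=> j s t; exact: increment_L2s. Qed.
Let incO : forall j s t, 0 <= s -> s <= t -> orth P (allbut x0 W j s) (fun w => W j t w - W j s w).
Proof. by move=> j s t; exact: increment_orth. Qed.
Let incS : forall j s t, 0 <= s -> s <= t ->
  orth P (allbut x0 W j s) (fun w => (W j t w - W j s w) ^+ 2 - (t - s)).
Proof. by move=> j s t; exact: increment_sq_orth. Qed.
Let sub0T : `[0, T]%classic `<=` (`[0, +oo[%classic : set R).
Proof. by move=> t; rewrite /= !in_itv /= => /andP[-> _]. Qed.
Let cW : forall j, acont P T (fun t => [eta W j t]).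
Proof. by move=> j; have [_ _ _] := hW j; apply: ae_imp => w; exact: continuous_subspaceW. Qed.
Let blum : forall xi, L1 P setT xi -> (forall e, 0 < e -> e <= T -> AM P (F e) xi) -> AM P (F 0) xi.
Proof. by move=> xi; exact: blumenthal. Qed.

Let comp_cont (k : nat) (u : R -> 'cV[R]_k) l : {within `[0, +oo[, continuous u} -> {within `[0, T], continuous (fun t => u t l 0)}.
Proof.
move=> cu t; have cs := continuous_subspaceW sub0T cu.
exact: (cvg_comp _ (fun v : 'cV[R]_k => v l 0) (cs t) (@coord_continuous _ _ _ l 0 _)).
Qed.

Lemma QQ_sym : QQ^T = QQ.
Proof.
rewrite linearB /= dblk_tr mblk_tr hQ; congr (_ - mblk N _).
by rewrite /QGamma linearB linearD /= !trmx_mul !trmxK hQ mulmxA (addrC (lqQ D *m _)).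
Qed.

Let RRp : posdef RR := dblk_posdef N hR.

Let Lphi l : L2s lam `[0, T] (fun t => phi t l 0).
Proof.
case/mxvec_indexP: l => i j; apply: (L2s_eq (itv_meas 0 T) (f := fun t => lqf D t j 0)) => [t _|].
  by rewrite stkE.
by apply: cont_L2s => //; exact: comp_cont hf.
Qed.

Let csg j l : {within `[0, T], continuous (fun t => sg j t l 0)}.
Proof.
case/mxvec_indexP: l => i k; rewrite (_ : (fun t => _) = fun t => (i == j)%:R * lqsigma D t k 0); last first.
  by apply/funext => t; rewrite stkE mxE.
move=> t; apply: cvgM; first exact: cvg_cst.
have cs := @comp_cont n (lqsigma D) k hsigma; exact: (cs t).
Qed.

Let Lx0 i k : L2s P setT (fun w => x0 i w k 0).
Proof.
split; first exact: hx0meas.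
apply/integrableP; split; first by apply/measurable_EFinP; apply: measurable_funX; exact: hx0meas.
apply: le_lt_trans (lt_trans (hx0C0 i) (ltry C0)); rewrite unlock; apply: ge0_le_integral => //.
- by apply/measurable_EFinP; apply: measurableT_comp; [exact: normr_measurable|apply: measurable_funX; exact: hx0meas].
- by apply/measurable_EFinP; apply: measurable_sqnorm => l; exact: hx0meas.
- by move=> w _; rewrite /= lee_fin ger0_norm ?sqr_ge0// sqr_le_sqnorm.
Qed.

Let Lini l : L2s P setT (fun w => ini w l 0).
Proof.
case/mxvec_indexP: l => i k; apply: (L2s_eq measurableT (f := fun w => x0 i w k 0)) => [w _|]; first by rewrite stkE.
exact: Lx0.
Qed.

Let gini l : gmeas (F 0) (fun w => ini w l 0).
Proof.
case/mxvec_indexP: l => i k; rewrite (_ : (fun w => _) = fun w => x0 i w k 0); last by apply/funext => w; rewrite stkE.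
exact: gmeas_x0.
Qed.

Lemma L2F_stk (k : nat) (z : 'I_N -> R -> Omega -> 'cV[R]_k) : (forall i, L2F P F T (z i)) -> L2F P F T (stkp z).
Proof.
move=> hz; apply (proj2 (@L2F_SL2 d Omega R P F T sF (N * k)%N (stkp z))) => l; case/mxvec_indexP: l => i j.
by apply: (SL2_eq _ (L2Fc sF j (hz i))) => t w _; rewrite stkE.
Qed.

Lemma L2F_cmp (k : nat) (X : R -> Omega -> 'cV[R]_(N * k)) i : L2F P F T X -> L2F P F T (cmpp X i).
Proof.
move=> hX; apply (proj2 (@L2F_SL2 d Omega R P F T sF k (cmpp X i))) => l.
by apply: (SL2_eq _ (L2Fc sF (mxvec_index i l) hX)) => t w _; rewrite mxE.
Qed.

Lemma cmpAA i X : cmp i (AA *m X) = lqA D *m cmp i X + lqG D *m avg (fun j => cmp j X).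
Proof. by rewrite mulmxDl cmpD cmp_dblk cmp_mblk. Qed.

Lemma cmpQQ i X : cmp i (QQ *m X) = lqQ D *m cmp i X - QGamma D *m avg (fun j => cmp j X).
Proof. by rewrite mulmxBl cmpD cmpN cmp_dblk cmp_mblk. Qed.

Lemma cmpAR i X : cmp i ((AA - rho%:M)^T *m X) =
  (lqA D - rho%:M)^T *m cmp i X + (lqG D)^T *m avg (fun j => cmp j X).
Proof.
rewrite !linearB !linearD /= !tr_scalar_mx dblk_tr mblk_tr mulmxBl mulmxDl cmpD cmpN cmpD cmp_dblk cmp_mblk.
by rewrite !mul_scalar_mx mulmxBl cmpZ mul_scalar_mx addrAC.
Qed.

Lemma noise_exists : exists2 z : 'I_N -> R -> Omega -> 'cV[R]_n,
  forall j, is_ito_integral F T (W j) (fun t _ => lqsigma D t) (z j) & forall j, L2F P F T (z j).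
Proof.
have cs l : {within `[0, T], continuous (fun t => lqsigma D t l 0)} := @comp_cont n (lqsigma D) l hsigma.
have /choice[z hz] : forall j, exists Z : R -> Omega -> 'cV[R]_n,
    is_ito_integral F T (W j) (fun t _ => lqsigma D t) Z /\ L2F P F T Z.
  move=> j; have [l e e0|l|Z h1 h2] := ito_exists_L2F sF mF T0 gW sK FK KW incL incO incS hT cW j (k := lqsigma D).
  - by apply: continuous_subspaceW (cs l); apply: subset_itvScc; rewrite bnd_simp// ltW.
  - exact: cont_L2s (cs l).
  - by exists Z.
by exists z => j; have [] := hz j.
Qed.

Variable z : 'I_N -> R -> Omega -> 'cV[R]_n.
Hypothesis hz : forall j, is_ito_integral F T (W j) (fun t _ => lqsigma D t) (z j).
Hypothesis Lz : forall j, L2F P F T (z j).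
(** Noise j enters only the block of agent j. *)
Let Zs j t w : 'cV[R]_(N * n) := stk (fun i => (i == j)%:R *: z j t w).
Local Notation Nn := (fun t w => \sum_j Zs j t w).

Let hZs j : sitov F T W j (fun t _ => sg j t) (Zs j).
Proof.
move=> l; case/mxvec_indexP: l => i k; have s := is_ito_sito sF incL k (hz j).
case: (eqVneq i j) => [ij|ij].
  rewrite (_ : (fun t w => sg j t _ 0) = fun t w => lqsigma D t k 0); last first.
    by apply/funext => t; apply/funext => w; rewrite stkE ij eqxx scale1r.
  rewrite (_ : (fun t w => Zs j t w _ 0) = fun t w => z j t w k 0) //.
  by apply/funext => t; apply/funext => w; rewrite stkE ij eqxx scale1r.
have := sito_sub s s.
rewrite (_ : (fun t w => sg j t _ 0) = fun t w => lqsigma D t k 0 - lqsigma D t k 0); last first.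
  by apply/funext => t; apply/funext => w; rewrite stkE (negbTE ij) scale0r mxE subrr.
rewrite (_ : (fun t w => Zs j t w _ 0) = fun t w => z j t w k 0 - z j t w k 0) //.
by apply/funext => t; apply/funext => w; rewrite stkE (negbTE ij) scale0r mxE subrr.
Qed.

Let cmpNn i t w : cmp i (Nn t w) = z i t w.
Proof.
rewrite cmp_sum (bigD1 i)//= cmp_stk eqxx scale1r big1 ?addr0// => j ji.
by rewrite cmp_stk eq_sym (negbTE ji) scale0r.
Qed.

Let LNn : L2F P F T Nn.
Proof.
apply: (L2F_sum sF) => j _; apply: L2F_stk => i; exact: (L2FZ sF _ (Lz j)).
Qed.

Local Notation SOL := (solves P F T AA BB ini phi Nn).

(** The stochastic integral occurring in a state equation is indistinguishable from the fixed [z i],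
    so all states are driven by one common stacked noise path. *)
Lemma state_solves u x : admissible D x0 W u -> is_state D x0 W u x -> SOL (stkp u) (stkp x).
Proof.
move=> hu hx; split; first by apply: L2F_stk => i; exact: (hx i).1.
have : {ae P, forall w, forall i, forall t, 0 <= t <= T -> x i t w = x0 i w +
   vint 0 t (fun s => lqA D *m x i s w + lqB D *m u i s w + lqG D *m avgp x s w + lqf D s) + z i t w}.
  apply: ae_fin => i; have [_ [Z hZ eZ]] := hx i.
  have zZ : {ae P, forall w, forall l, forall t, 0 <= t <= T -> Z t w l 0 = z i t w l 0}.
    by apply: ae_fin => l; exact: (sito_uniq sF mF gW sK FK KW incL incO incS (is_ito_sito sF incL l hZ) (is_ito_sito sF incL l (hz i))).
  apply: ae_imp2 zZ eZ => w e1 e2 t tT; rewrite (e2 t tT); congr (_ + _).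
  by apply/matrixP => l c; rewrite ord1; exact: e1.
apply: ae_imp => w hw t tT; apply: eq_cmp => i.
rewrite cmp_stk (hw i t tT) !cmpD cmp_stk cmpNn cmp_vint; congr (_ + _ + _); apply: eq_vint => s _.
rewrite !cmpD cmpAA cmp_dblk !cmp_stk /avgp; congr (_ + _).
rewrite (_ : (fun j => cmp j _) = fun j => x j s w); first by rewrite addrAC.
by apply/funext => j; rewrite cmp_stk.
Qed.

Lemma solves_state u X : SOL (stkp u) X -> is_state D x0 W u (cmpp X).
Proof.
move=> [LX hX] i; split; first exact: L2F_cmp.
exists (z i); first exact: hz.
apply: ae_imp hX => w hw t tT; rewrite (hw t tT) !cmpD cmp_stk cmpNn cmp_vint.
congr (_ + _ + _); apply: eq_vint => s _.
by rewrite !cmpD cmpAA cmp_dblk !cmp_stk /avgp; congr (_ + _); rewrite addrAC.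
Qed.

Lemma SOL_exists U : L2F P F T U -> exists X, SOL U X.
Proof. by move=> LU; apply: (solves_exists sF mF T0) => //; exact: LNn. Qed.

Lemma stkp_cmpp (k : nat) (X : R -> Omega -> 'cV[R]_(N * k)) : stkp (cmpp X) = X.
Proof. by apply/funext => t; apply/funext => w; apply: eq_cmp => i; rewrite cmp_stk. Qed.

(** For admissible controls [state] is a genuine solution, never the default value. *)
Lemma is_state_state u : admissible D x0 W u -> is_state D x0 W u (state D x0 W u).
Proof.
move=> hu; have [X hX] := SOL_exists (L2F_stk hu).
by apply: (xgetPex (fun _ _ _ => 0)); exists (cmpp X); exact: solves_state.
Qed.

Let ip_L1' (q : nat) (a b : R -> Omega -> 'cV[R]_q) : L2F P F T a -> L2F P F T b ->
  L1 (lam \x P)%E DD (fun u : R * Omega => expR (- rho * u.1) * dot (a u.1 u.2) (b u.1 u.2)).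
Proof. by move=> La Lb; apply: (ip_L1 F T0 rho); apply: (L2F_L2P sF). Qed.

(** The contribution of eta alone, common to all controls. *)
Let cst : R := \int[(lam \x P)%E]_(u in DD) (expR (- rho * u.1) * (N%:R * qform (lqQ D) (lqeta D))).

Lemma L1_cst_wt c : L1 (lam \x P)%E DD (fun u : R * Omega => expR (- rho * u.1) * c).
Proof. by apply: (wtM F T0 rho); apply: (L1_cst (mDD T)); exact: DD_lty. Qed.

Lemma Jsoc_state u : admissible D x0 W u ->
  Jsoc D x0 W u = (cost P T rho QQ RR hh (stkp (state D x0 W u)) (stkp u) + cst)%:E.
Proof.
move=> hu; have hx := is_state_state hu; set x := state D x0 W u in hx *.
pose y i t w := x i t w - lqGamma D *m avgp x t w - lqeta D.
have Lx i : L2F P F T (x i) := (hx i).1.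
have La : L2F P F T (avgp x) by apply: (L2FZ sF); apply: (L2F_sum sF) => j _; exact: Lx.
have Ly i : L2F P F T (y i) := L2FB sF (L2FB sF (Lx i) (L2FM sF T0 _ La)) (L2F_cst P T sF (lqeta D)).
have qE (k : nat) (M : 'M[R]_k) v : qform M v = dot v (M *m v) by rewrite /qform /dot mulmxA.
pose rc i (v : R * Omega) := expR (- rho * v.1) * dot (y i v.1 v.2) (lqQ D *m y i v.1 v.2) +
   expR (- rho * v.1) * dot (u i v.1 v.2) (lqR D *m u i v.1 v.2).
have Lrc i : L1 (lam \x P)%E DD (rc i).
  exact: (L1D (mDD T) (ip_L1' (Ly i) (L2FM sF T0 (lqQ D) (Ly i))) (ip_L1' (hu i) (L2FM sF T0 (lqR D) (hu i)))).
have JE i : J D x0 W i u = (\int[(lam \x P)%E]_(v in DD) rc i v)%:E.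
  have := fubini_slab1E (m1 := lam) (m2 := P) (f := fun t w => rc i (t, w)) (itv_meas 0 T).
  move=> /(_ (Lrc i)) <-.
  apply: eq_integral => w _; apply: eq_integral => t _.
  by rewrite /running_cost !qE mulrDr.
rewrite /Jsoc (eq_bigr _ (fun i _ => JE i)) sumEFin -(Int_sum (mDD T)) => [|i _]; last exact: Lrc.
have LU := L2F_stk hu; have LX := L2F_stk Lx.
have L1c := L1_cst_wt (N%:R * qform (lqQ D) (lqeta D)).
have LQX := L2FB sF (L2FM sF T0 QQ LX) (L2F_cst P T sF (2 *: hh)).
have M1 := ip_L1' LQX LX; have M2 := ip_L1' (L2FM sF T0 RR LU) LU.
rewrite /cost /ip /cst -(IntD (mDD T) M1 M2) -(IntD (mDD T) (L1D (mDD T) M1 M2) L1c); congr (_%:E).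
apply: Int_eq => -[t w] _ /=; rewrite /rc big_split /= -!mulr_sumr -!mulrDr; congr (_ * _).
have := stacked_cost (lqGamma D) (lqeta D) (stk (fun i => x i t w)) hN hQ => /= sc.
rewrite [RHS]addrAC -[X in _ = X + _]sc; congr (_ + _).
  apply: eq_bigr => i _; rewrite cmp_stk qE /y /avgp.
  by rewrite (_ : (fun j => cmp j _) = fun j => x j t w)//; apply/funext => j; rewrite cmp_stk.
by rewrite dot_cmp; apply: eq_bigr => i _; rewrite cmp_dblk cmp_stk dotC.
Qed.

Lemma cost_ae h X Y U : L2F P F T X -> L2F P F T Y -> L2F P F T U ->
  {ae P, forall w, forall t, 0 <= t <= T -> X t w = Y t w} ->
  cost P T rho QQ RR h X U = cost P T rho QQ RR h Y U.
Proof.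
move=> LX LY LU XY; congr (_ + _).
have LQ Z := L2FB sF (L2FM sF T0 QQ Z) (L2F_cst P T sF (2 *: h)).
apply: (Int_ae (mDD T) (L1_meas (mDD T) (ip_L1' (LQ _ LX) LX)) (L1_meas (mDD T) (ip_L1' (LQ _ LY) LY))).
have LXY := L2FB sF LX LY.
have XY0 : {ae P, forall w, forall t, 0 < t <= T -> X t w - Y t w = 0}.
  by apply: ae_imp XY => w e t /andP[t0 tT]; rewrite e ?subrr// ltW.
apply: ae_imp (ae_path_DD sF T0 rho LXY XY0) => u e Du.
by have /eqP := e Du; rewrite subr_eq0 => /eqP ->.
Qed.

(** By uniqueness up to indistinguishability, any stacked solution may replace the one selected by
    [state]. *)
Lemma JsocE u X : admissible D x0 W u -> SOL (stkp u) X ->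
  Jsoc D x0 W u = (cost P T rho QQ RR hh X (stkp u) + cst)%:E.
Proof.
move=> hu hX; have LU := L2F_stk hu.
have hs := state_solves hu (is_state_state hu).
have e := cost_ae hh hs.1 hX.1 LU (solves_uniq sF T0 Lphi LU hs hX).
by rewrite (Jsoc_state hu) e.
Qed.

Local Notation HSOL := (solves P F T AA BB (fun=> 0) (fun=> 0) (fun _ _ => 0)).

Lemma optimal_le u : optimal D x0 W u <->
  admissible D x0 W u /\ forall v, admissible D x0 W v -> (Jsoc D x0 W u <= Jsoc D x0 W v)%E.
Proof.
split=> -[hu hle]; (split; first exact: hu).
  by move=> v hv; rewrite hle; apply: ereal_inf_lbound; exists v.
apply/eqP; rewrite eq_le; apply/andP; split; last by apply: ereal_inf_lbound; exists u.
by apply: le_ereal_inf_tmp => _ [v hv <-]; exact: hle.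
Qed.

Lemma adm_cmpp U : L2F P F T U -> admissible D x0 W (cmpp U).
Proof. by move=> LU i; exact: L2F_cmp. Qed.

(** Midpoint convexity between V and -V around the zero control: the linear terms cancel and the
    nonnegative quantity that remains is q(V). *)
Lemma convex_cost_ge0 : convex_in_u D x0 W ->
  forall V y, L2F P F T V -> HSOL V y -> 0 <= cost P T rho QQ RR 0 y V.
Proof.
move=> cvx V y LV hy.
have L0 : L2F P F T (fun _ _ => 0 : 'cV[R]_(N * r)) := L2F0 P T sF _.
have [X hX] := SOL_exists L0.
have h1 := solves_perturb sF T0 1 Lphi L0 LV hX hy.
have h2 := solves_perturb sF T0 (-1) Lphi L0 LV hX hy.
have LU c : L2F P F T (fun t w => 0 + c *: V t w) := L2FD sF L0 (L2FZ sF c LV).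
have half : 0 <= (2^-1 : R) <= 1 by lra.
have := cvx _ _ 2^-1 (adm_cmpp (LU 1)) (adm_cmpp (LU (-1))) half.
have E0 : (fun (i : 'I_N) t w => 2^-1 *: cmp i (0 + 1 *: V t w) + (1 - 2^-1) *: cmp i (0 + (-1) *: V t w)) = cmpp (fun (_ : R) (_ : Omega) => 0 : 'cV[R]_(N * r)).
  apply/funext => i; apply/funext => t; apply/funext => w.
  by rewrite !cmpD !cmpZ; apply/matrixP => a b; rewrite !mxE; lra.
rewrite E0.
have JE U Y : L2F P F T U -> SOL U Y -> Jsoc D x0 W (cmpp U) = (cost P T rho QQ RR hh Y U + cst)%:E.
  by move=> LU' hY; have := @JsocE (cmpp U) Y (adm_cmpp LU'); rewrite stkp_cmpp => /(_ hY).
rewrite (JE _ _ L0 hX) (JE _ _ (LU 1) h1) (JE _ _ (LU (-1)) h2) -!EFinM -EFinD lee_fin.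
rewrite (cost_expand sF T0 rho QQ_sym RRp hh 1 hX.1 L0 hy.1 LV) (cost_expand sF T0 rho QQ_sym RRp hh (-1) hX.1 L0 hy.1 LV).
lra.
Qed.

Lemma convex_comb (l a b q c : R) : 0 <= l -> l <= 1 -> 0 <= q ->
  a + 2 * l * b + l ^+ 2 * q + c <= l * (a + 2 * 1 * b + 1 ^+ 2 * q + c) + (1 - l) * (a + c).
Proof.
move=> l0 l1 q0; rewrite -subr_ge0 (_ : _ - _ = l * (1 - l) * q); last by ring.
by rewrite !mulr_ge0// subr_ge0.
Qed.

(** Along the segment from v to u the defect of convexity is l (1 - l) q(u - v). *)
Lemma cost_ge0_convex : (forall V y, L2F P F T V -> HSOL V y -> 0 <= cost P T rho QQ RR 0 y V) ->
  convex_in_u D x0 W.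
Proof.
move=> q0 u v l hu hv /andP[l0 l1].
have Lu := L2F_stk hu; have Lv := L2F_stk hv.
have [Xu hXu] := SOL_exists Lu; have [Xv hXv] := SOL_exists Lv.
have hd := solves_diff sF T0 Lphi Lu Lv hXu hXv.
have Ld := L2FB sF Lu Lv.
have P1' := solves_perturb sF T0 1 Lphi Lv Ld hXv hd.
have Pl := solves_perturb sF T0 l Lphi Lv Ld hXv hd.
have Eu : (fun t w => stkp v t w + 1 *: (stkp u t w - stkp v t w)) = stkp u.
  by apply/funext => t; apply/funext => w; rewrite scale1r addrC subrK.
have EX : (fun t w => Xv t w + 1 *: (Xu t w - Xv t w)) = Xu.
  by apply/funext => t; apply/funext => w; rewrite scale1r addrC subrK.
have El : (fun t w => stkp v t w + l *: (stkp u t w - stkp v t w)) = stkp (fun i t w => l *: u i t w + (1 - l) *: v i t w).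
  apply/funext => t; apply/funext => w; apply: eq_cmp => i; rewrite cmpD cmpZ cmpD cmpN !cmp_stk.
  by apply/matrixP => a b; rewrite !mxE; ring.
have ha : admissible D x0 W (fun i t w => l *: u i t w + (1 - l) *: v i t w).
  by move=> i; apply: (L2FD sF); apply: (L2FZ sF); [exact: hu|exact: hv].
rewrite El in Pl; rewrite (JsocE ha Pl) (JsocE hu hXu) (JsocE hv hXv) -!EFinM -EFinD lee_fin.
have e1 := cost_expand sF T0 rho QQ_sym RRp hh 1 hXv.1 Lv hd.1 Ld.
have el := cost_expand sF T0 rho QQ_sym RRp hh l hXv.1 Lv hd.1 Ld.
rewrite Eu EX in e1; rewrite El in el; rewrite e1 el.
apply: convex_comb => //; exact: q0 Ld hd.
Qed.

Lemma drift_ucheck (x p : 'I_N -> R -> Omega -> 'cV[R]_n) i :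
  (fun t w => lqA D *m x i t w - lqB D *m invmx (lqR D) *m (lqB D)^T *m p i t w + lqG D *m avgp x t w + lqf D t) =
  (fun t w => lqA D *m x i t w + lqB D *m ucheck D p i t w + lqG D *m avgp x t w + lqf D t).
Proof. by apply/funext => t; apply/funext => w; rewrite /ucheck mulmxN !mulmxA. Qed.

Lemma avg_cmp_stk (k : nat) (v : 'I_N -> 'cV[R]_k) : avg (fun j => cmp j (stk v)) = avg v.
Proof. by congr avg; apply/funext => j; rewrite cmp_stk. Qed.

Lemma fbsde_state x p beta : fbsde D x0 W x p beta ->
  admissible D x0 W (ucheck D p) /\ is_state D x0 W (ucheck D p) x.
Proof.
move=> hfb; split.
  by move=> i; have [_ Lp _ _ _] := hfb i; exact: (L2FN sF (L2FM sF T0 _ Lp)).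
move=> i; have [Lx _ _ [Z hZ eZ] _] := hfb i; split; first exact: Lx.
by exists Z; [exact: hZ|rewrite -drift_ucheck].
Qed.

(** The feedback is stationary by [adjoint_stationary], so the expansion of the cost around it
    consists of its own cost plus a nonnegative quadratic term. *)
Lemma fbsde_optimal x p beta : convex_in_u D x0 W -> fbsde D x0 W x p beta -> optimal D x0 W (ucheck D p).
Proof.
move=> cvx hfb; have [hu hx] := fbsde_state hfb.
have hX := state_solves hu hx; have LU := L2F_stk hu.
have Lp : L2F P F T (stkp p) by apply: L2F_stk => i; have [_ h _ _ _] := hfb i; exact: h.
have /choice[Z hZ] : forall i, exists Z : 'I_N -> R -> Omega -> 'cV[R]_n,
    (forall j, is_ito_integral F T (W j) (beta i j) (Z j)) /\
    ito_equation P T (p i 0) (fun t w => - ((lqA D - rho%:M)^T *m p i t w + (lqG D)^T *m avgp p t w)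
              - (lqQ D *m x i t w - QGamma D *m avgp x t w - etabar D)) (fun t w => \sum_(j < N) Z j t w) (p i).
  by move=> i; have [_ _ _ _ [[Z h1 h2] _]] := hfb i; exists Z.
pose Zt t w := stk (fun i => \sum_j Z i j t w).
have sZ i j : sitov F T W j (beta i j) (Z i j) by move=> l; exact: (is_ito_sito sF incL l ((hZ i).1 j)).
have dc0 : forall V y, L2F P F T V -> HSOL V y -> dcost P T rho QQ RR hh (stkp x) (stkp (ucheck D p)) y V = 0.
  apply: (adjoint_stationary sF mF T0 RRp (p := stkp p) (Zt := Zt) hX.1 Lp).
  - move=> t l tT; case/mxvec_indexP: l => i k.
    apply: (L2s_eq measurableT (f := fun w => (\sum_j Z i j t w) k 0)) => [w _|]; first by rewrite stkE.
    exact: (ito_sum_L2s k (sZ i) tT).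
  - move=> t l t0 tT; case/mxvec_indexP: l => i k A FA.
    rewrite (Int_eq P (g := fun w => (\sum_j Z i j T w) k 0 - (\sum_j Z i j t w) k 0)) => [|w _]; last by rewrite !stkE.
    exact: (ito_sum_orth sF mF sK FK incL incO k (sZ i) t0 tT (lexx T) FA).
  - have h : {ae P, forall w, forall i, forall t, 0 <= t <= T -> p i t w = p i 0 w +
       vint 0 t (fun s => - ((lqA D - rho%:M)^T *m p i s w + (lqG D)^T *m avgp p s w)
              - (lqQ D *m x i s w - QGamma D *m avgp x s w - etabar D)) + \sum_(j < N) Z i j t w}.
      by apply: ae_fin => i; exact: (hZ i).2.
    apply: ae_imp h => w hw t tT; apply: eq_cmp => i.
    rewrite cmp_stk (hw i t tT) !cmpD !cmp_stk cmp_vint; congr (_ + _ + _); apply: eq_vint => s _.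
    rewrite cmpD !cmpN cmpD cmpN cmpAR cmpQQ !cmp_stk.
    by rewrite !avg_cmp_stk.
  - have h : {ae P, forall w, forall i, p i T w = 0} by apply: ae_fin => i; have [_ _ _ _ []] := hfb i.
    by apply: ae_imp h => w hw; apply: eq_cmp => i; rewrite cmp_stk hw; apply/matrixP => a b; rewrite !mxE.
  - by move=> t w; apply: eq_cmp => i; rewrite cmpN cmp_invmx_dblk// !cmp_stk.
apply/optimal_le; split=> // v hv.
have [Y hY] := SOL_exists (L2F_stk hv); have Lv := L2F_stk hv.
have hd := solves_diff sF T0 Lphi Lv LU hY hX.
have Ld := L2FB sF Lv LU.
have EV : (fun t w => stkp (ucheck D p) t w + 1 *: (stkp v t w - stkp (ucheck D p) t w)) = stkp v.
  by apply/funext => t; apply/funext => w; rewrite scale1r addrC subrK.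
have EY : (fun t w => stkp x t w + 1 *: (Y t w - stkp x t w)) = Y.
  by apply/funext => t; apply/funext => w; rewrite scale1r addrC subrK.
have e1 := cost_expand sF T0 rho QQ_sym RRp hh 1 hX.1 LU hd.1 Ld.
rewrite EV EY (dc0 _ _ Ld hd) in e1.
rewrite (JsocE hu hX) (JsocE hv hY) lee_fin e1 lerD2r mulr0 addr0 expr1n mul1r lerDl.
exact: convex_cost_ge0 cvx _ _ Ld hd.
Qed.

(** Minimality gives stationarity and q >= 0 together; q >= 0 yields convexity and [optimal_adjoint]
    the adjoint. The integrands beta obtained are deterministic, and x is the state of u itself. *)
Lemma optimal_fbsde u : optimal D x0 W u -> convex_in_u D x0 W /\
  exists x p beta, fbsde D x0 W x p beta /\ ae_eq_processes P D u (ucheck D p).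
Proof.
move=> /optimal_le[hu hle]; have LU := L2F_stk hu.
have hst := is_state_state hu; set x := state D x0 W u in hst *.
have hX := state_solves hu hst.
have fo := first_order sF T0 QQ_sym RRp (h := hh) Lphi LU hX.
have {}fo : forall V y, L2F P F T V -> HSOL V y -> dcost P T rho QQ RR hh (stkp x) (stkp u) y V = 0 /\ 0 <= cost P T rho QQ RR 0 y V.
  move=> V y; apply: fo => V' y' LV' hy'.
  have := hle _ (adm_cmpp LV'); have hy2 : SOL (stkp (cmpp V')) y' by rewrite stkp_cmpp.
  by rewrite (JsocE hu hX) (JsocE (adm_cmpp LV') hy2) stkp_cmpp lee_fin lerD2r.
have q0 V y LV hy := (fo V y LV hy).2.
split; first exact: cost_ge0_convex.
have hdc V y LV hy := (fo V y LV hy).1.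
have Lcol l : L1 lam `[0, T] (fun t => (col_mx (phi t) hh) l 0).
  case: (split_ordP l) => k ->.
    apply: (L1_eq (itv_meas 0 T) _ (L2s_L1 (itv_meas 0 T) (lam_itv_lty 0 T) (Lphi k))) => t _.
    by rewrite [RHS]col_mxEu.
  by apply: (L1_eq (itv_meas 0 T) _ (L1_cst (itv_meas 0 T) (hh k 0) (lam_itv_lty 0 T))) => t _; rewrite [RHS]col_mxEd.
(* The forced Hamiltonian system is solved backwards from 0 at T, which supplies the affine parts av
   and bv. *)
have [zp [hzp zpT]] := ode_backward (Ham rho AA BB QQ RR) 0 T0 Lcol.
have [p [be [Lp cbe Lbe heq [pT hae]]]] := optimal_adjoint sF mF T0 gW sK FK KW incL incO incS hT cW
  QQ_sym RRp Lphi csg Lini hZs q0 hzp zpT LU hX hdc blum.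
have /choice[Z hZ] : forall ij : 'I_N * 'I_N, exists Z, is_ito_integral F T (W ij.2)
    (fun t (_ : Omega) => cmp ij.1 (be ij.2 t)) Z.
  move=> [i j]; apply: (ito_exists sF mF T0 gW sK FK KW incL incO incS hT cW) => [l e e0|l].
    rewrite (_ : (fun t => _) = fun t => be j t (mxvec_index i l) 0); first exact: cbe.
    by apply/funext => t; rewrite mxE.
  by apply: (L2s_eq (itv_meas 0 T) _ (Lbe j (mxvec_index i l))) => t _; rewrite mxE.
pose Zt j t w := stk (fun i => Z (i, j) t w).
have sZ j : sitov F T W j (fun t _ => be j t) (Zt j).
  move=> l; case/mxvec_indexP: l => i k; have := is_ito_sito sF incL k (hZ (i, j)).
  rewrite (_ : (fun t w => cmp _ _ k 0) = fun t _ => be j t (mxvec_index i k) 0); last first.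
    by apply/funext => t; apply/funext => w; rewrite mxE.
  rewrite (_ : (fun t w => Zt j t w _ 0) = fun t w => Z (i, j) t w k 0) //.
  by apply/funext => t; apply/funext => w; rewrite stkE.
have hbs := heq Zt sZ.
have LUp : L2F P F T (fun t w => - (invmx RR *m BB^T *m p t w)) := L2FN sF (L2FM sF T0 _ Lp).
(* u and the feedback agree only almost everywhere in (t, w); the state equation is transported to
   the feedback, for which it holds with the same x. *)
have hXp := solves_ae sF T0 Lphi LU LUp hae hX.
pose pc := cmpp p.
have EU : (fun t w => - (invmx RR *m BB^T *m p t w)) = stkp (ucheck D pc).
  apply/funext => t; apply/funext => w; apply: eq_cmp => i.
  by rewrite cmpN cmp_invmx_dblk// cmp_stk.
rewrite EU in hXp.
exists x, pc, (fun i j t _ => cmp i (be j t)); split; last first.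
  move=> i; apply: ae_imp hae => q hq qT.
  have Dq : DD q by split=> //; rewrite /= in_itv.
  have := congr1 (fun v => cmp i v) (hq Dq).
  by rewrite cmp_stk cmpN cmp_invmx_dblk.
have Ex : cmpp (stkp x) = x.
  by apply/funext => i'; apply/funext => t; apply/funext => w; rewrite cmp_stk.
have st : is_state D x0 W (ucheck D pc) x by rewrite -Ex; exact: solves_state hXp.
move=> i; have [Lxi [Zx hZx eZx]] := st i.
split.
- exact: Lxi.
- exact: L2F_cmp.
- by move=> j; have [] := hZ (i, j).
- by exists Zx; [exact: hZx|rewrite drift_ucheck].
split; last first.
  by apply: ae_true => w; rewrite /pc pT; apply/matrixP => a b; rewrite !mxE.
exists (fun j => Z (i, j)); first by move=> j; exact: (hZ (i, j)).
apply: ae_imp hbs => w hw t tT; rewrite {1}/pc (hw t tT) !cmpD cmp_vint cmp_sum; congr (_ + _ + _).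
  apply: eq_vint => s _; by rewrite cmpD !cmpN cmpD cmpN cmpAR cmpQQ !cmp_stk avg_cmp_stk.
by apply: eq_bigr => j _; rewrite cmp_stk.
Qed.

End Transfer.

Theorem mainTheorem1 (R : realType) (d : measure_display)
  (Omega : measurableType d) (P : probability Omega R)
  (N n r : nat) (hN : (0 < N)%N) (hn : (0 < n)%N) (hr : (0 < r)%N)
  (D : lq_data R n r)
  (hT : 0 < lqT D) (hrho : 0 < lqrho D)
  (hQ : (lqQ D)^T = lqQ D) (hRsym : (lqR D)^T = lqR D)
  (hf : {within `[0, +oo[, continuous (lqf D)})
  (hsigma : {within `[0, +oo[, continuous (lqsigma D)})
  (hfsigma : (\int[lebesgue_measure]_(t in `[0%R, +oo[)
     (expR (- lqrho D * t) * (sqnorm (lqf D t) + sqnorm (lqsigma D t)))%:E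
     < +oo)%E)
  (x0 : 'I_N -> Omega -> 'cV[R]_n) (W : 'I_N -> R -> {RV P >-> R})
  (hW : forall i, is_brownian (W i))
  (hWind : mutually_independent P (sigma_noise W))
  (hx0meas : forall i k, measurable_fun setT (fun w => x0 i w k 0))
  (hx0ind : mutually_independent P (sigma_init x0))
  (xbar0 : 'cV[R]_n)
  (hx0mean : forall i k, ('E_P[fun w => x0 i w k 0%R] = (xbar0 k 0%R)%:E)%E)
  (C0 : R) (hx0C0 : forall i, ('E_P[fun w => sqnorm (x0 i w)] < C0%:E)%E)
  (hx0W : independent2 P
     (<<s \bigcup_(i in [set: 'I_N]) sigma_init x0 i >>)
     (<<s \bigcup_(i in [set: 'I_N]) sigma_noise W i >>))
  (hR : posdef (lqR D)) :
  ((exists u, optimal D x0 W u) <->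
   (convex_in_u D x0 W /\ exists x p beta, fbsde D x0 W x p beta))
  /\
  (convex_in_u D x0 W ->
   forall x p beta, fbsde D x0 W x p beta -> optimal D x0 W (ucheck D p))
  /\
  (forall u, optimal D x0 W u ->
   exists x p beta, fbsde D x0 W x p beta
                    /\ ae_eq_processes P D u (ucheck D p)).
Proof.
have [z hz Lz] : exists2 z : 'I_N -> R -> Omega -> 'cV[R]_n,
    forall j, is_ito_integral (filtration x0 W) (lqT D) (W j) (fun t _ => lqsigma D t) (z j) &
    forall j, L2F P (filtration x0 W) (lqT D) (z j).
  exact: (noise_exists hT hsigma hW hWind hx0meas hx0W).
have opt u := @optimal_fbsde _ _ _ _ _ _ _ _ _ _ hN hT hQ hf hsigma hW hWind hx0meas _ hx0C0 hx0W hR _ hz Lz u.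
have fb x p beta := @fbsde_optimal _ _ _ _ _ _ _ _ _ _ hN hT hQ hf hW hWind hx0meas _ hx0C0 hx0W hR _ hz Lz x p beta.
split; [split|split].
- by move=> [u /opt[cvx [x [p [beta [h _]]]]]]; split=> //; exists x, p, beta.
- by move=> [cvx [x [p [beta h]]]]; exists (ucheck D p); exact: fb cvx h.
- by move=> cvx x p beta; exact: fb.
- by move=> u /opt[].
Qed.
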